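(* Let $u_0=u^{\mathrm{lin}}\circ\xi^{-1}$ be the dislocation predictor and let $f:\Lambda\to\mathbb{R}^m$ be the field of forces at the reference displacement $u_0$, that is, $f=-\mathrm{Div}(\delta\mathcal{E}(u_0))$, meaning that $$\sum_{\ell\in\Lambda} f(\ell)\cdot v(\ell)=\sum_{\ell\in\Lambda}\sum_{\rho\in\mathcal{R}}\nabla_\rho V_\ell(Du_0(\ell))\cdot D_\rho v(\ell)\qquad\text{for all finitely supported } v:\Lambda\to\mathbb{R}^m .$$ If there is no residual stress at the reference lattice, i.e. $\sigma^0=0$, and there is no force line at the dislocation core, i.e. $\int_{\partial B_1(\hat x)}\mathbb{C}[\nabla u^{\mathrm{lin}}]\,\nu\,\mathrm{d}\sigma=0$, then $$\sum_{\ell\in\Lambda}f(\ell)=0 .$$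
   Context: **Lattice and Burgers vector.** $\Lambda\subset\mathbb{R}^2$ is a two-dimensional Bravais lattice (the projection of a three-dimensional Bravais lattice). Points are written $\ell=(\ell_1,\ell_2)$. $\mathcal{R}\subset\Lambda\setminus\{0\}$ is a finite set of interaction directions. Displacements take values in $\mathbb{R}^m$ with $m=3$ (or $m=2$ if $b_3=0$, in which case $\mathsf{b}$ is identified with $(b_1,b_2)$). The Burgers vector is $\mathsf{b}=(b_1,b_2,b_3)$ with $b_2=0$, $b_1\neq0$, and $\mathsf{b}_{12}=(b_1,b_2)=(b_1,0)\in\Lambda$ is its projection. The dislocation core is $\hat{x}=(\hat x_1,\hat x_2)\in\mathbb{R}^2$, with $\ell_2\ne\hat x_2$ for all $\ell\in\Lambda$. The branch cut is $\Gamma=\{x\in\mathbb{R}^2: x_2=\hat x_2,\ x_1\ge\hat x_1\}$, and $\Omega_\Gamma=\{x\in\mathbb{R}^2: x_1\ge\hat x_1\}\setminus B_r(\hat x)$ for a fixed $r>0$. **Operators.** $D_\rho u(\ell)=u(\ell+\rho)-u(\ell)$ and $Du(\ell)=(D_\rho u(\ell))_{\rho\in\mathcal{R}}$. The shift $S_0$ is $S_0u(\ell)=u(\ell)$ if $\ell_2>\hat x_2$ and $S_0u(\ell)=u(\ell-\mathsf{b}_{12})-\mathsf{b}$ if $\ell_2<\hat x_2$. **Energy.** Formally $\mathcal{E}(u)=\sum_{\ell\in\Lambda}V_\ell(Du(\ell))$, with site potentials $V_\ell:(\mathbb{R}^m)^{\mathcal{R}}\to\mathbb{R}$ that are sufficiently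 smooth (to be read as $C^\infty$) and $V_\ell=V$ for all $\ell$ outside some bounded set. $\nabla_\rho V\in\mathbb{R}^m$ denotes the partial gradient with respect to the slot $D_\rho u$. Slip invariance is assumed: $V(DS_0v(\ell))=V(Dv(\ell))$ for $\ell_2>\hat x_2$, and $V(DS_0v(\ell+\mathsf{b}_{12}))=V(Dv(\ell))$ for $\ell_2<\hat x_2$, for all displacements $v=u_0+w$ (with $u_0$ the predictor below) where $w:\Lambda\to\mathbb{R}^m$ is finitely supported with $\sup|w|\le\varepsilon$, for some fixed $\varepsilon>0$. The Cauchy–Born energy density is $W(A)=c_\Lambda V((A\rho)_{\rho\in\mathcal{R}})$ for $A\in\mathbb{R}^{m\times2}$, where $c_\Lambda$ is the inverse of the area per lattice site. Set $\mathbb{C}=D^2W(0)$, with $(\mathbb{C}[F])_{ij}=\sum_{k,l}\mathbb{C}_{ijkl}F_{kl}$ for $F\in\mathbb{R}^{m\times 2}$, and $$\sigma^0_{ij}=\nabla W(0)_{ij}=c_\Lambda\sum_{\rho\in\mathcal{R}}\nabla_\rho V(0)_i\,\rho_j .$$ **Linear elastic field.** $u^{\mathrm{lin}}\in C^\infty(\mathbb{R}^2\setminus\Gamma;\mathbb{R}^m)$ satisfies $\nabla\cdot(\mathbb{C}\nabla u^{\mathrm{lin}})=0$ in $\mathbb{R}^2\setminus\Gamma$; $[u^{\mathrm{lin}}]^+_-=-\mathsf{b}$ and $[(\mathbb{C}\nabla u^{\mathrm{lin}})\mathsf{e}_2]^+_-=0$ on $\Gamma\setminus\{\hat x\}$,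 where $[v(x)]^+_-$ is the limit of $v(x_1,x_2)$ as $x_2\downarrow\hat x_2$ minus the limit as $x_2\uparrow\hat x_2$. Moreover, for every $j\ge1$ there is $C_j$ with $|\nabla^ju^{\mathrm{lin}}(x)|\le C_j|x-\hat x|^{-j}$ for $x\in\mathbb{R}^2\setminus\Gamma$. **Predictor.** Let $\xi(x)=x-\frac{\mathsf{b}_{12}}{2\pi}\arg(x-\hat x)\,\eta(|x-\hat x|/r)$ for $x\in\mathbb{R}^2\setminus\Gamma$, with $\arg\in(0,2\pi)$ the polar angle measured from $\mathsf{e}_1$, and $\eta:\mathbb{R}\to[0,1]$ a $C^\infty$ function with $\eta(s)=0$ for $s<0$, $\eta(s)=1$ for $s>1$, $\eta'>0$ on $(0,1)$. The radius $r$ is such that $\xi:\mathbb{R}^2\setminus\Gamma\to\mathbb{R}^2\setminus\Gamma$ is a smooth diffeomorphism with $|\xi^{-1}(x)-x|\le C_0$ and $|\nabla^j\xi^{-1}(x)|\le C_j$ on $\mathbb{R}^2\setminus\Gamma$ for $j\ge1$. The predictor is $u_0=u^{\mathrm{lin}}\circ\xi^{-1}$. It is part of the setting that $S_0u_0$ (with $S_0$ applied to functions of $x\in\mathbb{R}^2$ by the same formula) extends smoothly across $\Gamma$ in $\Omega_\Gamma$. **Integral.** $B_1(\hat x)$ is the disc of radius 1 around $\hat x$, $\nu$ its outward unit normal, $\mathrm{d}\sigma$ arc length, and $\mathbb{C}[\nabla u^{\mathrm{lin}}]\,\nu\in\mathbb{R}^m$ has components $\sum_j(\mathbb{C}[\nabla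 u^{\mathrm{lin}}])_{ij}\nu_j$. *)

(* Defs.v *)
From HB Require Import structures.
From mathcomp Require Import all_boot all_order all_algebra.
From mathcomp Require Import all_classical all_reals all_analysis.

Set Implicit Arguments.
Unset Strict Implicit.
Unset Printing Implicit Defensive.

Import Order.TTheory GRing.Theory Num.Theory.
Import numFieldNormedType.Exports.

Local Open Scope classical_set_scope.
Local Open Scope ring_scope.

(* Vectors are row vectors; coordinates 1 and 2 of x : 'rV[R]_2 are x 0 0 and
   x 0 1.  The library norm on matrices is the sup norm, hence [enorm]. *)

Section Calculus.
Variable R : realType.

Definition dotp (n : nat) (u v : 'rV[R]_n) : R := \sum_i u 0 i * v 0 i.

Definition enorm (n : nat) (u : 'rV[R]_n) : R := Num.sqrt (dotp u u).

Definition evec (n : nat) (i : 'I_n) : 'rV[R]_n := delta_mx 0 i.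

Fixpoint iter_derive (U W : normedModType R) (f : U -> W) (vs : seq U) : U -> W :=
  match vs with
  | [::] => f
  | v :: vs' => fun x => 'D_v (iter_derive f vs') x
  end.

(* C^oo on A, meant for open A: in finite dimension this is equivalent to the
   existence and continuity of all partial derivatives of all orders. *)
Definition smooth_on (U W : normedModType R) (A : set U) (f : U -> W) : Prop :=
  forall (vs : seq U) (x : U), A x -> differentiable (iter_derive f vs) x.

(* |nabla^j u (x)|: Euclidean norm of the tensor of all j-th order partial
   derivatives of all components of u. *)
Definition nabla_norm (d n j : nat) (u : 'rV[R]_d -> 'rV[R]_n) (x : 'rV[R]_d)
    : R :=
  Num.sqrt (\sum_(s : j.-tuple 'I_d)
              enorm (iter_derive u [seq evec i | i <- s] x) ^+ 2).

Definition grad (m : nat) (u : 'rV[R]_2 -> 'rV[R]_m) (x : 'rV[R]_2)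
    : 'M[R]_(m, 2) :=
  \matrix_(i, j) ('D_(evec j) u x) 0 i.

Definition mdiv (m : nat) (S : 'rV[R]_2 -> 'M[R]_(m, 2)) (x : 'rV[R]_2)
    : 'rV[R]_m :=
  \row_i \sum_j 'D_(evec j) (fun y => S y i j) x.

Definition pt (s t : R) : 'rV[R]_2 := \row_j (if j == 0 then s else t).

(* [v(x)]^+_- = d; both one-sided limits are required to exist. *)
Definition has_jump (m : nat) (v : 'rV[R]_2 -> 'rV[R]_m) (x : 'rV[R]_2)
    (d : 'rV[R]_m) : Prop :=
  exists p q : 'rV[R]_m,
    [/\ v (pt (x 0 0) t) @[t --> (x 0 1)^'+] --> p,
        v (pt (x 0 0) t) @[t --> (x 0 1)^'-] --> q &
        p - q = d].

(* Unconditional sum of the family (f x)_{x in D}: the finite partial sums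
   converge to s along the finite subsets of D directed by inclusion. *)
Definition has_sum (T : choiceType) (m : nat) (D : set T) (f : T -> 'rV[R]_m)
    (s : 'rV[R]_m) : Prop :=
  forall e : R, 0 < e -> exists A : set T,
    [/\ finite_set A, A `<=` D &
        forall B : set T, finite_set B -> A `<=` B -> B `<=` D ->
          enorm (\sum_(x \in B) f x - s) < e].

(* Polar angle of x measured from e_1, valued in (0, 2 pi) off the half line
   {x_2 = 0, x_1 >= 0}. *)
Definition polar_arg (x : 'rV[R]_2) : R :=
  if 0 <= x 0 1 then acos (x 0 0 / enorm x) else 2 * pi - acos (x 0 0 / enorm x).

(* Outward flux of S through the unit circle around c, parametrized by arc
   length. *)
Definition circle_flux (m : nat) (S : 'rV[R]_2 -> 'M[R]_(m, 2)) (c : 'rV[R]_2)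
    : 'rV[R]_m :=
  \row_i \int[lebesgue_measure]_(t in `]0, (2 * pi)[)
           (\sum_j S (c + pt (cos t) (sin t)) i j * pt (cos t) (sin t) 0 j).

End Calculus.

Section Dislocation.
Variable R : realType.

(* The Bravais lattice spanned by the rows of B. *)
Definition lattice (B : 'M[R]_2) : set 'rV[R]_2 :=
  [set x : 'rV[R]_2 | exists z : 'rV[int]_2, x = map_mx intr z *m B].

(* c_Lambda: inverse of the area per lattice site. *)
Definition site_density (B : 'M[R]_2) : R := `|\det B|^-1.

(* The Burgers vector as an element of R^m: all of b for m = 3, (b_1, b_2) for
   m = 2. *)
Definition burgers (m : nat) (b : 'rV[R]_3) : 'rV[R]_m :=
  \row_(i < m) b 0 (inord i).

(* Functions on Lambda are represented by functions on R^2 of which only the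
   values on Lambda are used. *)
Definition finitely_supported (m : nat) (Lam : set 'rV[R]_2)
    (w : 'rV[R]_2 -> 'rV[R]_m) : Prop :=
  finite_set [set x | w x != 0] /\ [set x | w x != 0] `<=` Lam.

(* The interaction directions are rho_0, ..., rho_(n-1), and an element of
   (R^m)^{directions} is the n x m matrix of its rows. *)
Definition Drho (m : nat) (rho : 'rV[R]_2) (u : 'rV[R]_2 -> 'rV[R]_m)
    (l : 'rV[R]_2) : 'rV[R]_m :=
  u (l + rho) - u l.

Definition Dstencil (m n : nat) (rho : 'I_n -> 'rV[R]_2)
    (u : 'rV[R]_2 -> 'rV[R]_m) (l : 'rV[R]_2) : 'M[R]_(n, m) :=
  \matrix_(k, i) Drho (rho k) u l 0 i.

Definition partial_grad (m n : nat) (V : 'M[R]_(n, m) -> R) (k : 'I_n)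
    (G : 'M[R]_(n, m)) : 'rV[R]_m :=
  \row_i 'D_(delta_mx k i) V G.

Definition cb_energy (m n : nat) (c : R) (rho : 'I_n -> 'rV[R]_2)
    (V : 'M[R]_(n, m) -> R) (A : 'M[R]_(m, 2)) : R :=
  c * V (\matrix_(k, i) \sum_j A i j * rho k 0 j).

Definition sigma0 (m : nat) (W : 'M[R]_(m, 2) -> R) : 'M[R]_(m, 2) :=
  \matrix_(i, j) 'D_(delta_mx i j) W 0.

Definition elast (m : nat) (W : 'M[R]_(m, 2) -> R) (F : 'M[R]_(m, 2))
    : 'M[R]_(m, 2) :=
  \matrix_(i, j) \sum_k \sum_l
    'D_(delta_mx i j) (fun A => 'D_(delta_mx k l) W A) 0 * F k l.

Definition branch_cut (c : 'rV[R]_2) : set 'rV[R]_2 :=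
  [set x : 'rV[R]_2 | x 0 1 = c 0 1 /\ c 0 0 <= x 0 0].

Definition Omega_cut (c : 'rV[R]_2) (r : R) : set 'rV[R]_2 :=
  [set x : 'rV[R]_2 | c 0 0 <= x 0 0 /\ r <= enorm (x - c)].

(* The value on the line x_2 = c_2, which contains no lattice point, is
   irrelevant. *)
Definition slip0 (m : nat) (c b12 : 'rV[R]_2) (bm : 'rV[R]_m)
    (u : 'rV[R]_2 -> 'rV[R]_m) (x : 'rV[R]_2) : 'rV[R]_m :=
  if c 0 1 < x 0 1 then u x else u (x - b12) - bm.

Definition slip_invariant (m n : nat) (Lam : set 'rV[R]_2) (c b12 : 'rV[R]_2)
    (bm : 'rV[R]_m) (rho : 'I_n -> 'rV[R]_2) (V : 'M[R]_(n, m) -> R)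
    (u0 : 'rV[R]_2 -> 'rV[R]_m) (eps : R) : Prop :=
  forall w : 'rV[R]_2 -> 'rV[R]_m,
    finitely_supported Lam w -> (forall l, Lam l -> enorm (w l) <= eps) ->
    let v := fun x => u0 x + w x in
    forall l, Lam l ->
      (c 0 1 < l 0 1 ->
         V (Dstencil rho (slip0 c b12 bm v) l) = V (Dstencil rho v l)) /\
      (l 0 1 < c 0 1 ->
         V (Dstencil rho (slip0 c b12 bm v) (l + b12)) = V (Dstencil rho v l)).

Definition linear_elastic_field (m : nat) (W : 'M[R]_(m, 2) -> R)
    (c : 'rV[R]_2) (bm : 'rV[R]_m) (u : 'rV[R]_2 -> 'rV[R]_m) : Prop :=
  [/\ smooth_on (~` branch_cut c) u,
      forall x, ~ branch_cut c x -> mdiv (fun y => elast W (grad u y)) x = 0,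
      forall x, branch_cut c x -> x != c -> has_jump u x (- bm),
      forall x, branch_cut c x -> x != c ->
        has_jump (fun y => \row_i elast W (grad u y) i 1) x 0 &
      forall j, (0 < j)%N -> exists C : R, forall x, ~ branch_cut c x ->
        nabla_norm j u x <= C * enorm (x - c) ^- j].

Definition is_cutoff (eta : R -> R) : Prop :=
  [/\ smooth_on setT eta,
      forall s, 0 <= eta s <= 1,
      forall s, s < 0 -> eta s = 0,
      forall s, 1 < s -> eta s = 1 &
      forall s, 0 < s < 1 -> 0 < derive1 eta s].

Definition xi_map (c b12 : 'rV[R]_2) (r : R) (eta : R -> R) (x : 'rV[R]_2)
    : 'rV[R]_2 :=
  x - (polar_arg (x - c) * eta (enorm (x - c) / r)) *: ((2 * pi)^-1 *: b12).

(* g is the inverse of the smooth diffeomorphism f of A, with g - id and all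
   derivatives of g bounded on A. *)
Definition controlled_inverse (A : set 'rV[R]_2) (f g : 'rV[R]_2 -> 'rV[R]_2)
    : Prop :=
  [/\ [/\ smooth_on A f, smooth_on A g,
          forall x, A x -> A (f x) & forall x, A x -> A (g x)],
      forall x, A x -> g (f x) = x,
      forall x, A x -> f (g x) = x,
      exists C0 : R, forall x, A x -> enorm (g x - x) <= C0 &
      forall j, (0 < j)%N -> exists C : R, forall x, A x ->
        nabla_norm j g x <= C].

(* S_0 u extends smoothly across the cut in Omega_cut; nothing is required at
   the boundary of Omega_cut. *)
Definition extends_across (m : nat) (c b12 : 'rV[R]_2) (bm : 'rV[R]_m) (r : R)
    (u : 'rV[R]_2 -> 'rV[R]_m) : Prop :=
  exists g : 'rV[R]_2 -> 'rV[R]_m,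
    smooth_on (Omega_cut c r)° g /\
    forall x, (Omega_cut c r)° x -> ~ branch_cut c x -> g x = slip0 c b12 bm u x.

(* f = - Div (delta E (u0)). *)
Definition is_force (m n : nat) (Lam : set 'rV[R]_2) (rho : 'I_n -> 'rV[R]_2)
    (Vl : 'rV[R]_2 -> 'M[R]_(n, m) -> R) (u0 f : 'rV[R]_2 -> 'rV[R]_m) : Prop :=
  forall v : 'rV[R]_2 -> 'rV[R]_m, finitely_supported Lam v ->
    \sum_(l \in Lam) dotp (f l) (v l) =
    \sum_(l \in Lam) \sum_(k < n)
      dotp (partial_grad (Vl l) k (Dstencil rho u0 l)) (Drho (rho k) v l).

End Dislocation.

(* Main.v *)
(** Test the force against the cutoff phi_N(x) = max(0, 1 - |x|^2/N^2)^2, whose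
    first increments are O((1+|x|)/N^2) and second increments O(1/N^2).  Since
    f = O(d^-3) at distance d from the core, and O(d^-2) in a horizontal strip
    around the branch cut (slip invariance replaces u_0 by its extension S_0 u_0
    there), f is summable and its sum is the limit of the sums of f phi_N, i.e.
    of sum_l sum_k p_k(l).D_k phi_N(l), where p_k(l) = grad_k V_l(Du_0(l)).

    Off the strip p_k = a_k + s_k + O(d^-2), with a_k = grad_k V(0) and s_k linear
    in grad u^lin.  The part from a_k telescopes to zero, up to a sum over bonds
    crossing the cut which is asymptotically additive in the bond and vanishes in
    the limit because sigma^0 = 0 means sum_k a_k rho_k = 0.  The part from s_k is
    S.grad phi_N with S = C grad u^lin divergence free: S is the rotated gradient
    of a stream function psi, and S.grad phi_N agrees with a lattice Jacobian of
    (psi, phi_N), whose lattice sum is zero.  The zero flux of S through the unit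
    circle and the continuity of S e_2 across the cut make psi continuous across
    the cut, so that its increments there are still O(1/d). *)
Require Import Defs.
From HB Require Import structures.
From mathcomp Require Import all_boot all_order all_algebra.
From mathcomp Require Import all_classical all_reals all_analysis.
From mathcomp Require Import measurable_realfun.
From mathcomp Require Import ring lra zify.

Set Implicit Arguments.
Unset Strict Implicit.
Unset Printing Implicit Defensive.

Import Order.TTheory GRing.Theory Num.Theory.
Import numFieldNormedType.Exports.

Local Open Scope classical_set_scope.
Local Open Scope ring_scope.

(** * Calculus in coordinates *)

Section Calc.
Variable R : realType.

(** Size estimates settle only the errors. A ball of radius N holds about N^2 sites, and there
    s_k.D_k phi_N is O(1/d) times O(d/N^2), so its sum is merely O(1) and has to be cancelled
    exactly: hence a lattice Jacobian whose sum is zero for every N. An error with one more factor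
    1/d then vanishes on average, and one without it is tolerable on the O(N) sites of a strip.

    The decay d^-3 is not immediate: u_0 is a solution composed with the inverse of xi, hence not a
    solution itself. Around a site l its increments are those of u^lin around y = xi^-1(l) plus a
    term linear in the increment, up to O(d^-3). Second differences do not see the linear term, and
    at y the equations of elasticity hold exactly.

    Across the cut a smooth extension exists but comes without estimates. Bounds on its gradient are
    recovered from increments on either side; they give no control of second derivatives, whence
    d^-2 in the strip, which suffices because a strip has linear growth. *)

Lemma line_derive (U : normedModType R) (F : U -> R) (x h : U) (t : R) :
  derivable F (x + t *: h) h ->
  is_derive t 1 (fun s => F (x + s *: h)) ('D_h F (x + t *: h)).
Proof.
have E : (fun e : R => e^-1 *: (F (e *: h + (x + t *: h)) - F (x + t *: h))) =
  (fun e : R => e^-1 *: (F (x + (e *: (1:R^o) + t) *: h) - F (x + t *: h))).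
  by apply/funext => e; rewrite scaler1 scalerDl addrCA.
move=> d; apply: DeriveDef; first by rewrite /derivable -E.
by rewrite /derive -E.
Qed.

Lemma mvt_seg (U : normedModType R) (F : U -> R) (x h : U) :
  (forall t, 0 <= t <= 1 -> derivable F (x + t *: h) h) ->
  exists2 t, 0 <= t <= 1 & F (x + h) - F x = 'D_h F (x + t *: h).
Proof.
move=> d.
have [||t] := @MVT_segment R (fun s => F (x + s *: h))
  (fun t => 'D_h F (x + t *: h)) 0 1 ler01.
- move=> t; rewrite in_itv /= => /andP[t0 t1].
  by apply: line_derive; apply: d; rewrite !ltW.
- apply: derivable_within_continuous => t; rewrite in_itv /= => t01.
  by have [] := line_derive (d t t01).
- rewrite in_itv /= => t01; rewrite scale1r scale0r addr0 subr0 mulr1 => ->.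
  by exists t.
Qed.

Lemma derive_sum_coord (m n : nat) (F : 'M[R]_(m, n) -> R) x h :
  differentiable F x ->
  'D_h F x = \sum_i \sum_j h i j * 'D_(delta_mx i j) F x.
Proof.
move=> d; rewrite deriveE // {1}(matrix_sum_delta h) linear_sum /=.
apply: eq_bigr => i _; rewrite linear_sum /=; apply: eq_bigr => j _.
by rewrite linearZ /= deriveE.
Qed.

Lemma derive_sum_row (n : nat) (F : 'rV[R]_n -> R) x h :
  differentiable F x -> 'D_h F x = \sum_j h 0 j * 'D_(evec R j) F x.
Proof. by move=> d; rewrite derive_sum_coord // big_ord1. Qed.

Lemma mvt_row (n : nat) (F : 'rV[R]_n -> R) x h :
  (forall t, 0 <= t <= 1 -> differentiable F (x + t *: h)) ->
  exists2 t, 0 <= t <= 1 &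
    F (x + h) - F x = \sum_j h 0 j * 'D_(evec R j) F (x + t *: h).
Proof.
move=> d; have [|t t01 ->] := @mvt_seg _ F x h.
  by move=> t t01; apply/diff_derivable/d.
by exists t => //; rewrite derive_sum_row //; exact: d.
Qed.

Lemma coord_le (m n : nat) (x : 'M[R]_(m, n)) i j : `|x i j| <= `|x|.
Proof.
rewrite [in leRHS]/Num.Def.normr /= mx_normrE.
by apply: (le_trans _ (le_bigmax _ _ (i, j))) => /=.
Qed.

Lemma norm_le_coord (m n : nat) (x : 'M[R]_(m, n)) (a : R) : 0 <= a ->
  (forall i j, `|x i j| <= a) -> `|x| <= a.
Proof.
move=> a0 H; rewrite [in leLHS]/Num.Def.normr /= mx_normrE.
by apply: bigmax_le => // -[i j] _ /=.
Qed.

Lemma derive_coord (U : normedModType R) (m : nat) (u : U -> 'rV[R]_m) v x i :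
  derivable u x v -> 'D_v (fun y => u y 0 i) x = ('D_v u x) 0 i.
Proof. by move=> d; rewrite derive_mx // mxE. Qed.

Lemma derivable_coord (U : normedModType R) (m : nat) (u : U -> 'rV[R]_m) v x i :
  derivable u x v -> derivable (fun y => u y 0 i) x v.
Proof. by move/derivable_mxP. Qed.

Lemma differentiable_coordf (U : normedModType R) (m : nat) (u : U -> 'rV[R]_m) x i :
  differentiable u x -> differentiable (fun y => u y 0 i) x.
Proof.
move=> d; apply: (@differentiable_comp _ _ _ _ u (fun M : 'rV_m => M 0 i)) => //.
exact: differentiable_coord.
Qed.

Lemma iter_derive_rcons (U W : normedModType R) (f : U -> W) vs v :
  iter_derive ('D_v f) vs = iter_derive f (rcons vs v).
Proof. by elim: vs => //= w vs ->. Qed.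

Lemma smooth_derive (U W : normedModType R) (A : set U) (f : U -> W) v :
  smooth_on A f -> smooth_on A ('D_v f).
Proof. by move=> sf vs x Ax; rewrite iter_derive_rcons; exact: sf. Qed.

Lemma smooth_diff (U W : normedModType R) (A : set U) (f : U -> W) x :
  smooth_on A f -> A x -> differentiable f x.
Proof. by move=> sf; exact: (sf [::]). Qed.

(** The head of [s] is the derivative taken last, so that [pd u (j :: s)] is a partial derivative of
    [pd u s]. A single coordinate is kept because the mean value theorem holds for real-valued
    functions only. *)
Definition pd (d m : nat) (u : 'rV[R]_d -> 'rV[R]_m) (s : seq 'I_d) i x : R :=
  iter_derive u [seq evec R k | k <- s] x 0 i.

Lemma pd_differentiable (d m : nat) (A : set 'rV[R]_d) (u : 'rV[R]_d -> 'rV[R]_m)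
  s i x : smooth_on A u -> A x -> differentiable (pd u s i) x.
Proof. by move=> su Ax; apply: differentiable_coordf; exact: su. Qed.

Lemma derive_pd (d m : nat) (A : set 'rV[R]_d) (u : 'rV[R]_d -> 'rV[R]_m)
  s i j x : smooth_on A u -> A x -> 'D_(evec R j) (pd u s i) x = pd u (j :: s) i x.
Proof. by move=> su Ax; rewrite derive_coord //; exact/diff_derivable/su. Qed.

Lemma mvt_pd (d m : nat) (A : set 'rV[R]_d) (u : 'rV[R]_d -> 'rV[R]_m)
  s i x h : smooth_on A u -> (forall t, 0 <= t <= 1 -> A (x + t *: h)) ->
  exists2 t, 0 <= t <= 1 &
    pd u s i (x + h) - pd u s i x = \sum_j h 0 j * pd u (j :: s) i (x + t *: h).
Proof.
move=> su Ax; have [|t t01 ->] := @mvt_row d (pd u s i) x h.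
  by move=> t t01; apply: (pd_differentiable _ _ su); exact: Ax.
by exists t => //; apply: eq_bigr => j _; rewrite (derive_pd _ _ _ su) //; exact: Ax.
Qed.

Lemma enorm_coord (n : nat) (x : 'rV[R]_n) i : `|x 0 i| <= enorm x.
Proof.
rewrite /enorm -sqrtr_sqr ler_sqrt; last first.
  by apply: sumr_ge0 => j _; rewrite -expr2 sqr_ge0.
rewrite /dotp (bigD1 i) //= -expr2 lerDl.
by apply: sumr_ge0 => j _; rewrite -expr2 sqr_ge0.
Qed.

Lemma enorm_ge0 (n : nat) (x : 'rV[R]_n) : 0 <= enorm x.
Proof. exact: sqrtr_ge0. Qed.

Lemma norm_le_enorm (n : nat) (x : 'rV[R]_n) : `|x| <= enorm x.
Proof.
by apply: norm_le_coord; [exact: enorm_ge0|move=> i j; rewrite ord1; exact: enorm_coord].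
Qed.

Lemma enorm_le_norm (n : nat) (x : 'rV[R]_n) : enorm x <= n%:R * `|x|.
Proof.
case: n x => [|n] x; first by rewrite /enorm /dotp big_ord0 sqrtr0 mul0r.
rewrite /enorm -[leRHS]ger0_norm ?mulr_ge0 // -sqrtr_sqr ler_sqrt ?sqr_ge0 //.
rewrite /dotp (@le_trans _ _ (\sum_(i < n.+1) `|x| ^+ 2)) //.
  by apply: ler_sum => i _; rewrite -expr2 -real_normK ?num_real // lerXn2r ?nnegrE // coord_le.
rewrite sumr_const card_ord exprMn -[leLHS]mulr_natl ler_wpM2r ?sqr_ge0 //.
by rewrite -natrX ler_nat expnS leq_pmulr // expn_gt0.
Qed.

Lemma nabla_norm_coord (d n j : nat) (u : 'rV[R]_d -> 'rV[R]_n) x i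
    (s : j.-tuple 'I_d) :
  `|pd u s i x| <= nabla_norm j u x.
Proof.
apply: (le_trans (enorm_coord _ i)).
rewrite /nabla_norm -[leLHS]ger0_norm ?enorm_ge0 // -sqrtr_sqr ler_sqrt; last first.
  by apply: sumr_ge0 => t _; rewrite sqr_ge0.
by rewrite (bigD1 s) //= lerDl; apply: sumr_ge0 => t _; rewrite sqr_ge0.
Qed.

End Calc.

(** * Second differences, symmetry of second derivatives, Taylor bounds at 0 *)

Section Taylor.
Variable R : realType.

(** The mean value theorem is applied along [h] to [F (y + k) - F y], then along [k] to ['D_h F].
    The left side is symmetric in [h] and [k] while the order of the derivatives is not, which is
    what [derive_comm0] exploits. *)
Lemma second_difference (U : normedModType R) (A : set U) (F : U -> R) (x h k : U) :
  smooth_on A F ->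
  (forall s t, 0 <= s <= 1 -> 0 <= t <= 1 -> A (x + s *: h + t *: k)) ->
  exists st : R * R, [/\ 0 <= st.1 <= 1, 0 <= st.2 <= 1 &
    F (x + h + k) - F (x + h) - (F (x + k) - F x) =
    'D_k ('D_h F) (x + st.1 *: h + st.2 *: k)].
Proof.
move=> sF Ax.
have A0 s : 0 <= s <= 1 -> A (x + s *: h).
  by move=> s01; have := Ax s 0 s01; rewrite scale0r addr0; apply; rewrite lexx ler01.
have A1 s : 0 <= s <= 1 -> A (x + s *: h + k).
  by move=> s01; have := Ax s 1 s01; rewrite scale1r; apply; rewrite lexx ler01.
pose Phi := fun y => F (y + k) - F y.
have dk y : A (y + k) -> is_derive y h (fun y => F (y + k)) ('D_h F (y + k)).
  move=> Ay; have d : derivable F (y + k) h by exact/diff_derivable/(smooth_diff sF).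
  have E : (fun e : R => e^-1 *: (F (e *: h + y + k) - F (y + k))) =
    (fun e : R => e^-1 *: (F (e *: h + (y + k)) - F (y + k))).
    by apply/funext => e; rewrite addrA.
  by apply: DeriveDef; [rewrite /derivable E|rewrite /derive E].
have dPhi s : 0 <= s <= 1 ->
    is_derive (x + s *: h) h Phi ('D_h F (x + s *: h + k) - 'D_h F (x + s *: h)).
  move=> s01; apply: is_deriveB; first exact/dk/A1.
  exact/derivableP/diff_derivable/(smooth_diff sF)/A0.
have [s s01] := @mvt_seg R U Phi x h (fun s s01 => @ex_derive _ _ _ _ _ _ _ (dPhi s s01)).
rewrite (@derive_val _ _ _ _ _ _ _ (dPhi s s01)) /Phi => ->.
have [|t t01 ->] := @mvt_seg R U ('D_h F) (x + s *: h) k.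
  by move=> t t01; apply/diff_derivable/(smooth_diff (smooth_derive h sF))/(Ax s t).
by exists (s, t).
Qed.

Lemma scaled_second_difference (U : normedModType R) (F : U -> R) (a b : U) (t : R) :
  smooth_on setT F -> exists2 z, `|z| <= `|t| * (`|a| + `|b|) &
    F (t *: a + t *: b) - F (t *: a) - (F (t *: b) - F 0) =
    t * (t * 'D_b ('D_a F) z).
Proof.
move=> sF; have [//|[s1 s2] /= [s01 s01' E]] := @second_difference U setT F 0 (t *: a) (t *: b) sF.
exists (0 + s1 *: (t *: a) + s2 *: (t *: b)).
  rewrite add0r (le_trans (ler_normD _ _)) // mulrDr !normrZ lerD //.
    by rewrite ger0_norm ?ler_piMl //; case/andP: s01.
  by rewrite ger0_norm ?ler_piMl //; case/andP: s01'.
move: E; rewrite !add0r => ->.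
have dF z : differentiable F z by exact: (smooth_diff sF).
have -> : 'D_(t *: a) F = (fun z => t *: 'D_a F z).
  by apply/funext => z; rewrite !deriveE // linearZ.
rewrite deriveZ /=; last exact/diff_derivable/(smooth_diff (smooth_derive a sF)).
congr (_ * _); rewrite !deriveE ?linearZ //; exact: (smooth_diff (smooth_derive a sF)).
Qed.

Lemma midpoint_absurd (a b x : R) : `|a - x| < `|a - b| / 2 -> `|b - x| < `|a - b| / 2 -> False.
Proof. move=> h1 h2; have := ler_distD x a b; rewrite (distrC x); lra. Qed.

Lemma ltr_scale_succ (t a b : R) : 0 < t -> 0 <= a -> 0 <= b -> t * (a + b) < t * (a + b + 1) * 2.
Proof. move=> t0 a0 b0; rewrite -mulrA ltr_pM2l //; lra. Qed.

Lemma subr_swap (u v w z : R) : u - v - (w - z) = u - w - (v - z).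
Proof. ring. Qed.

(** Schwarz's theorem: the second difference does not depend on the order of the increments, so the
    two mixed derivatives, taken at points close to 0, agree after division by [t ^+ 2], and both
    are continuous at 0. *)
Lemma derive_comm0 (U : normedModType R) (F : U -> R) (a b : U) :
  smooth_on setT F -> 'D_a ('D_b F) 0 = 'D_b ('D_a F) 0.
Proof.
move=> sF.
have cont u v : {for 0, continuous ('D_u ('D_v F))}.
  exact/differentiable_continuous/(smooth_diff (smooth_derive u (smooth_derive v sF))).
apply/eqP/negPn/negP => ne.
pose e := `|'D_a ('D_b F) 0 - 'D_b ('D_a F) 0| / 2.
have e0 : 0 < e by rewrite divr_gt0 // normr_gt0 subr_eq0.
have [d1 /= d10 H1] : exists2 d, 0 < d & forall z, `|z| < d -> `|'D_a ('D_b F) 0 - 'D_a ('D_b F) z| < e.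
  have /cvgrPdist_lt/(_ e e0)/nbhs_ballP[d d0 H] := cont a b.
  by exists d => // z zd; apply: H; rewrite -ball_normE /= sub0r normrN.
have [d2 /= d20 H2] : exists2 d, 0 < d & forall z, `|z| < d -> `|'D_b ('D_a F) 0 - 'D_b ('D_a F) z| < e.
  have /cvgrPdist_lt/(_ e e0)/nbhs_ballP[d d0 H] := cont b a.
  by exists d => // z zd; apply: H; rewrite -ball_normE /= sub0r normrN.
pose M := `|a| + `|b| + 1.
have M0 : 0 < M by rewrite /M ltr_wpDl // addr_ge0.
(* Both intermediate points lie within [t * (|a| + |b|)] of 0, hence in both continuity
   neighbourhoods; the 1 in [M] covers [a = b = 0]. *)
pose t := Num.min d1 d2 / M / 2.
have t0 : 0 < t by rewrite !divr_gt0 // lt_min d10.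
have small z : `|z| <= `|t| * (`|a| + `|b|) -> `|z| < Num.min d1 d2.
  move=> zt; apply: (le_lt_trans zt); rewrite gtr0_norm //.
  apply: (@lt_le_trans _ _ (t * M * 2)); last by rewrite /t mulrAC !divfK // gt_eqF.
  exact: ltr_scale_succ.
have [z1 z1t E1] := scaled_second_difference a b t sF.
have [z2 z2t E2] := scaled_second_difference b a t sF.
have /andP[_ z1d] : (`|z1| < d1) && (`|z1| < d2) by rewrite -lt_min small.
have /andP[z2d _] : (`|z2| < d1) && (`|z2| < d2) by rewrite -lt_min small // (addrC `|a|).
have E : 'D_a ('D_b F) z2 = 'D_b ('D_a F) z1.
  have tn : t != 0 by rewrite gt_eqF.
  rewrite (addrC (t *: a)) in E1.
  have T := etrans (esym E2) (etrans (subr_swap _ _ _ _) E1).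
  exact: (mulfI tn (mulfI tn T)).
apply: (@midpoint_absurd ('D_a ('D_b F) 0) ('D_b ('D_a F) 0) ('D_b ('D_a F) z1)).
  by rewrite -E; exact: H1.
exact: H2.
Qed.

Lemma smooth_lip0 (m n : nat) (F : 'M[R]_(m, n) -> R) : smooth_on setT F ->
  exists C e : R, [/\ 0 <= C, 0 < e &
    forall z, `|z| <= e -> `|F z - F 0| <= C * `|z|].
Proof.
move=> sF.
have : \forall z \near (0 : 'M[R]_(m, n)), forall ij : 'I_m * 'I_n,
    `|'D_(delta_mx ij.1 ij.2) F z| <= `|'D_(delta_mx ij.1 ij.2) F 0| + 1.
  apply: (@filter_forall _ _ _ (nbhs (0 : 'M[R]_(m, n)))) => ij.
  have c : {for 0, continuous ('D_(delta_mx ij.1 ij.2) F)}.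
    exact/differentiable_continuous/(smooth_diff (smooth_derive _ sF)).
  have /cvgrPdist_le/(_ 1 ltr01) := c; apply: filterS => z.
  by move=> H; rewrite -lerBlDl (le_trans (lerB_dist _ _)) // distrC.
move=> /nbhs_ballP[e /= e0 H].
exists (\sum_i \sum_j (`|'D_(delta_mx i j) F 0| + 1)), (e / 2); split.
- by apply: sumr_ge0 => i _; apply: sumr_ge0 => j _; rewrite addr_ge0.
- by rewrite divr_gt0.
move=> z ze; have [|t t01] := @mvt_seg R _ F 0 z.
  by move=> t _; exact/diff_derivable/(smooth_diff sF).
rewrite !add0r => ->; rewrite derive_sum_coord; last exact: (smooth_diff sF).
apply: (le_trans (ler_norm_sum _ _ _)); rewrite mulr_suml; apply: ler_sum => i _.
apply: (le_trans (ler_norm_sum _ _ _)); rewrite mulr_suml; apply: ler_sum => j _.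
rewrite normrM mulrC ler_pM // ?coord_le //.
apply: (H _ _ (i, j)); rewrite -ball_normE /= sub0r normrN normrZ.
have /andP[t0 t1] := t01; rewrite ger0_norm //.
apply: (@le_lt_trans _ _ (e / 2)); last by move: e0; lra.
by apply: le_trans ze; rewrite ler_piMl.
Qed.

(** The derivative is frozen at 0 and the error is [r] times [|G - G'|]. With [G' = 0] this is the
    quadratic remainder of the linearised stress; for two neighbouring stencils it makes the
    difference of the stresses linear up to a product of two small factors. *)
Lemma smooth_taylor0 (m n : nat) (F : 'M[R]_(m, n) -> R) : smooth_on setT F ->
  exists C e : R, [/\ 0 <= C, 0 < e &
    forall G G' r, `|G| <= r -> `|G'| <= r -> r <= e ->
    `|F G - F G' - \sum_i \sum_j (G - G') i j * 'D_(delta_mx i j) F 0|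
      <= C * r * `|G - G'|].
Proof.
move=> sF.
have /choice[f Hf] : forall ij : 'I_m * 'I_n, exists Ce : R * R, [/\ 0 <= Ce.1, 0 < Ce.2 &
   forall z, `|z| <= Ce.2 -> `|'D_(delta_mx ij.1 ij.2) F z - 'D_(delta_mx ij.1 ij.2) F 0| <= Ce.1 * `|z|].
  move=> ij; have [C [e [C0 e0 H]]] := smooth_lip0 (smooth_derive (delta_mx ij.1 ij.2) sF).
  by exists (C, e).
have : \forall r \near (0 : R)^'+, forall ij : 'I_m * 'I_n, r <= (f ij).2.
  by apply: filter_forall => ij; have [_ e0 _] := Hf ij; apply: nbhs_right_le.
move=> /(filterI (nbhs_right_gt 0))/filter_ex[e [/= e0 He]].
exists (\sum_i \sum_j (f (i, j)).1), e; split => //.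
  by apply: sumr_ge0 => i _; apply: sumr_ge0 => j _; have [] := Hf (i, j).
move=> G G' r Gr Gr' re.
have [|t t01] := @mvt_seg R _ F G' (G - G').
  by move=> t _; exact/diff_derivable/(smooth_diff sF).
rewrite (addrC G') subrK => ->; rewrite derive_sum_coord; last exact: (smooth_diff sF).
rewrite -sumrB.
apply: (le_trans (ler_norm_sum _ _ _)); rewrite !mulr_suml; apply: ler_sum => i _.
rewrite -sumrB.
apply: (le_trans (ler_norm_sum _ _ _)); rewrite !mulr_suml; apply: ler_sum => j _.
rewrite -mulrBr normrM mulrC; apply: ler_pM => //; last exact: coord_le.
have [C0 e0' Hz] := Hf (i, j).
set z := G' + _.
have zr : `|z| <= r.
  have /andP[t0 t1] := t01.
  have -> : z = (1 - t) *: G' + t *: G.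
    by rewrite /z scalerBr [(1 - t) *: G']scalerBl scale1r -addrA (addrC (- _)).
  rewrite (le_trans (ler_normD _ _)) // !normrZ ger0_norm ?subr_ge0 // ger0_norm //.
  have : (1 - t) * `|G'| <= (1 - t) * r by rewrite ler_wpM2l // subr_ge0.
  have : t * `|G| <= t * r by rewrite ler_wpM2l.
  lra.
have zf : `|z| <= (f (i, j)).2 by rewrite (le_trans zr) // (le_trans re).
by apply: (le_trans (Hz z zf)); rewrite ler_wpM2l.
Qed.

End Taylor.

(** * Counting lattice points *)

Section Lattice.
Variable R : realType.
Implicit Types (B : 'M[R]_2).

Lemma det_mx22 (M : 'M[R]_2) : \det M = M 0 0 * M 1 1 - M 0 1 * M 1 0.
Proof.
rewrite (expand_det_row _ 0) big_ord_recl big_ord1 /cofactor !det_mx11 !mxE /=.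
rewrite (_ : lift 0 0 = 1); last exact/val_inj.
rewrite (_ : lift 1 0 = 0); last exact/val_inj.
by rewrite /bump /= expr0 addn0 expr1 mul1r mulN1r mulrN.
Qed.

Lemma lattice0 B : lattice B 0.
Proof. by exists 0; rewrite map_mx0 mul0mx. Qed.

Lemma latticeD B (x y : 'rV[R]_2) : lattice B x -> lattice B y -> lattice B (x + y).
Proof.
move=> [z ->] [w ->]; exists (z + w).
by rewrite map_mxD mulmxDl.
Qed.

Lemma latticeN B (x : 'rV[R]_2) : lattice B x -> lattice B (- x).
Proof. by move=> [z ->]; exists (- z); rewrite map_mxN mulNmx. Qed.

Lemma latticeB B (x y : 'rV[R]_2) : lattice B x -> lattice B y -> lattice B (x - y).
Proof. by move=> Lx Ly; apply: latticeD => //; exact: latticeN. Qed.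

Lemma mulmx_bound (m n p : nat) (M : 'M[R]_(n, p)) :
  exists2 C : R, 0 <= C & forall x : 'M[R]_(m, n), `|x *m M| <= C * `|x|.
Proof.
exists (n%:R * `|M|); first by rewrite mulr_ge0.
move=> x; apply: norm_le_coord; first by rewrite !mulr_ge0.
move=> i j; rewrite mxE (le_trans (ler_norm_sum _ _ _)) //.
apply: (@le_trans _ _ (\sum_(k < n) `|x| * `|M|)).
  by apply: ler_sum => k _; rewrite normrM ler_pM // coord_le.
by rewrite sumr_const card_ord -[leLHS]mulr_natl mulrA mulrAC.
Qed.

(** Integers of modulus at most [a] lie between [- (trunc a + 1)] and [trunc a + 1], which leaves at
    most [2 a + 3] values. *)
Lemma int_range_count (T : eqType) (s : seq T) (h : T -> int * int) (a b : R) :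
  0 <= a -> 0 <= b -> uniq s -> {in s &, injective h} ->
  (forall x, x \in s -> `|(h x).1%:~R| <= a /\ `|(h x).2%:~R| <= b) ->
  (size s)%:R <= (2 * a + 3) * (2 * b + 3).
Proof.
move=> a0 b0 us hi hb.
pose rg (M : nat) := [seq (i%:Z - M%:Z)%R | i <- iota 0 (M + M).+1].
have rgP (c : R) (z : int) : 0 <= c -> `|z%:~R| <= c -> z \in rg (Num.truncn c).+1.
  move=> c0 zc; have tc : c < (Num.truncn c).+1%:R by exact: truncnS_gt.
  have zt : `|z| < (Num.truncn c).+1%:Z.
    rewrite -(ltr_int R) intr_norm; exact: le_lt_trans zc tc.
  apply/mapP; exists (absz (z + (Num.truncn c).+1%:Z)%R); last by lia.
  by rewrite mem_iota; lia.
have sub : {subset map h s <= allpairs pair (rg (Num.truncn a).+1) (rg (Num.truncn b).+1)}.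
  move=> _ /mapP[x xs ->]; have [h1 h2] := hb x xs.
  by apply/allpairsP; exists (h x); split; [exact: rgP|exact: rgP|case: (h x)].
have /uniq_leq_size/(_ sub) : uniq (map h s) by rewrite map_inj_in_uniq.
rewrite size_map size_allpairs !size_map !size_iota.
rewrite -(ler_nat R) natrM => /le_trans; apply; apply: ler_pM => //.
  have := truncn_le a; rewrite a0 => ta.
  by rewrite -addn1 natrD natrD -addn1 natrD; lra.
have := truncn_le b; rewrite b0 => ta.
by rewrite -addn1 natrD natrD -addn1 natrD; lra.
Qed.

(** Duplicate-free sequences stand for the finite subsets, so no cardinal of [X] is involved; with
    [1 <= N] a pure power of [N] also accounts for the points near the origin. *)
Definition growth (X : set 'rV[R]_2) (d : nat) := exists2 C : R, 0 <= C &
  forall (N : R) (s : seq 'rV[R]_2), 1 <= N -> uniq s ->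
    (forall x, x \in s -> X x /\ `|x| <= N) -> (size s)%:R <= C * N ^+ d.

Lemma lattice_coord B : exists zc : 'rV[R]_2 -> 'rV[int]_2,
  forall x, lattice B x -> x = map_mx intr (zc x) *m B.
Proof.
have /choice[f Hf] : forall x, exists z : 'rV[int]_2, lattice B x -> x = map_mx intr z *m B.
  move=> x; have [[z ->]|n] := pselect (lattice B x); first by exists z.
  by exists 0.
by exists f.
Qed.

Lemma lattice_coord_bound B : B \in unitmx -> exists2 C : R, 0 <= C &
  forall z : 'rV[int]_2, forall j, `|(z 0 j)%:~R| <= C * `|map_mx intr z *m B|.
Proof.
move=> Bu; have [C C0 H] := @mulmx_bound 1 2 2 (invmx B).
exists C => // z j; apply: le_trans (H _); rewrite mulmxK //.
by have := coord_le (map_mx intr z : 'rV[R]_2) 0 j; rewrite mxE.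
Qed.

Lemma lattice_growth B : B \in unitmx -> growth (lattice B) 2.
Proof.
move=> Bu; have [C C0 HC] := lattice_coord_bound Bu.
have [zc Hz] := lattice_coord B.
exists ((2 * C + 3) * (2 * C + 3)); first by rewrite mulr_ge0 // addr_ge0 // mulr_ge0.
move=> N s N1 us sP.
have CN : 0 <= C * N by rewrite mulr_ge0 // (le_trans ler01).
apply: le_trans (@int_range_count _ s (fun x => (zc x 0 0, zc x 0 1)) _ _ CN CN us _ _) _.
- move=> x y /sP[Lx _] /sP[Ly _] [e0 e1]; rewrite (Hz x Lx) (Hz y Ly).
  congr (map_mx _ _ *m _); apply/rowP => j.
  by case: (unliftP 0 j) => [k|] -> //; rewrite (ord1 k) (_ : lift 0 0 = 1) //; exact/val_inj.
- move=> x /sP[Lx xN] /=; split.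
    by apply: (le_trans (HC _ _)); rewrite -(Hz x Lx) ler_wpM2l.
  by apply: (le_trans (HC _ _)); rewrite -(Hz x Lx) ler_wpM2l.
rewrite expr2 mulrACA; have : 2 * (C * N) + 3 <= (2 * C + 3) * N by lra.
by move=> h; apply: ler_pM => //; rewrite addr_ge0 // mulr_ge0.
Qed.

(** As a horizontal vector of length [|b1|] belongs to the lattice, the heights of lattice points
    are integer multiples of [det B / b1]. A strip thus meets boundedly many rows, and one more
    integer coordinate locates a point in its row. *)
Lemma strip_growth B (b1 : R) K : B \in unitmx -> b1 != 0 -> 0 <= K ->
  lattice B (pt b1 0) ->
  growth [set x | lattice B x /\ `|x 0 1| <= K] 1.
Proof.
move=> Bu b10 K0 [w Hw]; have [C C0 HC] := lattice_coord_bound Bu.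
have [zc Hz] := lattice_coord B.
have detB : \det B != 0 by rewrite -unitfE -unitmxE.
(* The determinant of the integer coordinates of a point and of [(b1, 0)]; it numbers the horizontal
   row of the point. *)
pose q (z : 'rV[int]_2) := z 0 0 * w 0 1 - z 0 1 * w 0 0.
have qE z : (q z)%:~R * \det B = - (map_mx intr z *m B) 0 1 * b1.
  have -> : b1 = (map_mx intr w *m B) 0 0 by rewrite -Hw mxE.
  have : (map_mx intr w *m B) 0 1 = 0 by rewrite -Hw mxE.
  rewrite det_mx22 !mxE !big_ord_recl !big_ord0 !addr0 !mxE.
  rewrite (_ : lift 0 0 = 1); last exact/val_inj.
  rewrite /q intrB !intrM; set w0 := (w 0 0)%:~R; set w1 := (w 0 1)%:~R.
  set z0 := (z 0 0)%:~R; set z1 := (z 0 1)%:~R => e.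
  have e' : w1 * B 1 1 = - (w0 * B 0 1) by move: e; lra.
  transitivity ((z0 * B 0 0) * (w1 * B 1 1) - z0 * w1 * B 0 1 * B 1 0 - z1 * w0 * B 0 0 * B 1 1 + z1 * B 1 0 * (w0 * B 0 1)); first by ring.
  have -> : w0 * B 0 1 = - (w1 * B 1 1) by rewrite e' opprK.
  have -> : z0 * B 0 0 * (w1 * B 1 1) = - (z0 * B 0 0) * (w0 * B 0 1) by rewrite e'; ring.
  by ring.
pose Q := K * `|b1| / `|\det B|.
have Q0 : 0 <= Q by rewrite !mulr_ge0 // invr_ge0.
have qb x : lattice B x -> `|x 0 1| <= K -> `|(q (zc x))%:~R| <= Q.
  move=> Lx xK; rewrite /Q ler_pdivlMr ?normr_gt0 // -normrM qE -(Hz x Lx).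
  by rewrite normrM normrN ler_wpM2r.
(* [w] is nonzero, so [j] can be chosen such that the coordinate [j] and [q] together determine the
   other coordinate. *)
have [j Hj] : exists j, forall z z' : 'rV[int]_2, z 0 j = z' 0 j -> q z = q z' -> z = z'.
  have vi : (lift 0 0 : 'I_2) = 1 by exact/val_inj.
  have rw (z z' : 'rV[int]_2) : z 0 0 = z' 0 0 -> z 0 1 = z' 0 1 -> z = z'.
    move=> e0 e1; apply/rowP => j; by case: (unliftP 0 j) => [k|] -> //; rewrite (ord1 k) vi.
  have [w00|w00] := eqVneq (w 0 0) 0.
    have w10 : w 0 1 != 0.
      apply: contraNneq b10 => w10; have : map_mx intr w *m B = 0 :> 'rV[R]_2.
        by rewrite (rw w 0) ?mxE // map_mx0 mul0mx.
      by rewrite -Hw => /rowP/(_ 0); rewrite !mxE /= => ->.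
    exists 1 => z z' e1; rewrite /q w00 !mulr0 !subr0 => /(mulIf w10) e0.
    exact: rw.
  exists 0 => z z' e0; rewrite /q e0 => /addrI/oppr_inj/(mulIf w00); exact: rw.
exists ((2 * C + 3) * (2 * Q + 3)).
  by rewrite mulr_ge0 // addr_ge0 // mulr_ge0.
move=> N s N1 us sP.
have CN : 0 <= C * N by rewrite mulr_ge0 // (le_trans ler01).
apply: le_trans (@int_range_count _ s (fun x => (zc x 0 j, q (zc x))) _ _ CN Q0 us _ _) _.
- move=> x y /sP[[Lx _] _] /sP[[Ly _] _] [e0 e1]; rewrite (Hz x Lx) (Hz y Ly).
  by rewrite (Hj _ _ e0 e1).
- move=> x /sP[[Lx xK] xN] /=; split; last exact: qb.
  by apply: (le_trans (HC _ _)); rewrite -(Hz x Lx) ler_wpM2l.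
rewrite expr1 mulrAC; have : 2 * (C * N) + 3 <= (2 * C + 3) * N by lra.
by move=> h; apply: ler_wpM2r => //; rewrite addr_ge0 // mulr_ge0.
Qed.

End Lattice.

(** * Tails and averages of power sums, and summation against cutoffs *)

Section Sums.
Variable R : realType.

(** Dyadic shells: the shell from [2^k M] to [2^(k+1) M] holds at most [C (2^(k+1) M)^d] points and
    contributes at most [C 2^d / (2^k M)], a geometric series. *)
Lemma growth_tail (X : set 'rV[R]_2) d : growth X d -> exists2 C : R, 0 <= C &
  forall (M : R) (s : seq 'rV[R]_2), 1 <= M -> uniq s ->
    (forall x, x \in s -> X x /\ M <= `|x|) ->
    \sum_(x <- s) `|x| ^- d.+1 <= C / M.
Proof.
move=> [C C0 HC]; exists (2 * (C * 2 ^+ d)); first by rewrite !mulr_ge0 // exprn_ge0.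
move=> M s M1 us sP; have M0 : 0 < M by exact: lt_le_trans M1.
have shells k : \sum_(x <- s | `|x| < 2 ^+ k * M) `|x| ^- d.+1 <=
    C * 2 ^+ d / M * (2 - 2 * 2 ^- k).
  elim: k => [|k IH].
    rewrite expr0 mul1r invr1 mulr1 subrr mulr0 big1_seq // => x /andP[xM /sP[_]].
    by rewrite leNgt xM.
  rewrite (bigID (fun x => `|x| < 2 ^+ k * M)) /=.
  have E : \sum_(x <- s | (`|x| < 2 ^+ k.+1 * M) && (`|x| < 2 ^+ k * M)) `|x| ^- d.+1 =
      \sum_(x <- s | `|x| < 2 ^+ k * M) `|x| ^- d.+1.
    apply: eq_bigl => x; rewrite andb_idl // => /lt_trans; apply.
    by rewrite ltr_pM2r // exprS ltr_pMl ?exprn_gt0 // ltr1n.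
  rewrite E; set L := 2 ^+ k * M; have L0 : 0 < L by rewrite mulr_gt0 // exprn_gt0.
  pose s' := [seq x <- s | (`|x| < 2 ^+ k.+1 * M) && ~~ (`|x| < L)].
  have c : (size s')%:R <= C * (2 * L) ^+ d.
    apply: HC; first (rewrite /L mulrA -exprS).
    - rewrite -[leLHS]mul1r ler_pM // exprn_ege1 //; lra.
    - by rewrite filter_uniq.
    - move=> x; rewrite mem_filter => /andP[/andP[xl _] /sP[Xx _]]; split => //.
      by rewrite /L mulrA -exprS ltW.
  have {}c : \sum_(x <- s | (`|x| < 2 ^+ k.+1 * M) && ~~ (`|x| < L)) `|x| ^- d.+1 <=
      C * 2 ^+ d / L.
    rewrite -big_filter -/s'.
    apply: (@le_trans _ _ (\sum_(x <- s') L ^- d.+1)).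
      rewrite !big_seq; apply: ler_sum => x; rewrite mem_filter => /andP[/andP[_ xL] _].
      rewrite -leNgt in xL; rewrite lef_pV2 ?posrE ?exprn_gt0 //; last exact: lt_le_trans xL.
      by rewrite lerXn2r ?nnegrE // ltW.
    rewrite big_const_seq iter_addr_0 count_predT -[leLHS]mulr_natl.
    rewrite ler_pdivrMr ?exprn_gt0 //; apply: (le_trans c).
    by rewrite exprMn [L ^+ d.+1]exprS [leRHS]mulrA divfK ?gt_eqF // mulrA.
  apply: (le_trans (lerD IH c)).
  rewrite -(mulrA (C * 2 ^+ d)) /L invfM (mulrC _ M^-1) !(mulrA _ M^-1) -mulrDr.
  rewrite ler_wpM2l ?mulr_ge0 ?exprn_ge0 ?invr_ge0 ?(ltW M0) //.
  rewrite exprS invfM mulrA divff ?mul1r ?pnatr_eq0 //; lra.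
have [k Hk] : exists k : nat, forall x, x \in s -> `|x| < 2 ^+ k * M.
  pose S := \sum_(x <- s) `|x|.
  exists (Num.truncn S).+1 => x xs.
  have xS : `|x| <= S.
    by rewrite /S (big_rem x) //= lerDl; apply: sumr_ge0.
  apply: (le_lt_trans xS); apply: (lt_le_trans (truncnS_gt S)).
  rewrite -[leLHS]mulr1 ler_pM // -natrX ler_nat; exact/ltnW/ltn_expl.
have := shells k; rewrite big_seq_cond (eq_bigl (fun x => x \in s)); last first.
  by move=> x; rewrite andb_idr //; exact: Hk.
rewrite -big_seq => /le_trans; apply.
rewrite mulrC -(mulrA 2) ler_wpM2r ?divr_ge0 ?mulr_ge0 ?exprn_ge0 ?(ltW M0) //.
by rewrite gerBl mulr_ge0 // invr_ge0 exprn_ge0.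
Qed.

(** Within radius [A] there are boundedly many points, and beyond it each term is at most [1 / A].
    Smallness on average, without a rate, is what turns errors of size [1 / (N^2 (1 + |l|))] into
    vanishing sums. *)
Lemma growth_average (X : set 'rV[R]_2) d (e : R) : (0 < d)%N -> growth X d -> 0 < e ->
  exists2 N0 : R, 1 <= N0 &
  forall (N : R) (s : seq 'rV[R]_2), N0 <= N -> uniq s ->
    (forall x, x \in s -> X x /\ `|x| <= N) ->
    \sum_(x <- s) (1 + `|x|)^-1 <= e * N ^+ d.
Proof.
move=> d0 [C C0 HC] e0.
pose A := 1 + 2 * C / e; have A1 : 1 <= A by rewrite /A lerDl !mulr_ge0 // invr_ge0 ltW.
pose N0 := A + 2 * C * A ^+ d / e.
have N01 : 1 <= N0.
  apply: (le_trans A1); rewrite lerDl divr_ge0 ?mulr_ge0 ?exprn_ge0 ?(ltW e0) //.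
  exact: le_trans A1.
exists N0 => // N s N0N us sP.
have N1 : 1 <= N by exact: le_trans N0N.
have NA : A <= N.
  apply: le_trans N0N; rewrite lerDl divr_ge0 ?mulr_ge0 ?exprn_ge0 ?(ltW e0) //.
  exact: le_trans A1.
rewrite (bigID (fun x => `|x| <= A)) /=.
have h1 : \sum_(x <- s | `|x| <= A) (1 + `|x|)^-1 <= e / 2 * N ^+ d.
  apply: (@le_trans _ _ (\sum_(x <- [seq x <- s | `|x| <= A]) 1)).
    rewrite big_filter; apply: ler_sum => x _; rewrite invf_le1 ?lerDl //.
  rewrite big_const_seq iter_addr_0 count_predT.
  apply: (@le_trans _ _ (C * A ^+ d)).
    apply: HC => //; first by rewrite filter_uniq.
    by move=> x; rewrite mem_filter => /andP[xA /sP[]].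
  have : e / 2 * N0 <= e / 2 * N ^+ d.
    rewrite ler_wpM2l ?divr_ge0 ?(ltW e0) //; apply: (le_trans N0N).
    by rewrite -{1}(expr1 N) ler_weXn2l.
  apply: le_trans; rewrite /N0 mulrDr.
  have -> : e / 2 * (2 * C * A ^+ d / e) = C * A ^+ d by field; rewrite gt_eqF.
  by rewrite lerDr mulr_ge0 ?divr_ge0 ?(ltW e0) //; exact: le_trans A1.
have h2 : \sum_(x <- s | ~~ (`|x| <= A)) (1 + `|x|)^-1 <= e / 2 * N ^+ d.
  apply: (@le_trans _ _ (\sum_(x <- s) A^-1)).
    rewrite big_mkcond; apply: ler_sum => x _; case: ifP => xA; last first.
      by rewrite invr_ge0 (le_trans ler01).
    rewrite lef_pV2 ?posrE ?(lt_le_trans ltr01) //; last by rewrite lerDl.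
    by move: xA; rewrite -ltNge => xA; have := xA; lra.
  rewrite big_const_seq iter_addr_0 count_predT -[leLHS]mulr_natl.
  rewrite ler_pdivrMr; last exact: lt_le_trans A1.
  apply: (@le_trans _ _ (C * N ^+ d)); first exact: HC.
  rewrite mulrAC ler_wpM2r ?exprn_ge0 //; first exact: le_trans N1.
  rewrite /A mulrDr mulr1.
  have -> : e / 2 * (2 * C / e) = C by field; rewrite gt_eqF.
  by rewrite lerDr divr_ge0 // ltW.
apply: (le_trans (lerD h1 h2)); lra.
Qed.

Lemma growth_finite (X : set 'rV[R]_2) d (N : R) : growth X d ->
  finite_set [set x | X x /\ `|x| <= N].
Proof.
move=> [C C0 HC]; apply: contrapT => /(infinite_set_fset (Num.truncn (C * (Num.max 1 N) ^+ d)).+1)[B BX Bc].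
have : (size (finmap.enum_fset B))%:R <= C * (Num.max 1 N) ^+ d.
  apply: HC; [by rewrite le_max lexx|exact: finmap.fset_uniq|].
  by move=> x /BX [Xx xN]; split => //; rewrite le_max xN orbT.
apply/negP; rewrite -ltNge; apply: (lt_le_trans (truncnS_gt _)).
by rewrite ler_nat.
Qed.

Lemma has_sum_cutoff (m : nat) (L T : set 'rV[R]_2) (f : 'rV[R]_2 -> 'rV[R]_m)
    (phi : nat -> 'rV[R]_2 -> R) (C R0 : R) :
  growth L 2 -> growth T 1 -> 0 <= C ->
  (forall x, L x -> R0 <= `|x| ->
     `|f x| <= C * `|x| ^- 3 \/ (T x /\ `|f x| <= C * `|x| ^- 2)) ->
  (forall N x, 0 <= phi N x <= 1) ->
  (forall N, finite_set [set x | L x /\ phi N x != 0]) ->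
  (forall M e, 0 < e -> exists N0, forall N x, (N0 <= N)%N -> `|x| <= M -> 1 - phi N x <= e) ->
  (forall e, 0 < e -> exists N0, forall N (s : seq 'rV[R]_2), (N0 <= N)%N -> uniq s ->
     (forall x, x \in s -> L x) -> (forall x, L x -> phi N x != 0 -> x \in s) ->
     `|\sum_(x <- s) phi N x *: f x| <= e) ->
  has_sum L f 0.
Proof.
move=> gL gT C0 fb phi01 phifin phi1 phisum e e0.
have [C1 C10 tailL] := growth_tail gL; have [C2 C20 tailT] := growth_tail gT.
(* The claim is in the Euclidean norm, which is at most [m] times the sup norm; [m.+1] keeps the
   divisor nonzero. *)
pose e1 := e / m.+1%:R; have e10 : 0 < e1 by rewrite divr_gt0.
(* Beyond the radius [M] the two tails add up to at most [e1 / 3]. *)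
pose M := 1 + `|R0| + 3 * (C * C1 + C * C2) / e1.
have Q0 : 0 <= 3 * (C * C1 + C * C2) / e1.
  by rewrite divr_ge0 ?(ltW e10) // mulr_ge0 // addr_ge0 // mulr_ge0.
have M1 : 1 <= M by rewrite /M -addrA lerDl addr_ge0.
have MR : R0 <= M by rewrite /M; have := ler_norm R0; lra.
have tailM : (C * C1 + C * C2) / M <= e1 / 3.
  rewrite ler_pdivrMr ?(lt_le_trans ltr01) //.
  apply: (@le_trans _ _ (e1 / 3 * (3 * (C * C1 + C * C2) / e1))).
    by rewrite le_eqVlt; apply/orP; left; apply/eqP; field; rewrite gt_eqF.
  have e30 : 0 <= e1 / 3 by rewrite divr_ge0 // ltW.
  apply: ler_wpM2l => //; rewrite /M lerDr; exact: addr_ge0.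
pose FM := fset_set [set x | L x /\ `|x| <= M].
have finM : finite_set [set x | L x /\ `|x| <= M] by exact: growth_finite gL.
pose K := \sum_(x <- finmap.enum_fset FM) `|f x|.
have K0 : 0 <= K by exact: sumr_ge0.
have [N0 HN0] := phi1 M (e1 / 3 / (K + 1)) (divr_gt0 (divr_gt0 e10 (ltr0Sn _ _)) (ltr_wpDl K0 ltr01)).
have [N1 HN1] := phisum (e1 / 3) (divr_gt0 e10 (ltr0Sn _ _)).
pose N := maxn N0 N1.
(* On any finite set larger than the support of [phi N], the sum splits into the cutoff sum, a near
   part where [1 - phi N] is small, and the tail. *)
exists [set x | L x /\ phi N x != 0]; split => //; first by move=> x [].
move=> B finB AB BL.
rewrite subr0 fsbig_finite //=.
set s := (finmap.enum_fset (fset_set B)).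
have us : uniq s by exact: finmap.fset_uniq.
have sB x : (x \in s) = (x \in B) by rewrite /s in_fset_set.
have sL x : x \in s -> L x by rewrite sB inE => /BL.
have E : \sum_(x <- s) f x = \sum_(x <- s) phi N x *: f x +
    \sum_(x <- s) (1 - phi N x) *: f x.
  rewrite -big_split; apply: eq_bigr => x _ /=.
  by rewrite -scalerDl addrC subrK scale1r.
have n1 : `|\sum_(x <- s) phi N x *: f x| <= e1 / 3.
  apply: HN1 => //; first by rewrite leq_max leqnn orbT.
  by move=> x Lx px; rewrite sB inE; apply: AB.
have n2 : `|\sum_(x <- s | `|x| <= M) (1 - phi N x) *: f x| <= e1 / 3.
  apply: (le_trans (ler_norm_sum _ _ _)).
  apply: (@le_trans _ _ (\sum_(x <- s | `|x| <= M) e1 / 3 / (K + 1) * `|f x|)).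
    apply: ler_sum => x xM; rewrite normrZ ler_wpM2r // ger0_norm.
      by apply: HN0 => //; rewrite leq_max leqnn.
    by rewrite subr_ge0; case/andP: (phi01 N x).
  rewrite -mulr_sumr.
  have -> : \sum_(x <- s | `|x| <= M) `|f x| = \sum_(x <- [seq x <- s | `|x| <= M]) `|f x|.
    by rewrite big_filter.
  have le : \sum_(x <- [seq x <- s | `|x| <= M]) `|f x| <= K.
    rewrite /K [leRHS](bigID (fun x => x \in [seq x <- s | `|x| <= M])) /=.
    rewrite -[leLHS]addr0; apply: lerD; last exact: sumr_ge0.
    rewrite -[leRHS]big_filter.
    rewrite (perm_big [seq i <- finmap.enum_fset FM | i \in [seq x <- s | `|x| <= M]]) //.
    apply: uniq_perm; rewrite ?filter_uniq //; first exact: finmap.fset_uniq.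
    move=> x; rewrite [RHS]mem_filter andb_idr // mem_filter => /andP[xM xs].
    by rewrite in_fset_set // inE; split => //; exact: sL.
  apply: (@le_trans _ _ (e1 / 3 / (K + 1) * K)).
    by rewrite ler_wpM2l // divr_ge0 ?divr_ge0 ?addr_ge0 // ltW.
  have K10 : 0 < K + 1 by lra.
  rewrite mulrAC ler_pdivrMr //; apply: ler_wpM2l; last by lra.
  by rewrite divr_ge0 // ltW.
have n3 : `|\sum_(x <- s | ~~ (`|x| <= M)) (1 - phi N x) *: f x| <= e1 / 3.
  apply: (le_trans (ler_norm_sum _ _ _)); apply: le_trans tailM.
  pose s' := [seq x <- s | ~~ (`|x| <= M)].
  have s'P x : x \in s' -> L x /\ M <= `|x|.
    by rewrite mem_filter -ltNge => /andP[/ltW xM /sL].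
  have us' : uniq s' by rewrite filter_uniq.
  apply: (@le_trans _ _ (\sum_(x <- s') (C * `|x| ^- 3 +
      (if x \in T then C * `|x| ^- 2 else 0)))).
    rewrite -big_filter -/s' !big_seq; apply: ler_sum => x xs'.
    have [Lx xM] := s'P x xs'.
    rewrite normrZ ger0_norm; last by rewrite subr_ge0; case/andP: (phi01 N x).
    apply: (@le_trans _ _ `|f x|).
      by rewrite ler_piMl // gerBl; case/andP: (phi01 N x).
    have [|fx|[Tx fx]] := fb x Lx; first exact: le_trans xM.
      apply: (le_trans fx); rewrite lerDl; case: ifP => // _.
      by rewrite mulr_ge0 // invr_ge0 exprn_ge0.
    rewrite mem_set //; apply: (le_trans fx); rewrite lerDr.
    by rewrite mulr_ge0 // invr_ge0 exprn_ge0.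
  rewrite big_split /= mulrDl; apply: lerD.
    rewrite -mulr_sumr -mulrA ler_wpM2l //; exact: tailL.
  rewrite -big_mkcond /= -mulr_sumr -big_filter -mulrA ler_wpM2l //.
  apply: tailT => //; first by rewrite filter_uniq.
  by move=> x; rewrite mem_filter => /andP[/set_mem Tx /s'P[]].
apply: (le_lt_trans (enorm_le_norm _)).
rewrite E [X in _ + X](bigID (fun x => `|x| <= M)) /=.
apply: (@le_lt_trans _ _ (m%:R * e1)).
  rewrite ler_wpM2l //; apply: (le_trans (ler_normD _ _)).
  have := lerD n1 (le_trans (ler_normD _ _) (lerD n2 n3)); lra.
by rewrite mulrCA gtr_pMr // ltr_pdivrMr // mul1r ltr_nat.
Qed.

End Sums.

(** * The cutoff *)

Section Cutoff.
Variable R : realType.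
Implicit Types (N K : R) (x k : 'rV[R]_2).

Lemma dotp2 (x y : 'rV[R]_2) : dotp x y = x 0 0 * y 0 0 + x 0 1 * y 0 1.
Proof.
rewrite /dotp big_ord_recl big_ord1; congr (_ + x 0 _ * y 0 _); exact/val_inj.
Qed.

Lemma sum2E (T : nmodType) (F : 'I_2 -> T) : \sum_i F i = F 0 + F 1.
Proof. by rewrite big_ord_recl big_ord1; congr (_ + F _); exact/val_inj. Qed.

Lemma dotp_bound x k : `|dotp x k| <= 2 * `|x| * `|k|.
Proof.
rewrite dotp2 (le_trans (ler_normD _ _)) // !normrM.
have h j : `|x 0 j| * `|k 0 j| <= `|x| * `|k| by rewrite ler_pM // coord_le.
by have := h 0; have := h 1; lra.
Qed.

Lemma dotp_ge0 x : 0 <= dotp x x.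
Proof. by rewrite dotp2 -!expr2 addr_ge0 ?sqr_ge0. Qed.

Lemma sqr_norm_le_dotp x : `|x| ^+ 2 <= dotp x x.
Proof.
rewrite -[leRHS]sqr_sqrtr; last by rewrite dotp_ge0.
by rewrite lerXn2r ?nnegrE ?sqrtr_ge0 // norm_le_enorm.
Qed.

(** Built on the Euclidean square, a polynomial whose increments are explicit; the support still
    lies in the sup-norm ball of radius [N], the sup norm being the smaller of the two. *)
Definition bump N x : R := Num.max 0 (1 - dotp x x / N ^+ 2) ^+ 2.

Definition gbump N x : 'rV[R]_2 :=
  (- 4 * Num.max 0 (1 - dotp x x / N ^+ 2) / N ^+ 2) *: x.

Lemma bump_itv N x : 0 <= bump N x <= 1.
Proof.
rewrite /bump sqr_ge0 /= expr_le1 //; last by rewrite le_max lexx.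
rewrite ge_max ler01 /= gerBl divr_ge0 ?sqr_ge0 //.
by rewrite dotp_ge0.
Qed.

Lemma bump_argle0 N x : 0 < N -> N <= `|x| -> 1 - dotp x x / N ^+ 2 <= 0.
Proof.
move=> N0 Nx; rewrite subr_le0 ler_pdivlMr ?exprn_gt0 // mul1r.
apply: le_trans (sqr_norm_le_dotp x); by rewrite lerXn2r ?nnegrE // ltW.
Qed.

Lemma bump_eq0 N x : 0 < N -> N <= `|x| -> bump N x = 0.
Proof.
by move=> N0 Nx; rewrite /bump max_l ?expr0n //; exact: bump_argle0.
Qed.

Lemma gbump_eq0 N x : 0 < N -> N <= `|x| -> gbump N x = 0.
Proof.
by move=> N0 Nx; rewrite /gbump max_l ?mulr0 ?mul0r ?scale0r //; exact: bump_argle0.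
Qed.

Lemma bump_near1 N x : 0 < N -> 1 - bump N x <= 4 * `|x| ^+ 2 / N ^+ 2.
Proof.
move=> N0; have N20 : 0 < N ^+ 2 by rewrite exprn_gt0.
set t := dotp x x / N ^+ 2.
have t0 : 0 <= t := divr_ge0 (dotp_ge0 _) (ltW N20).
have tb : 2 * t <= 4 * `|x| ^+ 2 / N ^+ 2.
  rewrite /t mulrA ler_wpM2r ?invr_ge0 ?(ltW N20) //.
  have := dotp_bound x x; have := ler_norm (dotp x x); rewrite expr2; lra.
apply: le_trans tb; rewrite /bump -/t maxEle; case: ifP => h; nra.
Qed.

Lemma gbump_bound N x k : 0 < N -> `|dotp (gbump N x) k| <= 8 * `|x| * `|k| / N ^+ 2.
Proof.
move=> N0; have N20 : 0 < N ^+ 2 by rewrite exprn_gt0.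
apply: (le_trans (dotp_bound _ _)); rewrite /gbump normrZ.
set X := Num.max _ _; have /andP[X0 X1] : 0 <= X <= 1.
  rewrite le_max lexx /= ge_max ler01 gerBl divr_ge0 ?(ltW N20) //.
  by rewrite dotp_ge0.
rewrite !normrM normrN normfV (ger0_norm X0) (ger0_norm (ltW N20)) ger0_norm //.
rewrite [leRHS]mulrC; have -> : 2 * (4 * X / N ^+ 2 * `|x|) * `|k| =
  (N ^+ 2)^-1 * (X * (8 * `|x| * `|k|)) by ring.
by rewrite ler_wpM2l ?invr_ge0 ?(ltW N20) // ler_piMl // !mulr_ge0.
Qed.

(** The function [max(0, t)^2] is convex with derivative [2 max(0, t)], which is 2-Lipschitz, so its
    Taylor remainder lies between 0 and [u^2]. This bound, which fails for [max(0, t)] itself, is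
    the reason for the square in the cutoff. *)
Lemma sqr_pos_part (X u : R) :
  0 <= Num.max 0 (X + u) ^+ 2 - Num.max 0 X ^+ 2 - 2 * Num.max 0 X * u <= u ^+ 2.
Proof.
rewrite !maxEle; case: (lerP 0 X) => hX; case: (lerP 0 (X + u)) => hu; nra.
Qed.

Lemma dotpDD x k : dotp (x + k) (x + k) = dotp x x + 2 * dotp x k + dotp k k.
Proof. rewrite !dotp2 !mxE; ring. Qed.

(** For [|x| < 2 N] the argument [X] moves by [u = O(1/N)], so the remainder in [sqr_pos_part] is
    [O(1/N^2)]; farther out both values and the gradient vanish. *)
Lemma bump_taylor K : 0 <= K -> exists2 C : R, 0 <= C & forall N x k,
  K + 1 <= N -> `|k| <= K ->
  `|bump N (x + k) - bump N x - dotp (gbump N x) k| <= C / N ^+ 2.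
Proof.
(* The square bounds [(N u)^2]; the term [4 K^2] comes from [dotp k k], the part of the increment of
   [X] that is not linear in [k]. *)
move=> K0; exists ((8 * K + 2 * K ^+ 2) ^+ 2 + 4 * K ^+ 2).
  by rewrite addr_ge0 ?sqr_ge0 // mulr_ge0 ?sqr_ge0.
move=> N x k KN kK; have N1 : 1 <= N by lra.
have N0 : 0 < N by lra.
have N20 : 0 < N ^+ 2 by rewrite exprn_gt0.
have [x2N|x2N] := lerP (2 * N) `|x|.
  have Nx : N <= `|x| by lra.
  have Nxk : N <= `|x + k|.
    have := lerB_dist x (- k); rewrite opprK normrN; lra.
  rewrite !bump_eq0 // gbump_eq0 // dotp2 !mxE !mul0r addr0 !subr0 normr0.
  by rewrite divr_ge0 ?(ltW N20) // addr_ge0 ?sqr_ge0 // mulr_ge0 ?sqr_ge0.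
set X := 1 - dotp x x / N ^+ 2.
pose u := - (2 * dotp x k + dotp k k) / N ^+ 2.
have E : 1 - dotp (x + k) (x + k) / N ^+ 2 = X + u by rewrite dotpDD /X /u; ring.
have G : dotp (gbump N x) k = 2 * Num.max 0 X * u + 2 * Num.max 0 X * (dotp k k / N ^+ 2).
  by rewrite /gbump -/X /u !dotp2 !mxE; ring.
have kk : 0 <= dotp k k / N ^+ 2 <= 2 * K ^+ 2 / N ^+ 2.
  apply/andP; split; first exact: divr_ge0 (dotp_ge0 _) (ltW N20).
  rewrite ler_wpM2r ?invr_ge0 ?(ltW N20) //.
  have := dotp_bound k k; have := ler_norm (dotp k k).
  have : `|k| * `|k| <= K ^+ 2 by rewrite expr2 ler_pM.
  lra.
have /andP[X0 X1] : 0 <= Num.max 0 X <= 1.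
  rewrite le_max lexx /= ge_max ler01 gerBl divr_ge0 ?(ltW N20) //.
  by rewrite dotp_ge0.
have ub : u ^+ 2 <= (8 * K + 2 * K ^+ 2) ^+ 2 / N ^+ 2.
  rewrite -[u ^+ 2]real_normK ?num_real // -expr_div_n lerXn2r ?nnegrE //.
    by rewrite divr_ge0 ?(ltW N0) // addr_ge0 ?mulr_ge0 ?sqr_ge0.
  rewrite /u normrM normrN normfV (ger0_norm (ltW N20)) ler_pdivrMr //.
  have -> : (8 * K + 2 * K ^+ 2) / N * N ^+ 2 = (8 * K + 2 * K ^+ 2) * N.
    by rewrite [N ^+ 2]expr2 [LHS]mulrA divfK // gt_eqF.
  rewrite (le_trans (ler_normD _ _)) // normrM (ger0_norm (ler0n _ _)).
  have h1 := dotp_bound x k; have h2 := dotp_bound k k.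
  have h3 : `|x| * `|k| <= 2 * N * K by rewrite ler_pM // ltW.
  have h4 : `|k| * `|k| <= K ^+ 2 by rewrite expr2 ler_pM.
  have h5 : K ^+ 2 <= K ^+ 2 * N by rewrite ler_peMr // sqr_ge0.
  lra.
rewrite G /bump E opprD addrA -/X.
have /andP[h0 h1] := sqr_pos_part X u.
apply: (le_trans (ler_normB _ _)); rewrite [leRHS]mulrDl; apply: lerD.
  by rewrite ger0_norm // (le_trans h1).
rewrite !normrM (ger0_norm X0) (ger0_norm (ler0n _ _)).
have /andP[kk0 kk1] := kk.
have -> : `|dotp k k| * `|(N ^+ 2)^-1| = dotp k k / N ^+ 2.
  by rewrite -normrM ger0_norm.
have : 2 * Num.max 0 X * (dotp k k / N ^+ 2) <= 2 * (2 * K ^+ 2 / N ^+ 2).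
  by rewrite -mulrA ler_wpM2l // -[leRHS]mul1r ler_pM.
lra.
Qed.

Lemma bump_diff K : 0 <= K -> exists2 C : R, 0 <= C & forall N x k,
  K + 1 <= N -> `|k| <= K ->
  `|bump N (x + k) - bump N x| <= C * (1 + `|x|) / N ^+ 2.
Proof.
move=> K0; have [C C0 HC] := bump_taylor K0.
exists (C + 8 * K); first by rewrite addr_ge0 // mulr_ge0.
move=> N x k KN kK; have N0 : 0 < N by lra.
have N20 : 0 < N ^+ 2 by rewrite exprn_gt0.
have := HC N x k KN kK; have := gbump_bound x k N0.
have h : 8 * `|x| * `|k| <= 8 * `|x| * K by rewrite ler_wpM2l // mulr_ge0.
rewrite !ler_pdivlMr // => h1 h2.
have := ler_normD (bump N (x + k) - bump N x - dotp (gbump N x) k) (dotp (gbump N x) k).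
rewrite subrK => /(ler_wpM2r (ltW N20)) /le_trans; apply.
rewrite mulrDl; have := normr_ge0 x; nra.
Qed.

Lemma bump_diff_eq0 K N x k : 0 <= K -> K + 1 <= N -> `|k| <= K -> 2 * N <= `|x| ->
  bump N (x + k) = 0.
Proof.
move=> K0 KN kK Nx; apply: bump_eq0; first by lra.
have := lerB_dist x (- k); rewrite opprK normrN; lra.
Qed.

End Cutoff.

(** * Stream functions of divergence-free fields off the cut *)

Section LocalBounds.
Variable R : realType.

Lemma far_line (c x h : 'rV[R]_2) t : `|h| <= `|x - c| / 2 -> 0 <= t <= 1 ->
  `|x - c| / 2 <= `|x + t *: h - c|.
Proof.
move=> hd /andP[t0 t1].
have := lerB_dist (x - c) (- (t *: h)); rewrite opprK normrN addrAC normrZ (ger0_norm t0).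
have : t * `|h| <= 1 * `|h| by rewrite ler_wpM2r.
lra.
Qed.

(** The segment keeps half the distance to [c], which costs [2 ^ j]; the remaining factor 2 counts
    the coordinates. *)
Lemma lip_decay (A : set 'rV[R]_2) (c : 'rV[R]_2) (F : 'rV[R]_2 -> R) (dF : 'I_2 -> 'rV[R]_2 -> R)
    (C0 : R) (j : nat) x h :
  0 <= C0 -> (forall x, A x -> differentiable F x) ->
  (forall i x, A x -> 'D_(evec R i) F x = dF i x) ->
  (forall i x, A x -> `|dF i x| <= C0 / `|x - c| ^+ j) ->
  (forall t, 0 <= t <= 1 -> A (x + t *: h)) -> 0 < `|x - c| -> `|h| <= `|x - c| / 2 ->
  `|F (x + h) - F x| <= 2 ^+ j.+1 * C0 * `|h| / `|x - c| ^+ j.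
Proof.
move=> C00 dif der bd seg d0 hd; have [|t t01 ->] := @mvt_row R 2 F x h.
  by move=> t t01; apply: dif; exact: seg.
have bt i : `|dF i (x + t *: h)| <= 2 ^+ j * C0 / `|x - c| ^+ j.
  apply: (le_trans (bd i _ (seg t t01))).
  have h1 := far_line hd t01.
  have z0 : 0 < `|x + t *: h - c| by apply: lt_le_trans h1; rewrite divr_gt0.
  rewrite ler_pdivlMr ?exprn_gt0 // mulrAC ler_pdivrMr ?exprn_gt0 //.
  rewrite (mulrC (2 ^+ j)) -[leRHS]mulrA ler_wpM2l // -exprMn lerXn2r ?nnegrE //.
  by lra.
rewrite sum2E !der; [|exact: seg..].
apply: (le_trans (ler_normD _ _)); rewrite !normrM.
have l i : `|h 0 i| * `|dF i (x + t *: h)| <= `|h| * (2 ^+ j * C0 / `|x - c| ^+ j).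
  by rewrite ler_pM // coord_le.
have := l 0; have := l 1; rewrite exprS.
set q := 2 ^+ j; set r := `|x - c| ^+ j => l0 l1.
have -> : 2 * q * C0 * `|h| / r = 2 * (`|h| * (q * C0 / r)) by ring.
lra.
Qed.

(** Replaces the chain rule along a curve: [psi] is known through its derivatives along straight
    lines, and its Taylor bound compares it along an arc with an explicit function. *)
Lemma is_derive_quadratic (f g : R -> R) (t l C e : R) : 0 < e ->
  (forall s, `|s| <= e -> `|f (s + t) - f t - (g (s + t) - g t)| <= C * s ^+ 2) ->
  is_derive t 1 g l -> is_derive t 1 f l.
Proof.
move=> e0 H [dg gl].
have key : s^-1 *: ((f (s *: (1 : R^o) + t) - f t) - (g (s *: (1 : R^o) + t) - g t)) @[s --> 0^'] --> (0 : R).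
  apply/cvgrPdist_le => eps eps0; near=> s.
  rewrite sub0r normrN scaler1 normrZ.
  have sn : s != 0 by near: s; exact: nbhs_dnbhs_neq.
  rewrite normfV ler_pdivrMl ?normr_gt0 //.
  apply: (@le_trans _ _ (C * s ^+ 2)).
    apply: H; near: s; apply: dnbhs0_le; exact: e0.
  rewrite -(@real_normK _ s) ?num_real // expr2 mulrCA ler_wpM2l //.
  have sC : `|s| <= eps / (`|C| + 1).
    by near: s; apply: dnbhs0_le; rewrite divr_gt0 // ltr_wpDl.
  move: sC; rewrite ler_pdivlMr ?ltr_wpDl // => sC; apply: le_trans sC.
  rewrite mulrC ler_wpM2l // (le_trans (ler_norm C)) // lerDl //.
have cg : s^-1 *: (g (s *: (1 : R^o) + t) - g t) @[s --> 0^'] --> l by rewrite -gl.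
have cf : s^-1 *: (f (s *: (1 : R^o) + t) - f t) @[s --> 0^'] --> l.
  have -> : (fun s : R => s^-1 *: (f (s *: (1 : R^o) + t) - f t)) =
    (fun s : R => s^-1 *: ((f (s *: (1 : R^o) + t) - f t) - (g (s *: (1 : R^o) + t) - g t)) +
                  s^-1 *: (g (s *: (1 : R^o) + t) - g t)).
    by apply/funext => s; rewrite -scalerDr subrK.
  by rewrite -[l]add0r; exact: cvgD.
apply: DeriveDef; last exact/cvg_lim.
by apply/cvg_ex; exists l.
Unshelve. all: by end_near. Qed.

Lemma is_derive_shift_arg (U W : normedModType R) (F : U -> W) (x v k : U) l :
  is_derive (x + k) v F l -> is_derive x v (fun y => F (y + k)) l.
Proof.
have E : (fun e : R => e^-1 *: (F (e *: v + x + k) - F (x + k))) =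
  (fun e : R => e^-1 *: (F (e *: v + (x + k)) - F (x + k))).
  by apply/funext => e; rewrite addrA.
by move=> [d <-]; apply: DeriveDef; [rewrite /derivable E|rewrite /derive E].
Qed.

Lemma ler_addsmall (a b M : R) : 0 <= M -> (forall t, 0 < t <= 1 / 4 -> a <= b + t * M) ->
  a <= b.
Proof.
move=> M0 H; apply/ler_addgt0Pr => e e0.
pose t := Num.min (1 / 4) (e / (M + 1)).
have M1 : 0 < M + 1 by rewrite ltr_wpDl.
have t0 : 0 < t by rewrite lt_min; apply/andP; split; [lra|exact: divr_gt0].
apply: (le_trans (H t _)); first by rewrite t0 ge_min lexx.
have tM : t * (M + 1) <= e by rewrite -ler_pdivlMr // ge_min lexx orbT.
rewrite mulrDr mulr1 in tM; lra.
Qed.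

Lemma Rintegral_FTC (f F : R -> R) (a b : R) : a < b ->
  (forall t, a <= t <= b -> {for t, continuous f}) ->
  (forall t, a <= t <= b -> is_derive t 1 F (f t)) ->
  \int[@lebesgue_measure R]_(t in `[a, b]) f t = F b - F a.
Proof.
move=> ab cf dF.
have cF t : a <= t <= b -> {for t, continuous F}.
  by move=> /dF[dFt _]; exact/differentiable_continuous/derivable1_diffP.
have H : derivable_oo_LRcontinuous F a b.
  split.
  + by move=> t; rewrite in_itv /= => /andP[t0 t1]; have [] := dF t; rewrite ?ltW.
  + by apply: cvg_at_right_filter; apply: cF; rewrite lexx ltW.
  + by apply: cvg_at_left_filter; apply: cF; rewrite lexx ltW.
have H2 : {in `]a, b[, (F^`())%classic =1 f}.
  move=> t; rewrite in_itv /= => /andP[t0 t1]; rewrite derive1E.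
  by apply: derive_val; apply: dF; rewrite !ltW.
have H3 : {within `[a, b], continuous f}.
  by apply: continuous_in_subspaceT => t; rewrite inE /= in_itv /= => t01; exact: cf.
by rewrite /Rintegral (continuous_FTC2 ab H3 H H2).
Qed.

Lemma convex_ge (a x y r : R) : a <= x -> a <= y -> 0 <= r -> r <= 1 -> a <= x + r * (y - x).
Proof.
move=> ax ay r0 r1; have := ler_wpM2l r0 ay.
have r10 : 0 <= 1 - r by lra.
have := ler_wpM2l r10 ax; lra.
Qed.

Lemma at_right_point (F : R -> R) (a q h e : R) : F t @[t --> a^'+] --> q -> 0 < h -> 0 < e ->
  exists t, [/\ a < t, t < a + h & `|q - F t| <= e].
Proof.
move=> /cvgrPdist_le cv h0 e0.
have ah : a < a + h by rewrite ltrDl.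
have n : \forall t \near a^'+, [/\ a < t, t < a + h & `|q - F t| <= e].
  near=> t; split; near: t; [exact: nbhs_right_gt|exact: nbhs_right_lt|exact: cv].
exact: (filter_ex n).
Unshelve. all: by end_near. Qed.

Lemma at_left_point (F : R -> R) (a q h e : R) : F t @[t --> a^'-] --> q -> 0 < h -> 0 < e ->
  exists t, [/\ a - h < t, t < a & `|q - F t| <= e].
Proof.
move=> /cvgrPdist_le cv h0 e0.
have ah : a - h < a by rewrite gtrBl.
have n : \forall t \near a^'-, [/\ a - h < t, t < a & `|q - F t| <= e].
  near=> t; split; near: t; [exact: nbhs_left_gt|exact: nbhs_left_lt|exact: cv].
exact: (filter_ex n).
Unshelve. all: by end_near. Qed.

Lemma lip_sin (s t : R) : `|sin s - sin t| <= `|s - t|.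
Proof.
have [|r r01 ] := @mvt_seg R R^o (@sin R) t (s - t).
  by move=> r _; apply/diff_derivable/derivable1_diffP; exact: derivable_sin.
rewrite (addrC t (s - t)) subrK => ->.
have -> : 'D_(s - t) (@sin R) (t + r *: (s - t)) = (s - t) * cos (t + r *: (s - t)).
  rewrite deriveE; last exact/derivable1_diffP/derivable_sin.
  rewrite -[X in 'd _ _ X](mulr1 (s - t)) linearZ /= -deriveE; last exact/derivable1_diffP/derivable_sin.
  by rewrite derive_val.
by rewrite normrM ler_piMr // ler_norml cos_geN1 cos_le1.
Qed.

Lemma lip_cos (s t : R) : `|cos s - cos t| <= `|s - t|.
Proof.
have := lip_sin (- s + pi / 2) (- t + pi / 2).
have -> : - s + pi / 2 - (- t + pi / 2) = - (s - t) by ring.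
by rewrite !sinDpihalf !cosN normrN.
Qed.

End LocalBounds.

(** * The unit circle around the core *)

Section Circle.
Variable R : realType.

Lemma ptE (s t : R) j : pt s t 0 j = if j == 0 then s else t.
Proof. by rewrite /pt mxE. Qed.

Lemma pt_norm (s t : R) (a : R) : 0 <= a -> `|s| <= a -> `|t| <= a -> `|pt s t| <= a.
Proof.
move=> a0 sa ta; apply: norm_le_coord => // i j; rewrite ord1 ptE.
by case: ifP.
Qed.

Lemma circle_norm_ge (t : R) : 1 / 2 <= `|pt (cos t) (sin t)|.
Proof.
have h0 := coord_le (pt (cos t) (sin t)) 0 0; have h1 := coord_le (pt (cos t) (sin t)) 0 1.
rewrite !ptE /= in h0 h1; have := cos2Dsin2 t.
rewrite -(@real_normK _ (cos t)) ?num_real // -(@real_normK _ (sin t)) ?num_real //.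
rewrite leNgt => e; apply/negP => n.
have : `|cos t| ^+ 2 <= (1 / 2) ^+ 2 by rewrite lerXn2r ?nnegrE //; lra.
have : `|sin t| ^+ 2 <= (1 / 2) ^+ 2 by rewrite lerXn2r ?nnegrE //; lra.
lra.
Qed.

Lemma circle_off_cut (c : 'rV[R]_2) (t : R) : 0 < t -> t < 2 * pi ->
  ~ branch_cut c (c + pt (cos t) (sin t)).
Proof.
move=> t0 t2 []; rewrite !mxE /= => h; have {h}s0 : sin t = 0 by lra.
rewrite lerDl; have [tpi|pit|->] := ltgtP t pi.
- by have := @sin_gt0_pi R t; rewrite t0 tpi s0 ltxx => /(_ isT).
- have := @sin_gt0_pi R (t - pi); rewrite subr_gt0 pit ltrBlDr.
  rewrite (_ : pi + pi = 2 * pi); last by ring.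
  by rewrite t2 sinB cospi sinpi s0 mul0r mulr0 subrr ltxx => /(_ isT).
- by rewrite cospi ler0N1.
Qed.

End Circle.

(** * The Poincare lemma on the plane cut along a half-line *)

Section Stream.
Variable R : realType.
Variables (c : 'rV[R]_2) (P Q : 'rV[R]_2 -> R) (dP dQ : 'I_2 -> 'rV[R]_2 -> R) (C0 : R).
Local Notation A := (~` branch_cut c).
Local Notation mu := (@lebesgue_measure R).
Hypothesis C0_ge0 : 0 <= C0.
Hypothesis diffP : forall x, A x -> differentiable P x.
Hypothesis diffQ : forall x, A x -> differentiable Q x.
Hypothesis derP : forall j x, A x -> 'D_(evec R j) P x = dP j x.
Hypothesis derQ : forall j x, A x -> 'D_(evec R j) Q x = dQ j x.
Hypothesis contP : forall j x, A x -> {for x, continuous (dP j)}.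
Hypothesis contQ : forall j x, A x -> {for x, continuous (dQ j)}.
Hypothesis boundP : forall x, A x -> `|P x| <= C0 / `|x - c|.
Hypothesis boundQ : forall x, A x -> `|Q x| <= C0 / `|x - c|.
Hypothesis bounddP : forall j x, A x -> `|dP j x| <= C0 / `|x - c| ^+ 2.
Hypothesis bounddQ : forall j x, A x -> `|dQ j x| <= C0 / `|x - c| ^+ 2.
Hypothesis div0 : forall x, A x -> dP 0 x + dQ 1 x = 0.

Let p : 'rV[R]_2 := c - evec R 0.
(** Line integral of [P dx_2 - Q dx_1], a closed form because [(P, Q)] is divergence free, along the
    segment from [p] to [x]. The complement of the cut is star-shaped about [p], one unit to the
    left of the core. *)
Definition stream (x : 'rV[R]_2) : R :=
  \int[mu]_(t in `[0, 1]) ((x - p) 0 1 * P (p + t *: (x - p)) -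
                           (x - p) 0 0 * Q (p + t *: (x - p))).

(** A whole neighbourhood of [x] with one distance [d] is required: the bounds on [P], [Q] and their
    derivatives blow up at the core and have to dominate the integrand uniformly when it is
    differentiated. *)
Lemma star_far x : A x -> exists e d : R, [/\ 0 < e, 0 < d &
  forall x', `|x' - x| <= e -> A x' /\
    forall t, 0 <= t <= 1 -> A (p + t *: (x' - p)) /\ d <= `|p + t *: (x' - p) - c|].
Proof.
move=> Ax.
have zE (x' : 'rV[R]_2) (t : R) j : (p + t *: (x' - p) - c) 0 j = t * (x' - c) 0 j - (1 - t) * (j == 0)%:R.
  by rewrite /p !mxE eqxx /=; ring.
have subE (a b : 'rV[R]_2) j : (a - b) 0 j = a 0 j - b 0 j by rewrite !mxE.
have zle (x' : 'rV[R]_2) (t d : R) : (d <= `|(p + t *: (x' - p) - c) 0 0| \/ d <= `|(p + t *: (x' - p) - c) 0 1|) ->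
    d <= `|p + t *: (x' - p) - c|.
  by case=> h; apply: le_trans h (coord_le _ _ _).
have coordd (x' : 'rV[R]_2) j : `|x' 0 j - x 0 j| <= `|x' - x|.
  by have := coord_le (x' - x) 0 j; rewrite !mxE.
have [x1|x1] := eqVneq (x 0 1) (c 0 1).
  have x0 : x 0 0 < c 0 0 by rewrite ltNge; apply/negP => h; apply: Ax.
  pose e := (c 0 0 - x 0 0) / 2; have e0 : 0 < e by rewrite /e; lra.
  exists e, (Num.min 1 e); split => //; first by rewrite lt_min ltr01.
  move=> x' xx'; have h0 := coordd x' 0; have x'0 : x' 0 0 <= c 0 0 - e.
    by have := ler_norm (x' 0 0 - x 0 0); rewrite /e in xx' h0 *; lra.
  split; first by move=> [_ h]; lra.
  move=> t /andP[t0 t1].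
  have zz : (p + t *: (x' - p) - c) 0 0 <= - Num.min 1 e.
    rewrite zE eqxx mulr1 !mxE.
    have me : Num.min 1 e <= e by rewrite ge_min lexx orbT.
    have m1 : Num.min 1 e <= 1 by rewrite ge_min lexx.
    have h1 : t * (x' 0 0 - c 0 0) <= t * (- Num.min 1 e) by rewrite ler_wpM2l //; lra.
    have h2 : (1 - t) * Num.min 1 e <= (1 - t) * 1 by rewrite ler_wpM2l //; lra.
    lra.
  have m0 : 0 < Num.min 1 e by rewrite lt_min ltr01.
  split.
    by move=> [_ h]; move: zz; rewrite subE; lra.
  by apply: zle; left; rewrite ler0_norm; lra.
pose Y := `|x 0 0 - c 0 0| + `|x 0 1 - c 0 1|.
have y1 : 0 < `|x 0 1 - c 0 1| by rewrite normr_gt0 subr_eq0.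
pose e := `|x 0 1 - c 0 1| / 2; have e0 : 0 < e by rewrite /e; lra.
have Y0 : 0 < 1 + Y by rewrite /Y; have := normr_ge0 (x 0 0 - c 0 0); lra.
(* Up to the time [1 / (2 (1 + Y))] the segment is still at least 1/2 to the left of the core;
   afterwards its distance to the line of the cut is at least [e / (2 (1 + Y))]. *)
pose d := Num.min (1 / 2) (e / (2 * (1 + Y))).
have d0 : 0 < d by rewrite lt_min !divr_gt0 //; lra.
exists e, d; split => // x' xx'.
have h0 := coordd x' 0; have h1 := coordd x' 1.
have x'1 : e <= `|x' 0 1 - c 0 1|.
  have := ler_distD (x' 0 1) (x 0 1) (c 0 1); rewrite (distrC (x 0 1) (x' 0 1)) /e in xx' *; lra.
have x'0 : `|x' 0 0 - c 0 0| <= Y.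
  have := ler_distD (x 0 0) (x' 0 0) (c 0 0); rewrite /Y /e in xx' *; lra.
have key t : 0 <= t <= 1 -> (p + t *: (x' - p) - c) 0 0 <= - d \/
    d <= `|(p + t *: (x' - p) - c) 0 1|.
  move=> /andP[t0 t1]; rewrite !zE eqxx mulr1 /= mulr0 subr0 !mxE normrM (ger0_norm t0).
  have [tY|tY] := lerP t (1 / (2 * (1 + Y))).
    left; have d1 : d <= 1 / 2 by rewrite ge_min lexx.
    have : t * (1 + (x' 0 0 - c 0 0)) <= 1 / 2.
      apply: (@le_trans _ _ (t * (1 + Y))).
        by rewrite ler_wpM2l //; have := ler_norm (x' 0 0 - c 0 0); lra.
      have -> : 1 / 2 = 1 / (2 * (1 + Y)) * (1 + Y) by field; lra.
      by rewrite ler_wpM2r // ltW.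
    lra.
  right; apply: (@le_trans _ _ (1 / (2 * (1 + Y)) * e)).
    by rewrite mulrC mul1r ge_min lexx orbT.
  by apply: ler_pM => //; rewrite ?divr_ge0 ?mulr_ge0 // ltW.
split; first by move=> [h _]; move: x'1; rewrite h subrr normr0; lra.
move=> t t01; have [h|h] := key t t01.
  split; last by apply: zle; left; rewrite ler0_norm; lra.
  by move=> [_ h']; move: h; rewrite subE; lra.
split; last by apply: zle; right.
by move=> [h' _]; move: h; rewrite subE h' subrr normr0; lra.
Qed.

Lemma dirP (v x : 'rV[R]_2) : A x -> 'D_v P x = v 0 0 * dP 0 x + v 0 1 * dP 1 x.
Proof. by move=> Ax; rewrite derive_sum_row ?sum2E ?derP //; exact: diffP. Qed.

Lemma dirQ (v x : 'rV[R]_2) : A x -> 'D_v Q x = v 0 0 * dQ 0 x + v 0 1 * dQ 1 x.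
Proof. by move=> Ax; rewrite derive_sum_row ?sum2E ?derQ //; exact: diffQ. Qed.

Lemma continuous_line (F : 'rV[R]_2 -> R) (z w : 'rV[R]_2) t :
  {for z + t *: w, continuous F} -> {for t, continuous (fun s : R => F (z + s *: w))}.
Proof.
move=> cF; apply: (@continuous_comp _ _ _ (fun s : R => z + s *: w) F) => //.
apply: continuousD; first exact: cst_continuous.
exact: scalel_continuous.
Qed.

Lemma continuous_combB (G H : R -> R) (a b t : R) :
  {for t, continuous G} -> {for t, continuous H} ->
  {for t, continuous (fun s => a * G s - b * H s)}.
Proof.
move=> cG cH; have cc (d : R) : {for t, continuous (fun=> d)} by exact: cst_continuous.
by apply: continuousB; apply: continuousM.
Qed.

Lemma line_deriveP (z w : 'rV[R]_2) t : A (z + t *: w) ->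
  is_derive t 1 (fun s => P (z + s *: w)) (w 0 0 * dP 0 (z + t *: w) + w 0 1 * dP 1 (z + t *: w)).
Proof. by move=> Az; rewrite -dirP //; apply: line_derive; exact/diff_derivable/diffP. Qed.

Lemma line_deriveQ (z w : 'rV[R]_2) t : A (z + t *: w) ->
  is_derive t 1 (fun s => Q (z + s *: w)) (w 0 0 * dQ 0 (z + t *: w) + w 0 1 * dQ 1 (z + t *: w)).
Proof. by move=> Az; rewrite -dirQ //; apply: line_derive; exact/diff_derivable/diffQ. Qed.

(** The integrand is the derivative in [t] of [t (v 0 1 * P - v 0 0 * Q)] along the ray. The
    derivative of [stream] under the integral sign takes this form once the divergence condition is
    used. *)
Lemma stream_radial (x v : 'rV[R]_2) : A x ->
  \int[mu]_(t in `[0, 1]) (v 0 1 * P (p + t *: (x - p)) - v 0 0 * Q (p + t *: (x - p)) +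
     t * (v 0 1 * ((x - p) 0 0 * dP 0 (p + t *: (x - p)) + (x - p) 0 1 * dP 1 (p + t *: (x - p)))
        - v 0 0 * ((x - p) 0 0 * dQ 0 (p + t *: (x - p)) + (x - p) 0 1 * dQ 1 (p + t *: (x - p)))))
  = v 0 1 * P x - v 0 0 * Q x.
Proof.
move=> Ax; have [e [d [e0 d0 He]]] := star_far Ax.
have [_ Hz] : A x /\ forall t, 0 <= t <= 1 -> A (p + t *: (x - p)) /\ d <= `|p + t *: (x - p) - c|.
  by apply: He; rewrite subrr normr0 ltW.
set w := x - p in Hz *.
pose F t := t * (v 0 1 * P (p + t *: w) - v 0 0 * Q (p + t *: w)).
pose g (t : R) : R := v 0 1 * P (p + t *: w) - v 0 0 * Q (p + t *: w) + t *
  (v 0 1 * (w 0 0 * dP 0 (p + t *: w) + w 0 1 * dP 1 (p + t *: w)) -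
   v 0 0 * (w 0 0 * dQ 0 (p + t *: w) + w 0 1 * dQ 1 (p + t *: w))).
rewrite -[LHS]/(\int[mu]_(t in `[0, 1]) g t).
have dF (t : R) : 0 <= t <= 1 -> is_derive t 1 F (g t).
  move=> /Hz[Az _]; have dp := line_deriveP Az; have dq := line_deriveQ Az.
  rewrite /F /g; apply: is_derive_eq; rewrite /GRing.scale /=; ring.
have cg (t : R) : 0 <= t <= 1 -> {for t, continuous g}.
  move=> /Hz[Az _].
  have cP : {for t, continuous (fun s : R => P (p + s *: w))}.
    exact/continuous_line/differentiable_continuous/diffP.
  have cQ : {for t, continuous (fun s : R => Q (p + s *: w))}.
    exact/continuous_line/differentiable_continuous/diffQ.
  have cdP j : {for t, continuous (fun s : R => dP j (p + s *: w))} by exact/continuous_line/contP.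
  have cdQ j : {for t, continuous (fun s : R => dQ j (p + s *: w))} by exact/continuous_line/contQ.
  have cc (a : R) : {for t, continuous (fun=> a)} by exact: cst_continuous.
  have ci : {for t, continuous (fun s : R => s)} by exact: cvg_id.
  have cS (G H : R -> R) (a b : R) : {for t, continuous G} -> {for t, continuous H} ->
      {for t, continuous (fun s => a * G s + b * H s)}.
    by move=> cG cH; apply: continuousD; apply: continuousM.
  apply: continuousD; first exact: continuous_combB.
  by apply: continuousM => //; apply: continuous_combB; apply: cS.
have -> : v 0 1 * P x - v 0 0 * Q x = F 1 - F 0.
  by rewrite /F mul0r mul1r subr0 scale1r (_ : p + w = x) // /w addrC subrK.
exact: Rintegral_FTC.
Qed.

Lemma stream_derive (x v : 'rV[R]_2) : A x ->
  is_derive x v stream (v 0 1 * P x - v 0 0 * Q x).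
Proof.
move=> Ax; have [e [d [e0 d0 He]]] := star_far Ax.
pose ev := e / (`|v| + 1).
have v1 : 0 < `|v| + 1 by rewrite ltr_wpDl.
have ev0 : 0 < ev by rewrite divr_gt0.
have evv (h : R) : `|h| <= ev -> `|h *: v| <= e.
  move=> hev; rewrite normrZ; apply: (@le_trans _ _ (ev * (`|v| + 1))).
    by apply: ler_pM => //; rewrite lerDl.
  by rewrite /ev divfK // gt_eqF.
pose w := x - p.
pose f (h t : R) := (w 0 1 + h * v 0 1) * P ((p + t *: w) + h *: (t *: v)) -
                    (w 0 0 + h * v 0 0) * Q ((p + t *: w) + h *: (t *: v)).
have zE (h t : R) : p + t *: w + h *: (t *: v) = p + t *: ((x + h *: v) - p).
  have -> : x + h *: v - p = w + h *: v by rewrite /w addrAC.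
  by rewrite (scalerDr t w) addrA !scalerA (mulrC h).
have Hz (h t : R) : `|h| <= ev -> 0 <= t <= 1 ->
    A (p + t *: w + h *: (t *: v)) /\ d <= `|p + t *: w + h *: (t *: v) - c|.
  move=> hev t01; rewrite zE.
  have [_] : A (x + h *: v) /\ forall t, 0 <= t <= 1 -> A (p + t *: (x + h *: v - p)) /\
       d <= `|p + t *: (x + h *: v - p) - c|.
    by apply: He; rewrite addrC addKr; exact: evv.
  exact.
pose df h t := v 0 1 * P (p + t *: w + h *: (t *: v)) + (w 0 1 + h * v 0 1) *
     ((t *: v) 0 0 * dP 0 (p + t *: w + h *: (t *: v)) + (t *: v) 0 1 * dP 1 (p + t *: w + h *: (t *: v)))
   - (v 0 0 * Q (p + t *: w + h *: (t *: v)) + (w 0 0 + h * v 0 0) *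
     ((t *: v) 0 0 * dQ 0 (p + t *: w + h *: (t *: v)) + (t *: v) 0 1 * dQ 1 (p + t *: w + h *: (t *: v)))).
have dfE (h t : R) : `|h| <= ev -> 0 <= t <= 1 -> is_derive h 1 (f ^~ t) (df h t).
  move=> hev /(Hz _ _ hev)[Az _]; have dp := line_deriveP Az; have dq := line_deriveQ Az.
  rewrite /f /df; apply: is_derive_eq; rewrite /GRing.scale /=; ring.
have Fs (h : R) : stream (x + h *: v) = \int[mu]_(t in `[0, 1]) f h t.
  apply: eq_Rintegral => t _; rewrite /f zE; congr (_ * _ - _ * _); rewrite /w !mxE; ring.
have intf (h : R) : h \in `]- ev, ev[ -> mu.-integrable `[0, 1] (EFin \o f h).
  rewrite in_itv /= => /andP[h1 h2]; have hev : `|h| <= ev by rewrite ler_norml !ltW.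
  apply: continuous_compact_integrable; first exact: segment_compact.
  apply: continuous_in_subspaceT => t; rewrite inE /= in_itv /= => t01.
  have [Az _] := Hz h t hev t01.
  have -> : f h = (fun t => (w 0 1 + h * v 0 1) * P (p + t *: ((x + h *: v) - p)) -
                    (w 0 0 + h * v 0 0) * Q (p + t *: ((x + h *: v) - p))).
    by apply/funext => s; rewrite /f zE.
  rewrite zE in Az.
  apply: continuous_combB.
    exact/continuous_line/differentiable_continuous/diffP.
  exact/continuous_line/differentiable_continuous/diffQ.
pose M := `|v| * (C0 / d) + (`|w| + e) * (`|v| * (C0 / d ^+ 2) + `|v| * (C0 / d ^+ 2)) +
   (`|v| * (C0 / d) + (`|w| + e) * (`|v| * (C0 / d ^+ 2) + `|v| * (C0 / d ^+ 2))).
have ub (h t : R) : `|h| <= ev -> 0 <= t <= 1 -> `|df h t| <= M.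
  move=> hev t01; have [Az dz] := Hz h t hev t01.
  set z := p + t *: w + h *: (t *: v) in Az dz *.
  have z0 : 0 < `|z - c| by exact: lt_le_trans dz.
  have b1 : C0 / `|z - c| <= C0 / d by rewrite ler_wpM2l // lef_pV2.
  have b2 : C0 / `|z - c| ^+ 2 <= C0 / d ^+ 2.
    by rewrite ler_wpM2l // lef_pV2 ?posrE ?exprn_gt0 // lerXn2r ?nnegrE // ltW.
  have wb j : `|w 0 j + h * v 0 j| <= `|w| + e.
    rewrite (le_trans (ler_normD _ _)) // lerD ?coord_le //.
    by apply: le_trans (evv h hev); have := coord_le (h *: v) 0 j; rewrite mxE.
  have tv j : `|(t *: v) 0 j| <= `|v|.
    rewrite mxE normrM; have /andP[t0 t1] := t01; rewrite (ger0_norm t0).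
    apply: le_trans (coord_le v 0 j); by rewrite ler_piMl.
  rewrite /df -/z /M; apply: (le_trans (ler_normB _ _)); apply: lerD.
    apply: (le_trans (ler_normD _ _)); apply: lerD; rewrite normrM; apply: ler_pM => //.
    - exact: coord_le.
    - exact: le_trans (boundP Az) b1.
    - apply: (le_trans (ler_normD _ _)); apply: lerD; rewrite normrM; apply: ler_pM => //.
      exact: le_trans (bounddP _ Az) b2.
      exact: le_trans (bounddP _ Az) b2.
  apply: (le_trans (ler_normD _ _)); apply: lerD; rewrite normrM; apply: ler_pM => //.
  - exact: coord_le.
  - exact: le_trans (boundQ Az) b1.
  - apply: (le_trans (ler_normD _ _)); apply: lerD; rewrite normrM; apply: ler_pM => //.
    exact: le_trans (bounddQ _ Az) b2.
    exact: le_trans (bounddQ _ Az) b2.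
have M0 : 0 <= M.
  by rewrite /M; do ![apply: addr_ge0 | apply: mulr_ge0 | rewrite invr_ge0] => //; rewrite ?sqr_ge0 // ltW.
have Ih (h : R) : h \in `]- ev, ev[ -> `|h| <= ev.
  by rewrite in_itv /= => /andP[h1 h2]; rewrite ler_norml !ltW.
have I0 : (0 : R) \in `]- ev, ev[ by rewrite in_itv /= oppr_lt0 ev0.
have key := @cvg_differentiation_under_integral R _ _ mu f `[0, 1]
  (measurable_itv _) 0 (- ev) ev I0 intf.
have {}key : h^-1 *: (stream (h *: v + x) - stream x) @[h --> 0^'] --> v 0 1 * P x - v 0 0 * Q x.
  have -> : (fun h : R => h^-1 *: (stream (h *: v + x) - stream x)) =
      (fun h : R => h^-1 *: (\int[mu]_(t in `[0, 1]) f (h + 0) t - \int[mu]_(t in `[0, 1]) f 0 t)).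
    apply/funext => h; rewrite addr0 (addrC _ x) Fs; congr (_ *: (_ - _)).
    by rewrite -Fs scale0r addr0.
  have -> : v 0 1 * P x - v 0 0 * Q x = \int[mu]_(t in `[0, 1]) (partial1of2 f) 0 t.
    rewrite -stream_radial //; apply: eq_Rintegral => t.
    rewrite inE /= in_itv /= => t01; rewrite partial1of2E.
    have n0 : `|0 : R| <= ev by rewrite normr0 ltW.
    have [_ ->] := dfE 0 t n0 t01; rewrite /df scale0r addr0 !mul0r !addr0 -/w.
    have [Az _] := Hz 0 t n0 t01; rewrite scale0r addr0 in Az.
    (* Replacing [dQ 1] by [- dP 0] exchanges the roles of [v] and [w] in the terms with first
       derivatives, which makes them radial derivatives. *)
    have := div0 Az => h.
    have -> : dQ 1 (p + t *: w) = - dP 0 (p + t *: w) by apply/eqP; rewrite -addr_eq0 addrC h.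
    rewrite ![(t *: v) _ _]mxE; ring.
  apply: (key _ (fun=> M)) => //.
  - move=> h t /Ih hev /=; rewrite in_itv /= => t01.
    by have [] := dfE h t hev t01.
  - apply: continuous_compact_integrable; first exact: segment_compact.
    exact/continuous_subspaceT/cst_continuous.
  - move=> h t /Ih hev /=; rewrite in_itv /= => t01; rewrite partial1of2E.
    by have [_ ->] := dfE h t hev t01; exact: ub.
apply: DeriveDef; last exact/cvg_lim.
by apply/cvg_ex; eexists; exact: key.
Qed.

End Stream.

Section Triangle.
Variable R : realType.

Lemma norm_chain (a b d e u v w : R) : `|a - b| <= u -> `|d - e| <= v -> `|e - b| <= w ->
  `|a - d| <= u + v + w.
Proof.
move=> h1 h2 h3; have -> : a - d = (a - b) - (e - b) - (d - e) by ring.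
apply: (le_trans (ler_normB _ _)); have := ler_normB (a - b) (e - b); lra.
Qed.

End Triangle.

(** * Taylor bounds for the stream function and its continuity across the cut *)

Section Potential.
Variable R : realType.
Variables (c : 'rV[R]_2) (P Q : 'rV[R]_2 -> R) (dP dQ : 'I_2 -> 'rV[R]_2 -> R) (C0 : R).
Variable psi : 'rV[R]_2 -> R.
Local Notation A := (~` branch_cut c).
Local Notation mu := (@lebesgue_measure R).
Hypothesis C0_ge0 : 0 <= C0.
Hypothesis diffP : forall x, A x -> differentiable P x.
Hypothesis diffQ : forall x, A x -> differentiable Q x.
Hypothesis derP : forall j x, A x -> 'D_(evec R j) P x = dP j x.
Hypothesis derQ : forall j x, A x -> 'D_(evec R j) Q x = dQ j x.
Hypothesis boundP : forall x, A x -> `|P x| <= C0 / `|x - c|.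
Hypothesis boundQ : forall x, A x -> `|Q x| <= C0 / `|x - c|.
Hypothesis bounddP : forall j x, A x -> `|dP j x| <= C0 / `|x - c| ^+ 2.
Hypothesis bounddQ : forall j x, A x -> `|dQ j x| <= C0 / `|x - c| ^+ 2.
Hypothesis psi_derive : forall (x v : 'rV[R]_2), A x ->
  is_derive x v psi (v 0 1 * P x - v 0 0 * Q x).

Lemma stream_taylor x h : (forall t, 0 <= t <= 1 -> A (x + t *: h)) ->
  0 < `|x - c| -> `|h| <= `|x - c| / 2 ->
  `|psi (x + h) - psi x - (h 0 1 * P x - h 0 0 * Q x)|
    <= 16 * C0 * `|h| ^+ 2 / `|x - c| ^+ 2.
Proof.
move=> seg d0 hd; have [|t t01 ->] := @mvt_seg R _ psi x h.
  by move=> t t01; have [] := psi_derive h (seg t t01).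
have [_ ->] := psi_derive h (seg t t01).
have [t0 t1] := andP t01.
have seg' s : 0 <= s <= 1 -> A (x + s *: (t *: h)).
  move=> /andP[s0 s1]; rewrite scalerA; apply: seg; rewrite mulr_ge0 //=.
  by rewrite mulr_ile1.
have th : `|t *: h| <= `|h| by rewrite normrZ ger0_norm // ler_piMl.
have hd' : `|t *: h| <= `|x - c| / 2 by exact: le_trans hd.
have bP := lip_decay C0_ge0 diffP derP bounddP seg' d0 hd'.
have bQ := lip_decay C0_ge0 diffQ derQ bounddQ seg' d0 hd'.
set r := `|x - c| in bP bQ d0 *.
have r20 : 0 < r ^+ 2 by rewrite exprn_gt0.
have b8 : 2 ^+ 3 * C0 * `|t *: h| / r ^+ 2 <= 8 * C0 * `|h| / r ^+ 2.
  rewrite ler_wpM2r ?invr_ge0 ?(ltW r20) //.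
  have -> : (2 ^+ 3 : R) = 8 by ring.
  by rewrite ler_wpM2l // mulr_ge0.
have -> : h 0 1 * P (x + t *: h) - h 0 0 * Q (x + t *: h) - (h 0 1 * P x - h 0 0 * Q x)
  = h 0 1 * (P (x + t *: h) - P x) - h 0 0 * (Q (x + t *: h) - Q x) by ring.
apply: (le_trans (ler_normB _ _)); rewrite !normrM.
have l1 : `|h 0 1| * `|P (x + t *: h) - P x| <= `|h| * (8 * C0 * `|h| / r ^+ 2).
  by apply: ler_pM => //; [exact: coord_le|exact: le_trans b8].
have l2 : `|h 0 0| * `|Q (x + t *: h) - Q x| <= `|h| * (8 * C0 * `|h| / r ^+ 2).
  by apply: ler_pM => //; [exact: coord_le|exact: le_trans b8].
have -> : 16 * C0 * `|h| ^+ 2 / r ^+ 2 = 2 * (`|h| * (8 * C0 * `|h| / r ^+ 2)) by ring.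
lra.
Qed.

Lemma stream_lip x h : (forall t, 0 <= t <= 1 -> A (x + t *: h)) ->
  0 < `|x - c| -> `|h| <= `|x - c| / 2 ->
  `|psi (x + h) - psi x| <= 4 * C0 * `|h| / `|x - c|.
Proof.
move=> seg d0 hd; have [|t t01 ->] := @mvt_seg R _ psi x h.
  by move=> t t01; have [] := psi_derive h (seg t t01).
have [_ ->] := psi_derive h (seg t t01).
have fl := far_line hd t01.
have z0 : 0 < `|x + t *: h - c| by apply: lt_le_trans fl; rewrite divr_gt0.
have b : C0 / `|x + t *: h - c| <= 2 * C0 / `|x - c|.
  rewrite ler_pdivrMr // mulrAC ler_pdivlMr // mulrC; have := ler_wpM2r C0_ge0 fl; lra.
apply: (le_trans (ler_normB _ _)); rewrite !normrM.
have l1 : `|h 0 1| * `|P (x + t *: h)| <= `|h| * (2 * C0 / `|x - c|).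
  by apply: ler_pM => //; [exact: coord_le|exact: le_trans (boundP (seg t t01)) b].
have l2 : `|h 0 0| * `|Q (x + t *: h)| <= `|h| * (2 * C0 / `|x - c|).
  by apply: ler_pM => //; [exact: coord_le|exact: le_trans (boundQ (seg t t01)) b].
have -> : 4 * C0 * `|h| / `|x - c| = 2 * (`|h| * (2 * C0 / `|x - c|)) by ring.
lra.
Qed.

Lemma open_ball_off_cut x : A x -> exists2 e : R, 0 < e & forall x', `|x' - x| <= e -> A x'.
Proof.
by move=> /star_far[e [d [e0 _ H]]]; exists e => // x' /H[].
Qed.

(** The angular derivative of the stream function is the outward flux density on the circle, the
    integrand of the flux condition. *)
Lemma stream_circle t : 0 < t -> t < 2 * pi ->
  is_derive t 1 (fun s => psi (c + pt (cos s) (sin s)))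
    (cos t * P (c + pt (cos t) (sin t)) + sin t * Q (c + pt (cos t) (sin t))).
Proof.
move=> t0 t2; set x := c + pt (cos t) (sin t).
have Ax : A x by exact: circle_off_cut.
have [e0 e00 He] := open_ball_off_cut Ax.
have dx : 1 / 2 <= `|x - c| by rewrite /x addrC addKr; exact: circle_norm_ge.
have dx0 : 0 < `|x - c| by lra.
(* The comparison function is the linear part of [psi] at the fixed point [x], restricted to the
   circle. *)
apply: (@is_derive_quadratic R _ (fun s => sin s * P x - cos s * Q x) t _
  (16 * C0 / `|x - c| ^+ 2) (Num.min e0 (1 / 4))).
- by rewrite lt_min e00; lra.
- move=> s; rewrite le_min => /andP[s0 s4].
  pose h := pt (cos (s + t) - cos t) (sin (s + t) - sin t).
  have hs : `|h| <= `|s|.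
    apply: pt_norm => //; [have := lip_cos (s + t) t|have := lip_sin (s + t) t];
      by rewrite addrK.
  have -> : c + pt (cos (s + t)) (sin (s + t)) = x + h.
    by apply/rowP => j; rewrite /x !mxE; case: ifP => _; ring.
  have -> : sin (s + t) * P x - cos (s + t) * Q x - (sin t * P x - cos t * Q x) =
     h 0 1 * P x - h 0 0 * Q x by rewrite /h !ptE /=; ring.
  apply: (le_trans (@stream_taylor x h _ dx0 _)).
  + move=> r /andP[r0 r1]; apply: He; rewrite addrC addKr normrZ ger0_norm //.
    by apply: le_trans s0; apply: le_trans hs; rewrite ler_piMl.
  + by apply: (le_trans hs); lra.
  + rewrite mulrAC ler_wpM2l ?divr_ge0 ?mulr_ge0 ?exprn_ge0 //.
    by rewrite -[s ^+ 2]real_normK ?num_real // lerXn2r ?nnegrE.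
- by apply: is_derive_eq; rewrite /GRing.scale /=; ring.
Qed.

Let k (t : R) : R := cos t * P (c + pt (cos t) (sin t)) + sin t * Q (c + pt (cos t) (sin t)).

Let k_bound t : 0 < t -> t < 2 * pi -> `|k t| <= 4 * C0.
Proof.
move=> t0 t2; have Ax := circle_off_cut (c := c) t0 t2.
have dx := circle_norm_ge t.
have b (F : 'rV[R]_2 -> R) : `|F (c + pt (cos t) (sin t))| <= C0 / `|c + pt (cos t) (sin t) - c| ->
    `|F (c + pt (cos t) (sin t))| <= 2 * C0.
  move=> h; apply: (le_trans h); rewrite addrC addKr ler_pdivrMr; last by lra.
  by have := ler_wpM2l C0_ge0 dx; lra.
have bP := b P (boundP Ax); have bQ := b Q (boundQ Ax).
apply: (le_trans (ler_normD _ _)); rewrite !normrM.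
have l1 : `|cos t| * `|P (c + pt (cos t) (sin t))| <= 1 * (2 * C0).
  by apply: ler_pM => //; rewrite ler_norml cos_geN1 cos_le1.
have l2 : `|sin t| * `|Q (c + pt (cos t) (sin t))| <= 1 * (2 * C0).
  by apply: ler_pM => //; rewrite ler_norml sin_geN1 sin_le1.
lra.
Qed.

Let k_cont t : 0 < t -> t < 2 * pi -> {for t, continuous k}.
Proof.
move=> t0 t2; have Ax := circle_off_cut (c := c) t0 t2.
have cg : {for t, continuous (fun s : R => c + pt (cos s) (sin s))}.
  have -> : (fun s : R => c + pt (cos s) (sin s)) =
     (fun s => c + (cos s *: evec R 0 + sin s *: evec R 1)).
    apply/funext => s; congr (_ + _); apply/rowP => j; rewrite ptE !mxE eqxx /=.
    case: (unliftP 0 j) => [i|] ->; first by rewrite ord1 /=; ring.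
    by rewrite /=; ring.
  apply: continuousD; first exact: cst_continuous.
  apply: continuousD; apply: (@continuousZl); first [exact: continuous_cos|exact: continuous_sin].
have cP : {for t, continuous (fun s : R => P (c + pt (cos s) (sin s)))}.
  apply: (@continuous_comp _ _ _ (fun s : R => c + pt (cos s) (sin s)) P) => //.
  exact/differentiable_continuous/diffP.
have cQ : {for t, continuous (fun s : R => Q (c + pt (cos s) (sin s)))}.
  apply: (@continuous_comp _ _ _ (fun s : R => c + pt (cos s) (sin s)) Q) => //.
  exact/differentiable_continuous/diffQ.
apply: continuousD; apply: continuousM => //; [exact: continuous_cos|exact: continuous_sin].
Qed.

Let k_int : mu.-integrable `]0, (2 * pi)[ (EFin \o k).
Proof.
apply: measurable_bounded_integrable => //.
- by rewrite /= lebesgue_measure_itv /=; case: ifP => _; rewrite ltry.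
- apply: subspace_continuous_measurable_fun => //.
  by apply: continuous_in_subspaceT => t; rewrite inE /= in_itv /= => /andP[]; exact: k_cont.
- exists (4 * C0); split; first exact: num_real.
  move=> y hy t; rewrite /= in_itv /= => /andP[t0 t2].
  exact: le_trans (k_bound t0 t2) (ltW hy).
Qed.

Let k_small (D : set R) (r : R) : measurable D -> D `<=` `]0, (2 * pi)[ -> mu D = r%:E ->
  `|\int[mu]_(t in D) k t| <= 4 * C0 * r.
Proof.
move=> mD Dsub Dr.
have kD : mu.-integrable D (EFin \o k) by apply: integrableS k_int.
apply: (le_trans (@le_normr_Rintegral _ _ _ mu D k mD kD)).
apply: (@le_trans _ _ (\int[mu]_(t in D) (4 * C0))); last first.
  rewrite (@Rintegral_cst _ _ _ mu D mD); apply: ler_wpM2l; first exact: mulr_ge0.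
  by have := congr1 fine Dr => /= e; rewrite le_eqVlt; apply/orP; left; apply/eqP; exact: e.
apply: (@le_Rintegral _ _ _ mu D) => //.
- by have := integrable_norm kD.
- apply/integrableP; split; first exact: measurable_cst.
  by rewrite integral_cst //= Dr -EFinM ltry.
- by move=> t /Dsub; rewrite /= in_itv /= => /andP[]; exact: k_bound.
Qed.

(** The two points have the polar angles [2 pi - t] and [t]: mirror images with respect to the
    cut. *)
Definition arc_gap := forall t, 0 < t -> t < pi ->
  `|psi (c + pt (cos t) (- sin t)) - psi (c + pt (cos t) (sin t))| <= 8 * C0 * t.

(** The gap is the flux through the long arc between the two points. As the total flux is zero, it
    is minus the flux through the two short arcs beside the cut, each of which is at most
    [4 C0 t]. *)
Lemma stream_gap : \int[mu]_(t in `]0, (2 * pi)[)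
  (P (c + pt (cos t) (sin t)) * cos t + Q (c + pt (cos t) (sin t)) * sin t) = 0 -> arc_gap.
Proof.
move=> flux0 t t0 tpi; have pi0 : 0 < pi :> R by exact: pi_gt0.
have a1 : t <= 2 * pi - t by lra.
have a2 : 2 * pi - t <= 2 * pi by lra.
have a3 : t <= 2 * pi by lra.
have a4 : 0 <= 2 * pi - t by lra.
have a5 : t < 2 * pi - t by lra.
have a6 : t < 2 * pi by lra.
have a7 : 2 * pi - t < 2 * pi by lra.
have E : psi (c + pt (cos t) (- sin t)) - psi (c + pt (cos t) (sin t)) =
    \int[mu]_(s in `[t, 2 * pi - t]) k s.
  pose F s := psi (c + pt (cos s) (sin s)).
  transitivity (F (2 * pi - t) - F t).
    have ec : cos (2 * pi - t) = cos t :> R by rewrite mulr_natl cosB cos2pi sin2pi; ring.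
    have es : sin (2 * pi - t) = - sin t :> R by rewrite mulr_natl sinB cos2pi sin2pi; ring.
    by rewrite /F ec es.
  apply/esym; apply: Rintegral_FTC; first by lra.
    by move=> s /andP[s1 s2]; apply: k_cont; lra.
  by move=> s /andP[s1 s2]; apply: stream_circle; lra.
have F0 : \int[mu]_(s in `]0, (2 * pi)[) k s = 0.
  by apply: etrans flux0; apply: eq_Rintegral => s _; rewrite /k mulrC (mulrC (sin s)).
have s1 := @Rintegral_itvB R k (BRight 0) (BLeft (2 * pi)) t k_int.
rewrite F0 sub0r in s1.
have k_int2 : mu.-integrable `]t, (2 * pi)[ (EFin \o k).
  apply: (integrableS _ _ _ k_int); [exact: measurable_itv|exact: measurable_itv|].
  by apply: subset_itvr; rewrite bnd_simp; exact: ltW.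
have s2 := @Rintegral_itvB R k (BRight t) (BLeft (2 * pi)) (2 * pi - t) k_int2.
rewrite E -Rintegral_itv_obnd_cbnd; last first.
  apply: (integrableS _ _ _ k_int2); [exact: measurable_itv|exact: measurable_itv|].
  by apply: subset_itvl; rewrite bnd_simp.
have -> : \int[mu]_(s in `]t, (2 * pi - t)]) k s =
    - (\int[mu]_(s in `]0, t]) k s) - (\int[mu]_(s in `](2 * pi - t), (2 * pi)[) k s).
  have {}s1 := s1 ltac:(by rewrite bnd_simp ltW) ltac:(by rewrite bnd_simp).
  have {}s2 := s2 ltac:(by rewrite bnd_simp) ltac:(by rewrite bnd_simp).
  have e1 : - (\int[mu]_(s in `]0, t]) k s) = \int[mu]_(s in `]t, (2 * pi)[) k s by exact: s1.
  have e2 : (\int[mu]_(s in `]t, (2 * pi)[) k s) - (\int[mu]_(s in `]t, (2 * pi - t)]) k s) =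
    \int[mu]_(s in `](2 * pi - t), (2 * pi)[) k s by exact: s2.
  by rewrite e1 -e2 opprB addrCA subrr addr0.
apply: (le_trans (ler_normB _ _)); rewrite normrN.
have b1 : `|\int[mu]_(s in `]0, t]) k s| <= 4 * C0 * t.
  apply: k_small => //.
    by apply: subset_itvl; rewrite bnd_simp.
  by rewrite lebesgue_measure_itv /= lte_fin t0 oppr0 adde0.
have b2 : `|\int[mu]_(s in `](2 * pi - t), (2 * pi)[) k s| <= 4 * C0 * t.
  apply: k_small => //.
    by apply: subset_itvr; rewrite bnd_simp.
  by rewrite lebesgue_measure_itv /= lte_fin gtrBl t0 -EFinB; congr EFin; rewrite opprB addrCA subrr addr0.
apply: (le_trans (lerD b1 b2)); rewrite le_eqVlt; apply/orP; left; apply/eqP; ring.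
Qed.

Lemma off_cut_vert (s h : R) : h != 0 -> A (c + pt s h).
Proof.
by move=> h0 [e _]; move: e; rewrite !mxE /= => e; apply/negP: h0; apply/negPn/eqP; lra.
Qed.

Lemma Q_vert (s h h' : R) : 1 / 2 <= s -> 0 < h * h' -> `|h'| <= `|h| -> `|h| <= 1 / 4 ->
  `|Q (c + pt s h') - Q (c + pt s h)| <= 32 * C0 * `|h|.
Proof.
move=> s2 hh h'h h4.
have d1 : 1 / 2 <= `|c + pt s h - c|.
  rewrite addrC addKr; apply: (le_trans s2); have := coord_le (pt s h) 0 0.
  by rewrite ptE /=; apply: le_trans; exact: ler_norm.
have d0 : 0 < `|c + pt s h - c| by lra.
have E : c + pt s h + pt 0 (h' - h) = c + pt s h'.
  by apply/rowP => j; rewrite !mxE; case: ifP => _; ring.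
have kh : `|pt 0 (h' - h) : 'rV[R]_2| <= `|h|.
  apply: pt_norm => //; first by rewrite normr0.
  have [h0|h0] := lerP 0 h.
    have h'0 : 0 <= h' by nra.
    rewrite (ger0_norm h0) (ger0_norm h'0) in h'h *; rewrite ler_norml; lra.
  have h'0 : h' <= 0 by nra.
  rewrite (ltr0_norm h0) (ler0_norm h'0) in h'h *; rewrite ler_norml; lra.
have := @lip_decay R A c Q dQ C0 2 (c + pt s h) (pt 0 (h' - h)) C0_ge0 diffQ derQ bounddQ _ d0 _.
rewrite E => H; apply: (le_trans (H _ _)).
- move=> t /andP[t0 t1].
  have -> : c + pt s h + t *: pt 0 (h' - h) = c + pt s (h + t * (h' - h)).
    by apply/rowP => j; rewrite !mxE; case: ifP => _; ring.
  apply: off_cut_vert; apply/eqP => e.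
  have : h * (h + t * (h' - h)) = 0 by rewrite e mulr0.
  have h2 : 0 < h ^+ 2 by rewrite exprn_even_gt0 //=; apply/eqP => z; rewrite z mul0r ltxx in hh.
  have [t11|t11] := eqVneq t 1; first by rewrite t11 => z; nra.
  have : 0 < (1 - t) * h ^+ 2 by rewrite mulr_gt0 // subr_gt0 lt_neqAle t11.
  have : 0 <= t * (h * h') by rewrite mulr_ge0 // ltW.
  nra.
- by apply: (le_trans kh); lra.
- set r := `|c + pt s h - c| in d1 d0 *.
  rewrite ler_pdivrMr ?exprn_gt0 //.
  have -> : (2 ^+ 3 : R) = 8 by ring.
  have r2 : 1 / 4 <= r ^+ 2.
    have -> : 1 / 4 = (1 / 2) ^+ 2 :> R by field.
    by rewrite lerXn2r ?nnegrE //; lra.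
  have l1 : 8 * C0 * `|pt 0 (h' - h) : 'rV[R]_2| <= 8 * C0 * `|h|.
    by rewrite ler_wpM2l // mulr_ge0.
  have l2 : 32 * C0 * `|h| * (1 / 4) <= 32 * C0 * `|h| * r ^+ 2.
    by rewrite ler_wpM2l // !mulr_ge0.
  lra.
Qed.

(** Uniform in [s], with a rate in [h]: it is used at an abscissa produced by the mean value
    theorem, for which equality of the one-sided limits point by point would not suffice. *)
Definition cut_gap := forall s h : R, 1 / 2 <= s -> 0 < h -> h <= 1 / 4 ->
  `|Q (c + pt s h) - Q (c + pt s (- h))| <= 64 * C0 * h.

Lemma Q_gap : (forall x, branch_cut c x -> x != c -> exists q : R,
  Q (pt (x 0 0) t) @[t --> (x 0 1)^'+] --> q /\ Q (pt (x 0 0) t) @[t --> (x 0 1)^'-] --> q) ->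
  cut_gap.
Proof.
move=> jumpQ s h s2 h0 h4.
have [||q [qp qm]] := jumpQ (c + pt s 0).
- by split; rewrite !mxE /= ?addr0 // lerDl; lra.
- apply/eqP => /rowP/(_ 0); rewrite !mxE /= => e; lra.
move: qp qm; rewrite !mxE /= addr0 => qp qm.
have cE t : pt (c 0 0 + s) t = c + pt s (t - c 0 1).
  apply/rowP => j; rewrite !mxE; case: (unliftP 0 j) => [i|] -> /=; last by ring.
  by rewrite ord1 (_ : lift 0 0 = 1); [ring|exact/val_inj].
have h40 : `|h| <= 1 / 4 by rewrite gtr0_norm.
have ch : c 0 1 < c 0 1 + h by lra.
have cmh : c 0 1 - h < c 0 1 by lra.
have bp : `|q - Q (c + pt s h)| <= 32 * C0 * h.
  apply/ler_addgt0Pr => e e0.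
  have [t [t1 t2 t3]] := at_right_point qp h0 e0.
  rewrite cE in t3.
  have := @Q_vert s h (t - c 0 1) s2; rewrite (gtr0_norm h0) (@gtr0_norm _ (t - _)); last by lra.
  move=> /(_ ltac:(nra) ltac:(lra) h4) Hv.
  have := ler_distD (Q (c + pt s (t - c 0 1))) q (Q (c + pt s h)); lra.
have bm : `|q - Q (c + pt s (- h))| <= 32 * C0 * h.
  apply/ler_addgt0Pr => e e0.
  have [t [t2 t1 t3]] := at_left_point qm h0 e0.
  rewrite cE in t3.
  have := @Q_vert s (- h) (t - c 0 1) s2; rewrite normrN (gtr0_norm h0) (@ltr0_norm _ (t - _)); last by lra.
  move=> /(_ ltac:(nra) ltac:(lra) h4) Hv.
  have := ler_distD (Q (c + pt s (t - c 0 1))) q (Q (c + pt s (- h))); lra.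
have := ler_distD q (Q (c + pt s h)) (Q (c + pt s (- h))); rewrite (distrC _ q); lra.
Qed.

(** The gap across the cut is transported horizontally from the unit circle to the abscissa [s], its
    derivative being the gap of [Q]. The bound grows with [s] but is proportional to [t], which is
    sent to 0 afterwards. *)
Lemma stream_gap_line (s t : R) : arc_gap -> cut_gap -> 1 / 2 <= s -> 0 < t -> t <= 1 / 4 ->
  `|psi (c + pt s (- sin t)) - psi (c + pt s (sin t))|
    <= t * (C0 * (8 + 64 * (s + 1))).
Proof.
move=> agap cgap s2 t0 t4.
have pi4 : t < pi by have := pi_ge2 R; lra.
have st0 : 0 < sin t by apply: sin_gt0_pi; rewrite t0.
have stt : sin t <= t.
  by have := lip_sin t 0; rewrite sin0 !subr0 gtr0_norm // gtr0_norm.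
have ct : 1 / 2 <= cos t.
  by have := lip_cos t 0; rewrite cos0 subr0 (gtr0_norm t0) ler_norml => /andP[]; lra.
have ct1 := cos_le1 t.
pose v := pt (s - cos t) 0 : 'rV[R]_2.
pose G x := psi (x + pt 0 (- sin t)) - psi (x + pt 0 (sin t)).
have xE r (z : R) : c + pt (cos t) 0 + r *: v + pt 0 z = c + pt (cos t + r * (s - cos t)) z.
  by apply/rowP => j; rewrite !mxE; case: ifP => _; ring.
have xE0 (z w : R) : c + pt w 0 + pt 0 z = c + pt w z.
  by apply/rowP => j; rewrite !mxE; case: ifP => _; ring.
have dG r : is_derive (c + pt (cos t) 0 + r *: v) v G
    ((s - cos t) * (Q (c + pt (cos t + r * (s - cos t)) (sin t)) -
                    Q (c + pt (cos t + r * (s - cos t)) (- sin t)))).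
  have d z : z != 0 -> is_derive (c + pt (cos t) 0 + r *: v) v (fun y => psi (y + pt 0 z))
      (- (s - cos t) * Q (c + pt (cos t + r * (s - cos t)) z)).
    move=> z0; apply: is_derive_shift_arg.
    rewrite xE; apply: is_derive_eq; first exact/psi_derive/off_cut_vert.
    by rewrite /v !ptE /=; ring.
  have d1 := d (sin t) ltac:(by rewrite gt_eqF).
  have d2 := d (- sin t) ltac:(by rewrite lt_eqF // oppr_lt0).
  by apply: is_derive_eq; ring.
have [|r /andP[r0 r1]] := @mvt_seg R _ G (c + pt (cos t) 0) v.
  by move=> r _; have [] := dG r.
have [_ ->] := dG r; rewrite /G.
have -> : c + pt (cos t) 0 + v = c + pt s 0.
  by apply/rowP => j; rewrite !mxE; case: ifP => _; ring.
rewrite !xE0 => E.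
have g := agap t t0 pi4.
set w := cos t + r * (s - cos t) in E.
have w2 : 1 / 2 <= w by exact: convex_ge.
have st4 : sin t <= 1 / 4 by lra.
have q := cgap w (sin t) w2 st0 st4.
have sc : `|s - cos t| <= s + 1 by rewrite ler_norml; lra.
have -> : psi (c + pt s (- sin t)) - psi (c + pt s (sin t)) =
  psi (c + pt (cos t) (- sin t)) - psi (c + pt (cos t) (sin t)) +
  (s - cos t) * (Q (c + pt w (sin t)) - Q (c + pt w (- sin t))) by rewrite -E; ring.
apply: (le_trans (ler_normD _ _)); rewrite normrM.
have m : `|s - cos t| * `|Q (c + pt w (sin t)) - Q (c + pt w (- sin t))| <= (s + 1) * (64 * C0 * t).
  apply: ler_pM => //; apply: (le_trans q); rewrite ler_wpM2l // mulr_ge0 //.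
lra.
Qed.

Lemma stream_same_side (x y : 'rV[R]_2) (K s : R) : 0 < (x 0 1 - c 0 1) * (y 0 1 - c 0 1) ->
  0 < s -> s <= x 0 0 - c 0 0 -> `|y - x| <= K -> 2 * K <= s ->
  `|psi y - psi x| <= 4 * C0 * K / s.
Proof.
move=> side s0 sx yx Ks.
have d1 : s <= `|x - c|.
  apply: (le_trans sx); have := coord_le (x - c) 0 0; rewrite !mxE; apply: le_trans; exact: ler_norm.
have d0 : 0 < `|x - c| by exact: lt_le_trans d1.
have := @stream_lip x (y - x) _ d0 _; rewrite (addrC x (y - x)) subrK => H.
apply: (le_trans (H _ _)).
- move=> t /andP[t0 t1] [e _]; move: e; rewrite !mxE => e.
  have : (x 0 1 - c 0 1) * (x 0 1 - c 0 1 + t * (y 0 1 - x 0 1)) = 0.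
    by have -> : x 0 1 - c 0 1 + t * (y 0 1 - x 0 1) = 0; [lra|rewrite mulr0].
  have x2 : 0 < (x 0 1 - c 0 1) ^+ 2.
    rewrite exprn_even_gt0 //=; apply/eqP => z; rewrite z mul0r ltxx in side; done.
  have [t11|t11] := eqVneq t 1; first by rewrite t11 => z; nra.
  have : 0 < (1 - t) * (x 0 1 - c 0 1) ^+ 2 by rewrite mulr_gt0 // subr_gt0 lt_neqAle t11.
  have : 0 <= t * ((x 0 1 - c 0 1) * (y 0 1 - c 0 1)) by rewrite mulr_ge0 // ltW.
  nra.
- by apply: (le_trans yx); lra.
- apply: ler_pM => //.
  + by rewrite !mulr_ge0.
  + by rewrite ler_wpM2l // mulr_ge0.
  + by rewrite lef_pV2.
Qed.

Local Ltac slim := clear - C0_ge0 diffP diffQ derP derQ boundP boundQ bounddP bounddQ psi_derive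
  k_bound k_cont k_int k_small.

(** Points on opposite sides are joined through two mirror points just above and below the cut at
    the abscissa of [x]. Each leg stays on one side and costs [4 C0 K / s]; the gap between the
    mirror points tends to 0 with [t0]. *)
Lemma stream_across (x y : 'rV[R]_2) (K : R) : arc_gap -> cut_gap -> x 0 1 != c 0 1 -> y 0 1 != c 0 1 ->
  0 <= K -> 1 + 2 * K <= x 0 0 - c 0 0 -> `|x - y| <= K ->
  `|psi x - psi y| <= 8 * C0 * K / (x 0 0 - c 0 0).
Proof.
move=> agap cgap x1 y1 K0 xK xy.
set s := x 0 0 - c 0 0 in xK *.
have s0 : 0 < s by lra.
have s1 : 1 / 2 <= s by lra.
have hd j : `|x 0 j - y 0 j| <= K.
  by apply: le_trans xy; have := coord_le (x - y) 0 j; rewrite !mxE.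
have CK0 : 0 <= 4 * C0 * K / s by rewrite divr_ge0 ?mulr_ge0 // ltW.
have E8 : 8 * C0 * K / s = 4 * C0 * K / s + 4 * C0 * K / s by ring.
have [side|side] := ltrP 0 ((x 0 1 - c 0 1) * (y 0 1 - c 0 1)).
  have := @stream_same_side x y K s side s0 (lexx _) _ _.
  rewrite distrC (distrC (psi y)) => /(_ xy ltac:(lra)); lra.
have M0 : 0 <= C0 * (8 + 64 * (s + 1)) by apply: mulr_ge0 => //; lra.
apply: (ler_addsmall M0) => t0 /andP[t00 t04].
have x1' : x 0 1 - c 0 1 != 0 by rewrite subr_eq0.
have y1' : y 0 1 - c 0 1 != 0 by rewrite subr_eq0.
(* Small enough for each mirror point to lie between the cut and the height of its endpoint, which
   keeps the vertical offset of both legs below [K]. *)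
pose m := Num.min t0 (Num.min `|x 0 1 - c 0 1| `|y 0 1 - c 0 1|).
have m0 : 0 < m by rewrite !lt_min t00 !normr_gt0 x1'.
have mt : m <= t0 by rewrite ge_min lexx.
have mx : m <= `|x 0 1 - c 0 1| by rewrite ge_min ge_min lexx orbT.
have m4 : m <= 1 / 4 by lra.
have my : m <= `|y 0 1 - c 0 1| by rewrite ge_min ge_min lexx !orbT.
have gap := @stream_gap_line s m agap cgap s1 m0 m4.
have st0 : 0 < sin m by apply: sin_gt0_pi; rewrite m0; have := pi_ge2 R; lra.
have stt : sin m <= m.
  by have := lip_sin m 0; rewrite sin0 !subr0 gtr0_norm // gtr0_norm.
have ptc (z w : R) : (c + pt z w) 0 0 - c 0 0 = z by rewrite !mxE /=; ring.
have ptc1 (z w : R) : (c + pt z w) 0 1 - c 0 1 = w by rewrite !mxE /=; ring.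
have near (u : 'rV[R]_2) (w : R) : `|u 0 0 - x 0 0| <= K -> `|u 0 1 - c 0 1| <= K ->
    `|w| <= `|u 0 1 - c 0 1| -> 0 < w * (u 0 1 - c 0 1) ->
    `|psi u - psi (c + pt s w)| <= 4 * C0 * K / s.
  move=> u0 u1 wu uw; apply: stream_same_side => //; rewrite ?ptc ?ptc1 //; last by move: xK K0; slim; lra.
  apply: norm_le_coord => // i j; rewrite ord1 !mxE; case: (unliftP 0 j) => [i'|] -> /=.
    rewrite ord1 (_ : lift 0 0 = 1); last exact/val_inj.
    have : `|u 0 1 - (c 0 1 + w)| <= `|u 0 1 - c 0 1|; last by move/le_trans; apply.
    have [h0|h0] := lerP 0 (u 0 1 - c 0 1).
      have w0 : 0 <= w by move: h0 uw; slim; nra.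
      rewrite (ger0_norm h0) (ger0_norm w0) in wu *; rewrite ler_norml.
      by move: h0 wu w0; slim; lra.
    have w0 : w <= 0 by move: h0 uw; slim; nra.
    rewrite (ltr0_norm h0) (ler0_norm w0) in wu *; rewrite ler_norml.
    by move: h0 wu w0; slim; lra.
  by move: u0; rewrite /s; have -> : c 0 0 + (x 0 0 - c 0 0) = x 0 0 by ring.
have hx := hd 1; have hx0 := hd 0.
have y0 : `|y 0 0 - x 0 0| <= K by rewrite distrC.
have x0 : `|x 0 0 - x 0 0| <= K by rewrite subrr normr0.
have gm : m * (C0 * (8 + 64 * (s + 1))) <= t0 * (C0 * (8 + 64 * (s + 1))) by rewrite ler_wpM2r.
have nsin : `|sin m| = sin m by rewrite gtr0_norm.
have [xp|xn] := ltrP 0 (x 0 1 - c 0 1).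
  have yn : y 0 1 - c 0 1 < 0.
    by rewrite lt_neqAle y1' /=; move: side; rewrite pmulr_rle0.
  rewrite ler_norml in hx; case/andP: hx => hx1 hx2.
  rewrite (gtr0_norm xp) in mx; rewrite (ltr0_norm yn) in my.
  have n1 := @near x (sin m) x0 _ _ _; have n2 := @near y (- sin m) y0 _ _ _.
  rewrite normrN nsin (ltr0_norm yn) in n2; rewrite nsin (gtr0_norm xp) in n1.
  have a1 : x 0 1 - c 0 1 <= K by move: yn hx2; slim; lra.
  have a2 : - (y 0 1 - c 0 1) <= K by move: xp hx2; slim; lra.
  have {}n1 := n1 a1 (le_trans stt mx) (mulr_gt0 st0 xp).
  have {}n2 : `|psi y - psi (c + pt s (- sin m))| <= 4 * C0 * K / s.
    by apply: n2 => //; [exact: le_trans stt my|rewrite mulNr -mulrN mulr_gt0 // oppr_gt0].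
  by have := norm_chain n1 n2 gap; move: gm E8; slim; lra.
have {}xn : x 0 1 - c 0 1 < 0 by rewrite lt_neqAle x1'.
have yp : 0 < y 0 1 - c 0 1.
  by rewrite lt_neqAle eq_sym y1' /=; move: side; rewrite nmulr_rle0.
rewrite ler_norml in hx; case/andP: hx => hx1 hx2.
rewrite (ltr0_norm xn) in mx; rewrite (gtr0_norm yp) in my.
have n1 := @near x (- sin m) x0 _ _ _; have n2 := @near y (sin m) y0 _ _ _.
rewrite nsin (gtr0_norm yp) in n2; rewrite normrN nsin (ltr0_norm xn) in n1.
have a1 : - (x 0 1 - c 0 1) <= K by move: yp hx1; slim; lra.
have a2 : y 0 1 - c 0 1 <= K by move: xn hx1; slim; lra.
have {}n2 := n2 a2 (le_trans stt my) (mulr_gt0 st0 yp).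
have {}n1 : `|psi x - psi (c + pt s (- sin m))| <= 4 * C0 * K / s.
  by apply: n1 => //; [exact: le_trans stt mx|rewrite mulNr -mulrN mulr_gt0 // oppr_gt0].
rewrite distrC in gap.
by have := norm_chain n1 n2 gap; move: gm E8; slim; lra.
Qed.

End Potential.

(** * The polar angle and the inverse of xi *)

Section Polar.
Variable R : realType.
Implicit Types x y h : 'rV[R]_2.

(** These identities are what the derivative of the angle is computed from; they hold at the origin
    too, where all terms are 0 whatever the angle. *)
Lemma polar_cosE y : enorm y * cos (polar_arg y) = y 0 0 /\ enorm y * sin (polar_arg y) = y 0 1.
Proof.
have d0 := dotp_ge0 y; have e2 : enorm y ^+ 2 = dotp y y by rewrite sqr_sqrtr.
have [e0|e0] := eqVneq (enorm y) 0.
  have c0 j : y 0 j = 0.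
    by have := enorm_coord y j; rewrite e0 normr_le0 => /eqP.
  by rewrite !c0 e0 !mul0r.
have ep : 0 < enorm y by rewrite lt_neqAle eq_sym e0 enorm_ge0.
set z := y 0 0 / enorm y.
have zb : -1 <= z <= 1.
  rewrite -ler_norml normrM normfV (ger0_norm (ltW ep)) ler_pdivrMr // mul1r.
  exact: enorm_coord.
have ez : enorm y * z = y 0 0 by rewrite /z mulrC divfK.
have es : enorm y * Num.sqrt (1 - z ^+ 2) = `|y 0 1|.
  rewrite -{1}(ger0_norm (ltW ep)) -sqrtr_sqr -sqrtrM ?sqr_ge0 // -sqrtr_sqr.
  congr (Num.sqrt _); rewrite mulrBr mulr1 -exprMn ez e2 dotp2; ring.
rewrite /polar_arg -/z; case: ifP => y1.
  by rewrite acosK ?in_itv // sin_acos // ez es ger0_norm.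
have yn : y 0 1 < 0 by rewrite ltNge y1.
rewrite mulr_natl cosB sinB cos2pi sin2pi mul1r !mul0r addr0 sub0r acosK ?in_itv //.
by rewrite sin_acos // ez mul1r mulrN es ltr0_norm // opprK.
Qed.

(** The differential of the polar angle at [y], applied to [h]. *)
Definition dtheta y h : R := (h 0 1 * y 0 0 - h 0 0 * y 0 1) / dotp y y.

Lemma polar_algebra (e c s T v0 v1 : R) : c ^+ 2 + s ^+ 2 = 1 ->
  v0 * s + e * c * (c * T) - (v1 * c + e * s * (- s * T)) = 0 ->
  T * e ^+ 2 = v1 * (e * c) - v0 * (e * s).
Proof.
move=> cs E; have -> : v1 * (e * c) - v0 * (e * s) = e * (e * T * (c ^+ 2 + s ^+ 2) -
   (v0 * s + e * c * (c * T) - (v1 * c + e * s * (- s * T)))) by ring.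
rewrite E cs; ring.
Qed.

Lemma polar_derive (th : 'rV[R]_2 -> R) (c x v : 'rV[R]_2) :
  (forall y, enorm (y - c) * cos (th y) = (y - c) 0 0 /\ enorm (y - c) * sin (th y) = (y - c) 0 1) ->
  0 < enorm (x - c) -> derivable th x v ->
  'D_v th x = dtheta (x - c) v.
Proof.
move=> H e0 d.
have d0 : derivable th (x + 0 *: v) v by rewrite scale0r addr0.
have dg := line_derive d0; rewrite scale0r addr0 in dg.
set T := 'D_v th x in dg *.
pose y0 := (x - c) 0 0; pose y1 := (x - c) 0 1.
pose g s := th (x + s *: v).
(* Differentiating [y_1 sin th - y_2 cos th = 0] along the line treats both branches of the arc
   cosine at once. *)
have id0 s : (y0 + s * v 0 0) * sin (g s) - (y1 + s * v 0 1) * cos (g s) = 0.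
  have [h0 h1] := H (x + s *: v).
  have -> : y0 + s * v 0 0 = (x + s *: v - c) 0 0 by rewrite /y0 !mxE; ring.
  have -> : y1 + s * v 0 1 = (x + s *: v - c) 0 1 by rewrite /y1 !mxE; ring.
  rewrite -h0 -h1 /g; ring.
have dg' : is_derive (0 : R) 1 g T by [].
have ds : is_derive (0 : R) 1 (fun s => sin (g s)) (cos (g 0) * T).
  have := @is_derive1_comp R sin g 0 (cos (g 0)) T _ dg'; apply; exact: is_derive_sin.
have dc : is_derive (0 : R) 1 (fun s => cos (g s)) (- sin (g 0) * T).
  have := @is_derive1_comp R cos g 0 (- sin (g 0)) T _ dg'; apply; exact: is_derive_cos.
have D : is_derive (0 : R) 1 (fun s => (y0 + s * v 0 0) * sin (g s) - (y1 + s * v 0 1) * cos (g s))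
   (v 0 0 * sin (g 0) + y0 * (cos (g 0) * T) - (v 0 1 * cos (g 0) + y1 * (- sin (g 0) * T))).
  apply: is_derive_eq; rewrite /GRing.scale /=; ring.
have E : v 0 0 * sin (g 0) + y0 * (cos (g 0) * T) - (v 0 1 * cos (g 0) + y1 * (- sin (g 0) * T)) = 0.
  have [_ <-] := D; have -> : (fun s => (y0 + s * v 0 0) * sin (g s) - (y1 + s * v 0 1) * cos (g s)) = cst 0.
    exact/funext.
  exact: derive_cst.
have [h0 h1] := H x.
have g0 : g 0 = th x by rewrite /g scale0r addr0.
rewrite g0 in E; rewrite -/y0 in h0; rewrite -/y1 in h1.
have e2 : enorm (x - c) ^+ 2 = dotp (x - c) (x - c) by rewrite sqr_sqrtr ?dotp_ge0.
have dp : 0 < dotp (x - c) (x - c) by rewrite -e2 exprn_gt0.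
apply: (mulIf (lt0r_neq0 dp)); rewrite /dtheta -/y0 -/y1 divfK ?lt0r_neq0 //.
rewrite -h0 -h1 in E *; rewrite -e2; exact: polar_algebra (cos2Dsin2 _) E.
Qed.

(** Additivity in the increment is what removes the angle from second differences of the
    predictor. *)
Lemma dthetaD y h k : dtheta y (h + k) = dtheta y h + dtheta y k.
Proof. rewrite /dtheta !mxE; ring. Qed.

Lemma dthetaZ y a h : dtheta y (a *: h) = a * dtheta y h.
Proof. rewrite /dtheta !mxE; ring. Qed.

Lemma cross_bound y h : `|h 0 1 * y 0 0 - h 0 0 * y 0 1| <= 2 * `|h| * `|y|.
Proof.
apply: (le_trans (ler_normB _ _)); rewrite !normrM.
have l i j : `|h 0 i| * `|y 0 j| <= `|h| * `|y| by rewrite ler_pM // coord_le.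
have := l 1 0; have := l 0 1; lra.
Qed.

Lemma dtheta_bound y h : 0 < `|y| -> `|dtheta y h| <= 2 * `|h| / `|y|.
Proof.
move=> y0; rewrite /dtheta normrM normfV (ger0_norm (dotp_ge0 y)).
have D := sqr_norm_le_dotp y; have D0 : 0 < dotp y y by apply: lt_le_trans D; rewrite exprn_gt0.
rewrite ler_pdivrMr //; apply: (le_trans (cross_bound y h)).
rewrite [leRHS]mulrAC ler_pdivlMr //.
have -> : 2 * `|h| * `|y| * `|y| = 2 * `|h| * `|y| ^+ 2 by ring.
by rewrite ler_wpM2l // mulr_ge0.
Qed.

Lemma dtheta_lip (y k h : 'rV[R]_2) : 0 < `|y| -> `|k| <= `|y| / 2 ->
  `|dtheta (y + k) h - dtheta y h| <= 48 * `|h| * `|k| / `|y| ^+ 2.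
Proof.
move=> y0 ky.
have D := sqr_norm_le_dotp y; have D0 : 0 < dotp y y by apply: lt_le_trans D; rewrite exprn_gt0.
have yk : `|y| / 2 <= `|y + k| by have := lerB_dist y (- k); rewrite opprK normrN; lra.
have D' : `|y| ^+ 2 / 4 <= dotp (y + k) (y + k).
  apply: le_trans (sqr_norm_le_dotp _); have -> : `|y| ^+ 2 / 4 = (`|y| / 2) ^+ 2 by field.
  by rewrite lerXn2r ?nnegrE // divr_ge0.
set r := `|y| in y0 ky yk D D' *.
have r20 : 0 < r ^+ 2 by rewrite exprn_gt0.
have D'0 : 0 < dotp (y + k) (y + k) by apply: lt_le_trans D'; rewrite divr_gt0.
set E := dotp (y + k) (y + k) in D' D'0 *; set F := dotp y y in D D0 *.
have FE : `|F - E| <= 5 * r * `|k|.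
  have -> : F - E = - (2 * dotp y k + dotp k k) by rewrite /E /F dotpDD; ring.
  rewrite normrN; apply: (le_trans (ler_normD _ _)); rewrite normrM (ger0_norm (ler0n _ _)).
  have h1 := dotp_bound y k; have h2 := dotp_bound k k; rewrite -/r in h1.
  have h3 : `|k| * `|k| <= r / 2 * `|k| by rewrite ler_wpM2r.
  lra.
pose n (z : 'rV[R]_2) := h 0 1 * z 0 0 - h 0 0 * z 0 1 : R.
have nk : `|n k| <= 2 * `|h| * `|k| by exact: cross_bound.
have ny : `|n y| <= 2 * `|h| * r by exact: cross_bound.
(* The change of the numerator and that of the denominator; they contribute 8 and 40 to the
   constant. *)
have -> : dtheta (y + k) h - dtheta y h = n k / E + n y * (F - E) / (E * F).
  rewrite /dtheta -/E -/F.
  have -> : h 0 1 * (y + k) 0 0 - h 0 0 * (y + k) 0 1 = n y + n k by rewrite /n !mxE; ring.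
  rewrite -/(n y); field; rewrite !lt0r_neq0 //.
have iE : E^-1 <= 4 / r ^+ 2.
  by rewrite -[4 / r ^+ 2]invf_div lef_pV2 ?posrE ?divr_gt0.
have iF : F^-1 <= (r ^+ 2)^-1 by rewrite lef_pV2.
have iE0 : 0 <= E^-1 by rewrite invr_ge0 ltW.
have iF0 : 0 <= F^-1 by rewrite invr_ge0 ltW.
apply: (le_trans (ler_normD _ _)).
have t1 : `|n k / E| <= 2 * `|h| * `|k| * (4 / r ^+ 2).
  by rewrite normrM (ger0_norm iE0); apply: ler_pM.
have t2 : `|n y * (F - E) / (E * F)| <= (2 * `|h| * r) * (5 * r * `|k|) * ((4 / r ^+ 2) * (r ^+ 2)^-1).
  rewrite invfM !normrM (ger0_norm iE0) (ger0_norm iF0).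
  by apply: ler_pM; rewrite ?mulr_ge0 //; apply: ler_pM.
have e2 : (2 * `|h| * r) * (5 * r * `|k|) * ((4 / r ^+ 2) * (r ^+ 2)^-1) =
   40 * (`|h| * `|k| * (r ^+ 2)^-1) by field; rewrite lt0r_neq0.
have -> : 48 * `|h| * `|k| / r ^+ 2 = 48 * (`|h| * `|k| * (r ^+ 2)^-1) by ring.
have e1 : 2 * `|h| * `|k| * (4 / r ^+ 2) = 8 * (`|h| * `|k| * (r ^+ 2)^-1) by ring.
rewrite e1 in t1; rewrite e2 in t2; lra.
Qed.

End Polar.

(** * Smoothness and increments of the polar angle off the cut *)

Section XiInverse.
Variable R : realType.
Variables (c : 'rV[R]_2) (b1 r K0 : R) (eta : R -> R) (xi_inv : 'rV[R]_2 -> 'rV[R]_2).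
Local Notation A := (~` branch_cut c).
Local Notation th := (fun x : 'rV[R]_2 => polar_arg (x - c)).
Local Notation xi := (xi_map c (pt b1 0) r eta).
Implicit Types x h v : 'rV[R]_2.
Hypothesis b1_neq0 : b1 != 0.
Hypothesis r_gt0 : 0 < r.
Hypothesis eta1 : forall s, 1 < s -> eta s = 1.
Hypothesis xi_smooth : smooth_on A xi.
Let beta := b1 / (2 * pi).

Let beta_neq0 : beta != 0.
Proof. by rewrite mulf_neq0 // invr_neq0 // mulf_neq0 ?gt_eqF // pi_gt0. Qed.

Lemma xi_farE x : r < `|x - c| -> xi x = x - pt (beta * th x) 0.
Proof.
move=> rx; have re : r < enorm (x - c) by exact: lt_le_trans (norm_le_enorm _).
rewrite /xi_map eta1; last by rewrite ltr_pdivlMr // mul1r.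
congr (_ - _); apply/rowP => j; rewrite !mxE mulr1 /beta invfM.
by case: ifP => _; ring.
Qed.

(** Farther than [r] from the core, [xi] subtracts [beta] times the angle from the first coordinate,
    so the angle inherits its regularity from the assumed smoothness of [xi]. *)
Lemma th_derivable x v : A x -> r < `|x - c| -> derivable th x v.
Proof.
move=> Ax rx.
have d : derivable (fun y : 'rV[R]_2 => beta^-1 * (y 0 0 - xi y 0 0)) x v.
  apply: derivableM; first exact: derivable_cst.
  apply: derivableB.
    exact/diff_derivable/differentiable_coord.
  exact/derivable_coord/diff_derivable/(smooth_diff xi_smooth).
apply: near_eq_derivable d.
near=> y.
have ry : r < `|y - c|.
  have yx : `|x - y| < `|x - c| - r.
    near: y; apply/nbhs_ballP; exists (`|x - c| - r); first by rewrite /= subr_gt0.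
    by move=> y; rewrite -ball_normE.
  have := ler_distD y x c; lra.
by rewrite xi_farE // !mxE /= opprB addrC subrK mulKf.
Unshelve. all: by end_near. Qed.

Lemma th_diff x h : (forall t, 0 <= t <= 1 -> A (x + t *: h)) ->
  2 * r < `|x - c| -> `|h| <= `|x - c| / 2 ->
  exists2 t, 0 <= t <= 1 & th (x + h) - th x = dtheta (x - c + t *: h) h.
Proof.
move=> seg rx hx.
have far t : 0 <= t <= 1 -> r < `|x + t *: h - c|.
  by move=> t01; apply: lt_le_trans (far_line hx t01); lra.
have [|t t01 ->] := @mvt_seg R _ th x h.
  by move=> t t01; apply: th_derivable; [exact: seg|exact: far].
exists t => //; rewrite (@polar_derive R th c).
- by congr dtheta; rewrite addrAC.
- by move=> y; exact: polar_cosE.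
- apply: lt_le_trans (norm_le_enorm _); exact: lt_trans (far t t01).
- by apply: th_derivable; [exact: seg|exact: far].
Qed.

Lemma th_lip x h : (forall t, 0 <= t <= 1 -> A (x + t *: h)) ->
  2 * r < `|x - c| -> `|h| <= `|x - c| / 2 ->
  `|th (x + h) - th x| <= 4 * `|h| / `|x - c|.
Proof.
move=> seg rx hx; have [t t01 ->] := th_diff seg rx hx.
have f := far_line hx t01.
have x0 : 0 < `|x - c| by apply: le_lt_trans rx; rewrite mulr_ge0 // ltW.
have E : x - c + t *: h = x + t *: h - c by rewrite addrAC.
have z0 : 0 < `|x + t *: h - c| by apply: lt_le_trans f; rewrite divr_gt0.
rewrite E; apply: (le_trans (dtheta_bound _ z0)).
rewrite ler_pdivrMr //.
rewrite [leRHS]mulrAC ler_pdivlMr //; have := ler_wpM2l (normr_ge0 h) f; lra.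
Qed.

Lemma th_taylor x h : (forall t, 0 <= t <= 1 -> A (x + t *: h)) ->
  2 * r < `|x - c| -> `|h| <= `|x - c| / 2 ->
  `|th (x + h) - th x - dtheta (x - c) h| <= 48 * `|h| ^+ 2 / `|x - c| ^+ 2.
Proof.
move=> seg rx hx; have [t t01 ->] := th_diff seg rx hx.
have x0 : 0 < `|x - c| by apply: le_lt_trans rx; rewrite mulr_ge0 // ltW.
have [t0 t1] := andP t01.
have th : `|t *: h| <= `|h| by rewrite normrZ ger0_norm // ler_piMl.
apply: (le_trans (dtheta_lip h x0 (le_trans th hx))).
rewrite ler_wpM2r ?invr_ge0 ?exprn_ge0 // expr2 -mulrA ler_wpM2l // ler_wpM2l //.
Qed.

End XiInverse.

(** * Increments of the predictor *)

Lemma ler_frac_half (R : realType) (p a d w : R) : 0 <= p -> p <= a -> 0 < d -> d / 2 <= w ->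
  4 * p / w <= 8 * a / d.
Proof.
move=> p0 pa d0 dw; have w0 : 0 < w by lra.
rewrite ler_pdivlMr // mulrAC ler_pdivrMr //.
have d2 : 0 <= d / 2 by lra.
have := ler_pM p0 d2 pa dw; lra.
Qed.

Lemma increment_algebra (R : realType) (a b d p q s t : R) :
  (a + d) * p + (b + 0) * q - (a * s + b * t) = a * (p - s) + b * (q - t) + d * p.
Proof. ring. Qed.

Lemma bilinear_remainder (R : realType) (a b p q : 'I_2 -> R) (D : 'I_2 -> 'I_2 -> R) (K B : R) :
  (forall j, `|a j| <= K) -> (forall j, `|b j| <= K) ->
  (forall j, exists2 P : 'I_2 -> R, p j - q j = \sum_l b l * P l &
     forall l, `|P l - D l j| <= B) ->
  `|\sum_j a j * p j - \sum_j a j * q j - \sum_j \sum_l a j * b l * D l j| <= 4 * (K * (K * B)).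
Proof.
move=> aK bK H.
have -> : 4 * (K * (K * B)) = \sum_(j < 2) \sum_(l < 2) K * (K * B) by rewrite !sum2E; ring.
rewrite -!sumrB; apply: (le_trans (ler_norm_sum _ _ _)); apply: ler_sum => j _.
have [P E PB] := H j; rewrite -mulrBr E mulr_sumr -sumrB.
apply: (le_trans (ler_norm_sum _ _ _)); apply: ler_sum => l _.
have -> : a j * (b l * P l) - a j * b l * D l j = a j * (b l * (P l - D l j)) by ring.
by rewrite !normrM; apply: ler_pM => //; apply: ler_pM.
Qed.

Lemma product_increment (R : realType) (d p q a : R) : d * p - q * a = d * (p - q) + q * (d - a).
Proof. ring. Qed.

Lemma sqr_le_double (R : realType) (a b : R) : 0 <= a -> a <= 2 * b -> a ^+ 2 <= 4 * b ^+ 2.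
Proof.
move=> a0 ab; have -> : 4 * b ^+ 2 = (2 * b) ^+ 2 by ring.
by rewrite lerXn2r ?nnegrE // (le_trans a0).
Qed.

Lemma div_cube_half (R : realType) (q w d : R) : 0 <= q -> 0 < d -> d / 2 <= w ->
  128 * q / w ^+ 3 <= 1024 * q / d ^+ 3.
Proof.
move=> q0 d0 dw; have w0 : 0 < w by lra.
have h : d ^+ 3 <= 8 * w ^+ 3.
  have -> : 8 * w ^+ 3 = (2 * w) ^+ 3 by ring.
  rewrite lerXn2r ?nnegrE //; lra.
rewrite ler_pdivlMr ?exprn_gt0 // mulrAC ler_pdivrMr ?exprn_gt0 //.
have := ler_wpM2l q0 h; lra.
Qed.

Lemma four_term_bound (R : realType) (a1 a2 a3 a4 s F G : R) :
  `|a1| <= F -> `|a2| <= F -> `|a3| <= F -> `|a4| <= F -> `|s| <= G ->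
  `|a1 - a2 - (a3 - a4) + s| <= 4 * F + G.
Proof.
move=> h1 h2 h3 h4 h5; apply: (le_trans (ler_normD _ _)).
have := ler_normB (a1 - a2) (a3 - a4); have := ler_normB a1 a2; have := ler_normB a3 a4; lra.
Qed.

(** The corrections [p * (b * t)] are additive in [t], so the four of them cancel in the second
    difference. *)
Lemma frozen_algebra (R : realType) (a1 a2 a3 a4 v1 v2 v3 v4 p b t1 t2 s : R) :
  a1 - a2 - (a3 - a4) - s =
  a1 - v1 - p * (b * (t1 + t2)) - (a2 - v2 - p * (b * t1))
  - (a3 - v3 - p * (b * t2) - (a4 - v4 - p * (b * 0))) + (v1 - v2 - (v3 - v4) - s).
Proof. ring. Qed.

Section Predictor.
Variable R : realType.
Variables (m : nat) (c : 'rV[R]_2) (b1 r K0 CC bb : R) (eta : R -> R).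
Variables (xi_inv : 'rV[R]_2 -> 'rV[R]_2) (u : 'rV[R]_2 -> 'rV[R]_m).
Local Notation A := (~` branch_cut c).
Local Notation th := (fun x : 'rV[R]_2 => polar_arg (x - c)).
Local Notation xi := (xi_map c (pt b1 0) r eta).
Implicit Types x h k v : 'rV[R]_2.
Implicit Types K : R.
Hypothesis b1_neq0 : b1 != 0.
Hypothesis r_gt0 : 0 < r.
Hypothesis K0_ge0 : 0 <= K0.
Hypothesis CC_ge0 : 0 <= CC.
Hypothesis eta1 : forall s, 1 < s -> eta s = 1.
Hypothesis xi_smooth : smooth_on A xi.
Hypothesis xi_invA : forall x, A x -> A (xi_inv x).
Hypothesis xi_invK : forall x, A x -> xi (xi_inv x) = x.
Hypothesis xi_inv_near : forall x, A x -> `|xi_inv x - x| <= K0.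
Hypothesis u_smooth : smooth_on A u.
Hypothesis u_bound : forall s i x, (0 < size s <= 3)%N -> A x ->
  `|pd u s i x| <= CC / `|x - c| ^+ size s.

Let beta := b1 / (2 * pi).
Hypothesis beta_le : `|beta| <= bb.

Let bb_ge0 : 0 <= bb.
Proof. exact: le_trans beta_le. Qed.

(** One threshold for all estimates: beyond twice this radius, [xi_inv] and the increments move a
    point by a small fraction of its distance to the core, and factors such as [16 * bb] can be
    absorbed. *)
Definition far_radius (K : R) : R := 16 * (1 + r + bb + K + K0).

(** The mean value theorem runs along segments between values of [xi_inv], which have to avoid the
    cut. Two kinds of sets occur: balls clear of the cut, and the open half-planes above and below
    its line. *)
Definition convex_in (Q : set 'rV[R]_2) := Q `<=` A /\
  forall x y t, Q x -> Q y -> 0 <= t <= 1 -> Q (x + t *: (y - x)).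

Lemma pd_lip (Q : set 'rV[R]_2) s i x y : convex_in Q -> (size s <= 2)%N -> Q x -> Q y ->
  0 < `|x - c| -> `|y - x| <= `|x - c| / 2 ->
  `|pd u s i y - pd u s i x| <= 2 ^+ (size s).+2 * CC * `|y - x| / `|x - c| ^+ (size s).+1.
Proof.
move=> [QA Qc] s2 Qx Qy d0 yx.
have := @lip_decay R A c (pd u s i) (fun j => pd u (j :: s) i) CC (size s).+1 x (y - x) CC_ge0.
rewrite (addrC x (y - x)) subrK; apply => //.
- by move=> z Az; exact: pd_differentiable u_smooth Az.
- by move=> j z Az; exact: derive_pd u_smooth Az.
- by move=> j z Az; apply: u_bound.
- by move=> t t01; apply: QA; exact: Qc.
Qed.

Lemma xi_inv_far x K : 0 <= K -> A x -> far_radius K <= `|x - c| ->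
  [/\ `|x - c| / 2 <= `|xi_inv x - c|, 2 * r < `|xi_inv x - c|,
      2 * (K + 2 * K0) <= `|xi_inv x - c| & xi_inv x = x + pt (beta * th (xi_inv x)) 0].
Proof.
move=> Kge Ax; rewrite /far_radius; have nx := xi_inv_near Ax; have b0 := bb_ge0; have r0 := r_gt0; have k0 := K0_ge0.
move=> xD; have e1 : `|x - c| - K0 <= `|xi_inv x - c|.
  by have := ler_distD (xi_inv x) x c; rewrite (distrC x (xi_inv x)); lra.
split; [lra|lra|lra|].
have := xi_invK Ax; rewrite xi_farE //; last by lra.
by move/eqP; rewrite subr_eq => /eqP.
Qed.

(** The horizontal displacement, in addition to [h], by which [xi_inv] moves when its argument moves
    by [h] far from the core. *)
Definition delta x h := beta * (th (xi_inv (x + h)) - th (xi_inv x)).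

Lemma far_radius_shift K x h : 0 <= K -> `|h| <= K -> 2 * far_radius K <= `|x - c| ->
  far_radius K <= `|x + h - c|.
Proof.
move=> Kge hK; rewrite /far_radius; have b0 := bb_ge0; have r0 := r_gt0; have k0 := K0_ge0 => xD.
have := lerB_dist (x - c) (- h); rewrite opprK normrN addrAC; lra.
Qed.

Lemma xi_inv_shift x h K : 0 <= K -> A x -> A (x + h) -> `|h| <= K ->
  2 * far_radius K <= `|x - c| -> xi_inv (x + h) = xi_inv x + (h + pt (delta x h) 0).
Proof.
move=> Kge Ax Axh hK xD.
have fK : 0 <= far_radius K.
  by rewrite /far_radius; have b0 := bb_ge0; have r0 := r_gt0; have k0 := K0_ge0; lra.
have [|_ _ _ E] := @xi_inv_far x K Kge Ax; first by lra.
have [|_ _ _ E'] := @xi_inv_far (x + h) K Kge Axh; first exact: far_radius_shift.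
rewrite {1}E' {1}E; apply/rowP => j; rewrite !mxE /delta; case: ifP => _; ring.
Qed.

(** The estimate is implicit: the angle is compared at two values of [xi_inv] whose distance is at
    most [|h| + |delta|]. Far from the core the [delta] on the right is absorbed, which doubles the
    constant 8. *)
Lemma delta_bound (Q : set 'rV[R]_2) x h K : convex_in Q -> 0 <= K -> A x -> A (x + h) ->
  Q (xi_inv x) -> Q (xi_inv (x + h)) -> `|h| <= K -> 2 * far_radius K <= `|x - c| ->
  `|delta x h| <= 16 * bb * `|h| / `|x - c|.
Proof.
move=> [QA Qc] Kge Ax Axh Qy Qy' hK xD.
have fK : 0 <= far_radius K.
  by rewrite /far_radius; have b0 := bb_ge0; have r0 := r_gt0; have k0 := K0_ge0; lra.
have [|w1 w2 w3 _] := @xi_inv_far x K Kge Ax; first by lra.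
have S := xi_inv_shift Kge Ax Axh hK xD.
set y := xi_inv x in Qy w1 w2 w3 S *; set y' := xi_inv (x + h) in Qy' S *.
have yy : `|y' - y| <= K + 2 * K0.
  have -> : y' - y = (y' - (x + h)) - (y - x) + h.
    by rewrite opprD !opprB !addrA; apply/rowP => j; rewrite !mxE; ring.
  apply: (le_trans (ler_normD _ _)); have := ler_normB (y' - (x + h)) (y - x).
  have := xi_inv_near Ax; have := xi_inv_near Axh; rewrite -/y -/y'; lra.
have L := @th_lip R c b1 r eta b1_neq0 r_gt0 eta1 xi_smooth y (y' - y) _ w2 _.
rewrite (addrC y (y' - y)) subrK in L.
have {}L : `|th y' - th y| <= 4 * `|y' - y| / `|y - c|.
  by apply: L; [move=> t t01; apply: QA; exact: Qc|lra].
have dpos : 0 < `|x - c| by have b0 := bb_ge0; have r0 := r_gt0; have k0 := K0_ge0; move: xD; rewrite /far_radius; lra.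
have hd : `|y' - y| <= `|h| + `|delta x h|.
  rewrite S addrC addKr (le_trans (ler_normD _ _)) // lerD2l.
  by apply: pt_norm => //; rewrite normr0.
have D1 : `|delta x h| <= 8 * bb * (`|h| + `|delta x h|) / `|x - c|.
  have -> : 8 * bb * (`|h| + `|delta x h|) / `|x - c| =
      bb * (8 * (`|h| + `|delta x h|) / `|x - c|) by ring.
  rewrite [leLHS](_ : _ = `|beta| * `|th y' - th y|); last by rewrite /delta normrM.
  apply: ler_pM => //; apply: (le_trans L); exact: ler_frac_half.
have bd : 16 * bb <= `|x - c|.
  by have b0 := bb_ge0; have r0 := r_gt0; have k0 := K0_ge0; move: xD; rewrite /far_radius; lra.
rewrite ler_pdivlMr //; rewrite ler_pdivlMr // in D1.
have := ler_wpM2r (normr_ge0 (delta x h)) bd; lra.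
Qed.

Definition predictor x := u (xi_inv x).

Lemma far_radius_gt0 K : 0 <= K -> 0 < far_radius K.
Proof. by move=> Kge; rewrite /far_radius; have b0 := bb_ge0; have r0 := r_gt0; have k0 := K0_ge0; lra. Qed.

(** [xi_inv] displaces points by at most [K0] and changes increments by [delta = O(1/d)]; against
    second derivatives [O(d^-2)] and the gradient [O(1/d)], both effects are [O(d^-2)]. *)
Lemma u0_diff (Q : set 'rV[R]_2) K : convex_in Q -> 0 <= K -> forall x h i, Q x -> Q (x + h) ->
  Q (xi_inv x) -> Q (xi_inv (x + h)) -> `|h| <= K -> 2 * far_radius K <= `|x - c| ->
  `|predictor (x + h) 0 i - predictor x 0 i - \sum_j h 0 j * pd u [:: j] i x|
     <= CC * (16 * (K + 3 * K0) + 32 * bb) * `|h| / `|x - c| ^+ 2.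
Proof.
move=> [QA Qc] Kge x h i Qx Qxh Qy Qy' hK xD.
have [Ax Axh] : A x /\ A (x + h) by split; exact: QA.
have F0 := far_radius_gt0 Kge.
have dpos : 0 < `|x - c| by lra.
have k0' := K0_ge0.
have [|w1 w2 w3 _] := @xi_inv_far x K Kge Ax; first by lra.
have db := delta_bound (conj QA Qc) Kge Ax Axh Qy Qy' hK xD.
have S := xi_inv_shift Kge Ax Axh hK xD.
set y := xi_inv x in Qy w1 w2 w3 S *; set y' := xi_inv (x + h) in Qy' S *.
have [|t t01] := @mvt_pd R 2 m A u [::] i y (y' - y) u_smooth.
  by move=> t t01; apply: QA; exact: Qc.
rewrite (addrC y (y' - y)) subrK.
set z := y + t *: (y' - y).
have Qz : Q z by exact: Qc.
rewrite /predictor -/y -/y' => E.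
have zx : `|z - x| <= K + 3 * K0.
  have -> : z - x = t *: (y' - y) + (y - x) by rewrite /z [y + _]addrC addrA.
  have yy : `|y' - y| <= K + 2 * K0.
    have -> : y' - y = (y' - (x + h)) - (y - x) + h by apply/rowP => j; rewrite !mxE; ring.
    apply: (le_trans (ler_normD _ _)); have := ler_normB (y' - (x + h)) (y - x).
    have := xi_inv_near Ax; have := xi_inv_near Axh; rewrite -/y -/y'; lra.
  apply: (le_trans (ler_normD _ _)); have := xi_inv_near Ax; rewrite -/y.
  have /andP[t0 t1] := t01; have ty : `|t *: (y' - y)| <= `|y' - y|.
    by rewrite normrZ ger0_norm // ler_piMl.
  lra.
have zxd : `|z - x| <= `|x - c| / 2.
  by have b0 := bb_ge0; have r0 := r_gt0; have k0 := K0_ge0; move: xD; rewrite /far_radius; lra.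
have zd : `|x - c| / 2 <= `|z - c|.
  have e : x - c - (x - z) = z - c by apply/rowP => j; rewrite !mxE; ring.
  by have := lerB_dist (x - c) (x - z); rewrite e (distrC x z); lra.
have {}E : u y' 0 i - u y 0 i = \sum_j (y' - y) 0 j * pd u [:: j] i z by exact: E.
have dj j : `|pd u [:: j] i z - pd u [:: j] i x| <= 8 * CC * (K + 3 * K0) / `|x - c| ^+ 2.
  apply: (le_trans (pd_lip i (conj QA Qc) _ Qx Qz dpos zxd)) => //=.
  rewrite ler_wpM2r ?invr_ge0 ?exprn_ge0 //.
  have -> : (2 ^+ 3 : R) = 8 by ring.
  by rewrite ler_wpM2l // mulr_ge0.
have d0 : `|pd u [:: 0] i z| <= 2 * CC / `|x - c|.
  apply: (le_trans (u_bound (s := [:: 0]) i isT (QA _ Qz))); rewrite expr1.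
  have z0 : 0 < `|z - c| by lra.
  rewrite ler_pdivrMr // mulrAC ler_pdivlMr //; have := ler_wpM2l CC_ge0 zd; lra.
have hj j : (y' - y) 0 j = h 0 j + (if j == 0 then delta x h else 0).
  by rewrite S !mxE; case: ifP => _; ring.
have -> : u y' 0 i - u y 0 i - \sum_j h 0 j * pd u [:: j] i x =
   h 0 0 * (pd u [:: 0] i z - pd u [:: 0] i x) + h 0 1 * (pd u [:: 1] i z - pd u [:: 1] i x)
   + delta x h * pd u [:: 0] i z.
  by rewrite E !sum2E !hj /=; exact: increment_algebra.
set B := 8 * CC * (K + 3 * K0) / `|x - c| ^+ 2 in dj.
have t1 j : `|h 0 j * (pd u [:: j] i z - pd u [:: j] i x)| <= `|h| * B.
  by rewrite normrM; apply: ler_pM => //; exact: coord_le.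
have t2 : `|delta x h * pd u [:: 0] i z| <= (16 * bb * `|h| / `|x - c|) * (2 * CC / `|x - c|).
  by rewrite normrM; apply: ler_pM.
have -> : CC * (16 * (K + 3 * K0) + 32 * bb) * `|h| / `|x - c| ^+ 2 =
   `|h| * B + `|h| * B + (16 * bb * `|h| / `|x - c|) * (2 * CC / `|x - c|).
  by rewrite /B; field; rewrite gt_eqF.
apply: (le_trans (ler_normD _ _)); apply: lerD => //.
by apply: (le_trans (ler_normD _ _)); apply: lerD.
Qed.

Lemma convex_ball l (rho : R) : (forall x, `|x - l| <= rho -> A x) ->
  convex_in [set x | `|x - l| <= rho].
Proof.
move=> H; split; first by move=> x; exact: H.
move=> x y t /= xl yl /andP[t0 t1].
have -> : x + t *: (y - x) - l = (1 - t) *: (x - l) + t *: (y - l).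
  by apply/rowP => j; rewrite !mxE; ring.
rewrite (le_trans (ler_normD _ _)) // !normrZ (ger0_norm t0) ger0_norm ?subr_ge0 //.
have t10 : 0 <= 1 - t by lra.
have := ler_wpM2l t0 yl; have := ler_wpM2l t10 xl; lra.
Qed.

Lemma u_second (Q : set 'rV[R]_2) (y h k : 'rV[R]_2) (K : R) i : convex_in Q ->
  (forall s t, 0 <= s <= 1 -> 0 <= t <= 1 -> Q (y + s *: h + t *: k)) ->
  0 <= K -> `|h| <= K -> `|k| <= K -> 4 * K <= `|y - c| -> 0 < `|y - c| ->
  `|u (y + h + k) 0 i - u (y + h) 0 i - (u (y + k) 0 i - u y 0 i)
    - \sum_j \sum_l h 0 j * k 0 l * pd u [:: l; j] i y| <= 128 * CC * K ^+ 3 / `|y - c| ^+ 3.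
Proof.
move=> QC Qy Kge hK kK yK y0; have [QA Qc] := QC.
have i01 : 0 <= (1 : R) <= 1 by rewrite lexx ler01.
have i00 : 0 <= (0 : R) <= 1 by rewrite lexx ler01.
pose F := pd u [::] i.
have dF z : A z -> is_derive z h F (\sum_j h 0 j * pd u [:: j] i z).
  move=> Az; have d := pd_differentiable [::] i u_smooth Az.
  have -> : \sum_j h 0 j * pd u [:: j] i z = 'D_h F z.
    rewrite derive_sum_row //; apply: eq_bigr => j _; congr (_ * _).
    by rewrite (derive_pd [::] i j u_smooth Az).
  exact/derivableP/diff_derivable.
have QA0 s : 0 <= s <= 1 -> Q (y + s *: h).
  by move=> s01; have := Qy s 0 s01 i00; rewrite scale0r addr0.
have QA1 s : 0 <= s <= 1 -> Q (y + s *: h + k).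
  by move=> s01; have := Qy s 1 s01 i01; rewrite scale1r.
pose Phi z := F (z + k) - F z.
have dPhi s : 0 <= s <= 1 -> is_derive (y + s *: h) h Phi
    (\sum_j h 0 j * pd u [:: j] i (y + s *: h + k) - \sum_j h 0 j * pd u [:: j] i (y + s *: h)).
  move=> s01; apply: is_deriveB; last exact/dF/QA/QA0.
  by apply: is_derive_shift_arg; exact/dF/QA/QA1.
have [|s s01 E] := @mvt_seg R _ Phi y h.
  by move=> s s01; have [] := dPhi s s01.
have [_ E2] := dPhi s s01; rewrite {}E2 /Phi /F /pd /= in E.
rewrite {}E.
have Qy0 : Q y by have := QA0 0 i00; rewrite scale0r addr0.
have seg j : exists2 t, 0 <= t <= 1 &
    pd u [:: j] i (y + s *: h + k) - pd u [:: j] i (y + s *: h) =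
    \sum_l k 0 l * pd u [:: l; j] i (y + s *: h + t *: k).
  by apply: (mvt_pd [:: j] i u_smooth) => t t01; exact/QA/Qy.
have bd j l t : 0 <= t <= 1 ->
    `|pd u [:: l; j] i (y + s *: h + t *: k) - pd u [:: l; j] i y| <= 32 * CC * K / `|y - c| ^+ 3.
  move=> t01; have [t0 t1] := andP t01; have [s0 s1] := andP s01.
  have E : y + s *: h + t *: k - y = s *: h + t *: k by rewrite addrAC (addrC y) addrK.
  have n : `|s *: h + t *: k| <= 2 * K.
    apply: (le_trans (ler_normD _ _)); rewrite !normrZ (ger0_norm s0) (ger0_norm t0).
    have := ler_pM s0 (normr_ge0 h) s1 hK; have := ler_pM t0 (normr_ge0 k) t1 kK; lra.
  have := @pd_lip Q [:: l; j] i y (y + s *: h + t *: k) QC isT Qy0 (Qy s t s01 t01) y0.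
  rewrite E => /(_ ltac:(lra)) /le_trans; apply; rewrite ler_wpM2r ?invr_ge0 ?exprn_ge0 //=.
  have -> : (2 ^+ 4 : R) = 16 by ring.
  have -> : 32 * CC * K = 16 * CC * (2 * K) by ring.
  by rewrite ler_wpM2l // mulr_ge0.
set B := 32 * CC * K / _ in bd.
have -> : 128 * CC * K ^+ 3 / `|y - c| ^+ 3 = 4 * (K * (K * B)) by rewrite /B; ring.
apply: (@bilinear_remainder R (fun j => h 0 j) (fun l => k 0 l) _ _ (fun l j => pd u [:: l; j] i y)).
- by move=> j; exact: le_trans (coord_le _ _ _) hK.
- by move=> j; exact: le_trans (coord_le _ _ _) kK.
- move=> j; have [t t01 Ej] := seg j.
  exists (fun l => pd u [:: l; j] i (y + s *: h + t *: k)) => // l; exact: bd.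
Qed.

(** The first part bounds [delta] times the change of the gradient, the second the gradient times
    the error made by linearising [delta]. *)
Definition frozen_const (K : R) : R :=
  1024 * bb * K ^+ 2 * CC + 2 * CC * (bb * (768 * K ^+ 2 + 64 * bb * K)).

Local Ltac slim := clear - b1_neq0 r_gt0 K0_ge0 CC_ge0 eta1 xi_smooth xi_invA xi_invK xi_inv_near
  u_smooth u_bound beta_le bb_ge0.

(** With [xi_inv l] kept as base point, the effect of the composition is one extra term, the first
    partial derivative times [beta * dtheta], linear in [h]. What remains is [delta = O(1/d)] times
    a change [O(d^-2)] of the gradient, and a gradient [O(1/d)] times an error [O(d^-2)] of
    [delta]. *)
Lemma u0_frozen l K h i : 0 <= K ->
  (forall x, `|x - l| <= 2 * K + 2 * K0 -> A x) -> `|h| <= K -> 2 * far_radius K <= `|l - c| ->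
  `|predictor (l + h) 0 i - u (xi_inv l + h) 0 i
     - pd u [:: 0] i (xi_inv l) * (beta * dtheta (xi_inv l - c) h)|
  <= frozen_const K / `|l - c| ^+ 3.
Proof.
move=> Kge HA hK xD; have k0 := K0_ge0; have b0 := bb_ge0; have r0 := r_gt0.
have QC := convex_ball HA; have [QA Qc] := QC.
set Q := [set x | _] in QC QA Qc.
have Ql : Q l by rewrite /Q /= subrr normr0; move: Kge k0; slim; lra.
have Qlh : Q (l + h) by rewrite /Q /= addrC addKr; move: Kge k0 hK; slim; lra.
have [Al Alh] : A l /\ A (l + h) by split; exact: QA.
have near1 := xi_inv_near Al; have near2 := xi_inv_near Alh.
have Qy : Q (xi_inv l) by rewrite /Q /=; move: Kge k0 near1; slim; lra.
have Qy' : Q (xi_inv (l + h)).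
  rewrite /Q /=; have -> : xi_inv (l + h) - l = (xi_inv (l + h) - (l + h)) + h by rewrite opprD addrA subrK.
  by apply: (le_trans (ler_normD _ _)); move: Kge k0 near2 hK; slim; lra.
have xD' : 32 * (1 + r + bb + K + K0) <= `|l - c|.
  by move: xD; rewrite /far_radius; slim; lra.
have dpos : 0 < `|l - c| by move: xD' r0 b0 Kge k0; slim; lra.
have [|w1 w2 w3 _] := @xi_inv_far l K Kge Al.
  by move: xD' r0 b0 Kge k0; rewrite /far_radius; slim; lra.
have db := delta_bound QC Kge Al Alh Qy Qy' hK xD.
have S := xi_inv_shift Kge Al Alh hK xD.
rewrite /predictor S.
set d := delta l h in db S *; set y := xi_inv l in Qy w1 w2 w3 S near1 *.
set D := `|l - c| in xD xD' dpos w1 db *; set w := `|y - c| in w1 w2 w3.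
have w0 : 0 < w by move: w1 dpos; slim; lra.
have d2 : `|d| <= 16 * bb * K / D.
  by apply: (le_trans db); rewrite ler_wpM2r ?invr_ge0 ?(ltW dpos) // ler_wpM2l // mulr_ge0.
have dK : `|d| <= K.
  apply: (le_trans d2); rewrite ler_pdivrMr // mulrC ler_wpM2l //; move: xD' r0 b0 Kge k0; slim; lra.
pose e := pt d 0 : 'rV[R]_2.
have en : `|e| <= `|d| by apply: pt_norm => //; rewrite normr0.
have Qyh : Q (y + h).
  rewrite /Q /=; have -> : y + h - l = (y - l) + h by rewrite addrAC.
  by apply: (le_trans (ler_normD _ _)); move: near1 hK Kge k0; slim; lra.
have Eyy : y + (h + e) = xi_inv (l + h) by rewrite S.
have eE : e = xi_inv (l + h) - (y + h) by rewrite -Eyy addrA [RHS]addrC addKr.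
have [|t t01 E] := @mvt_pd R 2 m A u [::] i (y + h) e u_smooth.
  move=> t t01; apply: QA.
  by rewrite eE; exact: Qc.
set z := y + h + t *: e in E.
have Qz : Q z.
  by rewrite /z eE; exact: Qc.
have [t0 t1] := andP t01.
have zy : `|z - y| <= 2 * K.
  have -> : z - y = h + t *: e by apply/rowP => j; rewrite /z !mxE; ring.
  apply: (le_trans (ler_normD _ _)); rewrite normrZ (ger0_norm t0).
  by have := ler_pM t0 (normr_ge0 e) t1 en; move: dK hK; slim; lra.
have {}E : u (y + (h + e)) 0 i - u (y + h) 0 i = d * pd u [:: 0] i z.
  by rewrite addrA; move: E; rewrite sum2E /e !ptE /= mul0r addr0.
have pz : `|pd u [:: 0] i z - pd u [:: 0] i y| <= 64 * CC * K / D ^+ 2.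
  have zw : `|z - y| <= w / 2 by move: zy w1 xD' r0 b0 Kge k0; slim; lra.
  have := @pd_lip Q [:: 0] i y z QC isT Qy Qz w0; rewrite -/w => /(_ zw) /le_trans; apply.
  have -> : (2 ^+ (size [:: (0 : 'I_2)]).+2 : R) = 8 by rewrite /=; ring.
  rewrite /= ler_pdivrMr ?exprn_gt0 //.
  have D2 : D ^+ 2 <= 4 * w ^+ 2.
    by apply: sqr_le_double; [exact: ltW|move: w1; slim; lra].
  have C16 : 0 <= 64 * CC * K / D ^+ 2 by apply: divr_ge0; [rewrite !mulr_ge0|rewrite exprn_ge0 // ltW].
  apply: (@le_trans _ _ (16 * CC * K)).
    have -> : 16 * CC * K = 8 * CC * (2 * K) by ring.
    by rewrite ler_wpM2l // mulr_ge0.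
  have -> : 16 * CC * K = 64 * CC * K / D ^+ 2 * (D ^+ 2 / 4) by field; rewrite gt_eqF.
  by rewrite ler_wpM2l //; move: D2; slim; lra.
have py : `|pd u [:: 0] i y| <= 2 * CC / D.
  apply: (le_trans (u_bound (s := [:: 0]) i isT (QA _ Qy))); rewrite expr1 -/w.
  rewrite ler_pdivrMr // mulrAC ler_pdivlMr //; by have := ler_wpM2l CC_ge0 w1; slim; lra.
(* The angle is linearised at [y] along [h + e]; the part [e], of length [|delta|], contributes only
   [O(d^-2)] to [dtheta]. *)
have da : `|d - beta * dtheta (y - c) h| <= bb * (768 * K ^+ 2 + 64 * bb * K) / D ^+ 2.
  have T := @th_taylor R c b1 r eta b1_neq0 r_gt0 eta1 xi_smooth y (h + e).
  rewrite -/w Eyy in T.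
  have he : `|h + e| <= 2 * K by apply: (le_trans (ler_normD _ _)); move: hK en dK; slim; lra.
  have {}T : `|th (xi_inv (l + h)) - th y - dtheta (y - c) (h + e)| <= 48 * `|h + e| ^+ 2 / w ^+ 2.
    apply: T; [|exact: w2|by move: he w1 xD' r0 b0 Kge k0; slim; lra].
    move=> s s01; apply: QA; have -> : h + e = xi_inv (l + h) - y by rewrite -Eyy [RHS]addrC addKr.
    exact: Qc.
  have T2 : 48 * `|h + e| ^+ 2 / w ^+ 2 <= 768 * K ^+ 2 / D ^+ 2.
    have i2 : (w ^+ 2)^-1 <= 4 / D ^+ 2.
      rewrite -[4 / D ^+ 2]invf_div lef_pV2 ?posrE ?divr_gt0 ?exprn_gt0 //.
      rewrite ler_pdivrMr // mulrC; apply: sqr_le_double; [exact: ltW|by move: w1; slim; lra].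
    have h2 : `|h + e| ^+ 2 <= 4 * K ^+ 2.
      exact: sqr_le_double.
    have -> : 768 * K ^+ 2 / D ^+ 2 = 48 * (4 * K ^+ 2) * (4 / D ^+ 2) by ring.
    by apply: ler_pM; rewrite ?mulr_ge0 ?invr_ge0 ?exprn_ge0 ?(ltW w0) // ler_wpM2l.
  have T3 : `|dtheta (y - c) e| <= 64 * bb * K / D ^+ 2.
    apply: (le_trans (dtheta_bound _ w0)); rewrite -/w.
    have i1 : w^-1 <= 2 / D.
      rewrite -[2 / D]invf_div lef_pV2 ?posrE ?divr_gt0 //.
    have -> : 64 * bb * K / D ^+ 2 = 2 * (16 * bb * K / D) * (2 / D) by field; rewrite gt_eqF.
    apply: ler_pM; rewrite ?mulr_ge0 ?invr_ge0 ?(ltW w0) // ler_wpM2l //.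
    exact: le_trans d2.
  have -> : d - beta * dtheta (y - c) h =
     beta * ((th (xi_inv (l + h)) - th y - dtheta (y - c) (h + e)) + dtheta (y - c) e).
    rewrite dthetaD /d /delta -/y; ring.
  rewrite normrM -mulrA; apply: ler_pM => //.
  apply: (le_trans (ler_normD _ _)); rewrite mulrDl; apply: lerD => //; exact: le_trans T2.
have -> : u (y + (h + e)) 0 i - u (y + h) 0 i - pd u [:: 0] i y * (beta * dtheta (y - c) h)
  = d * (pd u [:: 0] i z - pd u [:: 0] i y) + pd u [:: 0] i y * (d - beta * dtheta (y - c) h).
  by rewrite E; exact: product_increment.
have -> : frozen_const K / D ^+ 3 = 16 * bb * K / D * (64 * CC * K / D ^+ 2) +
   2 * CC / D * (bb * (768 * K ^+ 2 + 64 * bb * K) / D ^+ 2).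
  by rewrite /frozen_const; field; rewrite gt_eqF.
apply: (le_trans (ler_normD _ _)); rewrite (normrM d) (normrM (pd u [:: 0] i y)).
by apply: lerD; apply: ler_pM.
Qed.

Definition second_const (K : R) : R := 4 * frozen_const (2 * K) + 1024 * CC * K ^+ 3.

(** The linear corrections of [u0_frozen] cancel, so the second difference of the predictor at [l]
    is that of [u] at [xi_inv l], and hence a second derivative at a point where the equations of
    elasticity hold. *)
Lemma u0_second l K h k i : 0 <= K ->
  (forall x, `|x - l| <= 4 * K + 2 * K0 -> A x) -> `|h| <= K -> `|k| <= K ->
  2 * far_radius (2 * K) <= `|l - c| ->
  `|predictor (l + h + k) 0 i - predictor (l + h) 0 i - (predictor (l + k) 0 i - predictor l 0 i)
    - \sum_j \sum_l' h 0 j * k 0 l' * pd u [:: l'; j] i (xi_inv l)|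
  <= second_const K / `|l - c| ^+ 3.
Proof.
move=> Kge HA hK kK xD; have k0 := K0_ge0; have b0 := bb_ge0; have r0 := r_gt0.
have K2 : 0 <= 2 * K by rewrite mulr_ge0.
have HA2 x : `|x - l| <= 2 * (2 * K) + 2 * K0 -> A x.
  by move=> xl; apply: HA; move: xl; slim; lra.
have QC := convex_ball HA2; have [QA Qc] := QC.
have Al : A l by apply: HA; rewrite subrr normr0; move: Kge k0; slim; lra.
have hk : `|h + k| <= 2 * K by apply: (le_trans (ler_normD _ _)); lra.
have h2 : `|h| <= 2 * K by lra.
have k2 : `|k| <= 2 * K by lra.
have z2 : `|0 : 'rV[R]_2| <= 2 * K by rewrite normr0.
have f1 := u0_frozen i K2 HA2 hk xD; have f2 := u0_frozen i K2 HA2 h2 xD.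
have f3 := u0_frozen i K2 HA2 k2 xD; have f4 := u0_frozen i K2 HA2 z2 xD.
have near1 := xi_inv_near Al.
have [|w1 w2 w3 _] := @xi_inv_far l (2 * K) K2 Al.
  by have := far_radius_gt0 K2; move: xD; slim; lra.
have xD' : 32 * (1 + r + bb + 2 * K + K0) <= `|l - c|.
  by move: xD; rewrite /far_radius; slim; lra.
set y := xi_inv l in f1 f2 f3 f4 near1 w1 w2 w3 *.
have w4 : 4 * K <= `|y - c| by move: w3 w1 xD' r0 b0 Kge k0; slim; lra.
have w0 : 0 < `|y - c| by move: w1 xD' r0 b0 K2 k0; slim; lra.
have S := @u_second [set x | `|x - l| <= 2 * (2 * K) + 2 * K0] y h k K i QC _ Kge hK kK w4 w0.
have {}S : `|u (y + h + k) 0 i - u (y + h) 0 i - (u (y + k) 0 i - u y 0 i)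
    - \sum_j \sum_l h 0 j * k 0 l * pd u [:: l; j] i y| <= 1024 * CC * K ^+ 3 / `|l - c| ^+ 3.
  apply: (le_trans (S _)).
    move=> s t /andP[s0 s1] /andP[t0 t1] /=.
    have -> : y + s *: h + t *: k - l = (y - l) + (s *: h + t *: k).
      by apply/rowP => j; rewrite !mxE; ring.
    apply: (le_trans (ler_normD _ _)); have := ler_normD (s *: h) (t *: k).
    rewrite !normrZ (ger0_norm s0) (ger0_norm t0).
    have := ler_pM s0 (normr_ge0 h) s1 hK; have := ler_pM t0 (normr_ge0 k) t1 kK.
    by move: near1 k0 Kge; slim; lra.
  have -> : 128 * CC * K ^+ 3 = 128 * (CC * K ^+ 3) by rewrite mulrA.
  have -> : 1024 * CC * K ^+ 3 = 1024 * (CC * K ^+ 3) by rewrite mulrA.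
  apply: div_cube_half => //; first by rewrite mulr_ge0 ?exprn_ge0.
  by move: xD' r0 b0 K2 k0; slim; lra.
set D := `|l - c| in f1 f2 f3 f4 S *.
rewrite -(addrA l h k) -(addrA y h k) in S *.
have T := four_term_bound f1 f2 f3 f4 S.
have -> : second_const K / D ^+ 3 = 4 * (frozen_const (2 * K) / D ^+ 3) + 1024 * CC * K ^+ 3 / D ^+ 3.
  by rewrite /second_const; ring.
rewrite dthetaD !addr0 (_ : dtheta _ 0 = 0) in T; last by rewrite -(scale0r 0) dthetaZ mul0r.
by rewrite -frozen_algebra in T.
Qed.

End Predictor.

(** * The predictor across the cut *)

Section StripAux.
Variable R : realType.

Lemma same_side_near (a d : R) : a != 0 -> `|d| <= `|a| / 2 -> 0 < a * (a + d).
Proof.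
move=> a0; rewrite ler_norml => /andP[h1 h2]; have [p|n|e] := ltrgt0P a.
- by rewrite mulr_gt0 //; rewrite (gtr0_norm p) in h1 h2; lra.
- by rewrite nmulr_rgt0 //; rewrite (ltr0_norm n) in h1 h2; lra.
- by rewrite e eqxx in a0.
Qed.

Lemma div_sqr_half (C s t : R) : 0 <= C -> 0 < s -> s / 2 <= t -> C / t ^+ 2 <= 4 * C / s ^+ 2.
Proof.
move=> C0 s0 st; have t0 : 0 < t by lra.
rewrite ler_pdivrMr ?exprn_gt0 // mulrAC ler_pdivlMr ?exprn_gt0 //.
have h : s ^+ 2 <= 4 * t ^+ 2.
  have -> : 4 * t ^+ 2 = (2 * t) ^+ 2 by ring.
  rewrite lerXn2r ?nnegrE //; lra.
have := ler_wpM2l C0 h; lra.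
Qed.

Lemma evec_norm n (j : 'I_n) : `|evec R j| <= 1.
Proof.
apply: norm_le_coord => // a b; rewrite mxE.
by case: (_ && _); rewrite ?normr1 ?normr0.
Qed.

Lemma continuous_along (F : 'rV[R]_2 -> R) (z v : 'rV[R]_2) (eps : R) :
  {for z, continuous F} -> 0 < eps -> `|v| <= 1 ->
  exists t : R, [/\ 0 < t, t <= 1 & `|F z - F (z + t *: v)| <= eps].
Proof.
move=> cF eps0 v1; have /cvgrPdist_le/(_ eps eps0)/nbhs_ballP[d /= d0 H] := cF.
pose t := Num.min 1 (d / 2); exists t.
have t0 : 0 < t by rewrite lt_min ltr01 divr_gt0.
split => //; first by rewrite ge_min lexx.
apply: H; rewrite -ball_normE /= opprD addNKr normrN normrZ gtr0_norm //.
have td : t <= d / 2 by rewrite ge_min lexx orbT.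
have := ler_wpM2l (ltW t0) v1; lra.
Qed.

Lemma five_chain (a1 b1 a2 b2 q1 q2 e1 e2 e3 e4 e5 : R) :
  `|a1 - b1| <= e1 -> `|b1 - q1| <= e2 -> `|a2 - b2| <= e3 -> `|b2 - q2| <= e4 ->
  `|q1 - q2| <= e5 -> `|a1 - a2| <= e1 + e2 + e3 + e4 + e5.
Proof.
move=> h1 h2 h3 h4 h5.
have -> : a1 - a2 = ((a1 - b1) + (b1 - q1)) - ((a2 - b2) + (b2 - q2)) + (q1 - q2) by ring.
apply: (le_trans (ler_normD _ _)).
have := ler_normB ((a1 - b1) + (b1 - q1)) ((a2 - b2) + (b2 - q2)).
have := ler_normD (a1 - b1) (b1 - q1); have := ler_normD (a2 - b2) (b2 - q2); lra.
Qed.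

Lemma dist_chain (a b p q e e1 e2 : R) : `|a - b| <= e -> `|b - p| <= e1 -> `|p - q| <= e2 ->
  `|a - q| <= e1 + e2 + e.
Proof.
by move=> h h1 h2; have := ler_distD b a q; have := ler_distD p b q; lra.
Qed.

Lemma three_chain (a b d e1 e2 e3 : R) :
  `|a - b| <= e1 -> `|b - d| <= e2 -> `|d| <= e3 -> `|a| <= e1 + e2 + e3.
Proof.
move=> h1 h2 h3; have -> : a = (a - b) + (b - d) + d by ring.
apply: (le_trans (ler_normD _ _)); have := ler_normD (a - b) (b - d); lra.
Qed.

Lemma pair_bound (a b p q K M : R) : `|a| <= K -> `|b| <= K -> `|p| <= M -> `|q| <= M ->
  `|a * p + b * q| <= 2 * K * M.
Proof.
move=> h1 h2 h3 h4; apply: (le_trans (ler_normD _ _)); rewrite !normrM.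
have := ler_pM (normr_ge0 a) (normr_ge0 p) h1 h3; have := ler_pM (normr_ge0 b) (normr_ge0 q) h2 h4.
lra.
Qed.

Lemma sum2_diff_bound (a p q u : 'I_2 -> R) (K E : R) : (forall j, `|a j| <= K) ->
  (forall j, `|p j - u j| <= E) -> (forall j, `|q j - u j| <= E) ->
  `|\sum_j a j * p j - \sum_j a j * q j| <= 4 * K * E.
Proof.
move=> h1 h2 h3.
have -> : \sum_j a j * p j - \sum_j a j * q j = a 0 * (p 0 - q 0) + a 1 * (p 1 - q 1).
  by rewrite !sum2E; ring.
have -> : 4 * K * E = 2 * K * (2 * E) by ring.
have h j : `|p j - q j| <= 2 * E.
  have -> : p j - q j = (p j - u j) - (q j - u j) by ring.
  apply: (le_trans (ler_normB _ _)); have := h2 j; have := h3 j; lra.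
exact: pair_bound.
Qed.

End StripAux.

Section Strip.
Variable R : realType.
Variables (m : nat) (c : 'rV[R]_2) (b1 : R) (bm : 'rV[R]_m) (U : 'rV[R]_2 -> 'rV[R]_m).
Variables (p : 'I_2 -> 'I_m -> 'rV[R]_2 -> R) (O : set 'rV[R]_2) (r : R).
Variable g : 'rV[R]_2 -> 'rV[R]_m.
Implicit Types x y z h k : 'rV[R]_2.
Implicit Types K : R.
Local Notation same_side x y := (0 < (x 0 1 - c 0 1) * (y 0 1 - c 0 1)).
Local Notation dist x := (x 0 0 - c 0 0).
Local Notation w := (slip0 c (pt b1 0) bm U).
Hypothesis p_lip : forall K, 0 <= K -> exists C D : R, [/\ 0 <= C, 1 <= D &
  forall j i x y, same_side x y -> `|y - x| <= K -> D <= dist x ->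
    `|p j i y - p j i x| <= C / dist x ^+ 2].
Hypothesis p_bound : exists C : R, 0 <= C /\
  forall j i x, x 0 1 != c 0 1 -> 1 <= dist x -> `|p j i x| <= C / dist x.
Hypothesis U_diff : forall K, 0 <= K -> exists C D : R, [/\ 0 <= C, 1 <= D &
  forall i x h, same_side x (x + h) -> `|h| <= K -> D <= dist x ->
    `|U (x + h) 0 i - U x 0 i - \sum_j h 0 j * p j i x| <= C * `|h| / dist x ^+ 2].
Hypothesis O_right : forall x, r < dist x -> O x.
Hypothesis g_smooth : smooth_on O g.
Hypothesis g_slip : forall x, r < dist x -> x 0 1 != c 0 1 -> g x = w x.

(** Extracts a derivative bound from increments: the extension [g] is smooth but carries no estimate
    of its own, while the increments of [U] are controlled. *)
Lemma derive_near (G : 'rV[R]_2 -> R) x v (a M e : R) : derivable G x v -> 0 < e ->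
  (forall t, `|t| <= e -> `|G (x + t *: v) - G x - t * a| <= M * `|t|) ->
  `|'D_v G x - a| <= M.
Proof.
move=> d e0 H.
have cv : h^-1 *: (G (h *: v + x) - G x) @[h --> 0^'] --> 'D_v G x by exact: d.
apply/ler_addgt0Pr => eps eps0.
move/cvgrPdist_le/(_ eps eps0): cv => cv.
have n : \forall h \near (0 : R)^', [/\ h != 0, `|h| <= e &
   `|'D_v G x - h^-1 *: (G (h *: v + x) - G x)| <= eps].
  near=> h; split; near: h; [exact: nbhs_dnbhs_neq|exact: dnbhs0_le|exact: cv].
have [h [h0 he hd]] := filter_ex n.
have hp : 0 < `|h| by rewrite normr_gt0.
have {}H := H h he; rewrite (addrC x) in H.
have q : `|h^-1 *: (G (h *: v + x) - G x) - a| <= M.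
  have -> : h^-1 *: (G (h *: v + x) - G x) - a = h^-1 * (G (h *: v + x) - G x - h * a).
    by rewrite /GRing.scale /= [RHS]mulrBr (mulKf h0).
  by rewrite normrM normfV ler_pdivrMl // [leRHS]mulrC.
by have := ler_distD (h^-1 *: (G (h *: v + x) - G x)) ('D_v G x) a; lra.
Unshelve. all: by end_near. Qed.

Let gi i x := g x 0 i.
Let dg j i x := pd g [:: j] i x.

Let dg_derive j i x : r < dist x -> 'D_(evec R j) (gi i) x = dg j i x.
Proof. by move=> rx; rewrite /dg -(derive_pd [::] i j g_smooth (O_right rx)). Qed.

Let gi_derivable v i x : r < dist x -> derivable (gi i) x v.
Proof.
by move=> rx; exact/diff_derivable/(pd_differentiable [::] i g_smooth (O_right rx)).
Qed.

Local Ltac slim := clear - p_lip p_bound U_diff O_right g_smooth g_slip dg_derive gi_derivable.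

(** Off the cut [g] is locally [U], or a translate of [U] minus a constant, and [U_diff] compares
    its increments with [p]. Below the cut the translation by [b1] changes [p] by [O(dist^-2)]
    only. *)
Lemma g_off_cut : exists C D : R, [/\ 0 <= C, 1 <= D &
  forall j i x, x 0 1 != c 0 1 -> D <= dist x -> `|dg j i x - p j i x| <= C / dist x ^+ 2].
Proof.
have [C1 [D1 [C10 D11 H1]]] := U_diff ler01.
have [C2 [D2 [C20 D21 H2]]] := p_lip (normr_ge0 b1).
exists (4 * C1 + C2), (D1 + D2 + `|r| + 2 * `|b1| + 2); split; first by lra.
  by have := normr_ge0 r; have := normr_ge0 b1; lra.
move=> j i x x1 Dx; have rr := ler_norm r; have b0 := normr_ge0 b1; have r0 := normr_ge0 r.
have bb := ler_norm b1.
set s := dist x in Dx *.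
have rx : r < s by lra.
have s0 : 0 < s by lra.
(* Steps of length at most [e] do not leave the side of [x]. *)
pose e := Num.min 1 (`|x 0 1 - c 0 1| / 2).
have xc : 0 < `|x 0 1 - c 0 1| by rewrite normr_gt0 subr_eq0.
have e0 : 0 < e by rewrite lt_min ltr01 divr_gt0.
have e1 : e <= 1 by rewrite ge_min lexx.
have e2 : e <= `|x 0 1 - c 0 1| / 2 by rewrite ge_min lexx orbT.
have ev (t : R) : `|t *: evec R j : 'rV[R]_2| <= `|t|.
  by rewrite normrZ ler_piMr // evec_norm.
have evj (t : R) q : `|(t *: evec R j : 'rV[R]_2) 0 q| <= `|t|.
  exact: le_trans (coord_le _ _ _) (ev t).
have side (t : R) : `|t| <= e -> same_side x (x + t *: evec R j).
  move=> te; have := le_trans (evj t 1) (le_trans te e2).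
  have x1' : x 0 1 - c 0 1 != 0 by rewrite subr_eq0.
  move/(same_side_near x1'); rewrite [(x + _) 0 1]mxE; congr (_ < _ * _); ring.
have distt (t : R) : `|t| <= e -> s - 1 <= dist (x + t *: evec R j).
  move=> te; rewrite [(x + _) 0 0]mxE.
  have := le_trans (evj t 0) (le_trans te e1); rewrite ler_norml => /andP[q _]; rewrite /s; lra.
have sumE (t : R) y : \sum_l (t *: evec R j : 'rV[R]_2) 0 l * p l i y = t * p j i y.
  rewrite (bigD1 j) //= big1 ?addr0.
    by rewrite !mxE !eqxx mulr1.
  by move=> l lj; rewrite !mxE (negbTE lj) andbF mulr0 mul0r.
rewrite -dg_derive //.
have key (y : 'rV[R]_2) (q : 'rV[R]_m) : y 0 1 = x 0 1 -> s / 2 <= dist y -> D1 <= dist y ->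
    (forall t : R, `|t| <= e -> g (x + t *: evec R j) = U (y + t *: evec R j) - q) ->
    `|'D_(evec R j) (gi i) x - p j i y| <= 4 * C1 / s ^+ 2.
  move=> yx sy Dy gE; apply: (@derive_near (gi i) x (evec R j) (p j i y) (4 * C1 / s ^+ 2) e (gi_derivable rx) e0) => t te.
  have t0e : `|0 : R| <= e by rewrite normr0 ltW.
  have gx : g x = U y - q by have := gE 0 t0e; rewrite !scale0r !addr0.
  rewrite /gi gE // gx !mxE -sumE.
  have -> : U (y + t *: evec R j) 0 i - q 0 i - (U y 0 i - q 0 i)
     = U (y + t *: evec R j) 0 i - U y 0 i by ring.
  apply: le_trans (H1 _ _ _ _ _ Dy) _.
  - by have := side t te; rewrite [(x + _) 0 1]mxE [(y + _) 0 1]mxE yx.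
  - by apply: le_trans (ev t) _; rewrite (le_trans te).
  - rewrite mulrAC; apply: (@le_trans _ _ (4 * C1 / s ^+ 2 * `|t *: evec R j : 'rV[R]_2|)).
      by rewrite ler_wpM2r //; exact: div_sqr_half.
    by rewrite ler_wpM2l // divr_ge0 ?sqr_ge0 // mulr_ge0.
have s20 : 0 < s ^+ 2 by rewrite exprn_gt0.
have sle : 4 * C1 / s ^+ 2 <= (4 * C1 + C2) / s ^+ 2.
  by rewrite ler_wpM2r ?invr_ge0 ?(ltW s20) // lerDl.
have rt (t : R) : `|t| <= e -> r < dist (x + t *: evec R j).
  by move=> te; have := distt t te; move: Dx D11 D21 rr b0; slim; lra.
have [xp|xn] := ltrP (c 0 1) (x 0 1).
  apply: le_trans sle; apply: (key x 0) => //; rewrite -/s; [by move: s0; slim; lra|by move: Dx D21 r0 b0; slim; lra|].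
  move=> t te; have sd := side t te.
  have up : c 0 1 < (x + t *: evec R j) 0 1.
    by move: sd; rewrite pmulr_rgt0 subr_gt0.
  by rewrite g_slip ?rt ?gt_eqF // /slip0 up subr0.
have {}xn : x 0 1 < c 0 1 by rewrite lt_neqAle x1.
pose y := x - pt b1 0.
have yE0 : dist y = s - b1 by rewrite /y /s !mxE /=; ring.
have yE1 : y 0 1 = x 0 1 by rewrite /y !mxE /=; ring.
have k1 : `|'D_(evec R j) (gi i) x - p j i y| <= 4 * C1 / s ^+ 2.
  apply: (key y bm) => //; rewrite ?yE0;
    [by move: Dx D11 D21 r0 bb; slim; lra|by move: Dx D21 r0 bb b0; slim; lra|].
  move=> t te; have sd := side t te.
  have dn : (x + t *: evec R j) 0 1 < c 0 1.
    by move: sd; rewrite nmulr_rgt0 subr_lt0.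
  rewrite g_slip ?rt ?lt_eqF // /slip0 ltNge (ltW dn) /= /y.
  by congr (U _ - _); rewrite addrAC.
have k2 : `|p j i y - p j i x| <= C2 / s ^+ 2.
  apply: H2; last by rewrite -/s; move: Dx D11 r0 b0; slim; lra.
    by rewrite yE1 -expr2 exprn_even_gt0 //= subr_eq0.
  have -> : y - x = pt (- b1) 0 by apply/rowP => l; rewrite /y !mxE; case: ifP => _; ring.
  by apply: pt_norm; rewrite ?normrN ?normr0.
have -> : (4 * C1 + C2) / s ^+ 2 = 4 * C1 / s ^+ 2 + C2 / s ^+ 2 by rewrite mulrDl.
by have := ler_distD (p j i y) ('D_(evec R j) (gi i) x) (p j i x); move: k1 k2; slim; lra.
Qed.

Let foot x : 'rV[R]_2 := pt (x 0 0) (c 0 1).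
Let shift (sg t : R) x : 'rV[R]_2 := x + t *: pt 0 sg.

Let same_side_shift sg t t' x : sg ^+ 2 = 1 -> 0 < t -> 0 < t' ->
  same_side (shift sg t (foot x)) (shift sg t' (foot x)).
Proof.
move=> sg1 t0 t'0; rewrite /shift /foot !mxE /=.
have -> : (c 0 1 + t * sg - c 0 1) * (c 0 1 + t' * sg - c 0 1) = t * t' * sg ^+ 2 by ring.
by rewrite sg1 mulr1 mulr_gt0.
Qed.

Let dist_shift sg t x : dist (shift sg t (foot x)) = dist x.
Proof. by rewrite /shift /foot !mxE /= mulr0 addr0. Qed.

Local Ltac slim ::= clear - p_lip p_bound U_diff O_right g_smooth g_slip dg_derive gi_derivable
  same_side_shift dist_shift foot shift.

(** Continuity of the derivative of [g] carries the bound down to the cut, from above for [sg = 1]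
    and from below for [sg = -1]. Taken together, the two cases say that [p] jumps by at most
    [O(dist^-2)]. *)
Lemma g_at_cut : exists C D : R, [/\ 0 <= C, 1 <= D &
  forall j i sg x, sg ^+ 2 = 1 -> D <= dist x ->
    `|dg j i (foot x) - p j i (shift sg 1 (foot x))| <= C / dist x ^+ 2].
Proof.
have [C1 [D1 [C10 D11 H1]]] := g_off_cut.
have [C2 [D2 [C20 D21 H2]]] := p_lip ler01.
exists (C1 + C2), (D1 + D2 + `|r| + 1); split; first by lra.
  by have := normr_ge0 r; lra.
move=> j i sg x sg1 Dx; have rr := ler_norm r; have r0 := normr_ge0 r.
have rx : r < dist (foot x) by rewrite /foot !mxE /=; lra.
have v1 : `|pt 0 sg : 'rV[R]_2| <= 1.
  apply: pt_norm => //; first by rewrite normr0.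
  by rewrite -(@expr_le1 _ 2) // real_normK ?num_real // sg1.
apply/ler_addgt0Pr => eps eps0.
have cdg : {for foot x, continuous (dg j i)}.
  exact/differentiable_continuous/(pd_differentiable [:: j] i g_smooth (O_right rx)).
have [t [t0 t1 te]] := continuous_along cdg eps0 v1.
have h1 := H1 j i (shift sg t (foot x)); rewrite dist_shift in h1.
have sn : sg != 0 by apply: contra_eqN sg1 => /eqP ->; rewrite expr0n /= eq_sym oner_eq0.
have {}h1 : `|dg j i (shift sg t (foot x)) - p j i (shift sg t (foot x))| <= C1 / dist x ^+ 2.
  apply: h1; last by lra.
  rewrite /shift /foot !mxE /= -subr_eq0 addrAC subrr add0r mulf_neq0 // gt_eqF //.
have h2 := H2 j i (shift sg 1 (foot x)) (shift sg t (foot x)).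
rewrite dist_shift in h2.
have {}h2 : `|p j i (shift sg t (foot x)) - p j i (shift sg 1 (foot x))| <= C2 / dist x ^+ 2.
  apply: h2; [exact: same_side_shift| |lra].
  have -> : shift sg t (foot x) - shift sg 1 (foot x) = (t - 1) *: pt 0 sg.
    by apply/rowP => l; rewrite /shift !mxE; ring.
  rewrite normrZ; have : `|t - 1| <= 1 by rewrite ler_norml; move: t0 t1; slim; lra.
  by move=> q; have := ler_pM (normr_ge0 _) (normr_ge0 _) q v1; rewrite mulr1.
have -> : (C1 + C2) / dist x ^+ 2 = C1 / dist x ^+ 2 + C2 / dist x ^+ 2 by rewrite mulrDl.
exact: dist_chain te h1 h2.
Qed.

Lemma g_foot K : 0 <= K -> exists C D : R, [/\ 0 <= C, 1 <= D &
  forall j i x, `|x 0 1 - c 0 1| <= K -> D <= dist x ->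
    `|dg j i x - dg j i (foot x)| <= C / dist x ^+ 2].
Proof.
move=> Kge; have K1 : 0 <= K + 1 by lra.
have [C1 [D1 [C10 D11 H1]]] := g_off_cut.
have [C2 [D2 [C20 D21 H2]]] := g_at_cut.
have [C3 [D3 [C30 D31 H3]]] := p_lip K1.
exists (C1 + C2 + C3), (D1 + D2 + D3); split; [lra|lra|].
move=> j i x xK Dx.
have s20 : 0 < dist x ^+ 2 by rewrite exprn_gt0 //; lra.
have [x1|x1] := eqVneq (x 0 1) (c 0 1).
  have -> : foot x = x.
    apply/rowP => l; rewrite /foot mxE -x1; case: (unliftP 0 l) => [l'|] -> //=.
    by rewrite ord1 /=; congr (x 0 _); exact/val_inj.
  by rewrite subrr normr0 divr_ge0 ?(ltW s20) //; lra.
have x1' : x 0 1 - c 0 1 != 0 by rewrite subr_eq0.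
pose sg : R := Num.sg (x 0 1 - c 0 1).
have sg1 : sg ^+ 2 = 1 by rewrite /sg sqr_sg x1'.
have h1 : `|dg j i x - p j i x| <= C1 / dist x ^+ 2 by apply: H1 => //; lra.
have h2 : `|dg j i (foot x) - p j i (shift sg 1 (foot x))| <= C2 / dist x ^+ 2.
  by apply: H2 => //; lra.
have h3 : `|p j i (shift sg 1 (foot x)) - p j i x| <= C3 / dist x ^+ 2.
  apply: H3; last by lra.
    rewrite /shift /foot !mxE /= mul1r addrAC subrr add0r /sg mulrC -normrEsg normr_gt0 //.
  have sgn : `|sg| = 1 by rewrite /sg normr_sg x1'.
  apply: norm_le_coord => // a l; rewrite ord1 /shift /foot !mxE mul1r.
  case: (unliftP 0 l) => [l'|] -> /=; last by rewrite addr0 subrr normr0.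
  rewrite ord1 (_ : lift 0 0 = 1); last exact/val_inj.
  have -> : c 0 1 + sg - x 0 1 = sg - (x 0 1 - c 0 1) by ring.
  apply: (le_trans (ler_normB _ _)); rewrite sgn; lra.
have -> : (C1 + C2 + C3) / dist x ^+ 2 = C1 / dist x ^+ 2 + C2 / dist x ^+ 2 + C3 / dist x ^+ 2.
  by rewrite !mulrDl.
rewrite -[leRHS]addrA [leRHS]addrC [C2 / _ + _]addrC.
by apply: dist_chain h1 _ _; rewrite distrC; [exact: h3|exact: h2].
Qed.

(** The comparison goes from [y] and from [x] to their feet on the cut, and between the feet by way
    of the points one unit above, so that [p] is compared only within one side. *)
Lemma g_lip K : 0 <= K -> exists C D : R, [/\ 0 <= C, 1 <= D &
  forall j i x y, `|x 0 1 - c 0 1| <= K -> `|y - x| <= K -> D <= dist x ->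
    `|dg j i y - dg j i x| <= C / dist x ^+ 2].
Proof.
move=> Kge; have K2 : 0 <= 2 * K by lra.
have [C1 [D1 [C10 D11 H1]]] := g_foot K2.
have [C2 [D2 [C20 D21 H2]]] := g_at_cut.
have [C3 [D3 [C30 D31 H3]]] := p_lip Kge.
exists (4 * C1 + 4 * C2 + C1 + C2 + C3), (2 * (D1 + D2 + D3 + K)); split; [lra|lra|].
move=> j i x y xK yx Dx.
have yc l : `|y 0 l - x 0 l| <= K.
  by apply: le_trans yx; have := coord_le (y - x) 0 l; rewrite !mxE.
have s0 : 0 < dist x by lra.
have dy : dist x / 2 <= dist y.
  by have := yc 0; rewrite ler_norml; lra.
have y2 : `|y 0 1 - c 0 1| <= 2 * K.
  by have := ler_distD (x 0 1) (y 0 1) (c 0 1); have := yc 1; lra.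
have e1 : (1 : R) ^+ 2 = 1 by rewrite expr1n.
have x2 : `|x 0 1 - c 0 1| <= 2 * K by lra.
have g1 : D1 <= dist x by lra.
have g2 : D1 <= dist y by lra.
have g3 : D2 <= dist x by lra.
have g4 : D2 <= dist y by lra.
have g5 : D3 <= dist x by lra.
have hx : `|dg j i x - dg j i (foot x)| <= C1 / dist x ^+ 2 by exact: H1.
have hy : `|dg j i y - dg j i (foot y)| <= 4 * C1 / dist x ^+ 2.
  by apply: le_trans (div_sqr_half C10 s0 dy); exact: H1.
have zx : `|dg j i (foot x) - p j i (shift 1 1 (foot x))| <= C2 / dist x ^+ 2 by exact: H2.
have zy : `|dg j i (foot y) - p j i (shift 1 1 (foot y))| <= 4 * C2 / dist x ^+ 2.
  by apply: le_trans (div_sqr_half C20 s0 dy); exact: H2.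
have pp : `|p j i (shift 1 1 (foot y)) - p j i (shift 1 1 (foot x))| <= C3 / dist x ^+ 2.
  have := H3 j i (shift 1 1 (foot x)) (shift 1 1 (foot y)); rewrite dist_shift; apply => //.
    by rewrite /shift /foot !mxE /= mulr1 addrAC subrr add0r mulr1 ltr01.
  apply: norm_le_coord => // a l; rewrite /shift /foot !mxE.
  case: ifP => l0.
    by rewrite mulr0 !addr0; exact: yc.
  by rewrite subrr normr0.
have -> : (4 * C1 + 4 * C2 + C1 + C2 + C3) / dist x ^+ 2 = 4 * C1 / dist x ^+ 2 + 4 * C2 / dist x ^+ 2
  + C1 / dist x ^+ 2 + C2 / dist x ^+ 2 + C3 / dist x ^+ 2 by rewrite !mulrDl.
exact: five_chain hy zy hx zx pp.
Qed.

(** Second increments are estimated as differences of first derivatives of [g] at two points, no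
    bound on its second derivatives being at hand; this is the source of [dist^-2] instead of
    [dist^-3]. *)
Lemma strip_increments K : 0 <= K -> exists C D : R, [/\ 0 <= C, 1 <= D &
  forall i (l h k : 'rV[R]_2), `|l 0 1 - c 0 1| <= K -> `|h| <= K -> `|k| <= K -> D <= dist l ->
  l 0 1 != c 0 1 -> (l + k) 0 1 != c 0 1 ->
  `|w (l + k) 0 i - w l 0 i| <= C / dist l /\
  ((l + h) 0 1 != c 0 1 -> (l + h + k) 0 1 != c 0 1 ->
  `|w (l + h + k) 0 i - w (l + h) 0 i - (w (l + k) 0 i - w l 0 i)| <= C / dist l ^+ 2)].
Proof.
move=> Kge; have K2 : 0 <= 2 * K by lra.
have [C1 [D1 [C10 D11 H1]]] := g_lip K2.
have [C2 [D2 [C20 D21 H2]]] := g_off_cut.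
have [C3 [C30 H3]] := p_bound.
exists (2 * K * (C1 + C2 + C3) + 4 * K * C1), (D1 + D2 + `|r| + 2 * K + 1); split.
- by rewrite addr_ge0 // !mulr_ge0 //; lra.
- by have := normr_ge0 r; lra.
move=> i l h k lK hK kK Dl l1 lk1.
have rr := ler_norm r; have r0 := normr_ge0 r.
have s0 : 0 < dist l by lra.
have g1 : D1 <= dist l by lra.
have g2 : D2 <= dist l by lra.
have g3 : 1 <= dist l by lra.
have right x : `|x - l| <= 2 * K -> r < dist x.
  move=> xl; have := le_trans (coord_le (x - l) 0 0) xl; rewrite !mxE ler_norml; lra.
have segm x t : `|x - l| <= K -> 0 <= t <= 1 -> `|x + t *: k - l| <= 2 * K.
  move=> xl /andP[t0 t1]; rewrite addrAC (le_trans (ler_normD _ _)) // normrZ (ger0_norm t0).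
  have := ler_pM t0 (normr_ge0 k) t1 kK; lra.
have mv x : `|x - l| <= K -> exists2 t, 0 <= t <= 1 &
    g (x + k) 0 i - g x 0 i = \sum_j k 0 j * dg j i (x + t *: k).
  move=> xl; have [|t t01 E] := @mvt_pd R 2 m O g [::] i x k g_smooth.
    by move=> t t01; apply/O_right/right/segm.
  by exists t.
have wg x : `|x - l| <= 2 * K -> x 0 1 != c 0 1 -> w x = g x.
  by move=> xl x1; rewrite g_slip //; exact: right.
have l0 : `|l - l| <= K by rewrite subrr normr0.
have KK : K <= 2 * K by move: Kge; slim; lra.
have lk : `|l + k - l| <= 2 * K by rewrite addrC addKr; exact: le_trans KK.
have lh : `|l + h - l| <= K by rewrite addrC addKr.
have lh2 : `|l + h - l| <= 2 * K := le_trans lh KK.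
have wl : w l = g l by apply: wg => //; rewrite subrr normr0.
have [t t01 E] := mv l l0.
have kj j : `|k 0 j| <= K by exact: le_trans (coord_le _ _ _) kK.
have lK2 : `|l 0 1 - c 0 1| <= 2 * K := le_trans lK KK.
have dl x j : `|x - l| <= 2 * K -> `|dg j i x - dg j i l| <= C1 / dist l ^+ 2.
  by move=> xl; exact: H1.
have sq : (dist l ^+ 2)^-1 <= (dist l)^-1.
  by rewrite lef_pV2 ?posrE ?exprn_gt0 // expr2 ler_peMr // ltW.
have is0 : 0 <= (dist l)^-1 by rewrite invr_ge0 ltW.
have is2 : 0 <= (dist l ^+ 2)^-1 by rewrite invr_ge0 sqr_ge0.
split.
  rewrite wl wg // E.
  have b j : `|dg j i (l + t *: k)| <= (C1 + C2 + C3) / dist l.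
    have h1 : `|dg j i (l + t *: k) - dg j i l| <= C1 / dist l ^+ 2 by apply/dl/segm.
    have h2 : `|dg j i l - p j i l| <= C2 / dist l ^+ 2 by exact: H2.
    have h3 : `|p j i l| <= C3 / dist l by exact: H3.
    have q1 : C1 / dist l ^+ 2 <= C1 / dist l by rewrite ler_wpM2l.
    have q2 : C2 / dist l ^+ 2 <= C2 / dist l by rewrite ler_wpM2l.
    rewrite !mulrDl; exact: three_chain (le_trans h1 q1) (le_trans h2 q2) h3.
  rewrite sum2E; apply: (le_trans (pair_bound (kj 0) (kj 1) (b 0) (b 1))).
  rewrite [leRHS]mulrDl [leLHS]mulrA lerDl; apply: mulr_ge0 => //; apply: mulr_ge0 => //; exact: mulr_ge0.
move=> lh1 lhk1.
have lhk : `|l + h + k - l| <= 2 * K.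
  by have := segm (l + h) 1 lh; rewrite scale1r; apply; rewrite ler01 lexx.
rewrite wl !wg // E.
have [t' t'01 ->] := mv (l + h) lh.
have d1 j := dl _ j (segm _ _ lh t'01); have d2 j := dl _ j (segm _ _ l0 t01).
apply: (le_trans (sum2_diff_bound kj d1 d2)).
rewrite [leRHS]mulrDl [leLHS]mulrA lerDr; apply: mulr_ge0 => //.
by apply: mulr_ge0; [exact: mulr_ge0|apply: addr_ge0 => //; exact: addr_ge0].
Qed.

End Strip.

(** * Site potential and elasticity tensor *)

Section Energy.
Variable R : realType.
Variables (m n : nat) (rho : 'I_n -> 'rV[R]_2) (V : 'M[R]_(n, m) -> R) (dens : R).
Hypothesis V_smooth : smooth_on setT V.

Let MA (A : 'M[R]_(m, 2)) : 'M[R]_(n, m) := \matrix_(k, i) \sum_j A i j * rho k 0 j.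
Let W := cb_energy dens rho V.

Let MA_line (h : R) (v A : 'M[R]_(m, 2)) : MA (h *: v + A) = h *: MA v + MA A.
Proof.
apply/matrixP => k i; rewrite !mxE mulr_sumr -big_split; apply: eq_bigr => j _ /=.
by rewrite !mxE mulrDl mulrA.
Qed.

(** [MA] is linear, so the difference quotients of [F \o MA] are those of [F] along the image
    direction, and no remainder has to be estimated. *)
Lemma derive_comp_grad (F : 'M[R]_(n, m) -> R) (A : 'M[R]_(m, 2)) i j :
  differentiable F (MA A) ->
  is_derive A (delta_mx i j) (F \o MA) (\sum_b rho b 0 j * 'D_(delta_mx b i) F (MA A)).
Proof.
move=> dF.
have E : (fun e : R => e^-1 *: ((F \o MA) (e *: delta_mx i j + A) - (F \o MA) A)) =
  (fun e : R => e^-1 *: (F (e *: MA (delta_mx i j) + MA A) - F (MA A))).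
  by apply/funext => e; rewrite /= MA_line.
have d : is_derive A (delta_mx i j) (F \o MA) ('D_(MA (delta_mx i j)) F (MA A)).
  have d0 : derivable F (MA A) (MA (delta_mx i j)) by exact: diff_derivable.
  by apply: DeriveDef; [rewrite /derivable E|rewrite /derive E].
have -> : \sum_b rho b 0 j * 'D_(delta_mx b i) F (MA A) = 'D_(MA (delta_mx i j)) F (MA A).
  rewrite derive_sum_coord //; apply: eq_bigr => b _; rewrite (bigD1 i) //= big1 ?addr0.
    rewrite mxE (bigD1 j) //= big1 ?addr0; first by rewrite mxE !eqxx mul1r.
    by move=> j' jj'; rewrite mxE (negbTE jj') andbF mul0r.
  move=> i' ii'; rewrite mxE big1 ?mul0r // => j' _.
  by rewrite mxE (negbTE ii') mul0r.
exact: d.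
Qed.

Definition vgrad k i (G : 'M[R]_(n, m)) : R := 'D_(delta_mx k i) V G.
Definition vhess k i k' i' : R := 'D_(delta_mx k i) (vgrad k' i') 0.

Lemma vhess_sym k i k' i' : vhess k i k' i' = vhess k' i' k i.
Proof. exact: derive_comm0. Qed.

Let MA0 : MA 0 = 0.
Proof. by apply/matrixP => k i; rewrite !mxE big1 // => j _; rewrite mxE mul0r. Qed.

Let W_derive A i j : is_derive A (delta_mx i j) W (dens * \sum_b rho b 0 j * vgrad b i (MA A)).
Proof. exact/is_deriveZ/derive_comp_grad/(smooth_diff V_smooth). Qed.

Lemma sigma0E i j : sigma0 W i j = dens * \sum_b rho b 0 j * vgrad b i 0.
Proof. by rewrite mxE (@derive_val _ _ _ _ _ _ _ (W_derive 0 i j)) MA0. Qed.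

Lemma elastE F i j : elast W F i j =
  dens * \sum_k \sum_l \sum_a \sum_b rho b 0 j * rho a 0 l * vhess b i a k * F k l.
Proof.
rewrite mxE mulr_sumr; apply: eq_bigr => k _; rewrite mulr_sumr; apply: eq_bigr => l _.
have -> : (fun A => 'D_(delta_mx k l) W A) =
    (fun A => dens *: \sum_a rho a 0 l * vgrad a k (MA A)).
  by apply/funext => A; rewrite (@derive_val _ _ _ _ _ _ _ (W_derive A k l)).
have D a : is_derive 0 (delta_mx i j) (fun A => rho a 0 l * vgrad a k (MA A))
    (rho a 0 l * \sum_b rho b 0 j * vhess b i a k).
  have := @derive_comp_grad (vgrad a k) 0 i j; rewrite MA0 => /(_ _) H.
  exact/is_deriveZ/H/(smooth_diff (smooth_derive _ V_smooth)).
have S : is_derive 0 (delta_mx i j) (\sum_a (fun A => rho a 0 l * vgrad a k (MA A)))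
   (\sum_a rho a 0 l * \sum_b rho b 0 j * vhess b i a k) by exact: is_derive_sum.
have -> : (fun A => dens *: \sum_a rho a 0 l * vgrad a k (MA A)) =
   dens *: (\sum_a (fun A => rho a 0 l * vgrad a k (MA A))).
  by apply/funext => A; rewrite /= fct_sumE.
rewrite deriveZ; last by have [] := S.
have [_ ->] := S; rewrite /GRing.scale /= -mulrA; congr (_ * _).
rewrite mulr_suml; apply: eq_bigr => a _; rewrite mulr_sumr mulr_suml; apply: eq_bigr => b _.
ring.
Qed.

Lemma vgrad_taylor : exists C e : R, [/\ 0 <= C, 0 < e &
  forall k i G G' r, `|G| <= r -> `|G'| <= r -> r <= e ->
    `|vgrad k i G - vgrad k i G' - \sum_a \sum_b (G - G') a b * vhess a b k i|
      <= C * r * `|G - G'|].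
Proof.
have /choice[f Hf] : forall ki : 'I_n * 'I_m, exists Ce : R * R, [/\ 0 <= Ce.1, 0 < Ce.2 &
   forall G G' r, `|G| <= r -> `|G'| <= r -> r <= Ce.2 ->
   `|vgrad ki.1 ki.2 G - vgrad ki.1 ki.2 G' - \sum_a \sum_b (G - G') a b * vhess a b ki.1 ki.2|
      <= Ce.1 * r * `|G - G'|].
  move=> [k i]; have [C [e [C0 e0 H]]] := smooth_taylor0 (smooth_derive (delta_mx k i) V_smooth).
  by exists (C, e).
have : \forall r \near (0 : R)^'+, forall ki : 'I_n * 'I_m, r <= (f ki).2.
  by apply: filter_forall => ki; have [_ e0 _] := Hf ki; apply: nbhs_right_le.
move=> /(filterI (nbhs_right_gt 0))/filter_ex[e [/= e0 He]].
exists (\sum_ki (f ki).1), e; split => //.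
  by apply: sumr_ge0 => ki _; have [] := Hf ki.
move=> k i G G' r Gr Gr' re; have [C0 e0' H] := Hf (k, i).
apply: (le_trans (H G G' r Gr Gr' _)); first exact: le_trans (He (k, i)).
rewrite ler_wpM2r // ler_wpM2r //; first exact: le_trans Gr.
rewrite (bigD1 (k, i)) //= lerDl; apply: sumr_ge0 => ki _; by have [] := Hf ki.
Qed.

Lemma partial_grad_derive G H :
  \sum_k dotp (partial_grad V k G) (row k H) = 'D_H V G.
Proof.
rewrite derive_sum_coord; last exact: (smooth_diff V_smooth).
apply: eq_bigr => k _; apply: eq_bigr => i _; by rewrite !mxE mulrC.
Qed.

(** Slip invariance equates values of [V] along two lines; this converts it into an identity of
    first variations. *)
Lemma derive_eq_along (X Y X' Y' : 'M[R]_(n, m)) (e : R) : 0 < e ->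
  (forall t : R, `|t| <= e -> V (X + t *: Y) = V (X' + t *: Y')) ->
  'D_Y V X = 'D_Y' V X'.
Proof.
move=> e0 H.
have d Z z : is_derive (0 : R) 1 (fun t => V (Z + t *: z)) ('D_z V Z).
  have := @line_derive R _ V Z z 0; rewrite scale0r addr0; apply.
  exact/diff_derivable/(smooth_diff V_smooth).
have [_ <-] := d X Y; have [_ <-] := d X' Y'.
apply: near_eq_derive; near=> t; apply: H.
by near: t; apply: (@nbhs0_le R R^o).
Unshelve. all: by end_near. Qed.

End Energy.

(** * Lattice sums *)

Section LatticeSum.
Variable R : realType.
Variable B : 'M[R]_2.
Hypothesis B_unit : B \in unitmx.
Notation Lam := (lattice B).
Implicit Types (F G phi : 'rV[R]_2 -> R) (x l k : 'rV[R]_2) (N : R).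

(** A sum with infinite support has the default value 0, hence the side conditions [bsupp] wherever
    sums are split. *)
Definition lsum G : R := \sum_(l \in Lam) G l.

Definition ball_sites N : seq 'rV[R]_2 :=
  finmap.enum_fset (fset_set [set x | Lam x /\ `|x| <= N]).

Lemma ball_sites_uniq N : uniq (ball_sites N).
Proof. exact: finmap.fset_uniq. Qed.

Lemma mem_ball_sites N x : x \in ball_sites N -> Lam x /\ `|x| <= N.
Proof.
have fin := growth_finite N (lattice_growth B_unit).
by rewrite /ball_sites (in_fset_set fin) inE.
Qed.

Lemma in_ball_sites N x : Lam x -> `|x| <= N -> x \in ball_sites N.
Proof.
move=> Lx xN; have fin := growth_finite N (lattice_growth B_unit).
by rewrite /ball_sites (in_fset_set fin) inE.
Qed.

Definition bounded_by N G := forall l, Lam l -> N < `|l| -> G l = 0.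

Lemma lsum_seq G (s : seq 'rV[R]_2) : uniq s -> (forall x, x \in s -> Lam x) ->
  (forall x, Lam x -> G x != 0 -> x \in s) -> lsum G = \sum_(l <- s) G l.
Proof.
move=> us sL sG; rewrite /lsum (@fsbigE _ _ _ _ _ s _ us); first last.
- by move=> x Lx xs; apply/eqP; apply: contraNT xs; exact: sG.
- by move=> x; exact: sL.
rewrite big_seq_cond [RHS]big_seq; apply: eq_bigl => x.
by apply/andb_idr => xs; rewrite inE; exact: sL.
Qed.

Lemma lsum_ball N G : bounded_by N G -> lsum G = \sum_(l <- ball_sites N) G l.
Proof.
move=> GN; apply: lsum_seq; [exact: ball_sites_uniq|by move=> x /mem_ball_sites[]|].
move=> x Lx Gx; apply: in_ball_sites => //; rewrite leNgt; apply: contra Gx => h.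
by rewrite GN.
Qed.

Definition bsupp G := exists N, bounded_by N G.

Lemma bounded_byW N N' G : N <= N' -> bounded_by N G -> bounded_by N' G.
Proof. by move=> NN H l Ll Nl; apply: H => //; exact: le_lt_trans Nl. Qed.

Lemma bsuppD F G : bsupp F -> bsupp G -> bsupp (fun l => F l + G l).
Proof.
move=> [N HF] [N' HG]; exists (Num.max N N') => l Ll; rewrite gt_max => /andP[h h'].
by rewrite HF // HG // addr0.
Qed.

Lemma bsuppMr F G : bsupp G -> bsupp (fun l => F l * G l).
Proof. by move=> [N HG]; exists N => l Ll h; rewrite HG // mulr0. Qed.

Lemma bsuppMl F G : bsupp F -> bsupp (fun l => F l * G l).
Proof. by move=> [N HG]; exists N => l Ll h; rewrite HG // mul0r. Qed.

Lemma bsupp_shift k G : Lam k -> bsupp G -> bsupp (fun l => G (l + k)).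
Proof.
move=> Lk [N HG]; exists (N + `|k|) => l Ll h; apply: HG; first exact: latticeD.
by have := lerB_dist l (- k); rewrite opprK normrN; lra.
Qed.

Lemma bsuppN G : bsupp G -> bsupp (fun l => - G l).
Proof. by move=> [N HG]; exists N => l Ll h; rewrite HG // oppr0. Qed.

Lemma bsupp_diff k G : Lam k -> bsupp G -> bsupp (fun l => G (l + k) - G l).
Proof. by move=> Lk bG; apply/bsuppD/bsuppN => //; exact: bsupp_shift. Qed.

Lemma bsupp_sum (I : Type) (s : seq I) (G : I -> 'rV[R]_2 -> R) :
  (forall i, bsupp (G i)) -> bsupp (fun l => \sum_(i <- s) G i l).
Proof.
move=> H; elim: s => [|i s IH]; first by exists 0 => l _ _; rewrite big_nil.
have [N HN] := bsuppD (H i) IH; exists N => l Ll Nl.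
by rewrite big_cons; exact: HN.
Qed.

Lemma lsumD F G : bsupp F -> bsupp G -> lsum (fun l => F l + G l) = lsum F + lsum G.
Proof.
move=> [N HF] [N' HG]; have [N1 N2] : N <= Num.max N N' /\ N' <= Num.max N N'.
  by rewrite !le_max !lexx orbT.
rewrite (lsum_ball (bounded_byW N1 HF)) (lsum_ball (bounded_byW N2 HG)) -big_split /=.
apply: lsum_ball => l Ll h; rewrite (bounded_byW N1 HF) // (bounded_byW N2 HG) // addr0 //.
Qed.

Lemma lsumZ a F : lsum (fun l => a * F l) = a * lsum F.
Proof. by rewrite /lsum mulr_fsumr. Qed.

Lemma lsumN F : lsum (fun l => - F l) = - lsum F.
Proof.
rewrite -mulN1r -lsumZ; apply: eq_fsbigr => x _ /=; by rewrite mulN1r.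
Qed.

Lemma lsumB F G : bsupp F -> bsupp G -> lsum (fun l => F l - G l) = lsum F - lsum G.
Proof. by move=> bF bG; rewrite lsumD ?lsumN //; exact: bsuppN. Qed.

Lemma eq_lsum F G : (forall l, Lam l -> F l = G l) -> lsum F = lsum G.
Proof. by move=> H; apply: eq_fsbigr => x; rewrite inE; exact: H. Qed.

Lemma lsum_sum (I : Type) (s : seq I) (G : I -> 'rV[R]_2 -> R) :
  (forall i, bsupp (G i)) ->
  lsum (fun l => \sum_(i <- s) G i l) = \sum_(i <- s) lsum (G i).
Proof.
move=> H; elim: s => [|i s IH].
  by rewrite big_nil /lsum fsbig1 // => x _; rewrite big_nil.
rewrite big_cons -IH -lsumD //; last exact: bsupp_sum.
by apply: eq_lsum => l _; rewrite big_cons.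
Qed.

Lemma lsum_reindex (h : 'rV[R]_2 -> 'rV[R]_2) G : set_bij Lam Lam h ->
  lsum (G \o h) = lsum G.
Proof. by move=> hb; rewrite /lsum (@reindex_fsbig _ _ _ _ _ h _ _ G hb). Qed.

Lemma lsum_shift k G : Lam k -> lsum (fun l => G (l + k)) = lsum G.
Proof.
move=> Lk; apply: (@lsum_reindex (fun l => l + k)); split.
- by move=> l Ll; exact: latticeD.
- by move=> l l' _ _ /addIr.
- by move=> l Ll; exists (l - k); [exact: latticeB|rewrite subrK].
Qed.

Lemma lsum_diff0 k G : Lam k -> bsupp G -> lsum (fun l => G (l + k) - G l) = 0.
Proof. by move=> Lk bG; rewrite lsumB ?lsum_shift ?subrr //; exact: bsupp_shift. Qed.

Lemma lsum_by_parts (n : nat) (rho : 'I_n -> 'rV[R]_2) (q : 'I_n -> 'rV[R]_2 -> R) phi :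
  (forall a : 'I_n, Lam (rho a)) -> bsupp phi ->
  lsum (fun l => \sum_(a < n) q a l * (phi (l + rho a) - phi l)) =
  lsum (fun l => phi l * \sum_(a < n) (q a (l - rho a) - q a l)).
Proof.
move=> Lr bp; have bd a := bsupp_diff (Lr a) bp.
rewrite lsum_sum; last by move=> a; exact: bsuppMr.
under [RHS]eq_lsum => l _ do rewrite mulr_sumr.
rewrite lsum_sum; last by move=> a; exact: bsuppMl.
apply: eq_bigr => a _.
transitivity (lsum (fun l => q a l * phi (l + rho a)) - lsum (fun l => q a l * phi l)).
  rewrite -lsumB; [by apply: eq_lsum => l _; rewrite mulrBr| |exact: bsuppMr].
  exact/bsuppMr/bsupp_shift.
transitivity (lsum (fun l => phi l * q a (l - rho a)) - lsum (fun l => phi l * q a l)).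
  congr (_ - _); last by apply: eq_lsum => l _; rewrite mulrC.
  rewrite -[RHS](lsum_shift _ (Lr a)); apply: eq_lsum => l _; by rewrite addrK mulrC.
rewrite -lsumB; [by apply: eq_lsum => l _; rewrite mulrBr|exact: bsuppMl|exact: bsuppMl].
Qed.

Definition ind l0 x : R := (x == l0)%:R.

Lemma bsupp_ind l0 : bsupp (ind l0).
Proof. by exists `|l0| => l Ll; rewrite /ind; case: eqP => [->|//]; rewrite ltxx. Qed.

Lemma lsum_ind l0 (g : 'rV[R]_2 -> R) : Lam l0 -> lsum (fun l => g l * ind l0 l) = g l0.
Proof.
move=> Ll0; rewrite (@lsum_seq _ [:: l0]) //.
- by rewrite big_seq1 /ind eqxx mulr1.
- by move=> x; rewrite inE => /eqP ->.
- move=> x _; rewrite inE /ind; case: (x == l0) => //; by rewrite mulr0 eqxx.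
Qed.

End LatticeSum.

(** * Quantities that vanish as the cutoff radius grows *)

Section Vanishing.
Variable R : realType.

Definition vanishes (s : R -> R) := forall e : R, 0 < e ->
  exists N0 : R, forall N : R, N0 <= N -> `|s N| <= e.

Lemma vanishesD s t : vanishes s -> vanishes t -> vanishes (fun N => s N + t N).
Proof.
move=> hs ht e e0; have e20 : 0 < e / 2 by rewrite divr_gt0.
have [N1 H1] := hs _ e20; have [N2 H2] := ht _ e20.
exists (Num.max N1 N2) => N; rewrite ge_max => /andP[h1 h2].
rewrite (le_trans (ler_normD _ _)) //; have := H1 N h1; have := H2 N h2; lra.
Qed.

Lemma vanishesZ (a : R) s : vanishes s -> vanishes (fun N => a * s N).
Proof.
move=> hs e e0; have a1 : 0 < 1 + `|a| by rewrite ltr_pwDl.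
have [N0 H] := hs _ (divr_gt0 e0 a1); exists N0 => N /H.
rewrite ler_pdivlMr // normrM => h; apply: le_trans h; rewrite mulrC ler_wpM2l //; lra.
Qed.

Lemma vanishesB s t : vanishes s -> vanishes t -> vanishes (fun N => s N - t N).
Proof.
move=> hs ht; have := vanishesD hs (vanishesZ (-1) ht).
by under eq_fun do rewrite mulN1r.
Qed.

Lemma vanishes_sum (I : Type) (r : seq I) (s : I -> R -> R) :
  (forall i, vanishes (s i)) -> vanishes (fun N => \sum_(i <- r) s i N).
Proof.
move=> h; elim: r => [|i r IH].
  by move=> e e0; exists 0 => N _; rewrite big_nil normr0 ltW.
under eq_fun do rewrite big_cons; exact: vanishesD.
Qed.

Lemma eq_vanishes (N0 : R) s t : (forall N, N0 <= N -> s N = t N) ->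
  vanishes s -> vanishes t.
Proof.
move=> h hs e e0; have [N1 H] := hs e e0; exists (Num.max N0 N1) => N.
by rewrite ge_max => /andP[h1 h2]; rewrite -h //; exact: H.
Qed.

End Vanishing.

(** * Negligible errors, and sums over bonds crossing the cut *)

Section Negligible.
Variable R : realType.
Variables (B : 'M[R]_2) (b1 : R).
Hypotheses (B_unit : B \in unitmx) (b1_neq0 : b1 != 0) (b_lat : lattice B (pt b1 0)).
Notation Lam := (lattice B).
Implicit Types (x l k : 'rV[R]_2) (N : R).

Definition negligible (E : R -> 'rV[R]_2 -> R) := exists K C N0 : R,
  [/\ 0 <= K, 0 <= C & forall N, N0 <= N -> 1 <= N -> bounded_by B (3 * N) (E N) /\
    forall l, Lam l -> `|E N l| <= C / N ^+ 2 * (1 + `|l|)^-1 \/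
       (`|l 0 1| <= K /\ `|E N l| <= C / N ^+ 2)].

Lemma negligible_vanishes E : negligible E -> vanishes (fun N => lsum B (E N)).
Proof.
move=> [K [C [N0 [K0 C0 H]]]] e e0.
have [Cs Cs0 HCs] := strip_growth B_unit b1_neq0 K0 b_lat.
(* Summation over the ball of radius [3 N] multiplies [d] by [9 * C]; the added 1 keeps the divisor
   positive. *)
pose d := e / (2 * (9 * C + 1)).
have d0 : 0 < d by rewrite divr_gt0 // mulr_gt0 //; lra.
have [N1 N11 HN1] := growth_average (isT : (0 < 2)%N) (lattice_growth B_unit) d0.
exists (Num.max (Num.max N0 N1) (6 * C * Cs / e + 1)) => N.
rewrite !ge_max => /andP[/andP[N0N N1N] NC].
have N1' : 1 <= N by exact: le_trans N1N.
have Np : 0 < N by lra.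
have Cn : 0 <= C / N ^+ 2 by rewrite divr_ge0 // sqr_ge0.
have [bE HE] := H N N0N N1'.
rewrite (lsum_ball B_unit bE).
set s := ball_sites B (3 * N).
have us : uniq s := ball_sites_uniq _ _.
have ms x : x \in s -> Lam x /\ `|x| <= 3 * N := @mem_ball_sites _ _ B_unit _ _.
have S1 : \sum_(l <- s) (1 + `|l|)^-1 <= d * (3 * N) ^+ 2 by apply: HN1 => //; lra.
have S2 : (size [seq l <- s | `|(l : 'rV[R]_2) 0 1| <= K])%:R <= Cs * (3 * N).
  rewrite -[3 * N]expr1; apply: HCs; rewrite ?expr1; [lra|exact: filter_uniq|].
  by move=> x; rewrite mem_filter => /andP[xK /ms[Lx xN]].
apply: (le_trans (ler_norm_sum _ _ _)).
apply: (@le_trans _ _ (\sum_(l <- s) (C / N ^+ 2 * (1 + `|l|)^-1 +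
    (if `|l 0 1| <= K then C / N ^+ 2 else 0)))).
  rewrite big_seq [leRHS]big_seq; apply: ler_sum => l /ms[Ll _].
  have p0 : 0 <= C / N ^+ 2 * (1 + `|l|)^-1 by rewrite mulr_ge0 // invr_ge0 addr_ge0.
  case: (HE l Ll) => [h|[-> h]]; last by rewrite (le_trans h) // lerDr.
  by rewrite (le_trans h) // lerDl; case: ifP.
rewrite big_split /= -mulr_sumr -big_mkcond -big_filter big_const_seq count_predT iter_addr addr0 -mulr_natr.
move: (_%:R) S2 => z S2; move: (\sum_(l <- s) _) S1 => y S1.
have h1 : C / N ^+ 2 * y <= e / 2.
  apply: (@le_trans _ _ (C / N ^+ 2 * (d * (3 * N) ^+ 2))); first exact: ler_wpM2l.
  have -> : C / N ^+ 2 * (d * (3 * N) ^+ 2) = (9 * C) * d by field; lra.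
  rewrite /d mulrA ler_pdivrMr; first by lra.
  by rewrite mulr_gt0 //; lra.
have h2 : C / N ^+ 2 * z <= e / 2.
  apply: (@le_trans _ _ (C / N ^+ 2 * (Cs * (3 * N)))); first exact: ler_wpM2l.
  have -> : C / N ^+ 2 * (Cs * (3 * N)) = 3 * C * Cs / N by field; lra.
  rewrite ler_pdivrMr //.
  have : 6 * C * Cs / e <= N by lra.
  by rewrite ler_pdivrMr //; nra.
by lra.
Qed.

Variable c : 'rV[R]_2.
Let b := pt b1 0.

Definition upper x : R := (c 0 1 < x 0 1)%R%:R.

(** The change of the cutoff under the translation by [b], on the side of the core where the cut
    runs: the discrepancy that slip invariance creates in the increment along a bond crossing the
    cut. *)
Definition slip_bump N x : R := (c 0 0 < x 0 0)%R%:R * (bump N x - bump N (x - b)).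

Lemma bump_bsupp N : 0 < N -> bsupp B (bump N).
Proof. by move=> N0; exists N => l _ /ltW; exact: bump_eq0. Qed.

Lemma slip_bump_bsupp N : 0 < N -> bsupp B (slip_bump N).
Proof.
move=> N0; apply: bsuppMr; have bb := bump_bsupp N0.
by apply/bsuppD => //; apply/bsuppN/(bsupp_shift (latticeN b_lat)).
Qed.

(** Signed sum over the translates of the bond [s] that cross the line of the cut. It does not tend
    to 0 when [s] is not horizontal, because each row telescopes to values of the cutoff near the
    core; so additivity in [s] is used, and not smallness. *)
Definition jump_sum (N : R) (s : 'rV[R]_2) : R :=
  lsum B (fun l => (upper (l + s) - upper l) * slip_bump N l).

Lemma upper_bound x y : `|upper x - upper y| <= 1.
Proof. by rewrite /upper; do 2!case: (_ < _); rewrite ?subrr ?subr0 ?sub0r ?normrN ?normr0 ?normr1. Qed.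

Lemma upper_near x s : upper (x + s) != upper x -> `|x 0 1 - c 0 1| <= `|s|.
Proof.
have := coord_le s 0 1; rewrite /upper [(x + s) 0 1]mxE ler_norml => /andP[h1 h2].
rewrite ler_norml; case: ltrP => u1; case: ltrP => u2; rewrite ?eqxx // => _; lra.
Qed.

Lemma slip_bump_bound : exists2 C : R, 0 <= C & forall N x, `|b| + 1 <= N ->
  `|slip_bump N x| <= C * (1 + `|x|) / N ^+ 2.
Proof.
have [C C0 HC] := bump_diff (normr_ge0 b); exists C => // N x Nb.
rewrite /slip_bump normrM distrC.
have h : `|bump N (x + - b) - bump N x| <= C * (1 + `|x|) / N ^+ 2.
  by apply: HC => //; rewrite normrN.
apply: le_trans h; case: (_ < _); rewrite ?normr1 ?normr0 ?mul1r ?mul0r //.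
Qed.

(** The linear parts of three expansions at the same point [x] cancel and leave three remainders. *)
Lemma bump_second K : 0 <= K -> exists2 C : R, 0 <= C & forall N x h k, 2 * K + 1 <= N ->
  `|h| <= K -> `|k| <= K ->
  `|bump N (x + h + k) - bump N (x + h) - (bump N (x + k) - bump N x)| <= C / N ^+ 2.
Proof.
move=> K0; have K20 : 0 <= 2 * K by lra.
have [C C0 HC] := bump_taylor K20; exists (3 * C); first by rewrite mulr_ge0.
move=> N x h k KN hK kK.
have hk : `|h + k| <= 2 * K by rewrite (le_trans (ler_normD _ _)) //; lra.
have T1 := HC N x (h + k) KN hk.
have T2 : `|bump N (x + h) - bump N x - dotp (gbump N x) h| <= C / N ^+ 2 by apply: HC => //; lra.
have T3 : `|bump N (x + k) - bump N x - dotp (gbump N x) k| <= C / N ^+ 2 by apply: HC => //; lra.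
have E : dotp (gbump N x) (h + k) = dotp (gbump N x) h + dotp (gbump N x) k.
  by rewrite !dotp2 !mxE; ring.
move: T1; rewrite E -[_ + h + k]addrA.
rewrite -(mulrA 3).
move: (_ / _) T2 T3 => P; move: (dotp _ _) (dotp _ _) => d1 d2.
move: (bump _ _) (bump _ _) (bump _ _) (bump _ _) => p1 p2 p3 p4.
rewrite !ler_norml => /andP[? ?] /andP[? ?] /andP[? ?]; lra.
Qed.

(** Either the indicator agrees at both points, and a second increment of the cutoff remains, or the
    vertical line through the core separates them; then [x] stays within a fixed radius [M], where
    first increments are already [O(1/N^2)]. *)
Lemma slip_bump_lip s K : 0 <= K -> exists2 C : R, 0 <= C & forall N x,
  2 * (`|b| + `|s|) + 1 <= N -> `|x 0 1 - c 0 1| <= K ->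
  `|slip_bump N (x - s) - slip_bump N x| <= C / N ^+ 2.
Proof.
move=> K0; have bs0 : 0 <= `|b| + `|s| by rewrite addr_ge0.
have [C C0 HC] := bump_second bs0; have [C' C'0 HC'] := slip_bump_bound.
pose M := `|c| + `|s| + K.
have M0 : 0 <= M by rewrite !addr_ge0.
exists (C + C' * (2 + 2 * M + `|s|)).
  by rewrite addr_ge0 // mulr_ge0 // !addr_ge0 // mulr_ge0.
move=> N x NK xK; have nb := normr_ge0 b; have ns := normr_ge0 s.
have iN : 0 <= (N ^+ 2)^-1 by rewrite invr_ge0 sqr_ge0.
have [E|nE] := eqVneq (c 0 0 < (x - s) 0 0) (c 0 0 < x 0 0).
  apply: (@le_trans _ _ (C / N ^+ 2)); last first.
    rewrite ler_wpM2r // lerDl mulr_ge0 // !addr_ge0 // mulr_ge0 //.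
  rewrite /slip_bump E -mulrBr normrM.
  have h : `|bump N (x - s - b) - bump N (x - s) - (bump N (x - b) - bump N x)| <= C / N ^+ 2.
    by apply: HC => //; rewrite normrN; lra.
  have -> : bump N (x - s) - bump N (x - s - b) - (bump N x - bump N (x - b)) =
     - (bump N (x - s - b) - bump N (x - s) - (bump N (x - b) - bump N x)) by ring.
  rewrite normrN; apply: le_trans h.
  by case: (_ < _); rewrite ?normr1 ?normr0 ?mul1r ?mul0r.
have xc : `|x 0 0 - c 0 0| <= `|s|.
  have := coord_le s 0 0; rewrite ler_norml => /andP[h1 h2].
  move: nE; rewrite [(x - s) 0 0]mxE [(- s) 0 0]mxE ler_norml.
  case: ltrP => u1; case: ltrP => u2; rewrite ?eqxx // => _; lra.
have xM : `|x| <= M.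
  apply: norm_le_coord => // i j; rewrite ord1 /M.
  have [cc0 cc1] := (coord_le c 0 0, coord_le c 0 1).
  have := ler_normD (x 0 j - c 0 j) (c 0 j); rewrite subrK.
  have [->|->] : j = 0 \/ j = 1 by case: j => -[|[|//]] p; [left|right]; exact/val_inj.
    by move: xc cc0; move: nb ns; lra.
  by move: xK cc1; move: nb ns; lra.
have xsM : `|x - s| <= M + `|s| by rewrite (le_trans (ler_normB _ _)) // lerD2r.
have NK' : `|b| + 1 <= N by lra.
have h1 := HC' N x NK'; have h2 := HC' N (x - s) NK'.
rewrite (le_trans (ler_normB _ _)) //.
apply: (@le_trans _ _ (C' * (2 + 2 * M + `|s|) / N ^+ 2)); last by rewrite ler_wpM2r // lerDr.
apply: (le_trans (lerD h2 h1)); rewrite -mulrDl ler_wpM2r // -mulrDr ler_wpM2l //.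
by move: xM xsM; move: (`|x - s|) (`|x|) => *; lra.
Qed.

(** The step of [upper] along [s + t] splits into those along [s] and along [t], one of them based
    at a shifted site. Shifting it back costs an increment of [slip_bump] at sites near the line,
    which is negligible. *)
Lemma jump_sum_add s t : Lam s -> Lam t ->
  vanishes (fun N => jump_sum N (s + t) - jump_sum N s - jump_sum N t).
Proof.
move=> Ls Lt.
apply: (@eq_vanishes _ 1 (fun N => lsum B (fun l =>
   (upper (l + t) - upper l) * (slip_bump N (l - s) - slip_bump N l)))).
  move=> N N1; have N0 : 0 < N by lra.
  have bs := slip_bump_bsupp N0; have bs' := bsupp_shift (latticeN Ls) bs.
  rewrite /jump_sum -(lsumB B_unit); try exact: bsuppMr.
  under [in RHS]eq_lsum => l _ do rewrite -mulrBl.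
  have -> : lsum B (fun l => (upper (l + (s + t)) - upper l - (upper (l + s) - upper l)) * slip_bump N l)
    = lsum B (fun l => (upper (l + t) - upper l) * slip_bump N (l - s)).
    rewrite -[RHS](lsum_shift _ Ls); apply: eq_lsum => l _.
    by rewrite addrK addrA; congr (_ * _); ring.
  rewrite -(lsumB B_unit); try exact: bsuppMr.
  by apply: eq_lsum => l _; rewrite mulrBr.
apply: (@negligible_vanishes (fun N l =>
   (upper (l + t) - upper l) * (slip_bump N (l - s) - slip_bump N l))).
pose K := `|c| + `|t|; have K0 : 0 <= K by rewrite addr_ge0.
have [C C0 HC] := slip_bump_lip s (normr_ge0 t).
have nb := normr_ge0 b; have ns := normr_ge0 s.
exists K, C, (2 * (`|b| + `|s|) + 1); split => // N NK N1; split.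
  have bK : 0 <= `|b| + `|s| by rewrite addr_ge0.
  have Z l k : 3 * N < `|l| -> `|k| <= `|b| + `|s| -> bump N (l + k) = 0.
    by move=> Nl kb; apply: (@bump_diff_eq0 _ (`|b| + `|s|)) => //; lra.
  move=> l _ Nl; have Z0 : bump N l = 0 by rewrite -[l]addr0 Z // normr0.
  have Z1 : bump N (l - s) = 0 by rewrite Z // normrN; lra.
  have Z2 : bump N (l - b) = 0 by rewrite Z // normrN; lra.
  have Z3 : bump N (l - s - b) = 0 by rewrite -addrA Z // -opprD normrN addrC ler_normD.
  by rewrite /slip_bump Z0 Z1 Z2 Z3 subrr !mulr0 subrr mulr0.
move=> l Ll; have [->|ne] := eqVneq (upper (l + t)) (upper l).
  left; rewrite subrr mul0r normr0 mulr_ge0 // ?invr_ge0 ?addr_ge0 //.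
  by rewrite divr_ge0 // sqr_ge0.
right.
have lt := upper_near ne; split.
  have := ler_normD (l 0 1 - c 0 1) (c 0 1); rewrite subrK.
  by have := coord_le c 0 1; rewrite /K; lra.
rewrite normrM; apply: le_trans (HC N l NK lt).
by rewrite ler_piMl // upper_bound.
Qed.

Lemma jump_sum0 N : jump_sum N 0 = 0.
Proof.
by rewrite /jump_sum /lsum fsbig1 // => l _; rewrite addr0 subrr mul0r.
Qed.

Lemma jump_sumN s : Lam s -> vanishes (fun N => jump_sum N (- s) + jump_sum N s).
Proof.
move=> Ls; have := vanishesZ (-1) (jump_sum_add Ls (latticeN Ls)).
by apply: (@eq_vanishes _ 1) => N _; rewrite subrr jump_sum0; ring.
Qed.

Lemma jump_sumMz s (z : int) : Lam s ->
  Lam (s *~ z) /\ vanishes (fun N => jump_sum N (s *~ z) - z%:~R * jump_sum N s).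
Proof.
move=> Ls; have P (k : nat) : Lam (s *+ k) /\ vanishes (fun N => jump_sum N (s *+ k) - k%:R * jump_sum N s).
  elim: k => [|k [IH1 IH2]].
    split; first exact: lattice0.
    move=> e e0; exists 0 => N _; by rewrite jump_sum0 mul0r subrr normr0 ltW.
  split; first by rewrite mulrS; exact: latticeD.
  have := vanishesD (jump_sum_add Ls IH1) IH2.
  apply: (@eq_vanishes _ 1) => N _; rewrite mulrS -natr1; ring.
case: z => k; first exact: P.
have [P1 P2] := P k.+1; rewrite NegzE mulrNz; split; first exact: latticeN.
have := vanishesB (jump_sumN P1) P2.
by apply: (@eq_vanishes _ 1) => N _; rewrite mulrNz -!pmulrn; ring.
Qed.

Lemma lattice_row i : Lam (row i B).
Proof.
exists (delta_mx 0 i); rewrite rowE; congr (_ *m _).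
by apply/matrixP => p q; rewrite !mxE; case: (_ && _).
Qed.

Lemma jump_sum_coord (z : 'rV[int]_2) : vanishes (fun N =>
  jump_sum N (map_mx intr z *m B) - \sum_i (z 0 i)%:~R * jump_sum N (row i B)).
Proof.
have [L0 V0] := jump_sumMz (z 0 0) (lattice_row 0).
have [L1 V1] := jump_sumMz (z 0 1) (lattice_row 1).
have -> : map_mx intr z *m B = row 0 B *~ z 0 0 + row 1 B *~ z 0 1.
  rewrite -[row 0 B *~ _]scaler_int -[row 1 B *~ _]scaler_int.
  by apply/rowP => j; rewrite !mxE sum2E !mxE.
have := vanishesD (jump_sum_add L0 L1) (vanishesD V0 V1).
by apply: (@eq_vanishes _ 1) => N _; rewrite sum2E; ring.
Qed.

(** By additivity [jump_sum] is, up to vanishing terms, linear in the integer coordinates of the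
    bond, and the balance of the vectors [a k * rho k] carries over to these coordinates because [B]
    is invertible. *)
Lemma weighted_jump_vanishes (n : nat) (rho : 'I_n -> 'rV[R]_2) (a : 'I_n -> R) :
  (forall i, Lam (rho i)) -> (forall j, \sum_k a k * rho k 0 j = 0) ->
  vanishes (fun N => lsum B (fun l =>
     \sum_k a k * ((upper (l + rho k) - upper l) * slip_bump N l))).
Proof.
move=> Lr a0; have [zc zcE] := lattice_coord B.
have az i : \sum_k a k * (zc (rho k) 0 i)%:~R = 0.
  have : (\sum_k a k *: map_mx intr (zc (rho k))) *m B = 0.
    rewrite mulmx_suml; apply/rowP => j; rewrite summxE [RHS]mxE -[RHS](a0 j).
    by apply: eq_bigr => k _; rewrite -scalemxAl -zcE // mxE.
  move=> /(congr1 (fun X => X *m invmx B)); rewrite mul0mx mulmxK // => /rowP/(_ i).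
  by rewrite summxE mxE => E; rewrite -[RHS]E; apply: eq_bigr => k _; rewrite !mxE.
have H : vanishes (fun N => \sum_k a k * (jump_sum N (rho k)
     - \sum_i (zc (rho k) 0 i)%:~R * jump_sum N (row i B))).
  apply: vanishes_sum => k; apply: vanishesZ.
  have := jump_sum_coord (zc (rho k)); by rewrite -zcE.
apply: eq_vanishes H => N; instantiate (1 := 1) => N1.
rewrite (lsum_sum B_unit); last first.
  move=> k; apply: bsuppMr; apply: bsuppMr; apply: slip_bump_bsupp; lra.
under eq_bigr do rewrite mulrBr.
under [RHS]eq_bigr do rewrite lsumZ.
rewrite sumrB [X in _ - X](_ : _ = 0) ?subr0 //.
under eq_bigr do rewrite mulr_sumr.
rewrite exchange_big big1 // => i _ /=.
under eq_bigr do rewrite mulrA.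
by rewrite -mulr_suml az mul0r.
Qed.

(** By the discrete product rule the summand is [D_s (psi D_t phi) - D_t (psi D_s phi)], the two
    terms [psi D_s D_t phi] cancelling. Taking the increments of [phi] at [l + s] and [l + t] makes
    this exact. *)
Lemma lsum_stream (psi phi : 'rV[R]_2 -> R) (s t : 'rV[R]_2) :
  Lam s -> Lam t -> bsupp B phi ->
  lsum B (fun l => (psi (l + s) - psi l) * (phi (l + s + t) - phi (l + s))
                 - (psi (l + t) - psi l) * (phi (l + t + s) - phi (l + t))) = 0.
Proof.
move=> Ls Lt bp.
pose F1 l := psi l * phi (l + t); pose F2 l := psi l * phi l; pose F3 l := psi l * phi (l + s).
have b1' : bsupp B F1 by apply/bsuppMr/bsupp_shift.
have b2' : bsupp B F2 by apply/bsuppMr.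
have b3' : bsupp B F3 by apply/bsuppMr/bsupp_shift.
transitivity (lsum B (fun l => (F1 (l + s) - F1 l) - (F2 (l + s) - F2 l) +
    ((F2 (l + t) - F2 l) - (F3 (l + t) - F3 l)))).
  by apply: eq_lsum => l _; rewrite /F1 /F2 /F3 [l + t + s]addrAC; ring.
have bd F k : Lam k -> bsupp B F -> bsupp B (fun l => F (l + k) - F l) := @bsupp_diff _ _ k F.
have d1 := bd _ _ Ls b1'; have d2 := bd _ _ Ls b2'.
have d2' := bd _ _ Lt b2'; have d3 := bd _ _ Lt b3'.
rewrite (lsumD B_unit (bsuppD d1 (bsuppN d2)) (bsuppD d2' (bsuppN d3))).
rewrite (lsumB B_unit d1 d2) (lsumB B_unit d2' d3).
rewrite (lsum_diff0 B_unit Ls b1') (lsum_diff0 B_unit Ls b2').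
by rewrite (lsum_diff0 B_unit Lt b2') (lsum_diff0 B_unit Lt b3') !subrr addr0.
Qed.

End Negligible.

(** * Forces and slip invariance *)

Lemma finite_bound (R : realType) (T : choiceType) (X : set T) (g : T -> R) :
  finite_set X -> (forall x, 0 <= g x) -> exists2 M : R, 0 < M & forall x, X x -> g x <= M.
Proof.
move=> fin g0; exists (1 + \sum_(x <- finmap.enum_fset (fset_set X)) g x).
  by rewrite ltr_pwDl // sumr_ge0.
move=> x Xx; rewrite (bigD1_seq x) /= ?finmap.fset_uniq //; last first.
  by rewrite (in_fset_set fin) inE.
by rewrite addrCA lerDl addr_ge0 ?sumr_ge0.
Qed.

Section Force.
Variable R : realType.
Variables (m n : nat) (B : 'M[R]_2) (rho : 'I_n -> 'rV[R]_2).
Variables (V : 'M[R]_(n, m) -> R) (Vl : 'rV[R]_2 -> 'M[R]_(n, m) -> R).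
Variables (c : 'rV[R]_2) (b1 eps : R) (bm : 'rV[R]_m) (u0 f : 'rV[R]_2 -> 'rV[R]_m).
Notation Lam := (lattice B).
Let b := pt b1 0.
Hypotheses (B_unit : B \in unitmx) (rho_lat : forall k, Lam (rho k)) (b_lat : Lam b).
Hypothesis off_line : forall l, Lam l -> l 0 1 != c 0 1.
Hypotheses (V_smooth : smooth_on setT V) (eps_gt0 : 0 < eps).
Hypothesis slip : slip_invariant Lam c b bm rho V u0 eps.
Hypothesis force : is_force Lam rho Vl u0 f.
Implicit Types (phi : 'rV[R]_2 -> R) (x l : 'rV[R]_2).
Variable i : 'I_m.

Definition site_stress k l : R := vgrad (Vl l) k i (Dstencil rho u0 l).
Definition bulk_stress k l : R := vgrad V k i (Dstencil rho u0 l).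
Definition slip_stress k l : R := vgrad V k i (Dstencil rho (slip0 c b bm u0) l).

Definition test_function phi := finite_set [set x | phi x != 0] /\ [set x | phi x != 0] `<=` Lam.

Lemma test_function_ind l0 : Lam l0 -> test_function (ind l0).
Proof.
move=> Ll0; have sub : [set x | ind l0 x != 0] `<=` [set l0].
  by move=> x /=; rewrite /ind; have [->//|_] := eqVneq x l0; rewrite eqxx.
split; first exact: sub_finite_set sub (finite_set1 _).
by move=> x /sub ->.
Qed.

Let vec phi x : 'rV[R]_m := phi x *: evec R i.

Let vec_supp phi : test_function phi -> finitely_supported Lam (vec phi).
Proof.
move=> [fin subL]; have sub : [set x | vec phi x != 0] `<=` [set x | phi x != 0].
  by move=> x /=; apply: contraNneq => h; rewrite /vec h scale0r.
by split; [exact: sub_finite_set sub fin|exact: subset_trans sub subL].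
Qed.

Let dotp_evec (w : 'rV[R]_m) (a : R) : dotp w (a *: evec R i) = w 0 i * a.
Proof.
rewrite /dotp (bigD1 i) //= big1 => [|j ji]; first by rewrite addr0 !mxE !eqxx mulr1.
by rewrite !mxE (negbTE ji) !mulr0.
Qed.

Lemma force_test phi : test_function phi ->
  lsum B (fun l => f l 0 i * phi l) =
  lsum B (fun l => \sum_k site_stress k l * (phi (l + rho k) - phi l)).
Proof.
move=> tp; have E := force (vec_supp tp).
transitivity (\sum_(l \in Lam) dotp (f l) (vec phi l)).
  by apply: eq_lsum => l _; rewrite dotp_evec.
rewrite E; apply: eq_lsum => l _; apply: eq_bigr => k _.
by rewrite /Drho /vec -scalerBl dotp_evec mxE.
Qed.

Lemma force_at l0 : Lam l0 ->
  f l0 0 i = \sum_k (site_stress k (l0 - rho k) - site_stress k l0).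
Proof.
move=> Ll0; have := force_test (test_function_ind Ll0).
rewrite (lsum_ind (fun l => f l 0 i)) // (lsum_by_parts B_unit) //; last exact: bsupp_ind.
by move=> ->; under eq_lsum => l _ do rewrite mulrC; rewrite lsum_ind.
Qed.

(* [S_0] acting on test functions and on sites: increments of [phi] at [l] correspond to
   increments of [slip_pull phi] at [slip_site l]. *)
Definition slip_pull phi x : R := if c 0 1 < x 0 1 then phi x else phi (x - b).
Definition slip_site l := if c 0 1 < l 0 1 then l else l + b.

Let b_height x : (x + b) 0 1 = x 0 1.
Proof. by rewrite mxE [b 0 1]mxE /= addr0. Qed.

Let b_heightN x : (x - b) 0 1 = x 0 1.
Proof. by rewrite mxE [(- b) 0 1]mxE [b 0 1]mxE /= subr0. Qed.

Let stencil_slip phi (t : R) x :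
  Dstencil rho (slip0 c b bm (fun y => u0 y + t *: vec phi y)) x =
  Dstencil rho (slip0 c b bm u0) x +
    t *: \matrix_(k, j) (((slip_pull phi (x + rho k) - slip_pull phi x) *: evec R i : 'rV[R]_m) 0 j).
Proof.
have E y j : slip0 c b bm (fun y => u0 y + t *: vec phi y) y 0 j =
    slip0 c b bm u0 y 0 j + t * (slip_pull phi y * evec R i 0 j).
  by rewrite /slip0 /slip_pull; case: ifP => _; rewrite !mxE //; ring.
by apply/matrixP => k j; rewrite !mxE !E /evec !mxE; ring.
Qed.

Let stencil_vec phi (t : R) x :
  Dstencil rho (fun y => u0 y + t *: vec phi y) x =
  Dstencil rho u0 x +
    t *: \matrix_(k, j) (((phi (x + rho k) - phi x) *: evec R i : 'rV[R]_m) 0 j).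
Proof. by apply/matrixP => k j; rewrite !mxE /evec; ring. Qed.

Let derive_vec G (q : 'I_n -> R) :
  'D_(\matrix_(k, j) ((q k *: evec R i : 'rV[R]_m) 0 j)) V G = \sum_k vgrad V k i G * q k.
Proof.
rewrite -(partial_grad_derive V_smooth); apply: eq_bigr => k _.
have -> : row k (\matrix_(k, j) ((q k *: evec R i : 'rV[R]_m) 0 j)) = q k *: evec R i.
  by apply/rowP => j; rewrite !mxE.
by rewrite dotp_evec mxE.
Qed.

(** Slip invariance is differentiated along [u0] plus small multiples of the test function, which
    stay below [eps]; on perturbations the shift [S_0] acts as [slip_pull], the constant [bm]
    dropping out. *)
Lemma stress_slip phi l : test_function phi -> Lam l ->
  \sum_k bulk_stress k l * (phi (l + rho k) - phi l) =
  \sum_k slip_stress k (slip_site l) *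
    (slip_pull phi (slip_site l + rho k) - slip_pull phi (slip_site l)).
Proof.
move=> tp Ll; rewrite -!derive_vec.
have [M M0 HM] : exists2 M : R, 0 < M & forall x, enorm (vec phi x) <= M.
  have [fin _] := vec_supp tp.
  have [M M0 HM] := finite_bound fin (fun x => sqrtr_ge0 (dotp (vec phi x) (vec phi x))).
  exists M => // x; have [->|h] := eqVneq (vec phi x) 0; last exact: HM.
  by rewrite /enorm /dotp big1 ?sqrtr0 ?ltW // => j _; rewrite mxE mul0r.
have e0 : 0 < eps / M by rewrite divr_gt0.
apply: (derive_eq_along V_smooth e0) => t te.
rewrite -stencil_vec -stencil_slip.
have fs : finitely_supported Lam (fun x => t *: vec phi x).
  have [fin subL] := vec_supp tp.
  have sub : [set x | t *: vec phi x != 0] `<=` [set x | vec phi x != 0].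
    by move=> x /=; apply: contraNneq => ->; rewrite scaler0.
  by split; [exact: sub_finite_set sub fin|exact: subset_trans sub subL].
have ws l' : Lam l' -> enorm (t *: vec phi l') <= eps.
  move=> _; have -> : enorm (t *: vec phi l') = `|t| * enorm (vec phi l').
    rewrite -[`|t|]sqrtr_sqr /enorm -sqrtrM ?sqr_ge0 //; congr Num.sqrt.
    by rewrite /dotp mulr_sumr; apply: eq_bigr => j _; rewrite !mxE; ring.
  apply: (@le_trans _ _ (eps / M * M)); last by rewrite divfK // gt_eqF.
  by apply: ler_pM => //; exact: sqrtr_ge0.
have [H1 H2] := slip fs ws Ll.
rewrite /slip_site; case: ltrP => h; first by rewrite H1.
by rewrite H2 // lt_neqAle h off_line.
Qed.

Lemma slip_site_bij : set_bij Lam Lam slip_site.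
Proof.
split.
- by move=> l Ll; rewrite /slip_site; case: ifP => _ //; exact: latticeD.
- move=> x y _ _; rewrite /slip_site; case: ifP => hx; case: ifP => hy // E.
  + by rewrite E b_height hy in hx.
  + by rewrite -E b_height hx in hy.
  + exact: addIr E.
- move=> l Ll; rewrite /slip_site; have [h|h] := ltP (c 0 1) (l 0 1).
    by exists l => //; rewrite h.
  exists (l - b); first exact: latticeB.
  by rewrite b_heightN ltNge h subrK.
Qed.

Lemma slip_pull_ind l0 : slip_pull (ind l0) =1 ind (slip_site l0).
Proof.
move=> x; rewrite /slip_pull /slip_site /ind; case: ifP => hx; case: ifP => h0 //.
- have [E|_] := eqVneq x l0; first by rewrite E h0 in hx.
  by have [E|_] := eqVneq x (l0 + b); first by rewrite E b_height h0 in hx.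
- have [E|_] := eqVneq (x - b) l0; first by rewrite -E b_heightN hx in h0.
  by have [E|_] := eqVneq x l0; first by rewrite E h0 in hx.
- by rewrite subr_eq.
Qed.

(** Testing with an indicator, passing to the slipped stencil and reindexing the sites by
    [slip_site] expresses the force near the cut as a discrete divergence of the stress of
    [S_0 u_0], which has no jump there. The conditions on [Vl] cover the sites where the indicator
    has a nonzero increment. *)
Lemma force_slip_at l0 : Lam l0 -> Vl l0 = V -> (forall k, Vl (l0 - rho k) = V) ->
  f l0 0 i = \sum_k (slip_stress k (slip_site l0 - rho k) - slip_stress k (slip_site l0)).
Proof.
move=> Ll0 V0 Vk; have := force_test (test_function_ind Ll0).
rewrite (lsum_ind (fun l => f l 0 i)) // => ->.
have Ls : Lam (slip_site l0) by have [h _ _] := slip_site_bij; exact: h.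
transitivity (lsum B (fun l => \sum_k slip_stress k l *
    (ind (slip_site l0) (l + rho k) - ind (slip_site l0) l))); last first.
  rewrite (lsum_by_parts B_unit) //; last exact: bsupp_ind.
  by under eq_lsum => l _ do rewrite mulrC; rewrite lsum_ind.
rewrite -[RHS](lsum_reindex _ slip_site_bij); apply: eq_lsum => l Ll /=.
transitivity (\sum_k bulk_stress k l * (ind l0 (l + rho k) - ind l0 l)).
  apply: eq_bigr => k _; rewrite /site_stress /bulk_stress /ind.
  have [E|_] := eqVneq l l0; first by rewrite E V0.
  have [E|_] := eqVneq (l + rho k) l0; last by rewrite subrr !mulr0.
  have -> : l = l0 - rho k by rewrite -E addrK.
  by rewrite Vk.
rewrite (stress_slip (test_function_ind Ll0) Ll).
by apply: eq_bigr => k _; rewrite !slip_pull_ind.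
Qed.

End Force.

(** * Comparison with lattice sums that vanish *)

Section Algebra.
Variable R : realType.
Implicit Types (n : nat) (a b : R).

Lemma norm_sum_le n (F : 'I_n -> R) (M : R) : (forall k, `|F k| <= M) ->
  `|\sum_k F k| <= n%:R * M.
Proof.
move=> H; apply: (le_trans (ler_norm_sum _ _ _)).
apply: (le_trans (ler_sum _ (fun k _ => H k))).
by rewrite sumr_const card_ord -[leLHS]mulr_natl.
Qed.

Lemma norm_mul_le a b (x y : R) : `|a| <= x -> `|b| <= y -> `|a * b| <= x * y.
Proof. by move=> ha hb; rewrite normrM ler_pM. Qed.

Lemma swirl_bound a b x y (M D : R) : `|a| <= M -> `|b| <= M -> `|x| <= D -> `|y| <= D ->
  `|a * y - b * x| <= 2 * (M * D).
Proof.
move=> ha hb hx hy; apply: (le_trans (ler_normB _ _)).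
have := norm_mul_le ha hy; have := norm_mul_le hb hx; lra.
Qed.

Lemma core_defect n (p a D H : 'I_n -> R) (th psi0 psi1 f0 f1 c1 Mp Ma Ms d : R) :
  (forall k, `|p k| <= Mp) -> (forall k, `|a k| <= Ma) -> (forall k, `|D k| <= d) ->
  (forall k, `|H k| <= 1) -> `|th| <= d -> `|psi0| <= Ms -> `|psi1| <= Ms ->
  `|f0| <= d -> `|f1| <= d ->
  `|\sum_k p k * D k - \sum_k a k * D k - \sum_k a k * (H k * th)
     - c1 * (psi0 * f1 - psi1 * f0)| <= (n%:R * (Mp + 2 * Ma) + 2 * `|c1| * Ms) * d.
Proof.
move=> hp ha hD hH ht h0 h1 hf0 hf1.
have e1 : `|\sum_k p k * D k| <= n%:R * (Mp * d).
  by apply: norm_sum_le => k; exact: norm_mul_le.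
have e2 : `|\sum_k a k * D k| <= n%:R * (Ma * d).
  by apply: norm_sum_le => k; exact: norm_mul_le.
have e3 : `|\sum_k a k * (H k * th)| <= n%:R * (Ma * (1 * d)).
  by apply: norm_sum_le => k; do 2!apply: norm_mul_le => //.
have e4 : `|c1 * (psi0 * f1 - psi1 * f0)| <= `|c1| * (2 * (Ms * d)).
  by apply: norm_mul_le => //; exact: swirl_bound.
have T (x y z w : R) : `|x - y - z - w| <= `|x| + `|y| + `|z| + `|w|.
  have := ler_normB (x - y - z) w; have := ler_normB (x - y) z; have := ler_normB x y; lra.
apply: (le_trans (T _ _ _ _)); lra.
Qed.

(** No cancellation between stress and stream function is used: both deviate by [h], the cutoff
    increments are [d], and the product [h * d] is affordable on a strip. [ep] is the second-order
    error of the pulled-back cutoff. *)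
Lemma strip_defect n (P a D H ep : 'I_n -> R) (th psi0 psi1 f0 f1 c1 h Ma d w : R) :
  (forall k, `|P k - a k| <= h) -> (forall k, `|a k| <= Ma) -> (forall k, `|D k| <= d) ->
  (forall k, `|H k| <= 1) -> (forall k, `|ep k| <= w) ->
  `|th| <= d -> `|psi0| <= h -> `|psi1| <= h -> `|f0| <= d -> `|f1| <= d ->
  `|\sum_k P k * (D k + H k * th + ep k) - \sum_k a k * D k - \sum_k a k * (H k * th)
     - c1 * (psi0 * f1 - psi1 * f0)|
   <= n%:R * (h * (2 * d) + (Ma + h) * w) + 2 * `|c1| * (h * d).
Proof.
move=> hP ha hD hH he ht h0 h1 hf0 hf1.
have -> : \sum_k P k * (D k + H k * th + ep k) - \sum_k a k * D k - \sum_k a k * (H k * th)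
   = \sum_k ((P k - a k) * (D k + H k * th) + P k * ep k).
  by rewrite -!sumrB; apply: eq_bigr => k _; ring.
have e1 : `|\sum_k ((P k - a k) * (D k + H k * th) + P k * ep k)| <=
    n%:R * (h * (2 * d) + (Ma + h) * w).
  apply: norm_sum_le => k; apply: (le_trans (ler_normD _ _)); apply: lerD.
    apply: norm_mul_le => //; apply: (le_trans (ler_normD _ _)).
    have := norm_mul_le (hH k) ht; have := hD k; lra.
  apply: norm_mul_le => //; have := ler_normD (P k - a k) (a k); rewrite subrK.
  by have := hP k; have := ha k; lra.
have e4 : `|c1 * (psi0 * f1 - psi1 * f0)| <= `|c1| * (2 * (h * d)).
  by apply: norm_mul_le => //; exact: swirl_bound.
apply: (le_trans (ler_normB _ _)); lra.
Qed.

(** [q] and [g] are the linear parts of the increments of the stream function and of the cutoff. The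
    last hypothesis cancels the leading terms exactly, and every remaining product has one
    second-order factor. *)
Lemma bulk_defect n (p a s D g : 'I_n -> R) (psi0 psi1 q0 q1 f0 f1 g0 g1 c1 C h d w : R) :
  0 <= C -> 0 <= h ->
  (forall k, `|p k - a k - s k| <= C * h ^+ 2) -> (forall k, `|s k| <= C * h) ->
  (forall k, `|D k| <= d) -> (forall k, `|D k - g k| <= w) ->
  `|psi0 - q0| <= C * h ^+ 2 -> `|psi1 - q1| <= C * h ^+ 2 ->
  `|q0| <= C * h -> `|q1| <= C * h -> `|f0| <= d -> `|f1| <= d ->
  `|f0 - g0| <= w -> `|f1 - g1| <= w ->
  \sum_k s k * g k = c1 * (q0 * g1 - q1 * g0) ->
  `|\sum_k p k * D k - \sum_k a k * D k - c1 * (psi0 * f1 - psi1 * f0)|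
   <= (n%:R + 2 * `|c1|) * (C * h ^+ 2 * d + C * h * w).
Proof.
move=> C0 h0 hp hs hD hDg hp0 hp1 hq0 hq1 hf0 hf1 hg0 hg1 E.
have -> : \sum_k p k * D k - \sum_k a k * D k - c1 * (psi0 * f1 - psi1 * f0) =
  \sum_k ((p k - a k - s k) * D k + s k * (D k - g k)) -
  c1 * (((psi0 - q0) * f1 - (psi1 - q1) * f0) + (q0 * (f1 - g1) - q1 * (f0 - g0))).
  have -> : \sum_k ((p k - a k - s k) * D k + s k * (D k - g k)) =
    \sum_k p k * D k - \sum_k a k * D k - \sum_k s k * g k.
    by rewrite -!sumrB; apply: eq_bigr => k _; ring.
  by rewrite E; ring.
have e1 : `|\sum_k ((p k - a k - s k) * D k + s k * (D k - g k))| <=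
   n%:R * (C * h ^+ 2 * d + C * h * w).
  apply: norm_sum_le => k; apply: (le_trans (ler_normD _ _)); apply: lerD; exact: norm_mul_le.
have e2 : `|((psi0 - q0) * f1 - (psi1 - q1) * f0) + (q0 * (f1 - g1) - q1 * (f0 - g0))| <=
   2 * (C * h ^+ 2 * d + C * h * w).
  apply: (le_trans (ler_normD _ _)); rewrite [leRHS]mulrDr; apply: lerD; exact: swirl_bound.
have e3 := norm_mul_le (lexx `|c1|) e2.
apply: (le_trans (ler_normB _ _)); lra.
Qed.

End Algebra.

Section BumpFacts.
Variable R : realType.
Implicit Types (x h k : 'rV[R]_2) (N : R).

Lemma bump_facts (b1 K : R) (c : 'rV[R]_2) : 0 <= K -> exists C N0 : R, [/\ 0 <= C, 1 <= N0 &
  forall N, N0 <= N -> forall x h k, `|h| <= K -> `|k| <= K ->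
  [/\ `|bump N (x + h) - bump N x| <= C * (1 + `|x|) / N ^+ 2,
      `|slip_bump b1 c N x| <= C * (1 + `|x|) / N ^+ 2,
      `|bump N (x + h + k) - bump N (x + h) - (bump N (x + k) - bump N x)| <= C / N ^+ 2 &
      `|bump N (x + h) - bump N x - dotp (gbump N x) h| <= C / N ^+ 2]].
Proof.
move=> K0; have [C1 C10 H1] := bump_diff K0; have [C2 C20 H2] := slip_bump_bound b1 c.
have [C3 C30 H3] := bump_second K0; have [C4 C40 H4] := bump_taylor K0.
have nb := normr_ge0 (pt b1 0).
exists (C1 + C2 + C3 + C4), (2 * K + `|pt b1 0| + 1); split; [lra|lra|].
move=> N NN x h k hK kK.
have x0 : 0 <= (1 + `|x|) / N ^+ 2 by rewrite divr_ge0 ?sqr_ge0 // addr_ge0.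
have i0 : 0 <= (N ^+ 2)^-1 by rewrite invr_ge0 sqr_ge0.
have g1 : `|bump N (x + h) - bump N x| <= C1 * (1 + `|x|) / N ^+ 2 by apply: H1 => //; lra.
have g2 : `|slip_bump b1 c N x| <= C2 * (1 + `|x|) / N ^+ 2 by apply: H2 => //; lra.
have g3 := H3 N x h k ltac:(lra) hK kK.
have g4 := H4 N x h ltac:(lra) hK.
rewrite -!mulrA in g1 g2 *.
by split; [apply: (le_trans g1)|apply: (le_trans g2)|apply: (le_trans g3)|apply: (le_trans g4)];
   apply: ler_wpM2r => //; lra.
Qed.

End BumpFacts.

Section Comparison.
Variable R : realType.
Variables (n : nat) (B : 'M[R]_2) (rho : 'I_n -> 'rV[R]_2) (c : 'rV[R]_2) (b1 dens K Kc : R).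
Variables (p P s : 'I_n -> 'rV[R]_2 -> R) (a : 'I_n -> R) (psi : 'rV[R]_2 -> R).
Notation Lam := (lattice B).
Let b := pt b1 0.
Hypotheses (B_unit : B \in unitmx) (b1_neq0 : b1 != 0) (dens_neq0 : dens != 0).
Hypotheses (rho_lat : forall k, Lam (rho k)) (b_lat : Lam b).
Hypotheses (K_ge0 : 0 <= K) (rho_le : forall k, `|rho k| <= K) (b_le : `|b| <= K).
Hypotheses (row_le : forall j, `|row j B| <= K) (K_le : K <= Kc).
Hypothesis off_line : forall l, Lam l -> l 0 1 != c 0 1.
Implicit Types (l x : 'rV[R]_2) (N : R) (phi : 'rV[R]_2 -> R).

Definition strip l := `|l 0 1 - c 0 1| <= Kc /\ c 0 0 < l 0 0.

Variables (C D : R).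
Hypotheses (C_ge0 : 0 <= C) (D_ge1 : 1 <= D).
Hypothesis exchange : forall l phi, Lam l -> D <= `|l - c| -> test_function B phi ->
  \sum_k p k l * (phi (l + rho k) - phi l) =
  \sum_k P k (slip_site c b1 l) *
    (slip_pull c b1 phi (slip_site c b1 l + rho k) - slip_pull c b1 phi (slip_site c b1 l)).
Hypothesis stress_strip : forall l k, Lam l -> D <= `|l - c| -> strip l ->
  `|P k (slip_site c b1 l) - a k| <= C / `|l - c|.
Hypothesis psi_strip : forall l j, Lam l -> D <= `|l - c| -> strip l ->
  `|psi (l + row j B) - psi l| <= C / `|l - c|.
Hypothesis stress_bulk : forall l k, Lam l -> D <= `|l - c| -> ~ strip l ->
  `|p k l - a k - s k l| <= C / `|l - c| ^+ 2 /\ `|s k l| <= C / `|l - c|.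
(** The linear part of the increment of [psi] along [row j B]: the linear stress paired with that
    lattice vector turned by a right angle. *)
Let flux l j := dens * \sum_k s k l * (B j 1 * rho k 0 0 - B j 0 * rho k 0 1).
Hypothesis psi_bulk : forall l j, Lam l -> D <= `|l - c| -> ~ strip l ->
  `|psi (l + row j B) - psi l - flux l j| <= C / `|l - c| ^+ 2.
Hypothesis force_line : forall j, \sum_k a k * rho k 0 j = 0.

(** Undoes two factors, the area [det B] of the lattice basis and the density [dens]; the sign
    reflects the sense in which the stress is rotated. *)
Let c1 := - (dens * \det B)^-1.

(* A discrete Jacobian of the stream function and the cutoff: its lattice sum vanishes exactly. *)
Definition swirl N l := (psi (l + row 0 B) - psi l) *
    (bump N (l + row 0 B + row 1 B) - bump N (l + row 0 B)) -
  (psi (l + row 1 B) - psi l) * (bump N (l + row 1 B + row 0 B) - bump N (l + row 1 B)).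

(** The subtracted terms have vanishing lattice sums, the first and the last exactly and the middle
    one in the limit, so the stress sum vanishes as soon as this remainder is negligible. *)
Definition defect N l := \sum_k p k l * (bump N (l + rho k) - bump N l) -
   \sum_k a k * (bump N (l + rho k) - bump N l) -
   \sum_k a k * ((upper c (l + rho k) - upper c l) * slip_bump b1 c N l) - c1 * swirl N l.

(** Test functions have to vanish off the lattice, whereas [bump] lives on the plane. *)
Definition bump_test N x : R := if `[< Lam x >] then bump N x else 0.

Lemma bump_test_test N : 0 < N -> test_function B (bump_test N).
Proof.
move=> N0; have sub : [set x | bump_test N x != 0] `<=` [set x | Lam x /\ `|x| <= N].
  move=> x /=; rewrite /bump_test; case: asboolP => [Lx|_]; last by rewrite eqxx.
  move=> h; split => //; rewrite leNgt; apply: contra h => /ltW h.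
  by rewrite bump_eq0.
split; first exact: sub_finite_set sub (growth_finite N (lattice_growth B_unit)).
by move=> x /sub[].
Qed.

Lemma bump_testE N x : Lam x -> bump_test N x = bump N x.
Proof. by move=> Lx; rewrite /bump_test; case: asboolP. Qed.

(** Rotating one factor turns a scalar product into a determinant, and the determinant of the
    pairings with the lattice basis is [det B] times that of the vectors. *)
Lemma swirl_balance (G : 'rV[R]_2) l :
  \sum_k s k l * dotp G (rho k) =
  c1 * (flux l 0 * dotp G (row 1 B) - flux l 1 * dotp G (row 0 B)).
Proof.
have dB : \det B != 0 by rewrite -unitfE -unitmxE.
have h : flux l 0 * dotp G (row 1 B) - flux l 1 * dotp G (row 0 B) =
   - (dens * \det B) * \sum_k s k l * dotp G (rho k).
  rewrite /flux !dotp2 !mxE det_mx22 -!mulrA !mulr_suml -mulrBr -sumrB mulNr -mulrA -mulrN.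
  congr (_ * _); rewrite mulr_sumr -sumrN; apply: eq_bigr => k _; rewrite dotp2; ring.
rewrite h /c1 mulrA mulrNN mulVf ?mul1r // mulf_neq0 //.
Qed.

Lemma swirl_bsupp N : 0 < N -> bsupp B (swirl N).
Proof.
move=> N0; have bb := bump_bsupp B N0; have L := lattice_row B.
by apply: bsuppD; [|apply: bsuppN]; apply: bsuppMr;
   [have := bsupp_shift (L 0) (bsupp_diff (L 1) bb)|have := bsupp_shift (L 1) (bsupp_diff (L 0) bb)].
Qed.

Let zero_case N K' l : 0 <= K' -> 0 < N -> K' + 1 <= N -> 3 * N < `|l| ->
  forall h, `|h| <= K' -> bump N (l + h) = 0.
Proof. by move=> K0 N0 KN lN h hK; apply: (@bump_diff_eq0 _ K') => //; lra. Qed.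

Lemma defect_bounded_by N : 2 * K + 1 <= N -> bounded_by B (3 * N) (defect N).
Proof.
move=> KN l _ lN; have kge := K_ge0; have N0 : 0 < N by lra.
have K20 : 0 <= 2 * K by lra.
have Z := zero_case K20 N0 KN lN.
have ZK h : `|h| <= K -> bump N (l + h) = 0 by move=> hK; apply: Z; lra.
have Z0 : bump N l = 0 by rewrite -[l]addr0 Z // normr0; lra.
have ZZ i j : bump N (l + row i B + row j B) = 0.
  rewrite -addrA Z // (le_trans (ler_normD _ _)) //.
  by have := row_le i; have := row_le j; lra.
rewrite /defect /swirl /slip_bump !ZZ !(ZK (row _ _)) // Z0 (ZK (- pt b1 0)) ?normrN //.
rewrite !subrr !mulr0 subrr mulr0 subr0 !big1 ?subrr // => k _.
- by rewrite !mulr0.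
- by rewrite ZK // subrr mulr0.
- by rewrite ZK // subrr mulr0.
Qed.

Let cc := 2 + `|c|.

Let near_far l : 1 <= `|l - c| ->
  [/\ 0 < `|l - c|, 1 + `|l| <= cc * `|l - c| & `|l - c|^-1 <= cc * (1 + `|l|)^-1].
Proof.
move=> d1; have d0 : 0 < `|l - c| by lra.
have nc := normr_ge0 c; have nl := normr_ge0 l.
have h : 1 + `|l| <= cc * `|l - c|.
  have := ler_normD (l - c) c; rewrite subrK => h.
  have : `|c| <= `|c| * `|l - c| by rewrite ler_peMr.
  rewrite /cc; lra.
split => //; rewrite -[_ * _^-1]/(_ / _) ler_pdivlMr; last by lra.
by rewrite mulrC ler_pdivrMr.
Qed.

(** Along a bond that stays on one side the two increments agree exactly; along a bond that crosses
    the line they differ by a mixed second increment of the cutoff. *)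
Lemma pull_increment N l k (C1 : R) : Lam l -> c 0 0 < l 0 0 -> 0 <= C1 ->
  (forall x h h', `|h| <= 2 * K -> `|h'| <= 2 * K ->
    `|bump N (x + h + h') - bump N (x + h) - (bump N (x + h') - bump N x)| <= C1) ->
  `|slip_pull c b1 (bump_test N) (slip_site c b1 l + rho k)
    - slip_pull c b1 (bump_test N) (slip_site c b1 l)
    - (bump N (l + rho k) - bump N l + (upper c (l + rho k) - upper c l) * slip_bump b1 c N l)|
  <= C1.
Proof.
move=> Ll l0 C10 H; have kge := K_ge0; have ble := b_le; have Lr := rho_lat k; have rk := rho_le k.
have bh x : (x + b) 0 1 = x 0 1 by rewrite mxE [b 0 1]mxE /= addr0.
rewrite /slip_bump l0 mul1r /slip_pull /slip_site /upper.
have [up|low] := ltP (c 0 1) (l 0 1); have [up'|low'] := ltP (c 0 1) ((l + rho k) 0 1).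
- rewrite /= ?up ?up' /= !bump_testE //; last exact: latticeD.
  by rewrite !subrr mul0r addr0 subrr normr0.
- rewrite /= ?up ?[_ < (l + rho k) 0 1]ltNge ?low' /= !bump_testE //; last by apply/latticeB => //; exact: latticeD.
  have := H l (rho k) (- b); rewrite normrN => T.
  by apply: le_trans (T _ _); [rewrite -/b le_eqVlt; apply/orP; left; apply/eqP; congr (`|_|); ring|lra|lra].
- rewrite /= ![l + b + rho k]addrAC !bh ?up' /= ?[_ < l 0 1]ltNge ?low /= ?addrK !bump_testE //; last first.
    by apply/latticeD => //; exact: latticeD.
  (* The base point [l - b] and the step [rho k + b] bring the four values into the form of a second
     increment; this is why steps up to [2 * K] are allowed. *)
  have := H (l - b) (rho k + b) b; rewrite !addrA.
  rewrite [l - b + rho k]addrAC !subrK => T.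
  apply: le_trans (T _ _); [|by rewrite (le_trans (ler_normD _ _)) //; lra|lra].
  by rewrite -/b le_eqVlt; apply/orP; left; apply/eqP; congr (`|_|); ring.
- rewrite /= ![l + b + rho k]addrAC !bh ?[_ < l 0 1]ltNge ?[_ < (l + rho k) 0 1]ltNge ?low ?low' /= ?addrK ?addrK !bump_testE //; last exact: latticeD.
  by rewrite !subrr mul0r addr0 subrr normr0.
Qed.

Let omega_le (w t q M : R) : 0 <= w -> 0 <= q -> 1 <= t -> t <= M -> q * (t * w) <= q * M ^+ 2 * w * t^-1.
Proof.
move=> w0 q0 t1 tM; rewrite ler_pdivlMr; last by lra.
have h : t * t <= M ^+ 2 by rewrite expr2; apply: ler_pM => //; lra.
have -> : q * (t * w) * t = (q * w) * (t * t) by ring.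
have -> : q * M ^+ 2 * w = (q * w) * M ^+ 2 by ring.
by apply: ler_wpM2l => //; exact: mulr_ge0.
Qed.

Let slip_bump_far N l k : ~ strip l -> (upper c (l + rho k) - upper c l) * slip_bump b1 c N l = 0.
Proof.
move=> ns; have [->|/upper_near h] := eqVneq (upper c (l + rho k)) (upper c l).
  by rewrite subrr mul0r.
rewrite /slip_bump; case: ltP => l0; last by rewrite mul0r mulr0.
case: ns; split => //; apply: le_trans K_le; exact: le_trans (rho_le k).
Qed.

Local Ltac slim := clear - B_unit b1_neq0 dens_neq0 rho_lat b_lat K_ge0 rho_le b_le row_le K_le
  off_line C_ge0 D_ge1 exchange stress_strip psi_strip stress_bulk psi_bulk force_line c1
  zero_case near_far omega_le slip_bump_far.

(** Three zones: finitely many sites around the core, where bounds suffice; the strip, where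
    [exchange] replaces the stress by the slip stress; and the bulk, where [swirl_balance] cancels
    the linear parts. *)
Lemma defect_negligible : negligible B defect.
Proof.
have kge := K_ge0; have Kge2 : 0 <= 2 * K by lra.
have cge := C_ge0; have dge := D_ge1; have nc := normr_ge0 c.
have [C1 [N1 [C10 N11 HB]]] := bump_facts b1 c Kge2.
have [M M0 HM] := finite_bound (g := fun l => \sum_k `|p k l| + \sum_j `|psi (l + row j B) - psi l|)
  (growth_finite (D + `|c|) (lattice_growth B_unit))
  (fun l => addr_ge0 (sumr_ge0 _ (fun k _ => normr_ge0 _)) (sumr_ge0 _ (fun k _ => normr_ge0 _))).
pose Ma := \sum_k `|a k|.
have Ma0 : 0 <= Ma by apply: sumr_ge0.
have aM k : `|a k| <= Ma by rewrite /Ma (bigD1 k) //= lerDl sumr_ge0.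
pose C2 := C1 * (1 + K); have C20 : 0 <= C2 by rewrite mulr_ge0 // addr_ge0.
pose nn : R := n%:R; have nn0 : 0 <= nn by exact: ler0n.
have cc0 : 0 <= `|c1| by [].
have ccp : 0 <= cc by rewrite addr_ge0.
(* [A1], [A2] and [A3] are the constants of the core, the strip and the bulk. *)
pose A1 := (nn * (M + 2 * Ma) + 2 * `|c1| * M) * C2.
pose A2 := nn * (2 * (C * C2 * cc) + (Ma + C) * C1) + 2 * `|c1| * (C * C2 * cc).
pose C' := C * (1 + `|dens| * nn * (2 * (K * K))).
pose A3 := (nn + 2 * `|c1|) * (C' * (C2 * cc + 2 * C1)) * cc.
have C'0 : 0 <= C' by rewrite mulr_ge0 // addr_ge0 // !mulr_ge0.
have A10 : 0 <= A1 * (1 + D + `|c|) ^+ 2.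
  by apply: mulr_ge0; rewrite ?sqr_ge0 //; do ?[apply: mulr_ge0|apply: addr_ge0] => //; exact: ltW.
have A20 : 0 <= A2 by do ?[apply: mulr_ge0|apply: addr_ge0].
have A30 : 0 <= A3 by do ?[apply: mulr_ge0|apply: addr_ge0].
exists (Kc + `|c|), (A1 * (1 + D + `|c|) ^+ 2 + A2 + A3), (N1 + 2 * K + 1); split.
- by rewrite addr_ge0 // (le_trans kge).
- by apply: addr_ge0 => //; apply: addr_ge0.
move=> N NN N1'; have N0 : 0 < N by exact: lt_le_trans N1'.
have [NN1 NK] : N1 <= N /\ 2 * K + 1 <= N by move: NN Kge2 N11; slim; split; lra.
have {}HB := HB N NN1.
split; first exact: defect_bounded_by.
move=> l Ll; set w := (N ^+ 2)^-1; have w0 : 0 <= w by rewrite invr_ge0 sqr_ge0.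
set t := 1 + `|l|; have t1 : 1 <= t by rewrite /t lerDl.
have h0 : `|0 : 'rV[R]_2| <= 2 * K by rewrite normr0.
have t0 : 0 <= t := le_trans ler01 t1.
have C12 : C1 <= C2 by rewrite /C2 ler_peMr // lerDl.
have rho2 k : `|rho k| <= 2 * K by have := rho_le k; slim; move: K_ge0; lra.
have Dk k : `|bump N (l + rho k) - bump N l| <= C2 * (t * w).
  have [h _ _ _] := HB l (rho k) 0 (rho2 k) h0.
  by apply: (le_trans h); rewrite -/w -/t -mulrA ler_wpM2r // mulr_ge0.
have th : `|slip_bump b1 c N l| <= C2 * (t * w).
  have [_ h _ _] := HB l 0 0 h0 h0.
  by apply: (le_trans h); rewrite -/w -/t -mulrA ler_wpM2r // mulr_ge0.
have row2 j : `|row j B| <= 2 * K by have := row_le j; slim; move: K_ge0; lra.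
have fj j j' : `|bump N (l + row j B + row j' B) - bump N (l + row j B)| <= C2 * (t * w).
  have [h _ _ _] := HB (l + row j B) (row j' B) 0 (row2 _) h0.
  apply: (le_trans h); rewrite -/w -mulrA /C2 -mulrA ler_wpM2l // mulrA ler_wpM2r //.
  have := ler_normD l (row j B); have := row_le j; have : K <= K * t by rewrite ler_peMr.
  by rewrite /t; slim; lra.
have [dD|dD] := leP D `|l - c|; last first.
  have lD : `|l| <= D + `|c| by have := ler_normD (l - c) c; rewrite subrK; move: dD; slim; lra.
  have HMl : \sum_k `|p k l| + \sum_j `|psi (l + row j B) - psi l| <= M by exact: HM.
  have sp : 0 <= \sum_k `|p k l| by exact: sumr_ge0.
  have ss : 0 <= \sum_j `|psi (l + row j B) - psi l| by exact: sumr_ge0.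
  have pM k : `|p k l| <= M.
    have : `|p k l| <= \sum_k `|p k l| by rewrite (bigD1 k) //= lerDl sumr_ge0.
    by move: HMl ss; slim; lra.
  have sM j : `|psi (l + row j B) - psi l| <= M.
    have : `|psi (l + row j B) - psi l| <= \sum_j `|psi (l + row j B) - psi l|.
      by rewrite (bigD1 j) //= lerDl sumr_ge0.
    by move: HMl sp; slim; lra.
  left; apply: (le_trans (core_defect c1 pM aM Dk (fun k => upper_bound c _ _) th
    (sM 0) (sM 1) (fj 1 0) (fj 0 1))).
  (* Near the core [t] is at most [1 + D + |c|]; the square of this constant pays for the factors
     [t] and [t^-1]. *)
  rewrite -/nn mulrA -/A1; apply: (@le_trans _ _ (A1 * (1 + D + `|c|) ^+ 2 * w * t^-1)).
    apply: omega_le => //; last by rewrite /t -addrA lerD2l.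
    by do ?[apply: mulr_ge0|apply: addr_ge0]; rewrite // ltW.
  have it : 0 <= t^-1 by rewrite invr_ge0.
  by rewrite ler_wpM2r // ler_wpM2r // -[leRHS]addrA lerDl addr_ge0.
have [d0 tl it] := near_far (le_trans dge dD); rewrite -/t in tl it.
set d := `|l - c| in dD d0 tl it *.
have id0 : 0 <= d^-1 by rewrite invr_ge0 ltW.
have tw : C2 * (t * w) <= C2 * (cc * d * w) by rewrite ler_wpM2l // ler_wpM2r.
have [sl|nsl] := pselect (strip l).
  right; split.
    have := ler_normD (l 0 1 - c 0 1) (c 0 1); rewrite subrK.
    by have := coord_le c 0 1; have [] := sl; slim; lra.
  have PS k := stress_strip k Ll dD sl.
  have ps j := psi_strip j Ll dD sl.
  pose ep k := slip_pull c b1 (bump_test N) (slip_site c b1 l + rho k)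
    - slip_pull c b1 (bump_test N) (slip_site c b1 l)
    - (bump N (l + rho k) - bump N l + (upper c (l + rho k) - upper c l) * slip_bump b1 c N l).
  have epw k : `|ep k| <= C1 * w.
    apply: pull_increment => //; first by have [] := sl.
      exact: mulr_ge0.
    by move=> x h h' hh hh'; have [_ _ T _] := HB x h h' hh hh'.
  have -> : defect N l =
    \sum_k P k (slip_site c b1 l) * (bump N (l + rho k) - bump N l +
       (upper c (l + rho k) - upper c l) * slip_bump b1 c N l + ep k) -
     \sum_k a k * (bump N (l + rho k) - bump N l) -
     \sum_k a k * ((upper c (l + rho k) - upper c l) * slip_bump b1 c N l) - c1 * swirl N l.
    rewrite /defect; congr (_ - _ - _ - _).
    transitivity (\sum_k p k l * (bump_test N (l + rho k) - bump_test N l)).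
      by apply: eq_bigr => k _; rewrite !bump_testE //; exact: latticeD.
    rewrite (exchange Ll dD (bump_test_test N0)); apply: eq_bigr => k _.
    by congr (_ * _); rewrite /ep; ring.
  apply: (le_trans (strip_defect c1 PS aM Dk (fun k => upper_bound c _ _) epw th
    (ps 0) (ps 1) (fj 1 0) (fj 0 1))).
  have hd : C / d * (C2 * (t * w)) <= C * C2 * cc * w.
    have -> : C * C2 * cc * w = C / d * (C2 * (cc * d * w)) by field; rewrite gt_eqF.
    by rewrite ler_wpM2l // mulr_ge0.
  have hC : C / d <= C by rewrite ler_pdivrMr // ler_peMr // (le_trans dge).
  apply: (@le_trans _ _ (A2 * w)); last by rewrite ler_wpM2r // addrAC lerDr addr_ge0.
  have -> : A2 * w = nn * (2 * (C * C2 * cc * w) + (Ma + C) * (C1 * w)) + 2 * `|c1| * (C * C2 * cc * w).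
    by rewrite /A2; ring.
  apply: lerD; last by rewrite ler_wpM2l // mulr_ge0.
  rewrite ler_wpM2l // mulrCA; apply: lerD; first by rewrite ler_wpM2l.
  by rewrite ler_wpM2r ?mulr_ge0 // lerD2l.
left.
have nu : defect N l = \sum_k p k l * (bump N (l + rho k) - bump N l) -
   \sum_k a k * (bump N (l + rho k) - bump N l) - c1 * swirl N l.
  by rewrite /defect [X in _ - X - _]big1 ?subr0 // => k _; rewrite slip_bump_far ?mulr0.
rewrite nu.
have CC' : C <= C' by rewrite /C' ler_peMr // lerDl !mulr_ge0.
have hp k : `|p k l - a k - s k l| <= C' * d^-1 ^+ 2.
  have [h _] := stress_bulk k Ll dD nsl; rewrite exprVn; apply: (le_trans h).
  by rewrite ler_wpM2r // invr_ge0 sqr_ge0.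
have hs k : `|s k l| <= C / d by have [_ h] := stress_bulk k Ll dD nsl.
have hs' k : `|s k l| <= C' * d^-1 by apply: (le_trans (hs k)); rewrite ler_wpM2r.
have hq j : `|psi (l + row j B) - psi l - flux l j| <= C' * d^-1 ^+ 2.
  have h := psi_bulk j Ll dD nsl; rewrite exprVn; apply: (le_trans h).
  by rewrite ler_wpM2r // invr_ge0 sqr_ge0.
have hf j : `|flux l j| <= C' * d^-1.
  have e : `|flux l j| <= `|dens| * (nn * (C / d * (2 * (K * K)))).
    apply: norm_mul_le => //; apply: norm_sum_le => k; apply: norm_mul_le => //.
    have e0 q : `|rho k 0 q| <= K := le_trans (coord_le _ _ _) (rho_le k).
    have e1 q : `|B j q| <= K.
      by have := le_trans (coord_le (row j B) 0 q) (row_le j); rewrite mxE.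
    exact: swirl_bound.
  apply: (le_trans e); rewrite /C'.
  have -> : `|dens| * (nn * (C / d * (2 * (K * K)))) = C * (`|dens| * nn * (2 * (K * K))) * d^-1 by ring.
  by rewrite ler_wpM2r // ler_wpM2l // lerDr.
have g1 k : `|bump N (l + rho k) - bump N l - dotp (gbump N l) (rho k)| <= 2 * C1 * w.
  have [_ _ _ h] := HB l (rho k) 0 (rho2 k) h0.
  by apply: (le_trans h); rewrite ler_wpM2r // ler_peMl // ler1n.
have g2 j j' : `|bump N (l + row j B + row j' B) - bump N (l + row j B) - dotp (gbump N l) (row j' B)|
    <= 2 * C1 * w.
  have [_ _ e1 _] := HB l (row j B) (row j' B) (row2 _) (row2 _).
  have [_ _ _ e2] := HB l (row j' B) 0 (row2 _) h0.
  rewrite -/w in e1 e2.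
  have := ler_normD (bump N (l + row j B + row j' B) - bump N (l + row j B) -
    (bump N (l + row j' B) - bump N l)) (bump N (l + row j' B) - bump N l - dotp (gbump N l) (row j' B)).
  by rewrite addrA subrK; move: e1 e2; slim; lra.
apply: (le_trans (bulk_defect C'0 id0 hp hs' Dk g1 (hq 0) (hq 1) (hf 0) (hf 1) (fj 1 0) (fj 0 1)
  (g2 1 0) (g2 0 1) (swirl_balance _ _))).
have e : C' * d^-1 ^+ 2 * (C2 * (t * w)) + C' * d^-1 * (2 * C1 * w) <=
    C' * (C2 * cc + 2 * C1) * w * d^-1.
  have -> : C' * (C2 * cc + 2 * C1) * w * d^-1 =
    C' * d^-1 ^+ 2 * (C2 * (cc * d * w)) + C' * d^-1 * (2 * C1 * w) by field; rewrite gt_eqF.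
  by rewrite lerD2r ler_wpM2l // mulr_ge0 // sqr_ge0.
have nc0 : 0 <= nn + 2 * `|c1| by rewrite addr_ge0 // mulr_ge0.
apply: (@le_trans _ _ (A3 * w * t^-1)).
  have -> : A3 * w * t^-1 = (nn + 2 * `|c1|) * (C' * (C2 * cc + 2 * C1) * w * (cc * t^-1)).
    by rewrite /A3; ring.
  rewrite -/nn ler_wpM2l //; apply: (le_trans e); rewrite ler_wpM2l //.
  by do ?[apply: mulr_ge0|apply: addr_ge0].
have it0 : 0 <= t^-1 by rewrite invr_ge0.
by rewrite ler_wpM2r // ler_wpM2r // lerDr addr_ge0.
Qed.

Lemma stress_sum_vanishes :
  vanishes (fun N => lsum B (fun l => \sum_k p k l * (bump N (l + rho k) - bump N l))).
Proof.
have V1 := negligible_vanishes B_unit b1_neq0 b_lat defect_negligible.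
have V2 := weighted_jump_vanishes B_unit b1_neq0 b_lat c rho_lat force_line.
apply: eq_vanishes (vanishesD V1 V2) => N; instantiate (1 := 1) => N1.
have N0 : 0 < N by lra.
have bb := bump_bsupp B N0; have L := lattice_row B.
have bd k := bsupp_diff (rho_lat k) bb.
have b1' : bsupp B (fun l => \sum_k p k l * (bump N (l + rho k) - bump N l)).
  by apply: bsupp_sum => k; exact: bsuppMr.
have b2' : bsupp B (fun l => \sum_k a k * (bump N (l + rho k) - bump N l)).
  by apply: bsupp_sum => k; exact: bsuppMr.
have b3' : bsupp B (fun l => \sum_k a k * ((upper c (l + rho k) - upper c l) * slip_bump b1 c N l)).
  by apply: bsupp_sum => k; do 2!apply: bsuppMr; exact: slip_bump_bsupp.
have b4' : bsupp B (fun l => c1 * swirl N l) by apply: bsuppMr; exact: swirl_bsupp.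
have b12 := bsuppD b1' (bsuppN b2'); have b123 := bsuppD b12 (bsuppN b3').
rewrite /defect (lsumB B_unit b123 b4') (lsumB B_unit b12 b3') (lsumB B_unit b1' b2').
rewrite lsumZ (_ : lsum B (swirl N) = 0); last exact: lsum_stream.
have -> : lsum B (fun l => \sum_k a k * (bump N (l + rho k) - bump N l)) = 0.
  rewrite (lsum_sum B_unit); last by move=> k; exact: bsuppMr.
  by rewrite big1 // => k _; rewrite lsumZ (lsum_diff0 B_unit) ?mulr0.
by rewrite mulr0 !subr0 subrK.
Qed.

End Comparison.

(** * The linear elastic stress *)

Lemma term_le_sum2 (R : realType) (I J : finType) (G : I -> J -> R) i j :
  (forall i j, 0 <= G i j) -> G i j <= \sum_i \sum_j G i j.
Proof.
move=> G0; apply: (@le_trans _ _ (\sum_j G i j)).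
  by rewrite (bigD1 j) //= lerDl sumr_ge0.
by rewrite [leRHS](bigD1 i) //= lerDl sumr_ge0 // => k _; rewrite sumr_ge0.
Qed.

Section FluxField.
Variable R : realType.
Variables (m : nat) (W : 'M[R]_(m, 2) -> R) (c : 'rV[R]_2) (bm : 'rV[R]_m).
Variable u : 'rV[R]_2 -> 'rV[R]_m.
Local Notation A := (~` branch_cut c).
Implicit Types (x y h : 'rV[R]_2) (s : seq 'I_2).
Hypothesis elastic : linear_elastic_field W c bm u.

Lemma off_cut_dist x : A x -> 0 < `|x - c|.
Proof.
move=> Ax; rewrite normr_gt0 subr_eq0; apply/eqP => E; apply: Ax; rewrite E; split => //.
Qed.

Lemma pd_uniform : exists2 CC : R, 0 <= CC & forall s i x, (0 < size s <= 3)%N -> A x ->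
  `|pd u s i x| <= CC / `|x - c| ^+ size s.
Proof.
have [_ _ _ _ H] := elastic.
have [C1 H1] := H 1%N isT; have [C2 H2] := H 2%N isT; have [C3 H3] := H 3%N isT.
exists (`|C1| + `|C2| + `|C3|); first by rewrite !addr_ge0.
have K (j : nat) (Cj : R) : (0 < j)%N ->
    (forall x, ~ branch_cut c x -> nabla_norm j u x <= Cj * enorm (x - c) ^- j) ->
    `|Cj| <= `|C1| + `|C2| + `|C3| ->
    forall s i x, size s = j -> A x -> `|pd u s i x| <= (`|C1| + `|C2| + `|C3|) / `|x - c| ^+ j.
  move=> j0 Hj Cle s i x sj Ax.
  have d0 := off_cut_dist Ax; have de := norm_le_enorm (x - c).
  have -> : s = Tuple (introT eqP sj) by [].
  apply: (le_trans (nabla_norm_coord u x i (Tuple (introT eqP sj)))).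
  apply: (le_trans (Hj x Ax)); apply: (@le_trans _ _ (`|Cj| * enorm (x - c) ^- j)).
    rewrite ler_wpM2r ?ler_norm // invr_ge0 exprn_ge0 //; exact: enorm_ge0.
  apply: ler_pM => //; first by rewrite invr_ge0 exprn_ge0 //; exact: enorm_ge0.
  rewrite lef_pV2 ?posrE ?exprn_gt0 //; last exact: lt_le_trans de.
  by rewrite lerXn2r ?nnegrE // ltW // (lt_le_trans d0).
have n1 := normr_ge0 C1; have n2 := normr_ge0 C2; have n3 := normr_ge0 C3.
move=> s i x; case E : (size s) => [|[|[|[|//]]]] //= _ Ax.
- by apply: (K _ _ _ H1) => //; lra.
- by apply: (K _ _ _ H2) => //; lra.
- by apply: (K _ _ _ H3) => //; lra.
Qed.

Let ec i j k l : R := 'D_(delta_mx i j) (fun X => 'D_(delta_mx k l) W X) 0.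

(** The derivative along [s] of the entry [(i, j)] of the linear stress. [rcons s l] places the
    gradient direction innermost, so further derivatives are added at the head of [s]. *)
Definition flux_field i j s x : R :=
  elast W (\matrix_(k, l) pd u (rcons s l) k x) i j.

Let flux_fieldE i j s x : flux_field i j s x = \sum_k \sum_l ec i j k l * pd u (rcons s l) k x.
Proof. by rewrite /flux_field mxE; do 2!(apply: eq_bigr => ? _); rewrite mxE. Qed.

Lemma elast_grad i j x : elast W (grad u x) i j = flux_field i j [::] x.
Proof. by rewrite /flux_field; congr (elast W _ i j); apply/matrixP => k l; rewrite !mxE. Qed.

Lemma flux_field_derive i j s j' x : A x ->
  differentiable (flux_field i j s) x /\
  'D_(evec R j') (flux_field i j s) x = flux_field i j (j' :: s) x.
Proof.
move=> Ax; have [su _ _ _ _] := elastic.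
have -> : flux_field i j s = \sum_k \sum_l (ec i j k l *: pd u (rcons s l) k).
  by apply/funext => y; rewrite flux_fieldE fct_sumE; apply: eq_bigr => k _; rewrite fct_sumE.
have dk k l : differentiable (ec i j k l *: pd u (rcons s l) k) x.
  exact/differentiableZ/(pd_differentiable _ _ su).
have dk' k : differentiable (\sum_l (ec i j k l *: pd u (rcons s l) k)) x.
  exact: differentiable_sum.
split; first exact: differentiable_sum.
rewrite derive_sum; last by move=> k; exact: diff_derivable.
rewrite flux_fieldE; apply: eq_bigr => k _.
rewrite derive_sum; last by move=> l; exact: diff_derivable.
apply: eq_bigr => l _; rewrite deriveZ ?(derive_pd _ _ _ su) //.
exact/diff_derivable/(pd_differentiable _ _ su).
Qed.

Lemma flux_field_bound : exists2 C : R, 0 <= C & forall i j s x, (size s <= 2)%N -> A x ->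
  `|flux_field i j s x| <= C / `|x - c| ^+ (size s).+1.
Proof.
have [CC CC0 H] := pd_uniform.
exists (CC * \sum_i \sum_j \sum_k \sum_l `|ec i j k l|).
  by rewrite mulr_ge0 //; do 4!(apply: sumr_ge0 => ? _).
move=> i j s x s2 Ax; rewrite flux_fieldE.
have e0 : \sum_k \sum_l `|ec i j k l| <= \sum_i \sum_j \sum_k \sum_l `|ec i j k l|.
  apply: (@term_le_sum2 _ _ _ (fun i j => \sum_k \sum_l `|ec i j k l|)) => i' j'.
  by do 2!(apply: sumr_ge0 => ? _).
have iv : 0 <= (`|x - c| ^+ (size s).+1)^-1 by rewrite invr_ge0 exprn_ge0.
apply: (le_trans (ler_norm_sum _ _ _)).
apply: (@le_trans _ _ (CC * (\sum_k \sum_l `|ec i j k l|) / `|x - c| ^+ (size s).+1)); last first.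
  by rewrite ler_wpM2r // ler_wpM2l.
rewrite mulr_sumr mulr_suml; apply: ler_sum => k _; apply: (le_trans (ler_norm_sum _ _ _)).
rewrite mulr_sumr mulr_suml; apply: ler_sum => l _; rewrite normrM.
have := H (rcons s l) k x; rewrite size_rcons => /(_ _ Ax) h.
by rewrite mulrAC [leRHS]mulrC ler_wpM2l // h.
Qed.

Lemma flux_field_div0 i x : A x -> flux_field i 0 [:: 0] x + flux_field i 1 [:: 1] x = 0.
Proof.
move=> Ax; have [_ D0 _ _ _] := elastic; have /rowP/(_ i) := D0 x Ax.
rewrite mxE [RHS]mxE sum2E => E; rewrite -[RHS]E.
have e j : (fun y => elast W (grad u y) i j) = flux_field i j [::].
  by apply/funext => y; rewrite elast_grad.
by rewrite !e !(flux_field_derive _ _ _ _ Ax).2.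
Qed.

Lemma flux_field_jump i x : branch_cut c x -> x != c -> exists q : R,
  flux_field i 1 [::] (pt (x 0 0) t) @[t --> (x 0 1)^'+] --> q /\
  flux_field i 1 [::] (pt (x 0 0) t) @[t --> (x 0 1)^'-] --> q.
Proof.
move=> cx xc; have [_ _ _ J _] := elastic; have [p [q [hp hq /eqP]]] := J x cx xc.
rewrite subr_eq0 => /eqP E; subst q; exists (p 0 i).
have e (F : set_system R) : Filter F ->
    ((\row_i elast W (grad u (pt (x 0 0) t)) i 1) @[t --> F] --> p) ->
    flux_field i 1 [::] (pt (x 0 0) t) @[t --> F] --> p 0 i.
  move=> FF h.
  have cc : {for p, continuous (fun M : 'rV[R]_m => M 0 i)} by exact: coord_continuous.
  have := @cvg_comp _ _ _ _ _ _ _ _ h cc.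
  by apply: cvg_trans; apply: near_eq_cvg; apply: nearW => t /=; rewrite mxE elast_grad.
by split; apply: e.
Qed.

Definition stream_function i := stream c (flux_field i 0 [::]) (flux_field i 1 [::]).

Hypothesis no_force_line : circle_flux (fun x => elast W (grad u x)) c = 0.

(** The zero flux enters the second estimate through [arc_gap], and the continuity of the traction
    enters it through [cut_gap]; the first estimate is local. *)
Lemma stream_function_facts : exists2 C : R, 0 <= C & forall i,
  (forall x h, (forall t, 0 <= t <= 1 -> A (x + t *: h)) ->
     0 < `|x - c| -> `|h| <= `|x - c| / 2 ->
  `|stream_function i (x + h) - stream_function i x -
     (h 0 1 * flux_field i 0 [::] x - h 0 0 * flux_field i 1 [::] x)|
    <= 16 * C * `|h| ^+ 2 / `|x - c| ^+ 2) /\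
  (forall x y K, x 0 1 != c 0 1 -> y 0 1 != c 0 1 -> 0 <= K ->
     1 + 2 * K <= x 0 0 - c 0 0 -> `|x - y| <= K ->
  `|stream_function i x - stream_function i y| <= 8 * C * K / (x 0 0 - c 0 0)).
Proof.
have [C C0 H] := flux_field_bound; exists C => // i.
pose P := flux_field i 0 [::]; pose Q := flux_field i 1 [::].
pose dP j := flux_field i 0 [:: j]; pose dQ j := flux_field i 1 [:: j].
have diffP x : A x -> differentiable P x by move=> Ax; have [] := flux_field_derive i 0 [::] 0 Ax.
have diffQ x : A x -> differentiable Q x by move=> Ax; have [] := flux_field_derive i 1 [::] 0 Ax.
have derP j x : A x -> 'D_(evec R j) P x = dP j x.
  by move=> Ax; have [] := flux_field_derive i 0 [::] j Ax.
have derQ j x : A x -> 'D_(evec R j) Q x = dQ j x.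
  by move=> Ax; have [] := flux_field_derive i 1 [::] j Ax.
have contP j x : A x -> {for x, continuous (dP j)}.
  by move=> Ax; apply: differentiable_continuous; have [] := flux_field_derive i 0 [:: j] 0 Ax.
have contQ j x : A x -> {for x, continuous (dQ j)}.
  by move=> Ax; apply: differentiable_continuous; have [] := flux_field_derive i 1 [:: j] 0 Ax.
have boundP x : A x -> `|P x| <= C / `|x - c| by move=> Ax; have := H i 0 [::] x isT Ax.
have boundQ x : A x -> `|Q x| <= C / `|x - c| by move=> Ax; have := H i 1 [::] x isT Ax.
have bounddP j x : A x -> `|dP j x| <= C / `|x - c| ^+ 2.
  by move=> Ax; have := H i 0 [:: j] x isT Ax.
have bounddQ j x : A x -> `|dQ j x| <= C / `|x - c| ^+ 2.
  by move=> Ax; have := H i 1 [:: j] x isT Ax.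
have div0 x : A x -> dP 0 x + dQ 1 x = 0 by exact: flux_field_div0.
have psi x v : A x -> is_derive x v (stream c P Q) (v 0 1 * P x - v 0 0 * Q x).
  exact: (stream_derive C0 diffP diffQ derP derQ contP contQ boundP boundQ bounddP bounddQ div0).
have agap : arc_gap c C (stream c P Q).
  apply: (stream_gap C0 diffP diffQ derP derQ boundP boundQ bounddP bounddQ psi).
  have /rowP/(_ i) := no_force_line; rewrite mxE [RHS]mxE => E; rewrite -[RHS]E.
  congr (\int[_]_(_ in _) _); apply/funext => t.
  by rewrite sum2E !elast_grad !mxE.
have cgap : cut_gap c Q C.
  apply: (Q_gap C0 diffQ derQ bounddQ) => x cx xc; exact: flux_field_jump.
split.
- by move=> x h; apply: (stream_taylor C0 diffP diffQ derP derQ bounddP bounddQ psi).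
- by move=> x y K; apply: (stream_across C0 boundP boundQ psi agap cgap).
Qed.

End FluxField.

(** * Decay of the forces *)

Section PredictorStrip.
Variable R : realType.
Variables (m : nat) (c : 'rV[R]_2) (b1 r K0 CC bb : R) (eta : R -> R) (bm : 'rV[R]_m).
Variables (xi_inv : 'rV[R]_2 -> 'rV[R]_2) (u : 'rV[R]_2 -> 'rV[R]_m).
Local Notation A := (~` branch_cut c).
Local Notation xi := (xi_map c (pt b1 0) r eta).
Implicit Types (x y h k : 'rV[R]_2) (K : R).
Hypothesis b1_neq0 : b1 != 0.
Hypothesis r_gt0 : 0 < r.
Hypothesis K0_ge0 : 0 <= K0.
Hypothesis CC_ge0 : 0 <= CC.
Hypothesis eta1 : forall s, 1 < s -> eta s = 1.
Hypothesis xi_smooth : smooth_on A xi.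
Hypothesis xi_invA : forall x, A x -> A (xi_inv x).
Hypothesis xi_invK : forall x, A x -> xi (xi_inv x) = x.
Hypothesis xi_inv_near : forall x, A x -> `|xi_inv x - x| <= K0.
Hypothesis u_smooth : smooth_on A u.
Hypothesis u_bound : forall s i x, (0 < size s <= 3)%N -> A x ->
  `|pd u s i x| <= CC / `|x - c| ^+ size s.
Hypothesis beta_le : `|b1 / (2 * pi)| <= bb.
Hypothesis extends : extends_across c (pt b1 0) bm r (predictor xi_inv u).

Let dist x := x 0 0 - c 0 0.

Let same_side x y := 0 < (x 0 1 - c 0 1) * (y 0 1 - c 0 1).

Lemma off_line_off_cut x : x 0 1 != c 0 1 -> A x.
Proof. by move=> /eqP x1 [/x1]. Qed.

Lemma dist_le_norm x : dist x <= `|x - c|.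
Proof. by have := coord_le (x - c) 0 0; rewrite !mxE /dist; apply: le_trans; exact: ler_norm. Qed.

Let side_ne x y : same_side x y -> y 0 1 != c 0 1.
Proof. by rewrite /same_side => h; apply/eqP => E; rewrite E subrr mulr0 ltxx in h. Qed.

Let convex_side x : convex_in c [set y | same_side x y].
Proof.
split; first by move=> y /= /side_ne /off_line_off_cut.
move=> y z t /= sy sz /andP[t0 t1]; rewrite /same_side !mxE.
have -> : (x 0 1 - c 0 1) * (y 0 1 + t * (z 0 1 - y 0 1) - c 0 1) =
  (1 - t) * ((x 0 1 - c 0 1) * (y 0 1 - c 0 1)) + t * ((x 0 1 - c 0 1) * (z 0 1 - c 0 1)) by ring.
move: sy sz; rewrite /same_side.
move: (_ * (y 0 1 - _)) (_ * (z 0 1 - _)) => p q p0 q0.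
have [t2|t2] := lerP t (1 / 2).
  by apply: ltr_pwDl; [apply: mulr_gt0 => //; lra|apply: mulr_ge0 => //; exact: ltW].
by apply: ltr_wpDl; [apply: mulr_ge0; [lra|exact: ltW]|apply: mulr_gt0 => //; lra].
Qed.

Let inv_sqr_le (C s t : R) (j : nat) : 0 <= C -> 0 < s -> s <= t -> C / t ^+ j <= C / s ^+ j.
Proof.
move=> C0 s0 st; rewrite ler_wpM2l // lef_pV2 ?posrE ?exprn_gt0 //; last exact: lt_le_trans st.
by rewrite lerXn2r ?nnegrE // ltW // (lt_le_trans s0).
Qed.

Let self_side x y : same_side x y -> same_side x x.
Proof.
rewrite /same_side => h; rewrite -expr2 exprn_even_gt0 //=.
by apply: contraTneq h => ->; rewrite mul0r ltxx.
Qed.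

Lemma pd_lip_strip K : 0 <= K -> exists C D : R, [/\ 0 <= C, 1 <= D &
  forall (j : 'I_2) (i : 'I_m) x y, same_side x y -> `|y - x| <= K -> D <= dist x ->
    `|pd u [:: j] i y - pd u [:: j] i x| <= C / dist x ^+ 2].
Proof.
move=> Kge; exists (8 * CC * K), (1 + 2 * K); split; [by rewrite !mulr_ge0|lra|].
move=> j i x y sxy yx Dx; have dx := dist_le_norm x.
have d0 : 0 < dist x by lra.
apply: (le_trans (pd_lip CC_ge0 u_smooth u_bound i (convex_side x) _ _ _ _ _)) => //=.
- exact: self_side sxy.
- exact: lt_le_trans dx.
- lra.
apply: (le_trans (inv_sqr_le _ _ _ dx)) => //; first by rewrite !mulr_ge0 // exprn_ge0.
rewrite ler_wpM2r ?invr_ge0 ?sqr_ge0 // (_ : 2 ^+ 3 = 8) ?ler_wpM2l ?mulr_ge0 //; ring.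
Qed.

Lemma pd_bound_strip : exists C : R, 0 <= C /\
  forall (j : 'I_2) (i : 'I_m) x, x 0 1 != c 0 1 -> 1 <= dist x -> `|pd u [:: j] i x| <= C / dist x.
Proof.
exists CC; split => // j i x x1 dx.
have := u_bound i (_ : 0 < size [:: j] <= 3)%N (off_line_off_cut x1) => /(_ isT)/le_trans; apply.
by apply: (@inv_sqr_le CC (dist x) `|x - c| 1) => //; [exact: lt_le_trans dx|exact: dist_le_norm].
Qed.

Lemma u0_diff_strip K : 0 <= K -> exists C D : R, [/\ 0 <= C, 1 <= D &
  forall (i : 'I_m) x h, same_side x (x + h) -> `|h| <= K -> D <= dist x ->
    `|predictor xi_inv u (x + h) 0 i - predictor xi_inv u x 0 i - \sum_j h 0 j * pd u [:: j] i x|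
      <= C * `|h| / dist x ^+ 2].
Proof.
move=> Kge; have b0 : 0 <= bb := le_trans (normr_ge0 _) beta_le.
have r0 := r_gt0; have k0 := K0_ge0; have cc0 := CC_ge0.
have c0 : 0 <= CC * (16 * (K + 3 * K0) + 32 * bb).
  by apply: mulr_ge0 => //; lra.
have fr : 16 <= far_radius r K0 bb K by rewrite /far_radius; lra.
exists (CC * (16 * (K + 3 * K0) + 32 * bb)), (2 * far_radius r K0 bb K + K + 1); split => //.
  lra.
move=> i x h sxh hK Dx; have dx := dist_le_norm x.
have dxh : dist x - K <= `|x + h - c|.
  apply: le_trans (dist_le_norm _); rewrite /dist mxE.
  by have := le_trans (coord_le h 0 0) hK; rewrite ler_norml => /andP[? ?]; lra.
have sxx := self_side sxh.
have [Ax Axh] : A x /\ A (x + h).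
  by split; apply: off_line_off_cut; [exact: side_ne sxx|exact: side_ne sxh].
(* Far from the core [xi_inv] moves points horizontally and therefore keeps them on their side. *)
have height y : A y -> far_radius r K0 bb K <= `|y - c| -> xi_inv y 0 1 = y 0 1.
  move=> Ay yD; have [_ _ _ ->] := xi_inv_far r_gt0 K0_ge0 eta1 xi_invK xi_inv_near beta_le Kge Ay yD.
  by rewrite !mxE /= addr0.
apply: (le_trans (u0_diff b1_neq0 r_gt0 K0_ge0 CC_ge0 eta1 xi_smooth xi_invK xi_inv_near u_smooth
  u_bound beta_le (convex_side x) Kge i _ _ _ _ hK _)) => //=.
- by rewrite /same_side height //; lra.
- by rewrite /same_side height //; lra.
- lra.
apply: inv_sqr_le => //; [exact: mulr_ge0|lra].
Qed.

Lemma slip_increments K : 0 <= K -> exists C D, [/\ 0 <= C, 1 <= D &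
  forall i (l h k : 'rV[R]_2), `|l 0 1 - c 0 1| <= K -> `|h| <= K -> `|k| <= K -> D <= dist l ->
  l 0 1 != c 0 1 -> (l + k) 0 1 != c 0 1 ->
  let w := slip0 c (pt b1 0) bm (predictor xi_inv u) in
  `|w (l + k) 0 i - w l 0 i| <= C / dist l /\
  ((l + h) 0 1 != c 0 1 -> (l + h + k) 0 1 != c 0 1 ->
  `|w (l + h + k) 0 i - w (l + h) 0 i - (w (l + k) 0 i - w l 0 i)| <= C / dist l ^+ 2)].
Proof.
have [g [g_smooth g_slip]] := extends.
have O_right x : r < dist x -> (Omega_cut c r)° x.
  rewrite /dist => dx; have e0 : 0 < x 0 0 - c 0 0 - r by lra.
  apply/nbhs_ballP; exists (x 0 0 - c 0 0 - r) => //= y.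
  rewrite -ball_normE /= => xy; have := le_lt_trans (coord_le (x - y) 0 0) xy.
  rewrite !mxE ltr_norml => /andP[h1 h2]; have r0 := r_gt0.
  split; first by lra.
  apply: le_trans (norm_le_enorm _); apply: le_trans (dist_le_norm _); rewrite /dist; lra.
have gs x : r < dist x -> x 0 1 != c 0 1 -> g x = slip0 c (pt b1 0) bm (predictor xi_inv u) x.
  by move=> dx x1; apply: g_slip; [exact: O_right|exact: off_line_off_cut].
exact: (strip_increments (p := fun j i x => pd u [:: j] i x) pd_lip_strip pd_bound_strip
  u0_diff_strip O_right g_smooth gs).
Qed.

End PredictorStrip.

(** * Linearised stresses and quadratic forms of the site potential *)

Section HessianForms.
Variable R : realType.
Variables (m n : nat) (rho : 'I_n -> 'rV[R]_2) (V : 'M[R]_(n, m) -> R) (dens : R).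
Hypothesis V_smooth : smooth_on setT V.
Let W := cb_energy dens rho V.

Lemma exchange_big3 (I J K : finType) (F : I -> J -> K -> R) :
  \sum_i \sum_j \sum_k F i j k = \sum_j \sum_k \sum_i F i j k.
Proof. by rewrite exchange_big; apply: eq_bigr => j _; rewrite exchange_big. Qed.

(** Component [i] of the linearised stress of the bond [k] under the homogeneous strain [F]. *)
Definition strain_stress k i (F : 'M[R]_(m, 2)) : R :=
  \sum_a \sum_b (\sum_l rho a 0 l * F b l) * vhess V a b k i.

(** The two sides differentiate the potential in opposite orders, which [vhess_sym] reconciles; the
    rest is an exchange of sums. *)
Lemma elast_strain_stress F i j : elast W F i j = dens * \sum_k rho k 0 j * strain_stress k i F.
Proof.
rewrite (elastE _ _ V_smooth); congr (_ * _); symmetry.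
transitivity (\sum_k \sum_a \sum_b \sum_l rho k 0 j * rho a 0 l * vhess V k i a b * F b l).
  apply: eq_bigr => k _; rewrite mulr_sumr; apply: eq_bigr => a _.
  rewrite mulr_sumr; apply: eq_bigr => b _; rewrite mulr_suml mulr_sumr.
  by apply: eq_bigr => l _; rewrite (vhess_sym V_smooth); ring.
pose T k a b l := rho k 0 j * rho a 0 l * vhess V k i a b * F b l.
rewrite (eq_bigr (fun k => \sum_b \sum_l \sum_a T k a b l)); last first.
  by move=> k _; rewrite -(exchange_big3 (T k)).
rewrite (exchange_big3 (fun k b l => \sum_a T k a b l)).
apply: eq_bigr => b _; apply: eq_bigr => l _; exact: exchange_big.
Qed.

Definition hess_bound : R := \sum_k \sum_i \sum_a \sum_b `|vhess V a b k i|.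

Lemma hess_bound_ge0 : 0 <= hess_bound.
Proof. by do 4!(apply: sumr_ge0 => ? _). Qed.

Lemma hess_form_le (X : 'I_n -> 'I_m -> R) M k i : (forall a b, `|X a b| <= M) ->
  `|\sum_a \sum_b X a b * vhess V a b k i| <= hess_bound * M.
Proof.
move=> XM; apply: (@le_trans _ _ ((\sum_a \sum_b `|vhess V a b k i|) * M)).
  rewrite mulr_suml; apply: (le_trans (ler_norm_sum _ _ _)); apply: ler_sum => a _.
  rewrite mulr_suml; apply: (le_trans (ler_norm_sum _ _ _)); apply: ler_sum => b _.
  by rewrite normrM mulrC ler_wpM2l.
have [[a0]|nb] := pselect (exists a : 'I_n, exists b : 'I_m, True).
  move=> [b0 _]; have M0 : 0 <= M := le_trans (normr_ge0 _) (XM a0 b0).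
  apply: ler_wpM2r => //.
  apply: (@term_le_sum2 _ _ _ (fun k i => \sum_a \sum_b `|vhess V a b k i|)) => k' i'.
  by do 2!(apply: sumr_ge0 => ? _).
by case: nb; exists k, i.
Qed.

Lemma vgrad_lip : exists L e : R, [/\ 0 <= L, 0 < e & forall k i G G', `|G| <= e -> `|G'| <= e ->
  `|vgrad V k i G - vgrad V k i G'| <= L * `|G - G'|].
Proof.
have [C [e [C0 e0 H]]] := vgrad_taylor V_smooth.
exists (C * e + hess_bound), e; split => //.
  by rewrite addr_ge0 ?hess_bound_ge0 // mulr_ge0 // ltW.
move=> k i G G' Ge G'e; have := H k i G G' e Ge G'e (lexx _).
have := hess_form_le k i (fun a b => coord_le (G - G') a b).
have := ler_normD (vgrad V k i G - vgrad V k i G' -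
  \sum_a \sum_b (G - G') a b * vhess V a b k i) (\sum_a \sum_b (G - G') a b * vhess V a b k i).
rewrite subrK mulrDl; lra.
Qed.

End HessianForms.

(** * Slip stresses near the cut *)

Section StripStress.
Variable R : realType.
Variables (m n : nat) (Lam : set 'rV[R]_2) (rho : 'I_n -> 'rV[R]_2) (V : 'M[R]_(n, m) -> R).
Variables (c : 'rV[R]_2) (b1 K : R) (bm : 'rV[R]_m) (u : 'rV[R]_2 -> 'rV[R]_m).
Hypothesis V_smooth : smooth_on setT V.
Hypotheses (LamD : forall x y, Lam x -> Lam y -> Lam (x + y)).
Hypotheses (LamN : forall x, Lam x -> Lam (- x)) (rho_lat : forall k, Lam (rho k)).
Hypothesis off_line : forall l, Lam l -> l 0 1 != c 0 1.
Hypotheses (K_ge0 : 0 <= K) (rho_le : forall k, `|rho k| <= K).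
Let dist (x : 'rV[R]_2) := x 0 0 - c 0 0.
Let w := slip0 c (pt b1 0) bm u.
Hypothesis increments : forall K', 0 <= K' -> exists C D, [/\ 0 <= C, 1 <= D &
  forall i (l h k : 'rV[R]_2), `|l 0 1 - c 0 1| <= K' -> `|h| <= K' -> `|k| <= K' -> D <= dist l ->
  l 0 1 != c 0 1 -> (l + k) 0 1 != c 0 1 ->
  `|w (l + k) 0 i - w l 0 i| <= C / dist l /\
  ((l + h) 0 1 != c 0 1 -> (l + h + k) 0 1 != c 0 1 ->
  `|w (l + h + k) 0 i - w (l + h) 0 i - (w (l + k) 0 i - w l 0 i)| <= C / dist l ^+ 2)].

Local Ltac slim := clear - V_smooth LamD LamN rho_lat off_line K_ge0 rho_le increments dist w.

(** No linear part is split off near the cut: a Lipschitz bound on the gradient of [V] near 0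
    transfers the first and second increments of [S_0 u_0] directly to the stresses. *)
Lemma strip_stress Kc : 0 <= Kc -> exists C D, [/\ 0 <= C, 1 <= D &
  forall i k x, Lam x -> `|x 0 1 - c 0 1| <= Kc -> D <= dist x ->
  `|slip_stress rho V c b1 bm u i k x - vgrad V k i 0| <= C / dist x /\
  `|slip_stress rho V c b1 bm u i k (x - rho k) - slip_stress rho V c b1 bm u i k x|
     <= C / dist x ^+ 2].
Proof.
move=> Kc0; have kge := K_ge0; have K'0 : 0 <= Kc + K by rewrite addr_ge0.
have [C1 [D1 [C10 D11 H]]] := increments K'0.
have [L [e [L0 e0 HL]]] := vgrad_lip V_smooth.
have q0 : 0 <= C1 / e by rewrite divr_ge0 // ltW.
exists (L * C1), (D1 + K + C1 / e); split; [exact: mulr_ge0|lra|].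
move=> i k x Lx xK Dx; have dx0 : 0 < dist x by lra.
pose G y := Dstencil rho w y.
have Gb y : Lam y -> `|y 0 1 - c 0 1| <= Kc + K -> D1 + C1 / e <= dist y ->
    `|G y| <= C1 / dist y /\ `|G y| <= e.
  move=> Ly yK Dy; have dy0 : 0 < dist y by lra.
  have g1 : `|G y| <= C1 / dist y.
    apply: norm_le_coord; first by rewrite divr_ge0 // ltW.
    move=> a j; rewrite !mxE.
    have [] := H j y 0 (rho a) yK _ _ _ (off_line Ly) (off_line (LamD Ly (rho_lat a))) => //.
    - by rewrite normr0.
    - by apply: (le_trans (rho_le a)); lra.
    - lra.
  split => //; apply: (le_trans g1); rewrite ler_pdivrMr // -ler_pdivrMl // mulrC; lra.
have Lxk : Lam (x - rho k) by apply: LamD => //; exact: LamN.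
have rk := rho_le k.
have [g1 g2] : `|G x| <= C1 / dist x /\ `|G x| <= e by apply: Gb => //; lra.
have [_ g3] : `|G (x - rho k)| <= C1 / dist (x - rho k) /\ `|G (x - rho k)| <= e.
  have k0 := le_trans (coord_le (rho k) 0 0) rk; have k1 := le_trans (coord_le (rho k) 0 1) rk.
  apply: Gb => //.
    have -> : (x - rho k) 0 1 - c 0 1 = (x 0 1 - c 0 1) - rho k 0 1 by rewrite !mxE; ring.
    by apply: (le_trans (ler_normB _ _)); lra.
  by move: k0; rewrite ler_norml /dist !mxE => /andP[? ?]; move: Dx; rewrite /dist; lra.
have g4 : `|G (x - rho k) - G x| <= C1 / dist x ^+ 2.
  apply: norm_le_coord; first by rewrite divr_ge0 // exprn_ge0 // ltW.
  move=> a j; rewrite !mxE.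
  have KK : K <= Kc + K by rewrite lerDr.
  have xK' : `|x 0 1 - c 0 1| <= Kc + K by rewrite (le_trans xK) // lerDl.
  have rk' : `|- rho k| <= Kc + K by rewrite normrN; exact: le_trans KK.
  have xD1 : D1 <= dist x by move: Dx q0 kge; slim; lra.
  have [_] := H j x (- rho k) (rho a) xK' rk' (le_trans (rho_le a) KK) xD1
     (off_line Lx) (off_line (LamD Lx (rho_lat a))).
  by apply; apply: off_line => //; exact: LamD.
split.
  have := HL k i (G x) 0 g2; rewrite normr0 subr0 => /(_ (ltW e0))/le_trans; apply.
  by rewrite -mulrA ler_wpM2l.
apply: (le_trans (HL k i _ _ g3 g2)); by rewrite -mulrA ler_wpM2l.
Qed.

End StripStress.

Lemma second_form_algebra (R : realType) (ra rk : 'rV[R]_2) (p : 'I_2 -> 'I_2 -> R) (h : R) :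
  - ((\sum_j \sum_l ra 0 j * (- rk) 0 l * p l j) * h) =
  rk 0 0 * ((\sum_l ra 0 l * p 0 l) * h) + rk 0 1 * ((\sum_l ra 0 l * p 1 l) * h).
Proof. by rewrite !sum2E !mxE; ring. Qed.

(** * Stresses and forces away from the cut *)

Section BulkStress.
Variable R : realType.
Variables (m n : nat) (c : 'rV[R]_2) (b1 r K0 CC bb K dens : R) (eta : R -> R).
Variables (xi_inv : 'rV[R]_2 -> 'rV[R]_2) (u : 'rV[R]_2 -> 'rV[R]_m).
Variables (rho : 'I_n -> 'rV[R]_2) (V : 'M[R]_(n, m) -> R).
Local Notation A := (~` branch_cut c).
Local Notation xi := (xi_map c (pt b1 0) r eta).
Local Notation u0 := (predictor xi_inv u).
Hypothesis V_smooth : smooth_on setT V.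
Hypothesis b1_neq0 : b1 != 0.
Hypothesis r_gt0 : 0 < r.
Hypothesis K0_ge0 : 0 <= K0.
Hypothesis CC_ge0 : 0 <= CC.
Hypothesis eta1 : forall s, 1 < s -> eta s = 1.
Hypothesis xi_smooth : smooth_on A xi.
Hypothesis xi_invA : forall x, A x -> A (xi_inv x).
Hypothesis xi_invK : forall x, A x -> xi (xi_inv x) = x.
Hypothesis xi_inv_near : forall x, A x -> `|xi_inv x - x| <= K0.
Hypothesis u_smooth : smooth_on A u.
Hypothesis u_bound : forall s i x, (0 < size s <= 3)%N -> A x ->
  `|pd u s i x| <= CC / `|x - c| ^+ size s.
Hypothesis beta_le : `|b1 / (2 * pi)| <= bb.
Hypotheses (K_ge0 : 0 <= K) (rho_le : forall k, `|rho k| <= K) (dens_neq0 : dens != 0).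
Hypothesis div0 : forall i x, A x ->
  flux_field (cb_energy dens rho V) u i 0 [:: 0] x + flux_field (cb_energy dens rho V) u i 1 [:: 1] x = 0.
Implicit Types (x l : 'rV[R]_2).

Let clear_ball l := forall x, `|x - l| <= 4 * K + 2 * K0 -> A x.

Let bb_ge0 : 0 <= bb := le_trans (normr_ge0 _) beta_le.

Let strain a b x := \sum_j rho a 0 j * pd u [:: j] b x.

Let rho_coord a j : `|rho a 0 j| <= K := le_trans (coord_le _ _ _) (rho_le a).

Let C1 := CC * (16 * (K + 3 * K0) + 32 * bb) * K.

Let C1_ge0 : 0 <= C1.
Proof.
by have := bb_ge0; have := K_ge0; have := K0_ge0 => *; rewrite !mulr_ge0 // addr_ge0 ?mulr_ge0 // addr_ge0 ?mulr_ge0.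
Qed.

Let first_increment a b l : clear_ball l -> 2 * far_radius r K0 bb K <= `|l - c| ->
  `|u0 (l + rho a) 0 b - u0 l 0 b - strain a b l| <= C1 / `|l - c| ^+ 2.
Proof.
move=> Hl lD; have kge := K_ge0; have k0 := K0_ge0; have ra := rho_le a.
have Hl' x : `|x - l| <= K + K0 -> A x by move=> h; apply: Hl; lra.
have QC := convex_ball Hl'.
have nl : `|l - l| <= K + K0 by rewrite subrr normr0; lra.
have nr : `|l + rho a - l| <= K + K0 by rewrite addrAC subrr add0r; lra.
have nx : `|xi_inv l - l| <= K + K0 by have := xi_inv_near (Hl' l nl); lra.
have nxr : `|xi_inv (l + rho a) - l| <= K + K0.
  have -> : xi_inv (l + rho a) - l = (xi_inv (l + rho a) - (l + rho a)) + rho a.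
    by rewrite opprD addrA addrNK.
  by apply: (le_trans (ler_normD _ _)); have := xi_inv_near (Hl' _ nr); lra.
have h := u0_diff b1_neq0 r_gt0 K0_ge0 CC_ge0 eta1 xi_smooth xi_invK xi_inv_near u_smooth
  u_bound beta_le QC K_ge0 b nl nr nx nxr ra lD.
apply: (le_trans h); rewrite ler_wpM2r ?invr_ge0 ?sqr_ge0 // /C1 ler_wpM2l //.
by have := bb_ge0 => b0; apply: mulr_ge0 => //; lra.
Qed.

Let strain_le a b l : A l -> `|strain a b l| <= 2 * (K * CC) / `|l - c|.
Proof.
move=> Al; have h j : `|rho a 0 j * pd u [:: j] b l| <= K * (CC / `|l - c|).
  rewrite normrM; apply: ler_pM => //; exact: (u_bound b (s := [:: j]) isT Al).
rewrite /strain; apply: (le_trans (norm_sum_le h)); rewrite -!mulrA; lra.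
Qed.

Let center l : clear_ball l -> A l.
Proof. by move=> H; apply: H; rewrite subrr normr0; have := K_ge0; have := K0_ge0; lra. Qed.

Let C2 := C1 + 2 * (K * CC).

Let C2_ge0 : 0 <= C2.
Proof. by rewrite addr_ge0 ?C1_ge0 // !mulr_ge0. Qed.

Let R1 := 2 * far_radius r K0 bb (2 * K) + 1.

Let R1_facts : [/\ 1 <= R1, 2 * far_radius r K0 bb K <= R1 & 2 * far_radius r K0 bb (2 * K) <= R1].
Proof.
have := bb_ge0; have := K_ge0; have := K0_ge0; have := r_gt0.
by rewrite /R1 /far_radius; split; lra.
Qed.

Let le_inv_sqr (C d : R) : 0 <= C -> 1 <= d -> C / d ^+ 2 <= C / d.
Proof.
move=> C0 d1; rewrite ler_wpM2l // lef_pV2 ?posrE ?exprn_gt0 ?(lt_le_trans ltr01) //.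
by rewrite expr2 ler_peMl // (le_trans ler01).
Qed.

Let stencil_le l : clear_ball l -> R1 <= `|l - c| -> `|Dstencil rho u0 l| <= C2 / `|l - c|.
Proof.
move=> Hl lD; have [R11 R12 _] := R1_facts; have d1 : 1 <= `|l - c| by lra.
have d0 : 0 < `|l - c| by lra.
apply: norm_le_coord; first by rewrite divr_ge0 ?C2_ge0 // ltW.
move=> a b; rewrite !mxE.
have h1 := first_increment a b Hl (le_trans R12 lD).
have h2 := strain_le a b (center Hl).
have h3 := le_inv_sqr C1_ge0 d1.
have := ler_normD (u0 (l + rho a) 0 b - u0 l 0 b - strain a b l) (strain a b l).
rewrite subrK /C2 mulrDl; lra.
Qed.

Local Ltac slim := clear - V_smooth b1_neq0 r_gt0 K0_ge0 CC_ge0 eta1 xi_smooth xi_invA xi_invK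
  xi_inv_near u_smooth u_bound beta_le K_ge0 rho_le dens_neq0 div0 bb_ge0 rho_coord C1_ge0
  first_increment strain_le center C2_ge0 R1_facts le_inv_sqr stencil_le clear_ball strain C1 C2 R1.

(** Two errors of order [d^-2] add up: the Taylor remainder of the potential at stencils of size
    [O(1/d)], and the error of replacing increments of the predictor by [strain]. *)
Lemma bulk_stress_expansion : exists C D, [/\ 0 <= C, 1 <= D & forall i k l, clear_ball l ->
  D <= `|l - c| ->
  `|bulk_stress rho V u0 i k l - vgrad V k i 0 - strain_stress rho V k i (grad u l)|
    <= C / `|l - c| ^+ 2 /\
  `|strain_stress rho V k i (grad u l)| <= C / `|l - c|].
Proof.
have [Cv [e [Cv0 e0 H]]] := vgrad_taylor V_smooth.
have hb := hess_bound_ge0 V; have [R11 R12 _] := R1_facts.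
have c2 := C2_ge0; have c1 := C1_ge0.
have q0 : 0 <= C2 / e by rewrite divr_ge0 // ltW.
have kc : 0 <= 2 * (K * CC) by rewrite !mulr_ge0.
have t1 : 0 <= Cv * C2 * C2 by rewrite !mulr_ge0.
have t2 : 0 <= hess_bound V * C1 by rewrite mulr_ge0.
have t3 : 0 <= hess_bound V * (2 * (K * CC)) by rewrite mulr_ge0.
exists (Cv * C2 * C2 + hess_bound V * C1 + hess_bound V * (2 * (K * CC))), (R1 + C2 / e).
split; [lra|lra|].
move=> i k l Hl lD; have lR : R1 <= `|l - c| by lra.
have d1 : 1 <= `|l - c| by lra.
have d0 : 0 < `|l - c| by lra.
have sE : strain_stress rho V k i (grad u l) = \sum_a \sum_b strain a b l * vhess V a b k i.
  apply: eq_bigr => a _; apply: eq_bigr => b _; congr (_ * _).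
  by apply: eq_bigr => j _; rewrite mxE.
have Gle := stencil_le Hl lR.
have re : C2 / `|l - c| <= e by rewrite ler_pdivrMr // -ler_pdivrMl // mulrC; lra.
set G := Dstencil rho u0 l in Gle *.
have r0 : 0 <= C2 / `|l - c| by rewrite divr_ge0 // ltW.
have h1 : `|vgrad V k i G - vgrad V k i 0 - \sum_a \sum_b G a b * vhess V a b k i|
    <= Cv * C2 * C2 / `|l - c| ^+ 2.
  have := H k i G 0 _ Gle; rewrite normr0 subr0 => /(_ r0 re)/le_trans; apply.
  have -> : Cv * C2 * C2 / `|l - c| ^+ 2 = Cv * (C2 / `|l - c|) * (C2 / `|l - c|).
    by field; rewrite gt_eqF.
  by rewrite ler_wpM2l // mulr_ge0.
have h2 : `|\sum_a \sum_b (G a b - strain a b l) * vhess V a b k i|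
    <= hess_bound V * (C1 / `|l - c| ^+ 2).
  apply: hess_form_le => a b; rewrite !mxE; apply: first_increment => //; lra.
have h3 : `|\sum_a \sum_b strain a b l * vhess V a b k i| <= hess_bound V * (2 * (K * CC) / `|l - c|).
  by apply: hess_form_le => a b; apply: strain_le; exact: center.
have E : \sum_a \sum_b (G a b - strain a b l) * vhess V a b k i =
  \sum_a \sum_b G a b * vhess V a b k i - \sum_a \sum_b strain a b l * vhess V a b k i.
  rewrite -sumrB; apply: eq_bigr => a _; rewrite -sumrB; apply: eq_bigr => b _.
  by rewrite mulrBl.
rewrite sE /bulk_stress -/G; rewrite E in h2.
move: (\sum_a \sum_b G a b * _) (\sum_a \sum_b strain a b l * _) h1 h2 h3 => X Y h1 h2 h3.
have i2 : 0 <= (`|l - c| ^+ 2)^-1 by rewrite invr_ge0 sqr_ge0.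
have i1 : 0 <= (`|l - c|)^-1 by rewrite invr_ge0 ltW.
split.
  have -> : vgrad V k i G - vgrad V k i 0 - Y = (vgrad V k i G - vgrad V k i 0 - X) + (X - Y) by ring.
  apply: (le_trans (ler_normD _ _)); rewrite !mulrDl.
  have := mulr_ge0 t3 i2; rewrite mulrA in h2; lra.
apply: (le_trans h3); rewrite mulrA ler_wpM2r //; lra.
Qed.

Lemma flux_field_strain i j s y : flux_field (cb_energy dens rho V) u i j s y =
  dens * \sum_k rho k 0 j * strain_stress rho V k i (\matrix_(k, l) pd u (rcons s l) k y).
Proof. exact: (elast_strain_stress rho dens V_smooth (\matrix_(k, l) pd u (rcons s l) k y) i j). Qed.

Lemma mul_sum2D (I J : finType) (p q : R) (f g : I -> J -> R) :
  p * (\sum_a \sum_b f a b) + q * (\sum_a \sum_b g a b) =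
  \sum_a \sum_b (p * f a b + q * g a b).
Proof.
rewrite !mulr_sumr -big_split; apply: eq_bigr => a _ /=.
by rewrite !mulr_sumr -big_split.
Qed.

(** The equilibrium equation of linear elasticity as a sum over pairs of bonds. The sign of [rho k]
    is that of the backward difference in the force, of which this is the leading term. *)
Lemma second_form_div0 i y : A y ->
  \sum_k \sum_a \sum_b (\sum_j \sum_l rho a 0 j * (- rho k) 0 l * pd u [:: l; j] b y)
    * vhess V a b k i = 0.
Proof.
move=> Ay; have := div0 i Ay; rewrite !flux_field_strain.
rewrite -mulrDr => /eqP; rewrite mulf_eq0 (negbTE dens_neq0) /= -big_split /= => /eqP E.
apply/eqP; rewrite -oppr_eq0 -[X in _ == X]E; apply/eqP; rewrite -sumrN; apply: eq_bigr => k _.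
rewrite /strain_stress mul_sum2D -sumrN; apply: eq_bigr => a _.
rewrite -sumrN; apply: eq_bigr => b _.
have F := second_form_algebra (rho a) (rho k) (fun q j : 'I_2 => pd u [:: q; j] b y) (vhess V a b k i).
apply: (etrans F).
by congr (_ * (_ * _) + _ * (_ * _)); apply: eq_bigr => l _; rewrite mxE.
Qed.

(** The difference of two stresses is linear in that of the stencils up to [O(1/d)] times [O(d^-2)].
    The difference of the stencils is a second derivative of [u] at [xi_inv l] up to [O(d^-3)], and
    these second derivatives cancel by [second_form_div0]. *)
Lemma bulk_force : exists C D, [/\ 0 <= C, 1 <= D & forall i l, clear_ball l ->
  D <= `|l - c| ->
  `|\sum_k (bulk_stress rho V u0 i k (l - rho k) - bulk_stress rho V u0 i k l)|
    <= C / `|l - c| ^+ 3].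
Proof.
have [Cv [e [Cv0 e0 H]]] := vgrad_taylor V_smooth.
have hb := hess_bound_ge0 V; have [R11 R12 R13] := R1_facts.
have c2 := C2_ge0; have kge := K_ge0; have k0 := K0_ge0; have cc0 := CC_ge0; have b0 := bb_ge0.
(* [C3] bounds differences of stencils: the remainder plus four products of second derivatives, each
   with a factor 4 from the halved distance to the core. *)
pose S2 := second_const CC bb K; pose C3 := `|S2| + 16 * (K * K) * CC.
have kk : 0 <= 16 * (K * K) * CC by rewrite !mulr_ge0.
have C30 : 0 <= C3 by rewrite addr_ge0.
have c23 : 0 <= C2 + C3 := addr_ge0 c2 C30.
have q0 : 0 <= (C2 + C3) / e := divr_ge0 c23 (ltW e0).
have t1 : 0 <= Cv * (C2 + C3) * C3 := mulr_ge0 (mulr_ge0 Cv0 c23) C30.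
have t2 : 0 <= hess_bound V * `|S2| by rewrite mulr_ge0.
exists (n%:R * (Cv * (C2 + C3) * C3 + hess_bound V * `|S2|)), (R1 + (C2 + C3) / e).
split; [by rewrite mulr_ge0 // addr_ge0|lra|].
move=> i l Hl lD; have lR : R1 <= `|l - c| by lra.
have d1 : 1 <= `|l - c| by lra.
have d0 : 0 < `|l - c| by lra.
set d := `|l - c| in lD lR d1 d0 *.
have Al := center Hl; pose y := xi_inv l; have Ay : A y := xi_invA Al.
have yd : d / 2 <= `|y - c|.
  have fr : far_radius r K0 bb K <= `|l - c|.
    by rewrite -/d; have := far_radius_gt0 r_gt0 K0_ge0 beta_le K_ge0; lra.
  by have [] := xi_inv_far r_gt0 K0_ge0 eta1 xi_invK xi_inv_near beta_le K_ge0 Al fr.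
pose X k a b := \sum_j \sum_l' rho a 0 j * (- rho k) 0 l' * pd u [:: l'; j] b y.
have Gle := stencil_le Hl lR; rewrite -/d in Gle.
set G := Dstencil rho u0 l in Gle.
pose G' k := Dstencil rho u0 (l - rho k).
have dX k a b : `|(G' k - G) a b - X k a b| <= `|S2| / d ^+ 3.
  have h := u0_second b1_neq0 r_gt0 K0_ge0 CC_ge0 eta1 xi_smooth xi_invK xi_inv_near u_smooth
    u_bound beta_le b K_ge0 Hl (rho_le a) (k := - rho k).
  have {}h := h ltac:(by rewrite normrN) (le_trans R13 lR).
  have -> : (G' k - G) a b = u0 (l + rho a - rho k) 0 b - u0 (l + rho a) 0 b -
      (u0 (l - rho k) 0 b - u0 l 0 b) by rewrite !mxE [l - _ + _]addrAC; ring.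
  apply: (le_trans h); rewrite ler_wpM2r ?ler_norm // invr_ge0 exprn_ge0 // ltW //.
have Xle k a b : `|X k a b| <= 16 * (K * K) * CC / d ^+ 2.
  have y0 : 0 < `|y - c| by move: yd d0; slim; lra.
  have hy : CC / `|y - c| ^+ 2 <= 4 * CC / d ^+ 2 by exact: div_sqr_half.
  have h (j l' : 'I_2) : `|rho a 0 j * (- rho k) 0 l' * pd u [:: l'; j] b y| <= K * K * (4 * CC / d ^+ 2).
    apply: norm_mul_le; last exact: le_trans (u_bound b (s := [:: l'; j]) isT Ay) hy.
    by apply: norm_mul_le => //; rewrite mxE normrN.
  have h' j := norm_sum_le (h j); apply: (le_trans (norm_sum_le h')); slim; lra.
have i3 : 0 <= (d ^+ 3)^-1 by rewrite invr_ge0 exprn_ge0 // ltW.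
have i2 : 0 <= (d ^+ 2)^-1 by rewrite invr_ge0 exprn_ge0 // ltW.
have i32 : `|S2| / d ^+ 3 <= `|S2| / d ^+ 2.
  rewrite ler_wpM2l // lef_pV2 ?posrE ?exprn_gt0 // exprS ler_peMl // sqr_ge0 //.
have dG k : `|G' k - G| <= C3 / d ^+ 2.
  apply: norm_le_coord; first by rewrite mulr_ge0.
  move=> a b; have := ler_normD ((G' k - G) a b - X k a b) (X k a b); rewrite subrK.
  by have := dX k a b; have := Xle k a b; rewrite /C3 mulrDl; move: i32; slim; lra.
have dG1 k : `|G' k - G| <= C3 / d := le_trans (dG k) (le_inv_sqr C30 d1).
have id : 0 <= d^-1 by rewrite invr_ge0 ltW.
have rG : `|G| <= (C2 + C3) / d by rewrite mulrDl (le_trans Gle) // lerDl mulr_ge0.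
have rG' k : `|G' k| <= (C2 + C3) / d.
  by have := ler_normD (G' k - G) G; rewrite subrK mulrDl; have := dG1 k; move: Gle; slim; lra.
have re : (C2 + C3) / d <= e.
  by rewrite ler_pdivrMr // -ler_pdivrMl // mulrC (le_trans _ lD) // lerDr (le_trans ler01).
have h1 k : `|vgrad V k i (G' k) - vgrad V k i G - \sum_a \sum_b (G' k - G) a b * vhess V a b k i|
    <= Cv * (C2 + C3) * C3 / d ^+ 3.
  apply: (le_trans (H k i _ _ _ (rG' k) rG re)).
  have -> : Cv * (C2 + C3) * C3 / d ^+ 3 = Cv * ((C2 + C3) / d) * (C3 / d ^+ 2).
    by field; rewrite gt_eqF.
  by rewrite ler_wpM2l ?dG // !mulr_ge0.
have h2 k : `|\sum_a \sum_b ((G' k - G) a b - X k a b) * vhess V a b k i|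
    <= hess_bound V * (`|S2| / d ^+ 3) by exact: hess_form_le.
have X0 : \sum_k \sum_a \sum_b X k a b * vhess V a b k i = 0 := second_form_div0 i Ay.
have -> : \sum_k (bulk_stress rho V u0 i k (l - rho k) - bulk_stress rho V u0 i k l) =
   \sum_k ((vgrad V k i (G' k) - vgrad V k i G - \sum_a \sum_b (G' k - G) a b * vhess V a b k i)
     + \sum_a \sum_b ((G' k - G) a b - X k a b) * vhess V a b k i).
  transitivity (\sum_k (bulk_stress rho V u0 i k (l - rho k) - bulk_stress rho V u0 i k l)
      - \sum_k \sum_a \sum_b X k a b * vhess V a b k i); first by rewrite X0 subr0.
  rewrite -sumrB; apply: eq_bigr => k _; rewrite /bulk_stress -/G -/(G' k).
  have -> : \sum_a \sum_b ((G' k - G) a b - X k a b) * vhess V a b k i =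
    \sum_a \sum_b (G' k - G) a b * vhess V a b k i - \sum_a \sum_b X k a b * vhess V a b k i.
    rewrite -sumrB; apply: eq_bigr => a _; rewrite -sumrB; apply: eq_bigr => b _.
    by rewrite mulrBl.
  by ring.
have -> : n%:R * (Cv * (C2 + C3) * C3 + hess_bound V * `|S2|) / d ^+ 3 =
  n%:R * (Cv * (C2 + C3) * C3 / d ^+ 3 + hess_bound V * (`|S2| / d ^+ 3)) by ring.
apply: norm_sum_le => k.
by apply: (le_trans (ler_normD _ _)); apply: lerD.
Qed.

End BulkStress.

(** * Vanishing stress sums, decay of the forces, zero net force *)

Section Equilibrium.
Variable R : realType.
Variables (m n : nat) (B : 'M[R]_2) (rho : 'I_n -> 'rV[R]_2) (b1 r eps : R) (c : 'rV[R]_2).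
Variables (bm : 'rV[R]_m) (V : 'M[R]_(n, m) -> R) (Vl : 'rV[R]_2 -> 'M[R]_(n, m) -> R).
Variables (u : 'rV[R]_2 -> 'rV[R]_m) (eta : R -> R) (xi_inv : 'rV[R]_2 -> 'rV[R]_2).
Variable f : 'rV[R]_2 -> 'rV[R]_m.
Local Notation Lam := (lattice B).
Local Notation A := (~` branch_cut c).
Local Notation b := (pt b1 0).
Local Notation dens := (site_density B).
Local Notation W := (cb_energy (site_density B) rho V).
Local Notation u0 := (predictor xi_inv u).
Hypotheses (B_unit : B \in unitmx) (rho_lat : forall k, Lam (rho k)).
Hypotheses (b1_neq0 : b1 != 0) (b_lat : Lam b).
Hypothesis off_line : forall l, Lam l -> l 0 1 != c 0 1.
Hypothesis V_smooth : smooth_on setT V.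
Hypothesis V_far : exists M : R, forall l, Lam l -> M < enorm l -> Vl l = V.
Hypothesis elastic : linear_elastic_field W c bm u.
Hypothesis r_gt0 : 0 < r.
Hypothesis eta_cutoff : is_cutoff eta.
Hypothesis inverse : controlled_inverse A (xi_map c b r eta) xi_inv.
Hypothesis extends : extends_across c b bm r u0.
Hypothesis eps_gt0 : 0 < eps.
Hypothesis slip : slip_invariant Lam c b bm rho V u0 eps.
Hypothesis force : is_force Lam rho Vl u0 f.
Hypothesis no_stress : sigma0 W = 0.
Hypothesis no_force_line : circle_flux (fun x => elast W (grad u x)) c = 0.
Implicit Types (x l : 'rV[R]_2).

Let dens_neq0 : dens != 0.
Proof. by rewrite invr_eq0 normr_eq0 -unitfE -unitmxE. Qed.

Let K := \sum_k `|rho k| + `|b| + \sum_j `|row j B|.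

Let K_facts : [/\ 0 <= K, forall k, `|rho k| <= K, `|b| <= K & forall j, `|row j B| <= K].
Proof.
have h1 : 0 <= \sum_k `|rho k| by rewrite sumr_ge0.
have h2 : 0 <= \sum_j `|row j B| by rewrite sumr_ge0.
have h3 : 0 <= `|b| by [].
split; [by rewrite !addr_ge0| |rewrite /K; lra|].
- move=> k; have : `|rho k| <= \sum_k `|rho k| by rewrite (bigD1 k) //= lerDl sumr_ge0.
  rewrite /K; lra.
- move=> j; have : `|row j B| <= \sum_j `|row j B| by rewrite (bigD1 j) //= lerDl sumr_ge0.
  rewrite /K; lra.
Qed.

Let K_ge0 : 0 <= K. Proof. by have [] := K_facts. Qed.
Let rho_le k : `|rho k| <= K. Proof. by have [_ + _ _] := K_facts. Qed.
Let b_le : `|b| <= K. Proof. by have [] := K_facts. Qed.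
Let row_le j : `|row j B| <= K. Proof. by have [_ _ _ +] := K_facts. Qed.

Let eta1 s : 1 < s -> eta s = 1.
Proof. by have [_ _ _ H _] := eta_cutoff; exact: H. Qed.

Let xi_smooth : smooth_on A (xi_map c b r eta).
Proof. by have [[]] := inverse. Qed.

Let xi_invA x : A x -> A (xi_inv x).
Proof. by have [[_ _ _ H] _ _ _ _] := inverse; exact: H. Qed.

Let xi_invK x : A x -> xi_map c b r eta (xi_inv x) = x.
Proof. by have [_ _ H _ _] := inverse; exact: H. Qed.

Let u_smooth : smooth_on A u.
Proof. by have [] := elastic. Qed.

Variable K0 : R.
Hypotheses (K0_ge0 : 0 <= K0) (near : forall x, A x -> `|xi_inv x - x| <= K0).

(** Half-width of the strip, equal to the radius of the ball that second increments of the predictor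
    require to be clear of the cut. *)
Let Kc := 4 * K + 2 * K0.

Let K_le : K <= Kc.
Proof. by have := K_ge0; have := K0_ge0; rewrite /Kc; lra. Qed.

Let Kc_ge0 : 0 <= Kc := le_trans K_ge0 K_le.

Let off_strip l : ~ strip c Kc l -> Kc < `|l - c| -> forall x, `|x - l| <= Kc -> A x.
Proof.
move=> ns lK x xl [x1 x0]; apply: ns.
have h0 := le_trans (coord_le (x - l) 0 0) xl; have h1 := le_trans (coord_le (x - l) 0 1) xl.
move: h0 h1; rewrite !mxE x1 (distrC (c 0 1)) => h0 h1; split => //.
rewrite ltNge; apply/negP => l0; move: lK; rewrite ltNge => /negP; apply.
apply: norm_le_coord; first exact: Kc_ge0.
move=> i j; rewrite ord1 !mxE; have [->|->] : j = 0 \/ j = 1.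
    by case: j => -[|[|//]] p; [left|right]; exact/val_inj.
- by move: h0; rewrite !ler_norml => /andP[? ?]; apply/andP; split; have := Kc_ge0; lra.
- by [].
Qed.

(** Far out in the strip the vertical offset is at most [Kc], so the sup norm is attained by the
    horizontal coordinate and the two measures of distance coincide. *)
Let strip_dist l : strip c Kc l -> Kc < `|l - c| -> l 0 0 - c 0 0 = `|l - c|.
Proof.
move=> [l1 l0] lK; apply/eqP; rewrite eq_le; apply/andP; split; first exact: dist_le_norm.
have d0 : 0 < l 0 0 - c 0 0 by rewrite subr_gt0.
have [h|h] := leP Kc (l 0 0 - c 0 0); last first.
  have : `|l - c| <= Kc; last by rewrite leNgt lK.
  apply: norm_le_coord => [|i j]; first exact: Kc_ge0.
  rewrite ord1 !mxE; have [->|->] : j = 0 \/ j = 1.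
    by case: j => -[|[|//]] p; [left|right]; exact/val_inj.
  - by rewrite gtr0_norm // ltW.
  - exact: l1.
apply: norm_le_coord => [|i j]; first exact: ltW.
rewrite ord1 !mxE; have [->|->] : j = 0 \/ j = 1.
    by case: j => -[|[|//]] p; [left|right]; exact/val_inj.
- by rewrite gtr0_norm.
- exact: le_trans l1 h.
Qed.

Let far_site : exists D : R, forall l, Lam l -> D <= `|l - c| ->
  Vl l = V /\ forall k, Vl (l - rho k) = V.
Proof.
have [M HM] := V_far; exists (M + `|c| + K + 1) => l Ll lD.
have H x : Lam x -> `|l - x| <= K -> Vl x = V.
  move=> Lx lx; apply: HM => //; apply: lt_le_trans (norm_le_enorm _).
  have := ler_distD x l c; have := ler_normB x c; lra.
split; first by apply: H => //; rewrite subrr normr0; exact: K_ge0.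
by move=> k; apply: H; [exact: latticeB|rewrite opprB addrCA subrr addr0; exact: rho_le].
Qed.

Let slip_site_facts l : Lam l -> strip c Kc l ->
  [/\ Lam (slip_site c b1 l), `|(slip_site c b1 l) 0 1 - c 0 1| <= Kc &
      l 0 0 - c 0 0 - K <= (slip_site c b1 l) 0 0 - c 0 0].
Proof.
move=> Ll [l1 l0]; split.
- by have [h _ _] := slip_site_bij c b_lat; exact: h.
- by rewrite /slip_site; case: ifP => _ //; rewrite !mxE /= addr0.
- have := le_trans (coord_le b 0 0) b_le; have k0 := K_ge0.
  rewrite /slip_site mxE /= ler_norml => /andP[h1 h2]; case: ifP => _; rewrite ?mxE ?[b 0 0]mxE /=; lra.
Qed.

Let a i k : R := vgrad V k i 0.

Let force_line i j : \sum_k a i k * rho k 0 j = 0.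
Proof.
have /matrixP/(_ i j) := no_stress; rewrite (sigma0E _ _ V_smooth) [RHS]mxE => /eqP.
rewrite mulf_eq0 (negbTE dens_neq0) /= => /eqP E; rewrite -[RHS]E.
by apply: eq_bigr => k _; rewrite mulrC.
Qed.

Local Ltac slim := clear - B_unit rho_lat b1_neq0 b_lat off_line V_smooth V_far elastic r_gt0 eta_cutoff inverse
  extends eps_gt0 slip force no_stress no_force_line dens_neq0 K_facts K_ge0 rho_le b_le row_le eta1
  xi_smooth xi_invA xi_invK u_smooth K0_ge0 near K_le Kc_ge0 off_strip strip_dist far_site
  slip_site_facts force_line.

Let slip_stress_bound : exists C D, [/\ 0 <= C, 1 <= D & forall i k l, Lam l ->
  D <= `|l - c| -> strip c Kc l ->
  `|slip_stress rho V c b1 bm u0 i k (slip_site c b1 l) - a i k| <= C / `|l - c| /\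
  `|slip_stress rho V c b1 bm u0 i k (slip_site c b1 l - rho k)
     - slip_stress rho V c b1 bm u0 i k (slip_site c b1 l)| <= C / `|l - c| ^+ 2].
Proof.
have [CC CC0 u_bound] := pd_uniform elastic.
have inc K' (H : 0 <= K') := slip_increments b1_neq0 r_gt0 K0_ge0 CC0 eta1 xi_smooth xi_invK near
  u_smooth u_bound (lexx _) extends H.
have [C [D [C0 D1 H]]] := strip_stress V_smooth (@latticeD _ B) (@latticeN _ B) rho_lat
  off_line K_ge0 rho_le inc Kc_ge0.
exists (4 * C), (D + 2 * K + Kc + 1); have k0 := K_ge0; have kc0 := Kc_ge0.
split; [exact: mulr_ge0|lra|].
move=> i k l Ll lD sl; have [Ls s1 s0] := slip_site_facts Ll sl.
have ld := strip_dist sl ltac:(lra); rewrite ld in s0.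
set s := slip_site c b1 l in Ls s1 s0 *.
have [h1 h2] := H i k s Ls s1 ltac:(lra).
have sd : `|l - c| / 2 <= s 0 0 - c 0 0 by lra.
have d0 : 0 < `|l - c| by lra.
split; last by apply: (le_trans h2); exact: div_sqr_half.
apply: (le_trans h1); rewrite ler_pdivrMr; last by lra.
by rewrite mulrAC ler_pdivlMr //; have := ler_wpM2l C0 sd; have := mulr_ge0 C0 (ltW d0); slim; lra.
Qed.

Let stream_bound i : exists C D, [/\ 0 <= C, 1 <= D & forall j l, Lam l -> D <= `|l - c| ->
  (strip c Kc l ->
   `|stream_function W c u i (l + row j B) - stream_function W c u i l| <= C / `|l - c|) /\
  (~ strip c Kc l ->
   `|stream_function W c u i (l + row j B) - stream_function W c u i l -
     dens * \sum_k strain_stress rho V k i (grad u l) * (B j 1 * rho k 0 0 - B j 0 * rho k 0 1)|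
   <= C / `|l - c| ^+ 2)].
Proof.
have [C C0 H] := stream_function_facts elastic no_force_line; have [H1 H2] := H i.
move: (stream_function W c u i) H1 H2 => psi H1 H2.
have k0 := K_ge0; have kc0 := Kc_ge0; have kc := K_le.
have ck0 : 0 <= 8 * C * K by rewrite !mulr_ge0.
have ck2 : 0 <= 16 * C * K ^+ 2 by rewrite mulr_ge0 ?sqr_ge0 // mulr_ge0.
exists (8 * C * K + 16 * C * K ^+ 2), (Kc + 2 * K + 1); split; [exact: addr_ge0|lra|].
move=> j l Ll lD; have rj := row_le j; have d0 : 0 < `|l - c| by lra.
split=> sl.
  have ld := strip_dist sl ltac:(lra).
  have e : `|l - (l + row j B)| <= K by rewrite opprD addNKr normrN.
  have l0 : 1 + 2 * K <= l 0 0 - c 0 0 by lra.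
  have h := H2 l (l + row j B) K (off_line Ll) (off_line (latticeD Ll (lattice_row B j))) k0 l0 e.
  rewrite distrC; apply: (le_trans h); rewrite ld.
  by rewrite ler_wpM2r ?invr_ge0 ?normr_ge0 //; lra.
have ba := off_strip sl ltac:(lra).
have seg t : 0 <= t <= 1 -> A (l + t *: row j B).
  move=> /andP[t0 t1]; apply: ba; rewrite addrAC subrr add0r normrZ ger0_norm //.
  by apply: le_trans kc; apply: le_trans rj; rewrite ler_piMl.
have e q : flux_field W u i q [::] l = dens * \sum_k rho k 0 q * strain_stress rho V k i (grad u l).
  rewrite (flux_field_strain _ _ _ V_smooth).
  by have -> : (\matrix_(k, q) pd u (rcons [::] q) k l) = grad u l
    by apply/matrixP => p q'; rewrite !mxE.
have E : dens * \sum_k strain_stress rho V k i (grad u l) * (B j 1 * rho k 0 0 - B j 0 * rho k 0 1)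
  = (row j B) 0 1 * flux_field W u i 0 [::] l - (row j B) 0 0 * flux_field W u i 1 [::] l.
  rewrite !e !mxE !(mulrCA _ dens) -mulrBr; congr (_ * _).
  by rewrite !mulr_sumr -sumrB; apply: eq_bigr => k _; ring.
rewrite E; apply: (le_trans (H1 l (row j B) seg d0 _)); first lra.
rewrite ler_wpM2r ?invr_ge0 ?sqr_ge0 //.
have : `|row j B| ^+ 2 <= K ^+ 2 by rewrite lerXn2r ?nnegrE.
have cc : 0 <= 16 * C by rewrite mulr_ge0.
by move=> /(ler_wpM2l cc); lra.
Qed.

Local Ltac slim ::= clear - B_unit rho_lat b1_neq0 b_lat off_line V_smooth V_far elastic r_gt0 eta_cutoff inverse
  extends eps_gt0 slip force no_stress no_force_line dens_neq0 K_facts K_ge0 rho_le b_le row_le eta1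
  xi_smooth xi_invA xi_invK u_smooth K0_ge0 near K_le Kc_ge0 off_strip strip_dist far_site
  slip_site_facts force_line
  slip_stress_bound stream_bound.

Lemma stress_test_vanishes i : vanishes (fun N => lsum B (fun l =>
  \sum_k site_stress rho Vl u0 i k l * (bump N (l + rho k) - bump N l))).
Proof.
have [C1 [D1 [C10 D11 H1]]] := slip_stress_bound.
have [C2 [D2 [C20 D21 H2]]] := stream_bound i.
have [CC CC0 u_bound] := pd_uniform elastic.
have [C3 [D3 [C30 D31 H3]]] := bulk_stress_expansion V_smooth b1_neq0 r_gt0 K0_ge0 CC0 eta1
  xi_smooth xi_invK near u_smooth u_bound (lexx _) K_ge0 rho_le.
have [D4 H4] := far_site; have kc := Kc_ge0.
pose C := C1 + C2 + C3; pose D := D1 + D2 + D3 + `|D4| + Kc.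
have n4 := ler_norm D4; have n40 := normr_ge0 D4.
have C0 : 0 <= C by rewrite /C; lra.
have Dge : 1 <= D by rewrite /D; lra.
have up (c' d : R) : c' <= C -> 0 <= d -> c' * d <= C * d by move=> h d0; rewrite ler_wpM2r.
have [c1C c2C c3C] : [/\ C1 <= C, C2 <= C & C3 <= C].
  by rewrite /C; move: C10 C20 C30; slim; split; lra.
have Ds l : D <= `|l - c| -> [/\ D1 <= `|l - c|, D2 <= `|l - c|, D3 <= `|l - c|,
   D4 <= `|l - c| & Kc < `|l - c|].
  by rewrite /D => h; move: h D11 D21 D31 n4 n40 kc; slim; split; lra.
have i1 l : 0 <= `|l - c|^-1 by rewrite invr_ge0.
have i2 l : 0 <= (`|l - c| ^+ 2)^-1 by rewrite invr_ge0 sqr_ge0.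
apply: (@stress_sum_vanishes R n B rho c b1 dens K Kc _
  (slip_stress rho V c b1 bm u0 i) (fun k l => strain_stress rho V k i (grad u l)) (a i)
  (stream_function W c u i) B_unit b1_neq0 dens_neq0 rho_lat b_lat K_ge0 rho_le b_le row_le K_le
  C D C0 Dge) => //.
- move=> l phi Ll /Ds[_ _ _ d4 _] tp; rewrite -(stress_slip off_line V_smooth eps_gt0 slip i tp Ll).
  by apply: eq_bigr => k _; rewrite /site_stress (H4 l Ll d4).1.
- move=> l k Ll /Ds[d1 _ _ _ _] sl; have [h _] := H1 i k l Ll d1 sl.
  exact: le_trans h (up _ _ c1C (i1 l)).
- move=> l j Ll /Ds[_ d2 _ _ _] sl; have [h _] := H2 j l Ll d2.
  exact: le_trans (h sl) (up _ _ c2C (i1 l)).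
- move=> l k Ll /Ds[_ _ d3 d4 dk] sl; have [h h'] := H3 i k l (off_strip sl dk) d3.
  rewrite /site_stress (H4 l Ll d4).1; split.
    exact: le_trans h (up _ _ c3C (i2 l)).
  exact: le_trans h' (up _ _ c3C (i1 l)).
- move=> l j Ll /Ds[_ d2 _ _ _] sl; have [_ h] := H2 j l Ll d2.
  exact: le_trans (h sl) (up _ _ c2C (i2 l)).
Qed.

Lemma force_decay : exists C D, [/\ 0 <= C, 1 <= D & forall i l, Lam l -> D <= `|l - c| ->
  (strip c Kc l -> `|f l 0 i| <= C / `|l - c| ^+ 2) /\
  (~ strip c Kc l -> `|f l 0 i| <= C / `|l - c| ^+ 3)].
Proof.
have [C1 [D1 [C10 D11 H1]]] := slip_stress_bound.
have [CC CC0 u_bound] := pd_uniform elastic.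
have [C3 [D3 [C30 D31 H3]]] := bulk_force V_smooth b1_neq0 r_gt0 K0_ge0 CC0 eta1
  xi_smooth xi_invA xi_invK near u_smooth u_bound (lexx _) K_ge0 rho_le dens_neq0
  (flux_field_div0 elastic).
have [D4 H4] := far_site; have kc := Kc_ge0.
have n4 := ler_norm D4; have n40 := normr_ge0 D4; have nn : 0 <= n%:R :> R by exact: ler0n.
have nC : 0 <= n%:R * C1 by exact: mulr_ge0.
exists (n%:R * C1 + C3), (D1 + D3 + `|D4| + Kc); split; [exact: addr_ge0|lra|].
move=> i l Ll lD.
have [d1 d3 d4 dk] : [/\ D1 <= `|l - c|, D3 <= `|l - c|, D4 <= `|l - c| & Kc < `|l - c|].
  by move: lD D11 D31 n4 n40 kc; slim; split; lra.
have [V0 Vk] := H4 l Ll d4; split=> sl.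
  rewrite (force_slip_at B_unit rho_lat b_lat off_line V_smooth eps_gt0 slip force i Ll V0 Vk).
  have h k : `|slip_stress rho V c b1 bm u0 i k (slip_site c b1 l - rho k)
     - slip_stress rho V c b1 bm u0 i k (slip_site c b1 l)| <= C1 / `|l - c| ^+ 2.
    by have [] := H1 i k l Ll d1 sl.
  apply: (le_trans (norm_sum_le h)); rewrite mulrA ler_wpM2r ?invr_ge0 ?sqr_ge0 //; lra.
rewrite (force_at B_unit rho_lat force i Ll).
have -> : \sum_k (site_stress rho Vl u0 i k (l - rho k) - site_stress rho Vl u0 i k l) =
   \sum_k (bulk_stress rho V u0 i k (l - rho k) - bulk_stress rho V u0 i k l).
  by apply: eq_bigr => k _; rewrite /site_stress V0 Vk.
apply: (le_trans (H3 i l (off_strip sl dk) d3)).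
by rewrite ler_wpM2r ?invr_ge0 ?exprn_ge0 //; lra.
Qed.



Lemma cutoff_force_sum (e : R) : 0 < e -> exists N0 : R, forall N (s : seq 'rV[R]_2),
  N0 <= N -> uniq s -> (forall x, x \in s -> Lam x) ->
  (forall x, Lam x -> bump N x != 0 -> x \in s) -> `|\sum_(x <- s) bump N x *: f x| <= e.
Proof.
move=> e0; have /choice[F HF] : forall i : 'I_m, exists N0 : R, forall N, N0 <= N ->
  `|lsum B (fun l => \sum_k site_stress rho Vl u0 i k l * (bump N (l + rho k) - bump N l))| <= e.
  by move=> i; exact: (stress_test_vanishes i).
exists (1 + \sum_i `|F i|) => N s NF us sL sN.
have F0 : 0 <= \sum_i `|F i| by rewrite sumr_ge0.
have N0 : 0 < N by lra.
apply: norm_le_coord; first exact: ltW.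
move=> q i; rewrite ord1 summxE.
have FN : F i <= N.
  have : `|F i| <= \sum_i `|F i| by rewrite (bigD1 i) //= lerDl sumr_ge0.
  by have := ler_norm (F i); lra.
have tt := bump_test_test B_unit N0.
have E := force_test force i tt.
have -> : \sum_(x <- s) (bump N x *: f x) 0 i = lsum B (fun l => f l 0 i * bump_test B N l).
  rewrite (@lsum_seq _ _ _ s us sL).
    rewrite big_seq [RHS]big_seq; apply: eq_bigr => x xs.
    by rewrite bump_testE ?mxE 1?mulrC //; exact: sL.
  move=> x Lx; rewrite bump_testE // => h; apply: sN => //.
  by apply: contraNneq h => ->; rewrite mulr0.
rewrite E; apply: le_trans (HF i N FN); rewrite le_eqVlt; apply/orP; left; apply/eqP.
congr (`|_|); apply: eq_lsum => l Ll; apply: eq_bigr => k _.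
by rewrite !bump_testE //; exact: latticeD.
Qed.

Lemma net_force_zero : has_sum Lam f 0.
Proof.
have [C [D [C0 D1 H]]] := force_decay; have nc := normr_ge0 c.
have kc0 : 0 <= Kc + `|c| by rewrite addr_ge0.
(* [T] is a full horizontal strip around the origin, the kind of set that [strip_growth] counts. The
   factor 8 is the cube of 2, as [|x| <= 2 |x - c|] far out, and [N.+1] keeps the cutoff radius
   positive. *)
apply: (@has_sum_cutoff R m Lam [set x | Lam x /\ `|x 0 1| <= Kc + `|c|] f
  (fun N => bump N.+1%:R) (8 * C) (D + 2 * `|c|)).
- exact: lattice_growth.
- exact: strip_growth b1_neq0 kc0 b_lat.
- exact: mulr_ge0.
- move=> x Lx xD.
  have xd : `|x| / 2 <= `|x - c| by have := ler_normD (x - c) c; rewrite subrK; lra.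
  have dD : D <= `|x - c| by have := ler_normD (x - c) c; rewrite subrK; lra.
  have x0 : 0 < `|x| by lra.
  have pw j : (j <= 3)%N -> C / `|x - c| ^+ j <= 8 * C * `|x| ^- j.
    move=> j3; rewrite ler_pdivrMr ?exprn_gt0 //; last by lra.
    rewrite mulrAC ler_pdivlMr ?exprn_gt0 //.
    have h : `|x| ^+ j <= 8 * `|x - c| ^+ j.
      apply: (@le_trans _ _ ((2 * `|x - c|) ^+ j)); first by rewrite lerXn2r ?nnegrE //; lra.
      rewrite exprMn ler_wpM2r ?exprn_ge0 // (_ : 8 = 2 ^+ 3); last by ring.
      by rewrite ler_weXn2l //; lra.
    by have := ler_wpM2l C0 h; lra.
  have [sl|sl] := pselect (strip c Kc x); [right|left].
    split.
      split => //; have := ler_normD (x 0 1 - c 0 1) (c 0 1); rewrite subrK.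
      by have := coord_le c 0 1; have [] := sl; lra.
    apply: norm_le_coord => [|q i]; first by rewrite mulr_ge0 ?mulr_ge0 // invr_ge0 exprn_ge0.
    rewrite ord1; have [h _] := H i x Lx dD; exact: le_trans (h sl) (pw 2%N isT).
  apply: norm_le_coord => [|q i]; first by rewrite mulr_ge0 ?mulr_ge0 // invr_ge0 exprn_ge0.
  rewrite ord1; have [_ h] := H i x Lx dD; exact: le_trans (h sl) (pw 3%N isT).
- by move=> N x; exact: bump_itv.
- move=> N; apply: sub_finite_set (growth_finite N.+1%:R (lattice_growth B_unit)) => x [Lx h].
  by split => //; rewrite leNgt; apply: contra h => /ltW h; rewrite bump_eq0.
- move=> M e e0; exists (Num.truncn (4 * M ^+ 2 / e)) => N x NN xM.
  have yN : 4 * M ^+ 2 / e < N.+1%:R by apply: (lt_le_trans (truncnS_gt _)); rewrite ler_nat.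
  have y1 : 1 <= N.+1%:R :> R by rewrite ler1n.
  have y0 : 0 < N.+1%:R :> R by exact: lt_le_trans y1.
  apply: (le_trans (bump_near1 x y0)); rewrite ler_pdivrMr ?exprn_gt0 //.
  have x2 : `|x| ^+ 2 <= M ^+ 2 by rewrite lerXn2r ?nnegrE // (le_trans _ xM).
  have y2 : N.+1%:R <= N.+1%:R ^+ 2 :> R by rewrite expr2 ler_peMr // ltW.
  move: yN; rewrite ltr_pdivrMr // => yN; have ey := ler_wpM2l (ltW e0) y2.
  apply: le_trans ey; lra.
- move=> e e0; have [N0 H0] := cutoff_force_sum e0.
  exists (Num.truncn N0) => N s NN us sL sN; apply: H0 => //.
  by apply: ltW; apply: (lt_le_trans (truncnS_gt _)); rewrite ler_nat.
Qed.

End Equilibrium.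

Theorem corollary3p2 (R : realType) (m n : nat)
  (B : 'M[R]_2) (rho : 'I_n -> 'rV[R]_2)
  (b : 'rV[R]_3) (xh : 'rV[R]_2)
  (V : 'M[R]_(n, m) -> R) (Vl : 'rV[R]_2 -> 'M[R]_(n, m) -> R)
  (ulin : 'rV[R]_2 -> 'rV[R]_m)
  (r : R) (eta : R -> R) (xi_inv : 'rV[R]_2 -> 'rV[R]_2)
  (eps : R) (f : 'rV[R]_2 -> 'rV[R]_m) :
  let Lam := lattice B in
  let b12 := pt (b 0 0) (b 0 1) in
  let bm := burgers m b in
  let W := cb_energy (site_density B) rho V in
  let u0 := ulin \o xi_inv in
  (* lattice, interaction directions, Burgers vector, core *)
  B \in unitmx ->
  injective rho ->
  (forall k, Lam (rho k) /\ rho k != 0) ->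
  m = 3%N \/ (m = 2%N /\ b 0 2 = 0) ->
  b 0 1 = 0 -> b 0 0 != 0 -> Lam b12 ->
  (forall l, Lam l -> l 0 1 != xh 0 1) ->
  (* site potentials *)
  smooth_on setT V ->
  (forall l, Lam l -> smooth_on setT (Vl l)) ->
  (exists M : R, forall l, Lam l -> M < enorm l -> Vl l = V) ->
  (* predictor *)
  linear_elastic_field W xh bm ulin ->
  0 < r ->
  is_cutoff eta ->
  controlled_inverse (~` branch_cut xh) (xi_map xh b12 r eta) xi_inv ->
  extends_across xh b12 bm r u0 ->
  0 < eps ->
  slip_invariant Lam xh b12 bm rho V u0 eps ->
  (* forces *)
  is_force Lam rho Vl u0 f ->
  sigma0 W = 0 ->
  circle_flux (fun x => elast W (grad ulin x)) xh = 0 ->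
  has_sum Lam f 0.
Proof.
move=> Lam b12 bm W u0 B_unit _ rhoL _ b0 b1_neq0 bL off_line V_smooth _ V_far.
move=> elastic r_gt0 eta_cut inverse extends eps_gt0 slip force no_stress no_force_line.
have E : b12 = pt (b 0 0) 0 by rewrite /b12 b0.
rewrite E in bL inverse extends slip.
have [K0 K0_ge0 near] : exists2 K0 : R, 0 <= K0 &
    forall x, (~` branch_cut xh) x -> `|xi_inv x - x| <= K0.
  have [_ _ _ [C0 H] _] := inverse; exists `|C0| => // x Ax.
  by apply: (le_trans (norm_le_enorm _)); apply: (le_trans (H x Ax)); exact: ler_norm.
exact: (net_force_zero B_unit (fun k => (rhoL k).1) b1_neq0 bL off_line V_smooth V_far
  elastic r_gt0 eta_cut inverse extends eps_gt0 slip force no_stress no_force_line K0_ge0 near).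
Qed.
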